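(* Let $(\sigma_s,\mu)\in\mathbb{R}^2$ satisfy $e^{2\pi\mu} > \sinh^2(2\pi\sigma_s)$. Then $$\mathcal{Q}\Big(b, \frac{\sigma_s}{b}, \frac{\mu}{b}\Big) = \frac{e^{\frac{\pi i}{4}}}{\sqrt{2}\, (e^{2 \pi \mu }-\sinh^2(2 \pi \sigma_s))^{1/4}}\, e^{\frac{f_{\mathcal{Q}}(\sigma_s, \mu)}{b^2}} \big(1 + O(b)\big) \qquad \text{as } b \to 0^+,$$ where $(e^{2 \pi \mu }-\sinh^2(2 \pi \sigma_s))^{1/4}>0$, and, writing $R:=\sqrt{e^{2 \pi \mu }-\sinh^2(2 \pi \sigma_s)}>0$, \begin{align*} f_{\mathcal{Q}}(\sigma_s, \mu) =& -\frac{\operatorname{Li}_2\big(-e^{2 \pi \mu }\big)}{2 \pi i} -\frac{\operatorname{Li}_2\big(e^{-2 \pi \sigma_s} (\cosh (2 \pi \sigma_s)+i R)\big)}{2 \pi i} -\frac{\operatorname{Li}_2\big(e^{2 \pi \sigma_s} (\cosh (2 \pi \sigma_s)+i R)\big)}{2 \pi i}\\ & + \Big(\frac{1}{2}+i \mu \Big) \ln \big(-\cosh (2 \pi \sigma_s)-i R\big) -\pi \mu +\frac{5 \pi i}{12}, \end{align*} with principal branches for all functions. Moreover, for all such $(\sigma_s,\mu)$, $$f_{\mathcal{Q}}(\sigma_s, \mu) = 4i\pi\, W\Big(i\sigma_s,-\mu - \frac{i}{2}\Big) - \frac{\operatorname{Li}_2(-e^{2\pi \mu})}{2\pi i} - 2i\pi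 \sigma_s^2 + \frac{i\pi}{4},$$ where $W$ is the Painlevé III$_3$ generating function.
   Context: Let $b>0$, $Q := b+b^{-1}$, and let $s_b$ be the hyperbolic gamma function defined for $|\operatorname{Im} z|<Q/2$ by $s_b(z)=\exp\left[ i \int_0^\infty \left(\frac{\sin(2yz)}{2\sinh(b^{-1}y)\sinh(by)}-\frac{z}{y}\right) \frac{dy}{y} \right]$ and extended meromorphically to $\mathbb{C}$ (zeros at $\frac{iQ}{2}+imb+ilb^{-1}$, poles at $-\frac{iQ}{2}-imb-ilb^{-1}$, $m,l\in\mathbb{Z}_{\geq0}$). For $(\sigma_s,\mu)\in\mathbb{R}^2$, define $$\mathcal{Q}(b,\sigma_s,\mu) = e^{i \pi (\frac{1}{6}+\frac{7 Q^2}{24}-\frac{\mu^2}{2}+i \mu Q- \sigma_s^2)} s_b(\mu) \int_{\mathsf{Q}} e^{-i\pi x^2} e^{2i\pi x(\mu-\frac{iQ}2)} s_b(x+\sigma_s) s_b(x-\sigma_s)\, dx,$$ where $\mathsf{Q}$ is any curve from $-\infty$ to $+\infty$ lying in the strip $-Q/2 < \operatorname{Im} x < -Q/4-\delta$ for some $\delta>0$. The Painlevé III$_3$ generating function is $$8\pi^2 W(\sigma,\nu) = \operatorname{Li}_2 \big( - e^{2i\pi(\sigma+\eta-\frac{i \nu}2)}\big) + \operatorname{Li}_2 \big( - e^{-2i\pi(\sigma+\eta+\frac{i \nu}2)}\big) - (2\pi \eta)^2 + (\pi \nu)^2,\qquad \eta = \frac{1}{2\pi}\arcsin(e^{\pi\nu}\sin(2\pi\sigma)),$$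 where principal branches of $\operatorname{Li}_2$ and $\arcsin$ are used in the region where $0<\eta<\sigma<\frac14$ and $\nu<0$, and $W$ is extended to other $(\sigma,\nu)$ by analytic continuation. Principal branches: $\operatorname{Im}\ln z\in(-\pi,\pi]$, $z^\alpha=e^{\alpha\ln z}$, and $\operatorname{Li}_2(z)=-\int_0^z\frac{\ln(1-u)}{u}du$ on $\mathbb{C}\setminus[1,\infty)$. *)

(* Defs.v *)
From Stdlib Require Import Reals.
From Coquelicot Require Import Coquelicot.

Open Scope R_scope.

Definition Cexp (z : C) : C :=
  (exp (Re z) * cos (Im z), exp (Re z) * sin (Im z)).

(** principal argument, with values in (-PI, PI] *)
Definition Carg (z : C) : R :=
  let x := Re z in let y := Im z in
  if Rlt_dec 0 x then atan (y / x)
  else if Rlt_dec x 0 then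
    (if Rle_dec 0 y then atan (y / x) + PI else atan (y / x) - PI)
  else if Rlt_dec 0 y then PI / 2
  else if Rlt_dec y 0 then - (PI / 2)
  else 0.

Definition Cln (z : C) : C := (ln (Cmod z), Carg z).

Definition Csin (w : C) : C :=
  Cdiv (Cminus (Cexp (Cmult Ci w)) (Cexp (Copp (Cmult Ci w))))
       (Cmult (RtoC 2) Ci).

(** principal dilogarithm Li2(z) = - int_0^z ln(1-u)/u du on C \ [1,oo),
    integrated along the straight segment u = t z, t in [0,1]. *)
Definition Li2 (z : C) : C :=
  Copp (RInt (V := C_R_CompleteNormedModule)
          (fun t : R => Cdiv (Cln (Cminus (RtoC 1) (Cmult (RtoC t) z))) (RtoC t))
          0 1).

Definition Qb (b : R) : R := b + / b.

(** s_b(z) via its integral representation (valid for |Im z| < Q/2, which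
    is the only range where it is used below). *)
Definition s_b (b : R) (z : C) : C :=
  Cexp (Cmult Ci
    (RInt_gen (V := C_R_CompleteNormedModule)
       (fun y : R =>
          Cdiv
            (Cminus
               (Cdiv (Csin (Cmult (RtoC (2 * y)) z))
                     (RtoC (2 * sinh (y / b) * sinh (b * y))))
               (Cdiv z (RtoC y)))
            (RtoC y))
       (at_right 0) (Rbar_locally p_infty))).

(** The contour Q is taken to be the horizontal line Im x = -3Q/8,
    which lies in the strip -Q/2 < Im x < -Q/4 - delta (delta = Q/16). *)
Definition Qcal (b sigma mu : R) : C :=
  let Q := Qb b in
  Cmult
    (Cmult
       (Cexp (Cmult (Cmult Ci (RtoC PI))
          (Cplus (RtoC (1/6 + 7 * Q ^ 2 / 24 - mu ^ 2 / 2 - sigma ^ 2))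
                 (Cmult Ci (RtoC (mu * Q))))))
       (s_b b (RtoC mu)))
    (RInt_gen (V := C_R_CompleteNormedModule)
       (fun t : R =>
          let x : C := (t, - (3 * Q / 8)) in
          Cmult (Cmult (Cmult
            (Cexp (Copp (Cmult (Cmult Ci (RtoC PI)) (Cmult x x))))
            (Cexp (Cmult (Cmult (Cmult (RtoC 2) (Cmult Ci (RtoC PI))) x)
                         (Cminus (RtoC mu) (Cmult Ci (RtoC (Q / 2)))))))
            (s_b b (Cplus x (RtoC sigma))))
            (s_b b (Cminus x (RtoC sigma))))
       (Rbar_locally m_infty) (Rbar_locally p_infty)).

Definition Rfq (sigma mu : R) : R :=
  sqrt (exp (2 * PI * mu) - (sinh (2 * PI * sigma)) ^ 2).

Definition twoPIi : C := Cmult (RtoC (2 * PI)) Ci.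

Definition fQ (sigma mu : R) : C :=
  let Rr := Rfq sigma mu in
  let w : C := (cosh (2 * PI * sigma), Rr) in
  Cplus (Cplus (Cplus (Cplus
    (Copp (Cdiv (Li2 (RtoC (- exp (2 * PI * mu)))) twoPIi))
    (Copp (Cdiv (Li2 (Cmult (RtoC (exp (- (2 * PI * sigma)))) w)) twoPIi)))
    (Copp (Cdiv (Li2 (Cmult (RtoC (exp (2 * PI * sigma))) w)) twoPIi)))
    (Cmult ((1/2), mu) (Cln (Copp w))))
    (- (PI * mu), 5 * PI / 12).

Definition prefQ (sigma mu : R) : C :=
  Cdiv (Cexp (0, PI / 4))
       (RtoC (sqrt 2 * sqrt (sqrt (exp (2 * PI * mu) - (sinh (2 * PI * sigma)) ^ 2)))).

(** * Painleve III_3 generating function W, principal-branch formula,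
      valid on the base region 0 < eta < sigma < 1/4, nu < 0 *)

Definition etaW (sigma nu : R) : R :=
  asin (exp (PI * nu) * sin (2 * PI * sigma)) / (2 * PI).

Definition W_base (sigma nu : R) : C :=
  let eta := etaW sigma nu in
  Cdiv
    (Cplus
      (Cplus
        (Li2 (Copp (Cexp (Cmult (Cmult (RtoC 2) (Cmult Ci (RtoC PI)))
                                (Cminus (RtoC (sigma + eta)) (Cmult Ci (RtoC (nu / 2))))))))
        (Li2 (Copp (Cexp (Copp (Cmult (Cmult (RtoC 2) (Cmult Ci (RtoC PI)))
                                (Cplus (RtoC (sigma + eta)) (Cmult Ci (RtoC (nu / 2))))))))))
      (RtoC (- (2 * PI * eta) ^ 2 + (PI * nu) ^ 2)))
    (RtoC (8 * PI ^ 2)).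

Definition W_base_region (sigma nu : R) : Prop :=
  nu < 0 /\ 0 < etaW sigma nu /\ etaW sigma nu < sigma /\ sigma < 1/4.

Definition C2open (U : C -> C -> Prop) : Prop :=
  forall z w, U z w -> exists eps : R, 0 < eps /\
    forall z' w', Cmod (Cminus z' z) < eps -> Cmod (Cminus w' w) < eps -> U z' w'.

Definition C2connected (U : C -> C -> Prop) : Prop :=
  forall V1 V2 : C -> C -> Prop, C2open V1 -> C2open V2 ->
    (forall z w, U z w -> V1 z w \/ V2 z w) ->
    (exists z w, U z w /\ V1 z w) -> (exists z w, U z w /\ V2 z w) ->
    exists z w, U z w /\ V1 z w /\ V2 z w.

(** holomorphic in two variables: jointly continuous and complex
    differentiable in each variable separately (Osgood). *)
Definition C2holomorphic (U : C -> C -> Prop) (F : C -> C -> C) : Prop :=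
  forall z w, U z w ->
    (forall eps : R, 0 < eps -> exists delta : R, 0 < delta /\
       forall z' w', Cmod (Cminus z' z) < delta -> Cmod (Cminus w' w) < delta ->
         Cmod (Cminus (F z' w') (F z w)) < eps) /\
    ex_derive (K := C_AbsRing) (V := C_NormedModule) (fun z' => F z' w) z /\
    ex_derive (K := C_AbsRing) (V := C_NormedModule) (fun w' => F z w') w.

Definition is_continuation_W (U : C -> C -> Prop) (Wc : C -> C -> C) : Prop :=
  C2open U /\ C2connected U /\ C2holomorphic U Wc /\
  forall sigma nu : R, W_base_region sigma nu ->
    U (RtoC sigma) (RtoC nu) /\ Wc (RtoC sigma) (RtoC nu) = W_base sigma nu.

(* Main.v *)
(** With [beta = b^2] one has [s_b (z / b) = exp (i H_beta(z) / beta)], where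
    [H_beta] is an integral of an explicit kernel and [H_beta = H_0 + O(beta^2)]
    locally uniformly.  A duplication formula for the third derivative of [H_0]
    and the Herglotz trick give [H_0'(z) = PI z - ln (1 + exp (2 PI z))], so that
    [Li_2(-exp (2 PI z)) = 2 PI (H_0(z) - PI z^2 / 2) - PI^2 / 12].  The phase of
    the integral then has the saddle point [ln (- cosh (2 PI sigma) - i R) / (2 PI)];
    its real part is strictly concave on the horizontal line through that point,
    so that shifting the contour there and Laplace's method with a complex
    Gaussian give the asymptotics.

    At the points [(i sigma, - mu - i / 2)] the arcsine in the definition of [W] has
    an argument in [(-1, 1)].  The principal formula therefore stays valid on a
    domain that contains these points and is path connected to the initial region,
    and the formula for [f_Q] in terms of [W] reduces to the
    three-term relation between the dilogarithms at [w] and [1 / (1 - w)], whose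
    constant is determined at [w = exp (i PI / 3)]. *)
Require Import Defs.
From Stdlib Require Import Reals Lra Lia ClassicalEpsilon.
From Coquelicot Require Import Coquelicot.
Open Scope C_scope.
Open Scope R_scope.

(** * Complex differentiation *)

(** The special functions are studied on the strip |Im z| < 1/2, where w = - exp (2 PI z) makes
    logarithm and dilogarithm single valued; a principal logarithm is then identified by its
    exponential and the size of its imaginary part. Cauchy's theorem is avoided: identities come
    from the mean value inequality on segments, and contours are moved by thin strips with quadratic
    Taylor errors. Rescaling x by b splits Q / 2 into 1 / (2 b) and b / 2. The first part enters the
    phase divided by b^2; the second leaves a factor exp (PI x), of order one, which contributes to
    the prefactor. Replacing H_beta by H_0 costs O(beta^2) / beta = O(b^2), so the relative error
    O(b) comes from the Laplace step. The bound Im x < - Q / 4 becomes Im x < - 1/4 in the limit: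
    only below this level does the integrand decay for Re x -> +oo. The saddle point satisfies it
    because both parts of - cosh (2 PI sigma) - i R are negative. *)

Definition Cder (f : C -> C) (z l : C) : Prop :=
  forall eps : R, 0 < eps -> exists delta : R, 0 < delta /\
    forall h : C, Cmod h < delta ->
      Cmod (f (z + h) - f z - l * h)%C <= eps * Cmod h.

(** Componentwise, so that real calculus, in particular the mean value theorem, applies to each part
    of a curve in C. *)
Definition Rder (f : R -> C) (t : R) (l : C) : Prop :=
  is_derive (fun s => Re (f s)) t (Re l) /\ is_derive (fun s => Im (f s)) t (Im l).

Lemma Ceq_pair (z w : C) : Re z = Re w -> Im z = Im w -> z = w.
Proof. destruct z, w; simpl; intros -> ->; reflexivity. Qed.

Lemma Im_le_Cmod (z : C) : Rabs (Im z) <= Cmod z.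
Proof.
  destruct z as [x y]. eapply Rle_trans; [apply (Rmax_r (Rabs x)) | apply (Rmax_Cmod (x, y))].
Qed.

Lemma Cmod_le_Re_Im (z : C) : Cmod z <= Rabs (Re z) + Rabs (Im z).
Proof.
  destruct z as [x y]; unfold Cmod; simpl.
  apply Rsqr_incr_0_var.
  2: { assert (H := Rabs_pos x); assert (H' := Rabs_pos y); lra. }
  rewrite Rsqr_sqrt; [|nra].
  assert (Hx : x * x = Rabs x * Rabs x) by (rewrite <- Rabs_mult; rewrite Rabs_pos_eq; nra).
  assert (Hy : y * y = Rabs y * Rabs y) by (rewrite <- Rabs_mult; rewrite Rabs_pos_eq; nra).
  assert (H := Rabs_pos x); assert (H' := Rabs_pos y). unfold Rsqr. nra.
Qed.

Lemma Cmod_sqr (z : C) : Cmod z * Cmod z = Re z * Re z + Im z * Im z.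
Proof.
  assert (H := Cmod2_alt z). simpl in H. lra.
Qed.

Lemma Cmod_minus_sym (z w : C) : Cmod (z - w)%C = Cmod (w - z)%C.
Proof. rewrite <- Cmod_opp. f_equal. ring. Qed.

Lemma Cmod_triangle_minus (z w : C) : Cmod (z - w)%C <= Cmod z + Cmod w.
Proof. unfold Cminus. eapply Rle_trans; [apply Cmod_triangle|]. rewrite Cmod_opp. lra. Qed.

Lemma Cmod_minus_lower (z w : C) : Cmod z - Cmod w <= Cmod (z - w)%C.
Proof.
  assert (H := Cmod_triangle (z - w)%C w). replace (z - w + w)%C with z in H by ring. lra.
Qed.

Lemma Cmod_RtoC_nonneg (x : R) : 0 <= x -> Cmod (RtoC x) = x.
Proof. intros Hx. rewrite Cmod_R. now apply Rabs_pos_eq. Qed.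

(** The estimates produce the epsilon-delta form; this equivalence lets the rules for sums, products
    and compositions be inherited. *)
Lemma Cder_is_derive (f : C -> C) (z l : C) :
  Cder f z l <-> is_derive (K := C_AbsRing) (V := C_NormedModule) f z l.
Proof.
  split.
  - intros H. split.
    + apply (is_linear_scal_l (K := C_AbsRing) (V := C_NormedModule)).
    + intros x Hx eps.
      apply (is_filter_lim_locally_unique (K := C_AbsRing) (V := AbsRing_NormedModule C_AbsRing)) in Hx.
      subst x.
      destruct (H eps (cond_pos eps)) as [d [Hd Hf]].
      exists (mkposreal d Hd). intros y Hy.
      assert (Hy' : Cmod (y - z)%C < d) by exact Hy.
      specialize (Hf (y - z)%C Hy').
      assert (E : forall u v : C, (u + (v - u))%C = v) by (intros; ring).
      rewrite E, (Cmult_comm l) in Hf. exact Hf.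
  - intros [_ H] eps Heps.
    assert (Hx : is_filter_lim (locally (T := AbsRing_UniformSpace C_AbsRing) z) z)
      by (intros P HP; exact HP).
    destruct (H z Hx (mkposreal eps Heps)) as [d Hd].
    exists d; split; [apply cond_pos|]. intros h Hh.
    assert (Hb : ball (M := AbsRing_UniformSpace C_AbsRing) z d (z + h)%C).
    { change (Cmod (z + h - z)%C < d). now replace (z + h - z)%C with h by ring. }
    specialize (Hd _ Hb).
    replace (f (z + h) - f z - l * h)%C
      with (f (z + h) - f z - (z + h - z) * l)%C by ring.
    replace (Cmod h) with (Cmod (z + h - z)%C) by (f_equal; ring).
    exact Hd.
Qed.

(* The two normed module structures of [C] over itself are not convertible. *)
Lemma Cder_is_derive_AbsRing (f : C -> C) (z l : C) :
  Cder f z l <-> is_derive (K := C_AbsRing) (V := AbsRing_NormedModule C_AbsRing) f z l.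
Proof.
  rewrite Cder_is_derive. split; intros [_ H]; (split; [apply is_linear_scal_l | exact H]).
Qed.

Lemma Cder_eq (f : C -> C) (z l l' : C) : Cder f z l -> l = l' -> Cder f z l'.
Proof. now intros H <-. Qed.

Lemma Cder_const (c z : C) : Cder (fun _ => c) z 0%C.
Proof. apply Cder_is_derive. apply (is_derive_const (K := C_AbsRing) (V := C_NormedModule)). Qed.

Lemma Cder_id (z : C) : Cder (fun w => w) z 1%C.
Proof. apply Cder_is_derive_AbsRing. apply (is_derive_id (K := C_AbsRing)). Qed.

Lemma Cder_plus (f g : C -> C) (z a b : C) :
  Cder f z a -> Cder g z b -> Cder (fun w => f w + g w)%C z (a + b)%C.
Proof.
  rewrite !Cder_is_derive. intros; now apply (is_derive_plus (K := C_AbsRing) (V := C_NormedModule)).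
Qed.

Lemma Cder_opp (f : C -> C) (z a : C) : Cder f z a -> Cder (fun w => - f w)%C z (- a)%C.
Proof.
  rewrite !Cder_is_derive. intros; now apply (is_derive_opp (K := C_AbsRing) (V := C_NormedModule)).
Qed.

Lemma Cder_minus (f g : C -> C) (z a b : C) :
  Cder f z a -> Cder g z b -> Cder (fun w => f w - g w)%C z (a - b)%C.
Proof.
  rewrite !Cder_is_derive. intros; now apply (is_derive_minus (K := C_AbsRing) (V := C_NormedModule)).
Qed.

Lemma Cder_mult (f g : C -> C) (z a b : C) :
  Cder f z a -> Cder g z b -> Cder (fun w => f w * g w)%C z (a * g z + f z * b)%C.
Proof.
  rewrite !Cder_is_derive_AbsRing. intros.
  apply (is_derive_mult (K := C_AbsRing)); auto. intros; apply Cmult_comm.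
Qed.

Lemma Cder_scal (c : C) (f : C -> C) (z a : C) :
  Cder f z a -> Cder (fun w => c * f w)%C z (c * a)%C.
Proof.
  intros H. eapply Cder_eq; [apply Cder_mult; [apply Cder_const | exact H]|]. simpl. ring.
Qed.

Lemma Cder_comp (f g : C -> C) (z a b : C) :
  Cder f (g z) a -> Cder g z b -> Cder (fun w => f (g w)) z (a * b)%C.
Proof.
  rewrite (Cder_is_derive f), Cder_is_derive_AbsRing, Cder_is_derive. intros.
  rewrite Cmult_comm. now apply (is_derive_comp (K := C_AbsRing) (V := C_NormedModule)).
Qed.

Lemma Cder_ext_loc (f g : C -> C) (z l : C) (r : R) :
  0 < r -> (forall w, Cmod (w - z)%C < r -> f w = g w) -> Cder f z l -> Cder g z l.
Proof.
  intros Hr Hfg H eps Heps. destruct (H eps Heps) as [d' [Hd Hf]].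
  exists (Rmin d' r); split; [now apply Rmin_glb_lt|]. intros h Hh.
  assert (H1 := Rmin_l d' r). assert (H2 := Rmin_r d' r).
  rewrite <- !Hfg.
  - apply Hf. lra.
  - replace (z - z)%C with (RtoC 0) by ring. rewrite Cmod_0. exact Hr.
  - replace (z + h - z)%C with h by ring. lra.
Qed.

Lemma Cder_ext (f g : C -> C) (z l : C) :
  (forall w, f w = g w) -> Cder f z l -> Cder g z l.
Proof. intros Hfg. apply (Cder_ext_loc f g z l 1); [lra | auto]. Qed.

(** A quadratic remainder is the usual route to differentiability below, because such a bound
    survives integration over a parameter. *)
Lemma Cder_quad (f : C -> C) (z l : C) (B delta : R) :
  0 < delta ->
  (forall h, Cmod h < delta -> Cmod (f (z + h) - f z - l * h)%C <= B * (Cmod h * Cmod h)) ->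
  Cder f z l.
Proof.
  intros Hd H eps Heps.
  exists (Rmin delta (eps / (Rabs B + 1))).
  assert (HB : 0 < Rabs B + 1) by (assert (H0 := Rabs_pos B); lra).
  split. { apply Rmin_glb_lt; [exact Hd|]. now apply Rdiv_lt_0_compat. }
  intros h Hh.
  assert (H1 := Rmin_l delta (eps / (Rabs B + 1))).
  assert (H2 := Rmin_r delta (eps / (Rabs B + 1))).
  eapply Rle_trans; [apply H; lra|].
  assert (H3 := Cmod_ge_0 h). rewrite <- Rmult_assoc. apply Rmult_le_compat_r; [exact H3|].
  apply Rle_trans with ((Rabs B + 1) * (eps / (Rabs B + 1))).
  - apply Rle_trans with ((Rabs B + 1) * Cmod h).
    + apply Rmult_le_compat_r; [exact H3|]. assert (H4 := Rle_abs B). lra.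
    + apply Rmult_le_compat_l; lra.
  - right. field. lra.
Qed.

Lemma Cder_cont (f : C -> C) (z l : C) : Cder f z l ->
  forall eps, 0 < eps -> exists delta, 0 < delta /\
    forall w, Cmod (w - z)%C < delta -> Cmod (f w - f z)%C < eps.
Proof.
  intros H eps Heps. destruct (H 1 Rlt_0_1) as [d [Hd Hf]].
  assert (Hl := Cmod_ge_0 l).
  exists (Rmin d (eps / (Cmod l + 2))). split.
  { apply Rmin_glb_lt; [exact Hd|]. apply Rdiv_lt_0_compat; lra. }
  intros w Hw.
  assert (H1 := Rmin_l d (eps / (Cmod l + 2))).
  assert (H2 := Rmin_r d (eps / (Cmod l + 2))).
  assert (Hk : Cmod (w - z)%C < d) by lra.
  specialize (Hf _ Hk). replace (z + (w - z))%C with w in Hf by ring.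
  replace (f w - f z)%C with ((f w - f z - l * (w - z)) + l * (w - z))%C by ring.
  eapply Rle_lt_trans; [apply Cmod_triangle|]. rewrite Cmod_mult.
  assert (H3 := Cmod_ge_0 (w - z)%C).
  apply Rle_lt_trans with ((Cmod l + 1) * Cmod (w - z)%C); [nra|].
  apply Rle_lt_trans with ((Cmod l + 1) * (eps / (Cmod l + 2))).
  - apply Rmult_le_compat_l; lra.
  - apply Rlt_le_trans with ((Cmod l + 2) * (eps / (Cmod l + 2))).
    + apply Rmult_lt_compat_r; [apply Rdiv_lt_0_compat; lra | lra].
    + right; field; lra.
Qed.

(** The remainder is h^2 / (z^2 (z + h)), and |z + h| >= |z| / 2 for small h. *)
Lemma Cder_inv (z : C) : z <> 0%C -> Cder Cinv z (- / (z * z))%C.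
Proof.
  intros Hz. assert (Hm : 0 < Cmod z) by now apply Cmod_gt_0.
  apply (Cder_quad _ _ _ (2 / (Cmod z * Cmod z * Cmod z)) (Cmod z / 2)); [lra|].
  intros h Hh.
  assert (Hzh : Cmod z / 2 <= Cmod (z + h)%C).
  { assert (H := Cmod_minus_lower z (- h)%C). rewrite Cmod_opp in H.
    replace (z - - h)%C with (z + h)%C in H by ring. lra. }
  assert (Hne : (z + h)%C <> 0%C) by (apply Cmod_gt_0; lra).
  replace (/ (z + h) - / z - - / (z * z) * h)%C with ((h * h) / (z * z * (z + h)))%C
    by (field; split; assumption).
  rewrite Cmod_div by (repeat apply Cmult_neq_0; assumption).
  rewrite !Cmod_mult.
  replace (2 / (Cmod z * Cmod z * Cmod z) * (Cmod h * Cmod h))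
    with (Cmod h * Cmod h / (Cmod z * Cmod z * (Cmod z / 2))) by (field; lra).
  unfold Rdiv at 1 2. apply Rmult_le_compat_l.
  { assert (H := Cmod_ge_0 h). nra. }
  apply Rinv_le_contravar.
  - repeat apply Rmult_lt_0_compat; lra.
  - apply Rmult_le_compat_l; [nra | lra].
Qed.

Lemma Cder_Rder (f : C -> C) (a d l : C) (t : R) :
  Cder f (a + t * d)%C l -> Rder (fun s => f (a + s * d)%C) t (l * d)%C.
Proof.
  intros H.
  assert (Hd0 := Cmod_ge_0 d).
  assert (K : forall eps, 0 < eps -> exists delta : posreal, forall h : R, h <> 0 -> Rabs h < delta ->
     Cmod (/ h * (f (a + (t + h)%R * d) - f (a + t * d)) - l * d)%C < eps).
  { intros eps Heps.
    assert (He : 0 < eps / (2 * (Cmod d + 1))) by (apply Rdiv_lt_0_compat; lra).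
    destruct (H _ He) as [d0 [Hd0' Hf]].
    assert (Hp : 0 < d0 / (Cmod d + 1)) by (apply Rdiv_lt_0_compat; lra).
    exists (mkposreal _ Hp). simpl. intros h Hh0 Hh.
    assert (Hh' : 0 < Rabs h) by now apply Rabs_pos_lt.
    assert (HC : RtoC h <> 0%C) by (intros E; apply Hh0; now apply RtoC_inj).
    assert (Hb : Cmod (h * d)%C < d0).
    { rewrite Cmod_mult, Cmod_R.
      apply Rle_lt_trans with (Rabs h * (Cmod d + 1)); [nra|].
      apply Rlt_le_trans with (d0 / (Cmod d + 1) * (Cmod d + 1)).
      - apply Rmult_lt_compat_r; lra.
      - right; field; lra. }
    specialize (Hf _ Hb).
    replace (a + t * d + h * d)%C with (a + (t + h)%R * d)%C in Hf by (rewrite RtoC_plus; ring).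
    replace (/ h * (f (a + (t + h)%R * d) - f (a + t * d)) - l * d)%C
      with (/ h * (f (a + (t + h)%R * d) - f (a + t * d) - l * (h * d)))%C by (field; exact HC).
    rewrite Cmod_mult, Cmod_inv by exact HC. rewrite Cmod_R.
    rewrite Cmod_mult, Cmod_R in Hf.
    apply Rle_lt_trans with (/ Rabs h * (eps / (2 * (Cmod d + 1)) * (Rabs h * Cmod d))).
    - apply Rmult_le_compat_l; [left; now apply Rinv_0_lt_compat | exact Hf].
    - replace (/ Rabs h * (eps / (2 * (Cmod d + 1)) * (Rabs h * Cmod d)))
        with (eps * (Cmod d / (2 * (Cmod d + 1)))) by (field; lra).
      apply Rlt_le_trans with (eps * 1); [|lra].
      apply Rmult_lt_compat_l; [exact Heps|].
      apply (Rmult_lt_reg_r (2 * (Cmod d + 1))); [lra|].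
      unfold Rdiv. rewrite Rmult_assoc, Rinv_l; lra. }
  split; apply is_derive_Reals; intros eps Heps; destruct (K eps Heps) as [dl Hdl];
    exists dl; intros h Hh0 Hh; specialize (Hdl h Hh0 Hh).
  - eapply Rle_lt_trans; [|exact Hdl].
    eapply Rle_trans; [|apply re_le_Cmod]. right. f_equal.
    rewrite <- RtoC_inv by exact Hh0.
    destruct (f (a + (t + h)%R * d)%C), (f (a + t * d)%C), (l * d)%C; simpl; field; exact Hh0.
  - eapply Rle_lt_trans; [|exact Hdl].
    eapply Rle_trans; [|apply Im_le_Cmod]. right. f_equal.
    rewrite <- RtoC_inv by exact Hh0.
    destruct (f (a + (t + h)%R * d)%C), (f (a + t * d)%C), (l * d)%C; simpl; field; exact Hh0.
Qed.

(** Projecting the curve on its own increment [v] reduces the inequality to the real mean value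
    theorem: the projection [g] increases by exactly |v|^2. *)
Lemma R_mvt (f f' : R -> C) (a b M : R) : a <= b ->
  (forall t, a <= t <= b -> Rder f t (f' t)) ->
  (forall t, a <= t <= b -> Cmod (f' t) <= M) ->
  Cmod (f b - f a)%C <= M * (b - a).
Proof.
  intros Hab Hd HM.
  set (v := (f b - f a)%C).
  destruct (Req_dec (Cmod v) 0) as [Hv|Hv].
  { rewrite Hv. apply Rmult_le_pos; [|lra].
    apply Rle_trans with (Cmod (f' a)); [apply Cmod_ge_0 | apply HM; lra]. }
  assert (Hv0 : 0 < Cmod v) by (assert (H := Cmod_ge_0 v); lra).
  set (g := fun t => Re v * Re (f t) + Im v * Im (f t)).
  set (dg := fun t => Re v * Re (f' t) + Im v * Im (f' t)).
  assert (Hg : forall t, a <= t <= b -> is_derive g t (dg t)).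
  { intros t Ht. destruct (Hd t Ht) as [H1 H2].
    apply (is_derive_plus (fun t => Re v * Re (f t)) (fun t => Im v * Im (f t)));
      now apply is_derive_scal. }
  destruct (MVT_gen g a b dg) as [c [Hc Hgc]].
  - intros x Hx. rewrite Rmin_left, Rmax_right in Hx by exact Hab. apply Hg. lra.
  - intros x Hx. rewrite Rmin_left, Rmax_right in Hx by exact Hab.
    apply derivable_continuous_pt. exists (dg x). apply is_derive_Reals. now apply Hg.
  - rewrite Rmin_left, Rmax_right in Hc by exact Hab.
    assert (E : g b - g a = Cmod v * Cmod v).
    { rewrite Cmod_sqr. unfold g, v. destruct (f b), (f a). simpl. ring. }
    assert (Hdg : dg c <= Cmod v * M).
    { apply Rle_trans with (Cmod v * Cmod (f' c)).
      - replace (dg c) with (Re (Cconj v * f' c)%C)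
          by (unfold dg; destruct v, (f' c); simpl; ring).
        rewrite <- (Cmod_conj v), <- Cmod_mult.
        eapply Rle_trans; [apply Rle_abs | apply re_le_Cmod].
      - apply Rmult_le_compat_l; [lra | now apply HM]. }
    apply (Rmult_le_reg_l (Cmod v)); [exact Hv0|]. rewrite <- E, Hgc, <- Rmult_assoc.
    apply Rmult_le_compat_r; lra.
Qed.

(** This takes the place of path integrals. With M = 0 it shows that functions with equal
    derivatives on a convex set differ by a constant. *)
Lemma C_mvt (f f' : C -> C) (z1 z2 : C) (M : R) :
  (forall t : R, 0 <= t <= 1 -> Cder f (z1 + t * (z2 - z1))%C (f' (z1 + t * (z2 - z1))%C)) ->
  (forall t : R, 0 <= t <= 1 -> Cmod (f' (z1 + t * (z2 - z1))%C) <= M) ->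
  Cmod (f z2 - f z1)%C <= M * Cmod (z2 - z1)%C.
Proof.
  intros Hd HM.
  assert (H := R_mvt (fun t => f (z1 + t * (z2 - z1))%C)
    (fun t => f' (z1 + t * (z2 - z1)) * (z2 - z1))%C 0 1 (M * Cmod (z2 - z1)%C)).
  replace (f z2 - f z1)%C with
    (f (z1 + 1%R * (z2 - z1)) - f (z1 + 0%R * (z2 - z1)))%C
    by (f_equal; [f_equal; ring | do 2 f_equal; ring]).
  replace (M * Cmod (z2 - z1)%C) with (M * Cmod (z2 - z1)%C * (1 - 0)) by ring.
  apply H; [lra | |].
  - intros t Ht. now apply Cder_Rder, Hd.
  - intros t Ht. rewrite Cmod_mult. apply Rmult_le_compat_r; [apply Cmod_ge_0 | now apply HM].
Qed.

(** * The complex exponential *)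

Lemma Re_plus (z w : C) : Re (z + w)%C = Re z + Re w. Proof. reflexivity. Qed.
Lemma Im_plus (z w : C) : Im (z + w)%C = Im z + Im w. Proof. reflexivity. Qed.

Lemma Cexp_plus (z w : C) : Cexp (z + w)%C = (Cexp z * Cexp w)%C.
Proof.
  unfold Cexp. rewrite Re_plus, Im_plus, exp_plus, cos_plus, sin_plus.
  apply Ceq_pair; simpl; ring.
Qed.

Lemma Cexp_RtoC (x : R) : Cexp (RtoC x) = RtoC (exp x).
Proof. unfold Cexp. simpl. rewrite cos_0, sin_0. apply Ceq_pair; simpl; ring. Qed.

Lemma Cexp_0 : Cexp 0 = 1%C.
Proof. rewrite Cexp_RtoC, exp_0. reflexivity. Qed.

Lemma Cexp_opp_l (z : C) : (Cexp (- z) * Cexp z)%C = 1%C.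
Proof. rewrite <- Cexp_plus. replace (- z + z)%C with (RtoC 0) by ring. apply Cexp_0. Qed.

Lemma Cmod_Cexp (z : C) : Cmod (Cexp z) = exp (Re z).
Proof.
  assert (H := exp_pos (Re z)). unfold Cexp, Cmod. simpl.
  replace (_ + _) with (Rsqr (exp (Re z))).
  - rewrite sqrt_Rsqr; lra.
  - assert (Hc := sin2_cos2 (Im z)). unfold Rsqr in *.
    transitivity (exp (Re z) * exp (Re z) * (sin (Im z) * sin (Im z) + cos (Im z) * cos (Im z)));
    [rewrite Hc; ring | ring].
Qed.

Lemma Cexp_neq_0 (z : C) : Cexp z <> 0%C.
Proof. apply Cmod_gt_0. rewrite Cmod_Cexp. apply exp_pos. Qed.

Lemma Cexp_opp (z : C) : Cexp (- z)%C = (/ Cexp z)%C.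
Proof.
  assert (H := Cexp_neq_0 z). assert (H1 := Cexp_opp_l z).
  replace (/ Cexp z)%C with (Cexp (- z) * Cexp z * / Cexp z)%C by (rewrite H1; ring).
  field. exact H.
Qed.

Lemma Rder_Cexp_line (w : C) (t : R) :
  Rder (fun s => Cexp (s * w)%C) t (w * Cexp (t * w))%C.
Proof.
  destruct w as [x y]. unfold Rder, Cexp; simpl.
  split.
  - apply (is_derive_ext (fun s => exp (s * x) * cos (s * y))).
    { intros s. f_equal; f_equal; ring. }
    auto_derive; trivial.
    replace (t * x - 0 * y) with (t * x) by ring. replace (t * y + 0 * x) with (t * y) by ring. ring.
  - apply (is_derive_ext (fun s => exp (s * x) * sin (s * y))).
    { intros s. f_equal; f_equal; ring. }
    auto_derive; trivial.
    replace (t * x - 0 * y) with (t * x) by ring. replace (t * y + 0 * x) with (t * y) by ring. ring.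
Qed.

Lemma exp_le_exp (x y : R) : x <= y -> exp x <= exp y.
Proof. intros [H| ->]; [left; now apply exp_increasing | lra]. Qed.

Lemma Re_le_Cmod (z : C) : Re z <= Cmod z.
Proof. eapply Rle_trans; [apply Rle_abs | apply re_le_Cmod]. Qed.

Lemma Re_RtoC_mult (t : R) (w : C) : Re (t * w)%C = t * Re w.
Proof. unfold Re, Im; simpl; ring. Qed.

Lemma Im_RtoC_mult (t : R) (w : C) : Im (t * w)%C = t * Im w.
Proof. unfold Re, Im; simpl; ring. Qed.

Lemma Cexp_minus_1 (w : C) : Cmod (Cexp w - 1)%C <= Cmod w * exp (Rmax 0 (Re w)).
Proof.
  assert (H := R_mvt (fun t => Cexp (t * w)%C) (fun t => w * Cexp (t * w))%C 0 1
    (Cmod w * exp (Rmax 0 (Re w)))).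
  replace (Cexp w - 1)%C with (Cexp (1%R * w) - Cexp (0%R * w))%C.
  2: { rewrite !Cmult_1_l. replace (0 * w)%C with (RtoC 0) by ring. now rewrite Cexp_0. }
  rewrite Rminus_0_r, Rmult_1_r in H. apply H; [lra | |].
  - intros; apply Rder_Cexp_line.
  - intros t Ht. rewrite Cmod_mult, Cmod_Cexp, Re_RtoC_mult.
    apply Rmult_le_compat_l; [apply Cmod_ge_0|]. apply exp_le_exp.
    unfold Rmax. destruct (Rle_dec 0 (Re w)); nra.
Qed.

Lemma Cexp_minus_1_mod (w : C) : Cmod (Cexp w - 1)%C <= Cmod w * exp (Cmod w).
Proof.
  eapply Rle_trans; [apply Cexp_minus_1|]. apply Rmult_le_compat_l; [apply Cmod_ge_0|].
  apply exp_le_exp, Rmax_lub; [apply Cmod_ge_0 | apply Re_le_Cmod].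
Qed.

Lemma Cexp_minus_1_minus (w : C) :
  Cmod (Cexp w - 1 - w)%C <= Cmod w * Cmod w * exp (Cmod w).
Proof.
  assert (H := R_mvt (fun t => Cexp (t * w) - t * w)%C (fun t => w * Cexp (t * w) - w)%C 0 1
    (Cmod w * Cmod w * exp (Cmod w))).
  replace (Cexp w - 1 - w)%C with (Cexp (1%R * w) - 1%R * w - (Cexp (0%R * w) - 0%R * w))%C.
  2: { rewrite !Cmult_1_l. replace (0 * w)%C with (RtoC 0) by ring. rewrite Cexp_0. ring. }
  rewrite Rminus_0_r, Rmult_1_r in H. apply H; [lra | |].
  - intros t _. destruct (Rder_Cexp_line w t) as [H1 H2]. split.
    + apply (is_derive_minus (fun s : R => Re (Cexp (s * w))) (fun s : R => Re (s * w)%C)); [exact H1|].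
      destruct w; simpl. auto_derive; trivial. ring.
    + apply (is_derive_minus (fun s : R => Im (Cexp (s * w))) (fun s : R => Im (s * w)%C)); [exact H2|].
      destruct w; simpl. auto_derive; trivial. ring.
  - intros t Ht. replace (w * Cexp (t * w) - w)%C with (w * (Cexp (t * w) - 1))%C by ring.
    rewrite Cmod_mult, Rmult_assoc. apply Rmult_le_compat_l; [apply Cmod_ge_0|].
    assert (Hw := Cmod_ge_0 w).
    assert (Hm : Cmod (t * w)%C <= Cmod w).
    { rewrite Cmod_mult, Cmod_RtoC_nonneg by lra. nra. }
    eapply Rle_trans; [apply Cexp_minus_1_mod|].
    apply Rmult_le_compat; try apply Cmod_ge_0; [left; apply exp_pos | exact Hm | now apply exp_le_exp].
Qed.

(** The weight is the larger of the two moduli, which stays integrable when both exponents have very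
    negative real part, as in Laplace's method. *)
Lemma Cexp_diff (z w : C) :
  Cmod (Cexp z - Cexp w)%C <= Cmod (z - w)%C * exp (Rmax (Re z) (Re w)).
Proof.
  replace (Cexp z - Cexp w)%C with (Cexp w * (Cexp (z - w) - 1))%C.
  2: { unfold Cminus. rewrite Cmult_plus_distr_l, <- Cexp_plus.
       replace (w + (z + - w))%C with z by ring. ring. }
  rewrite Cmod_mult, Cmod_Cexp.
  apply Rle_trans with (exp (Re w) * (Cmod (z - w)%C * exp (Rmax 0 (Re (z - w)%C)))).
  - apply Rmult_le_compat_l; [left; apply exp_pos | apply Cexp_minus_1].
  - right. rewrite (Rmult_comm (exp (Re w))), Rmult_assoc, <- exp_plus. do 2 f_equal.
    destruct z, w; simpl. unfold Rmax. repeat destruct Rle_dec; lra.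
Qed.

Lemma Cder_Cexp (z : C) : Cder Cexp z (Cexp z).
Proof.
  apply (Cder_quad _ _ _ (Cmod (Cexp z) * exp 1) 1); [lra|].
  intros h Hh. rewrite Cexp_plus.
  replace (Cexp z * Cexp h - Cexp z - Cexp z * h)%C with (Cexp z * (Cexp h - 1 - h))%C by ring.
  rewrite Cmod_mult, Rmult_assoc. apply Rmult_le_compat_l; [apply Cmod_ge_0|].
  eapply Rle_trans; [apply Cexp_minus_1_minus|]. rewrite Rmult_comm.
  apply Rmult_le_compat_r; [assert (H := Cmod_ge_0 h); nra | apply exp_le_exp; lra].
Qed.

Lemma Cder_Cexp_comp (f : C -> C) (z l : C) :
  Cder f z l -> Cder (fun w => Cexp (f w)) z (Cexp (f z) * l)%C.
Proof. intros H. now apply (Cder_comp Cexp f); [apply Cder_Cexp|]. Qed.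

(** * Sine and cosine *)

Definition Ccos (w : C) : C := ((Cexp (Ci * w) + Cexp (- (Ci * w))) / 2)%C.

Lemma Ci_sqr : (Ci * Ci)%C = (- (1))%C.
Proof. apply Ceq_pair; simpl; ring. Qed.

Lemma RtoC_neq_0 (x : R) : x <> 0 -> RtoC x <> 0%C.
Proof. intros H E. apply H. now apply RtoC_inj. Qed.

Lemma Ci_neq_0 : Ci <> 0%C.
Proof. apply Cmod_gt_0. rewrite Cmod_Ci. lra. Qed.

Lemma Csin_alt (w : C) : Csin w = (- (Ci / 2) * (Cexp (Ci * w) - Cexp (- (Ci * w))))%C.
Proof.
  unfold Csin. assert (H2 : RtoC 2 <> 0%C) by (apply RtoC_neq_0; lra).
  assert (Hi := Ci_neq_0).
  replace (- (Ci / 2))%C with (- (Ci * Ci) / (2 * Ci))%C by (field; auto).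
  rewrite Ci_sqr. field. auto.
Qed.

Lemma Cder_Csin (z : C) : Cder Csin z (Ccos z).
Proof.
  eapply Cder_ext; [intros w; symmetry; apply Csin_alt|].
  eapply Cder_eq.
  - apply Cder_scal, Cder_minus; apply Cder_Cexp_comp;
      [apply Cder_scal, Cder_id | apply Cder_opp, Cder_scal, Cder_id].
  - unfold Ccos.
    replace (- (Ci / 2) * (Cexp (Ci * z) * (Ci * 1) - Cexp (- (Ci * z)) * - (Ci * 1)))%C
      with (- (Ci * Ci) / 2 * (Cexp (Ci * z) + Cexp (- (Ci * z))))%C
      by (unfold Cdiv; ring).
    rewrite Ci_sqr. unfold Cdiv; ring.
Qed.

Lemma Cder_Ccos (z : C) : Cder Ccos z (- Csin z)%C.
Proof.
  apply (Cder_ext (fun w => / 2 * (Cexp (Ci * w) + Cexp (- (Ci * w))))%C).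
  { intros w. unfold Ccos, Cdiv. ring. }
  eapply Cder_eq.
  - apply Cder_scal, Cder_plus; apply Cder_Cexp_comp;
      [apply Cder_scal, Cder_id | apply Cder_opp, Cder_scal, Cder_id].
  - rewrite Csin_alt. unfold Cdiv; ring.
Qed.

Lemma Re_Ci_mult (w : C) : Re (Ci * w)%C = - Im w.
Proof. unfold Re, Im; simpl; ring. Qed.

Lemma Cmod_Cexp_Ci (w : C) : Cmod (Cexp (Ci * w)) <= exp (Rabs (Im w)) /\
  Cmod (Cexp (- (Ci * w))) <= exp (Rabs (Im w)).
Proof.
  rewrite !Cmod_Cexp. change (Re (- (Ci * w))%C) with (- Re (Ci * w)%C). rewrite Re_Ci_mult.
  split; apply exp_le_exp; [rewrite <- Rabs_Ropp; apply Rle_abs | rewrite Ropp_involutive; apply Rle_abs].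
Qed.

Lemma Cmod_Csin_le (w : C) : Cmod (Csin w) <= exp (Rabs (Im w)).
Proof.
  rewrite Csin_alt, Cmod_mult, Cmod_opp, Cmod_div by (apply RtoC_neq_0; lra).
  rewrite Cmod_Ci, Cmod_RtoC_nonneg by lra.
  destruct (Cmod_Cexp_Ci w).
  assert (H1 := Cmod_triangle_minus (Cexp (Ci * w)) (Cexp (- (Ci * w)))). lra.
Qed.

Lemma Cmod_Ccos_le (w : C) : Cmod (Ccos w) <= exp (Rabs (Im w)).
Proof.
  unfold Ccos. rewrite Cmod_div by (apply RtoC_neq_0; lra).
  rewrite Cmod_RtoC_nonneg by lra.
  destruct (Cmod_Cexp_Ci w).
  assert (H1 := Cmod_triangle (Cexp (Ci * w)) (Cexp (- (Ci * w)))). lra.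
Qed.

Lemma Csin_0 : Csin 0 = 0%C.
Proof. rewrite Csin_alt. replace (Ci * 0)%C with (RtoC 0) by ring.
  replace (- 0)%C with (RtoC 0) by ring. rewrite Cexp_0. ring. Qed.

Lemma Ccos_0 : Ccos 0 = 1%C.
Proof. unfold Ccos. replace (Ci * 0)%C with (RtoC 0) by ring.
  replace (- 0)%C with (RtoC 0) by ring. rewrite Cexp_0. field. Qed.

Lemma Ccos_opp (w : C) : Ccos (- w)%C = Ccos w.
Proof. unfold Ccos. replace (Ci * - w)%C with (- (Ci * w))%C by ring.
  replace (- - (Ci * w))%C with (Ci * w)%C by ring. f_equal; ring. Qed.

(** Each bound integrates the previous one along the segment from 0 to [w]. *)
Lemma segment_bound (f f' : C -> C) (n : nat) :
  f 0%C = 0%C -> (forall z, Cder f z (f' z)) ->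
  (forall z, Cmod (f' z) <= Cmod z ^ n * exp (Rabs (Im z))) ->
  forall w, Cmod (f w) <= Cmod w ^ S n * exp (Rabs (Im w)).
Proof.
  intros H0 Hd Hb w.
  replace (f w) with (f w - f 0)%C by (rewrite H0; ring).
  replace (Cmod w ^ S n * exp (Rabs (Im w))) with
    (Cmod w ^ n * exp (Rabs (Im w)) * Cmod (w - 0)%C)
    by (replace (w - 0)%C with w by ring; simpl; ring).
  apply (C_mvt f f').
  - intros; apply Hd.
  - intros t Ht. replace (0 + t * (w - 0))%C with (t * w)%C by ring.
    eapply Rle_trans; [apply Hb|].
    rewrite Cmod_mult, Cmod_RtoC_nonneg, Im_RtoC_mult, Rabs_mult, (Rabs_pos_eq t) by lra.
    assert (Hw := Cmod_ge_0 w). assert (Hi := Rabs_pos (Im w)).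
    apply Rmult_le_compat; [apply pow_le; nra | left; apply exp_pos | |].
    + apply pow_incr; split; nra.
    + apply exp_le_exp; nra.
Qed.

Lemma Csin_bound (w : C) : Cmod (Csin w) <= Cmod w * exp (Rabs (Im w)).
Proof.
  rewrite <- (pow_1 (Cmod w)).
  apply (segment_bound Csin Ccos 0 Csin_0 Cder_Csin).
  intros z. simpl. rewrite Rmult_1_l. apply Cmod_Ccos_le.
Qed.

Lemma Ccos_minus_1_bound (w : C) : Cmod (Ccos w - 1)%C <= Cmod w ^ 2 * exp (Rabs (Im w)).
Proof.
  apply (segment_bound (fun z => Ccos z - 1)%C (fun z => - Csin z)%C 1).
  - rewrite Ccos_0. ring.
  - intros z. eapply Cder_eq; [apply Cder_minus; [apply Cder_Ccos | apply Cder_const]|]. ring.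
  - intros z. rewrite Cmod_opp, pow_1. apply Csin_bound.
Qed.

(** The cubic order compensates the factor u^(-3) of the kernel [phi 0] near u = 0. *)
Lemma Csin_minus_id_bound (w : C) : Cmod (Csin w - w)%C <= Cmod w ^ 3 * exp (Rabs (Im w)).
Proof.
  apply (segment_bound (fun z => Csin z - z)%C (fun z => Ccos z - 1)%C 2).
  - rewrite Csin_0. ring.
  - intros z. apply Cder_minus; [apply Cder_Csin | apply Cder_id].
  - apply Ccos_minus_1_bound.
Qed.

(** * The principal logarithm *)

Lemma Carg_polar (m y : R) : 0 < m -> - PI < y < PI -> Carg (m * cos y, m * sin y) = y.
Proof.
  intros Hm Hy. assert (HP := PI_RGT_0). unfold Carg; simpl.
  assert (Et : forall th, cos th <> 0 -> m * sin th / (m * cos th) = tan th)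
    by (intros th Hth; unfold tan; field; split; [exact Hth | lra]).
  destruct (Rlt_dec (- (PI / 2)) y) as [H1|H1]; [destruct (Rlt_dec y (PI / 2)) as [H2|H2]|].
  - assert (Hc := cos_gt_0 y H1 H2).
    destruct Rlt_dec as [_|N]; [|exfalso; apply N; nra].
    rewrite Et by lra. now apply atan_tan.
  - destruct (Req_dec y (PI / 2)) as [->|Hne].
    + rewrite cos_PI2, sin_PI2. do 2 (destruct Rlt_dec as [N|_]; [lra|]).
      destruct Rlt_dec as [_|N]; [reflexivity | lra].
    + assert (Hc : cos y < 0) by (apply cos_lt_0; lra).
      assert (Hs : 0 < sin y) by (apply sin_gt_0; lra).
      destruct Rlt_dec as [N|_]; [nra|]. destruct Rlt_dec as [_|N]; [|nra].
      destruct Rle_dec as [_|N]; [|nra].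
      rewrite Et by lra. replace (tan y) with (tan (y - PI)).
      2: { unfold tan. replace (y - PI) with (- (PI - y)) by ring.
           rewrite sin_neg, cos_neg, sin_PI_x, Rtrigo_facts.cos_pi_minus. field. lra. }
      rewrite atan_tan; lra.
  - destruct (Req_dec y (- (PI / 2))) as [->|Hne].
    + rewrite cos_neg, sin_neg, cos_PI2, sin_PI2.
      do 3 (destruct Rlt_dec as [N|_]; [lra|]).
      destruct Rlt_dec as [_|N]; [reflexivity | lra].
    + assert (Hc : cos y < 0) by (rewrite <- cos_neg; apply cos_lt_0; lra).
      assert (Hs : sin y < 0).
      { replace y with (- - y) by ring. rewrite sin_neg. assert (0 < sin (- y)) by (apply sin_gt_0; lra). lra. }
      destruct Rlt_dec as [N|_]; [nra|]. destruct Rlt_dec as [_|N]; [|nra].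
      destruct Rle_dec as [N|_]; [nra|].
      rewrite Et by lra. replace (tan y) with (tan (y + PI)).
      2: { unfold tan. rewrite neg_sin, neg_cos. field. lra. }
      rewrite atan_tan; lra.
Qed.

Lemma Cln_Cexp (w : C) : - PI < Im w < PI -> Cln (Cexp w) = w.
Proof.
  intros H. unfold Cln. rewrite Cmod_Cexp, ln_exp. unfold Cexp.
  rewrite Carg_polar by (apply exp_pos || exact H). destruct w; reflexivity.
Qed.

Lemma Cexp_Cln (z : C) : z <> 0%C -> Cexp (Cln z) = z.
Proof.
  intros Hz. assert (Hm : 0 < Cmod z) by now apply Cmod_gt_0.
  unfold Cln, Cexp; simpl. rewrite exp_ln by exact Hm.
  destruct z as [x y].
  assert (Hsq := Cmod_sqr (x, y)). simpl in Hsq.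
  set (m := Cmod (x, y)) in *.
  (* The formulas for [cos (atan t)] and [sin (atan t)] contain sqrt (1 + t^2), which at t = y / x
     equals m / |x|. *)
  assert (Key : x <> 0 -> sqrt (1 + (y / x)²) = m / Rabs x).
  { intros Hx. apply Rabs_pos_lt in Hx as Hx'.
    apply Rsqr_inj; [apply sqrt_pos | apply Rlt_le, Rdiv_lt_0_compat; assumption |].
    rewrite Rsqr_sqrt by (assert (H := Rle_0_sqr (y / x)); lra).
    assert (Hab : Rabs x * Rabs x = x * x) by (rewrite <- Rabs_mult; apply Rabs_pos_eq; nra).
    unfold Rsqr.
    replace (m / Rabs x * (m / Rabs x)) with ((m * m) / (Rabs x * Rabs x)) by (field; lra).
    rewrite Hab, Hsq. field. exact Hx. }
  unfold Carg; simpl. destruct Rlt_dec as [H1|H1]; [|destruct Rlt_dec as [H2|H2]].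
  - assert (K := Key ltac:(lra)). rewrite Rabs_pos_eq in K by lra.
    rewrite cos_atan, sin_atan, K. apply Ceq_pair; simpl; field; lra.
  - assert (K := Key ltac:(lra)). rewrite Rabs_left in K by lra.
    destruct Rle_dec.
    + rewrite neg_cos, neg_sin, cos_atan, sin_atan, K. apply Ceq_pair; simpl; field; lra.
    + replace (atan (y / x) - PI) with (- (PI - atan (y / x))) by ring.
      rewrite cos_neg, sin_neg, sin_PI_x, Rtrigo_facts.cos_pi_minus, cos_atan, sin_atan, K.
      apply Ceq_pair; simpl; field; lra.
  - assert (x = 0) by lra. subst x.
    assert (Hmy : m = Rabs y).
    { apply Rsqr_inj; [lra | apply Rabs_pos |]. unfold Rsqr.
      rewrite <- (Rabs_mult y y), (Rabs_pos_eq (y * y)); nra. }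
    destruct Rlt_dec; [|destruct Rlt_dec].
    + rewrite cos_PI2, sin_PI2, Hmy, Rabs_pos_eq by lra. apply Ceq_pair; simpl; ring.
    + rewrite cos_neg, sin_neg, cos_PI2, sin_PI2, Hmy, Rabs_left by lra. apply Ceq_pair; simpl; ring.
    + exfalso. assert (y = 0) by lra. subst y. apply Hz. reflexivity.
Qed.

Lemma Carg_bound (z : C) : - PI < Carg z <= PI.
Proof.
  assert (HP := PI_RGT_0). unfold Carg.
  assert (Ha := atan_bound (Im z / Re z)).
  destruct Rlt_dec; [lra|]. destruct Rlt_dec; [|repeat (destruct Rlt_dec; [lra|]); lra].
  destruct Rle_dec as [H|H].
  - split; [lra|]. assert (Im z / Re z <= 0).
    { unfold Rdiv. assert (/ Re z < 0) by now apply Rinv_lt_0_compat. nra. }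
    assert (Hle : atan (Im z / Re z) <= 0).
    { destruct (Rle_lt_or_eq_dec _ _ H0) as [L|E].
      - left. rewrite <- atan_0. now apply atan_increasing.
      - rewrite E, atan_0. lra. }
    lra.
  - split; [|lra]. assert (0 < Im z / Re z).
    { unfold Rdiv. assert (/ Re z < 0) by now apply Rinv_lt_0_compat. nra. }
    assert (0 < atan (Im z / Re z)) by (rewrite <- atan_0; now apply atan_increasing). lra.
Qed.

Lemma Cln_Re_Im (z : C) : z <> 0%C ->
  Re z = Cmod z * cos (Carg z) /\ Im z = Cmod z * sin (Carg z).
Proof.
  intros Hz. assert (H := Cexp_Cln z Hz).
  unfold Cln, Cexp in H; simpl in H. rewrite exp_ln in H by now apply Cmod_gt_0.
  split; [rewrite <- H at 1 | rewrite <- H at 1]; reflexivity.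
Qed.

Lemma Carg_Im_pos (z : C) : 0 < Im z -> 0 < Carg z < PI.
Proof.
  intros H. assert (Hz : z <> 0%C) by (intros ->; simpl in H; lra).
  assert (Hm : 0 < Cmod z) by now apply Cmod_gt_0.
  destruct (Cln_Re_Im z Hz) as [_ Hi]. assert (Hb := Carg_bound z).
  assert (Hs : 0 < sin (Carg z)) by nra.
  split.
  - apply Rnot_le_lt. intros N. assert (0 <= sin (- Carg z)) by (apply sin_ge_0; lra).
    rewrite sin_neg in H0. lra.
  - destruct (Req_dec (Carg z) PI) as [E|E]; [rewrite E, sin_PI in Hs|]; lra.
Qed.

Lemma Carg_Im_neg (z : C) : Im z < 0 -> - PI < Carg z < 0.
Proof.
  intros H. assert (Hz : z <> 0%C) by (intros ->; simpl in H; lra).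
  assert (Hm : 0 < Cmod z) by now apply Cmod_gt_0.
  destruct (Cln_Re_Im z Hz) as [_ Hi]. assert (Hb := Carg_bound z).
  assert (Hs : sin (Carg z) < 0) by nra.
  split; [lra|]. apply Rnot_le_lt. intros N.
  assert (0 <= sin (Carg z)) by (apply sin_ge_0; lra). lra.
Qed.

Lemma Carg_Re_pos (z : C) : 0 < Re z -> - (PI / 2) < Carg z < PI / 2.
Proof.
  intros H. unfold Carg. destruct Rlt_dec; [|lra].
  assert (Ha := atan_bound (Im z / Re z)). lra.
Qed.

(** * The plane cut along the negative axis *)

Definition slit (z : C) : Prop := 0 < Re z \/ Im z <> 0.

Lemma slit_neq_0 (z : C) : slit z -> z <> 0%C.
Proof. intros [H|H] ->; simpl in H; lra. Qed.

Lemma Carg_slit (z : C) : slit z -> - PI < Carg z < PI.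
Proof.
  assert (HP := PI_RGT_0). intros [H|H].
  - apply Carg_Re_pos in H. lra.
  - destruct (Rtotal_order (Im z) 0) as [H1|[H1|H1]]; [apply Carg_Im_neg in H1 | | apply Carg_Im_pos in H1]; lra.
Qed.

Lemma Cln_unique (z w : C) : - PI < Im w < PI -> Cexp w = z -> Cln z = w.
Proof. intros H <-. now apply Cln_Cexp. Qed.

Lemma ln_le_minus_1 (x : R) : 0 < x -> ln x <= x - 1.
Proof.
  intros Hx. assert (H := exp_ineq1_le (ln x)). rewrite exp_ln in H; lra.
Qed.

Lemma is_derive_atan_pow (x : R) : is_derive atan x (/ (1 + x ^ 2)).
Proof. rewrite <- Rsqr_pow2. apply is_derive_atan. Qed.

Lemma atan_abs_le (x : R) : Rabs (atan x) <= Rabs x.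
Proof.
  destruct (MVT_gen atan 0 x (fun t => / (1 + t ^ 2))) as [c [_ Hc]].
  - intros; apply is_derive_atan_pow.
  - intros; apply continuity_pt_filterlim, (ex_derive_continuous atan). eexists; apply is_derive_atan_pow.
  - rewrite atan_0, !Rminus_0_r in Hc. rewrite Hc, Rabs_mult.
    rewrite <- (Rmult_1_l (Rabs x)) at 2. apply Rmult_le_compat_r; [apply Rabs_pos|].
    rewrite Rabs_pos_eq.
    + rewrite <- Rinv_1. apply Rinv_le_contravar; nra.
    + left; apply Rinv_0_lt_compat; nra.
Qed.

(** As 1 + Re w >= 1/2, modulus and argument contribute at most 2 |w| each: the modulus by ln x <= x
    - 1 at m and at 1 / m, the argument by |atan x| <= |x|. *)
Lemma Cmod_Cln_1_plus (w : C) : Cmod w <= 1 / 2 -> Cmod (Cln (1 + w)) <= 4 * Cmod w.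
Proof.
  intros Hw. eapply Rle_trans; [apply Cmod_le_Re_Im|].
  assert (Hre := re_le_Cmod w). assert (Him := Im_le_Cmod w).
  assert (Hx : 1 / 2 <= 1 + Re w) by (assert (H := Rabs_def2 (Re w) (1/2 + 1)); apply Rabs_le_between in Hre; lra).
  assert (Hm1 : Cmod (1 + w)%C <= 1 + Cmod w).
  { eapply Rle_trans; [apply Cmod_triangle|]. rewrite Cmod_1. lra. }
  assert (Hm2 : 1 - Cmod w <= Cmod (1 + w)%C).
  { assert (H := Cmod_minus_lower 1 (- w)%C). rewrite Cmod_1, Cmod_opp in H.
    replace (1 - - w)%C with (1 + w)%C in H by ring. exact H. }
  assert (Hln : Rabs (Re (Cln (1 + w)%C)) <= 2 * Cmod w).
  { simpl. set (m := Cmod (1 + w)%C) in *. apply Rabs_le. split.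
    - assert (H := ln_le_minus_1 (/ m) ltac:(apply Rinv_0_lt_compat; lra)).
      rewrite ln_Rinv in H by lra.
      assert (/ m <= 1 + 2 * Cmod w); [|lra].
      apply (Rmult_le_reg_r m); [lra|]. rewrite Rinv_l by lra. nra.
    - assert (H := ln_le_minus_1 m ltac:(lra)). lra. }
  assert (Hat : Rabs (Im (Cln (1 + w)%C)) <= 2 * Cmod w).
  { simpl. unfold Carg. change (Re (1 + w)%C) with (1 + Re w).
    replace (Im (1 + w)%C) with (Im w) by (unfold Im; simpl; ring).
    destruct Rlt_dec as [_|N]; [|lra].
    eapply Rle_trans; [apply atan_abs_le|]. unfold Rdiv.
    rewrite Rabs_mult, (Rabs_pos_eq (/ _)) by (left; apply Rinv_0_lt_compat; lra).
    apply (Rmult_le_reg_r (1 + Re w)); [lra|]. rewrite Rmult_assoc, Rinv_l by lra.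
    assert (H := Rabs_pos (Im w)). nra. }
  lra.
Qed.

(** With w = h / z and v = [Cln (1 + w)], the increment of the logarithm is v as long as the cut is
    not crossed. Then w = exp v - 1, so v - w is quadratic by the estimate for the exponential. *)
Lemma Cder_Cln (z : C) : slit z -> Cder Cln z (/ z)%C.
Proof.
  intros Hs. assert (Hz := slit_neq_0 z Hs). assert (Hm : 0 < Cmod z) by now apply Cmod_gt_0.
  assert (Ha := Carg_slit z Hs).
  set (g := Rmin (PI - Carg z) (PI + Carg z)).
  assert (Hg : 0 < g) by (apply Rmin_glb_lt; lra).
  (* [g] is the distance of the argument from the values -PI and PI. Since |v| <= 4 |w| < 4 g / 5,
     adding v does not cross the cut. *)
  set (d := Rmin (1 / 2) (g / 5)).
  assert (Hd : 0 < d) by (apply Rmin_glb_lt; lra).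
  apply (Cder_quad _ _ _ (16 * exp 2 / (Cmod z * Cmod z)) (d * Cmod z)); [nra|].
  intros h Hh.
  set (w := (h / z)%C).
  assert (Hw : Cmod w = Cmod h / Cmod z) by (unfold w; now rewrite Cmod_div).
  assert (Hwd : Cmod w < d).
  { rewrite Hw. apply (Rmult_lt_reg_r (Cmod z)); [exact Hm|].
    unfold Rdiv. rewrite Rmult_assoc, Rinv_l; lra. }
  assert (Hd1 := Rmin_l (1/2) (g / 5)). assert (Hd2 := Rmin_r (1/2) (g / 5)). fold d in Hd1, Hd2.
  assert (Hg1 := Rmin_l (PI - Carg z) (PI + Carg z)). assert (Hg2 := Rmin_r (PI - Carg z) (PI + Carg z)).
  fold g in Hg1, Hg2.
  assert (Hb := Cmod_Cln_1_plus w ltac:(lra)).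
  assert (H1w : (1 + w)%C <> 0%C).
  { apply Cmod_gt_0. assert (H := Cmod_minus_lower 1 (- w)%C). rewrite Cmod_1, Cmod_opp in H.
    replace (1 - - w)%C with (1 + w)%C in H by ring. lra. }
  assert (E : Cln (z + h)%C = (Cln z + Cln (1 + w))%C).
  { apply Cln_unique.
    - rewrite Im_plus. assert (Hi := Im_le_Cmod (Cln (1 + w)%C)). apply Rabs_le_between in Hi.
      change (Im (Cln z)) with (Carg z). lra.
    - rewrite Cexp_plus, !Cexp_Cln by assumption. unfold w. field. exact Hz. }
  rewrite E.
  set (v := Cln (1 + w)%C) in *.
  replace (Cln z + v - Cln z - / z * h)%C with (v - w)%C by (unfold w, Cdiv; ring).
  assert (Ew : w = (Cexp v - 1)%C) by (unfold v; rewrite Cexp_Cln by exact H1w; ring).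
  rewrite Cmod_minus_sym, Ew. replace (Cexp v - 1 - v)%C with (Cexp v - 1 - v)%C by ring.
  eapply Rle_trans; [apply Cexp_minus_1_minus|].
  assert (Hv0 := Cmod_ge_0 v). assert (Hw0 := Cmod_ge_0 w).
  assert (He : exp (Cmod v) <= exp 2) by (apply exp_le_exp; lra).
  assert (He0 := exp_pos (Cmod v)).
  apply Rle_trans with ((4 * Cmod w) * (4 * Cmod w) * exp 2).
  - apply Rmult_le_compat; try nra; try (apply Rlt_le, exp_pos); assumption.
  - right. rewrite Hw. field. lra.
Qed.

Lemma Cder_Cln_comp (f : C -> C) (z l : C) :
  slit (f z) -> Cder f z l -> Cder (fun w => Cln (f w)) z (l / f z)%C.
Proof.
  intros Hs H. eapply Cder_eq; [apply (Cder_comp Cln f); [apply Cder_Cln, Hs | exact H]|].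
  unfold Cdiv. ring.
Qed.

(** * Improper integrals of complex-valued functions *)

Notation Cint := (is_RInt_gen (V := C_R_CompleteNormedModule)).
Notation Cint0 f l := (Cint f (at_right 0) (Rbar_locally p_infty) l).
Notation CintR f l := (Cint f (Rbar_locally m_infty) (Rbar_locally p_infty) l).

Definition Ccontinuous (f : R -> C) (t : R) : Prop :=
  continuous (U := C_R_NormedModule) f t.

Lemma Ccontinuous_pair (f : R -> C) (t : R) :
  continuous (fun s => Re (f s)) t -> continuous (fun s => Im (f s)) t -> Ccontinuous f t.
Proof.
  intros H1 H2 P [eps HP].
  assert (K1 : locally t (fun s => ball (Re (f t)) eps (Re (f s)))) by apply H1, locally_ball.
  assert (K2 : locally t (fun s => ball (Im (f t)) eps (Im (f s)))) by apply H2, locally_ball.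
  change (locally t (fun s => P (f s))).
  generalize (filter_and _ _ K1 K2). apply filter_imp.
  intros s [B1 B2]. apply HP. now split.
Qed.

Lemma Rder_Ccontinuous (f : R -> C) (t : R) (l : C) : Rder f t l -> Ccontinuous f t.
Proof.
  intros [H1 H2]. apply Ccontinuous_pair.
  - apply (ex_derive_continuous (fun s => Re (f s))). now exists (Re l).
  - apply (ex_derive_continuous (fun s => Im (f s))). now exists (Im l).
Qed.

Lemma Rder_is_derive (f : R -> C) (t : R) (l : C) :
  Rder f t l -> is_derive (K := R_AbsRing) (V := C_R_NormedModule) f t l.
Proof.
  intros [[_ H1] [_ H2]]. split.
  - apply (is_linear_scal_l (K := R_AbsRing) (V := C_R_NormedModule)).
  - intros x Hx.
    apply (is_filter_lim_locally_unique (K := R_AbsRing) (V := R_NormedModule)) in Hx. subst x.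
    assert (Hx : is_filter_lim (locally (T := R_UniformSpace) t) t) by (intros P HP; exact HP).
    intros eps.
    assert (He : 0 < eps / 2) by (assert (H := cond_pos eps); lra).
    specialize (H1 t Hx (mkposreal _ He)). specialize (H2 t Hx (mkposreal _ He)).
    generalize (filter_and _ _ H1 H2). apply filter_imp.
    intros y [K1 K2]. eapply Rle_trans; [apply Req_le; symmetry; apply Cmod_norm|].
    change (Cmod (f y - f t - scal (V := C_R_NormedModule) (minus y t) l)%C <= eps * Rabs (minus y t)).
    eapply Rle_trans; [apply Cmod_le_Re_Im|].
    change (Rabs (Re (f y - f t - scal (V := C_R_NormedModule) (minus y t) l)%C) <= eps / 2 * Rabs (minus y t)) in K1.
    change (Rabs (Im (f y - f t - scal (V := C_R_NormedModule) (minus y t) l)%C) <= eps / 2 * Rabs (minus y t)) in K2.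
    lra.
Qed.

Lemma is_RInt_Rder (f f' : R -> C) (a b : R) :
  (forall x, Rmin a b <= x <= Rmax a b -> Rder f x (f' x)) ->
  (forall x, Rmin a b <= x <= Rmax a b -> Ccontinuous f' x) ->
  is_RInt (V := C_R_CompleteNormedModule) f' a b (f b - f a)%C.
Proof.
  intros H1 H2. apply (is_RInt_derive (V := C_R_CompleteNormedModule) f f').
  - intros x Hx. now apply Rder_is_derive, H1.
  - exact H2.
Qed.

Lemma Cmod_RInt_le_atan (f : R -> C) (M a b : R) (l : C) :
  (forall x, Rmin a b <= x <= Rmax a b -> Cmod (f x) <= M / (1 + x ^ 2)) ->
  is_RInt (V := C_R_CompleteNormedModule) f a b l -> Cmod l <= M * Rabs (atan b - atan a).
Proof.
  assert (Hg : forall a b, is_RInt (fun x => M / (1 + x ^ 2)) a b (M * atan b - M * atan a)).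
  { intros a' b'.
    apply (is_RInt_derive (fun x => M * atan x) (fun x => M / (1 + x ^ 2))).
    - intros x _. apply is_derive_scal, is_derive_atan_pow.
    - intros x _. apply (ex_derive_continuous (fun x => M / (1 + x ^ 2))). auto_derive. nra. }
  assert (Hinc : forall a b, a <= b -> atan a <= atan b).
  { intros a' b' [H|E]; [left; now apply atan_increasing | subst; lra]. }
  intros H Hl. destruct (Rle_dec a b) as [Hab|Hab].
  - rewrite Rmin_left, Rmax_right in H by exact Hab.
    rewrite Rabs_pos_eq by (assert (K := Hinc a b Hab); lra).
    rewrite Rmult_minus_distr_l, Cmod_norm.
    apply (norm_RInt_le (V := C_R_CompleteNormedModule) f (fun x => M / (1 + x ^ 2)) a b l _ Hab);
      [intros x Hx; rewrite <- Cmod_norm; now apply H | exact Hl | apply Hg].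
  - assert (Hba : b <= a) by lra. rewrite Rmin_right, Rmax_left in H by exact Hba.
    rewrite Rabs_minus_sym, Rabs_pos_eq by (assert (K := Hinc b a Hba); lra).
    rewrite <- Cmod_opp, Rmult_minus_distr_l, Cmod_norm.
    apply (norm_RInt_le (V := C_R_CompleteNormedModule) f (fun x => M / (1 + x ^ 2)) b a _ _ Hba);
      [intros x Hx; rewrite <- Cmod_norm; now apply H | now apply (is_RInt_swap (V := C_R_CompleteNormedModule)) | apply Hg].
Qed.

(** With the majorant M / (1 + x^2), the integral over [a, b] is controlled by M |atan b - atan a|,
    so convergence follows from the finite limits of [atan]. The domination of improper integrals
    below is always brought into this form. The set [D] serves to leave out the end point 0, where
    the kernels need not be continuous. *)
Lemma dominated_integral (f : R -> C) (M la lb : R) (D : R -> Prop)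
    (Fa Fb : (R -> Prop) -> Prop) {PFa : ProperFilter Fa} {PFb : ProperFilter Fb} :
  (forall a b x, D a -> D b -> Rmin a b <= x <= Rmax a b -> D x) ->
  Fa D -> Fb D -> filter_prod Fa Fb (fun ab => fst ab <= snd ab) ->
  filterlim atan Fa (locally la) -> filterlim atan Fb (locally lb) ->
  (forall x, D x -> Ccontinuous f x) ->
  (forall x, D x -> Cmod (f x) <= M / (1 + x ^ 2)) ->
  exists l : C, Cint f Fa Fb l /\ Cmod l <= M * (lb - la).
Proof.
  intros HD HDa HDb Hle Hla Hlb Hc Hb.
  assert (Hex : forall a b, D a -> D b -> ex_RInt (V := C_R_CompleteNormedModule) f a b).
  { intros a b Ha Hb'. apply (ex_RInt_continuous (V := C_R_CompleteNormedModule)).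
    intros x Hx. apply Hc. now apply (HD a b). }
  assert (HM : 0 <= M).
  { destruct (filter_ex D HDa) as [x Hx]. specialize (Hb x Hx).
    assert (H := Cmod_ge_0 (f x)). apply Rnot_lt_le. intros N.
    assert (0 < / (1 + x ^ 2)) by (apply Rinv_0_lt_compat; nra).
    unfold Rdiv in Hb. nra. }
  (* The integral is a relation; the Cauchy criterion needs it to be total and single valued near
     the limit. *)
  destruct (proj1 (filterlimi_locally_cauchy (U := C_R_CompleteNormedModule)
      (F := filter_prod Fa Fb)
      (fun ab => is_RInt (V := C_R_CompleteNormedModule) f (fst ab) (snd ab)) ltac:(
      exists D D; [exact HDa | exact HDb |]; intros a b Ha Hb'; simpl; split;
      [destruct (Hex a b Ha Hb') as [l Hl]; now exists l
      | intros y1 y2 H1 H2; rewrite <- (is_RInt_unique (V := C_R_CompleteNormedModule) _ _ _ _ H1);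
        now apply (is_RInt_unique (V := C_R_CompleteNormedModule))]))) as [l Hl].
  - intros eps.
    (* There are two end pieces, and [atan] varies by at most twice this amount on each; M + 1
       avoids a division by zero. *)
    assert (He : 0 < eps / (4 * (M + 1))) by (apply Rdiv_lt_0_compat; [apply cond_pos | lra]).
    set (e := mkposreal _ He).
    exists (fun ab => (D (fst ab) /\ Rabs (atan (fst ab) - la) < e) /\
                      (D (snd ab) /\ Rabs (atan (snd ab) - lb) < e)).
    split.
    { exists (fun a => D a /\ Rabs (atan a - la) < e) (fun b => D b /\ Rabs (atan b - lb) < e).
      - apply filter_and; [exact HDa | apply (Hla (fun y => Rabs (y - la) < e)); exists e; intros y Hy; exact Hy].
      - apply filter_and; [exact HDb | apply (Hlb (fun y => Rabs (y - lb) < e)); exists e; intros y Hy; exact Hy].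
      - intros; simpl; tauto. }
    intros [a b] [a' b']; simpl. intros [[Da Ha] [Db Hb']] [[Da' Ha'] [Db' Hb'']] u v Hu Hv.
    destruct (Hex b' b Db' Db) as [p Hp]. destruct (Hex a a' Da Da') as [q Hq].
    assert (E : u = (q + v + p)%C).
    { rewrite <- (is_RInt_unique (V := C_R_CompleteNormedModule) _ _ _ _ Hu).
      apply (is_RInt_unique (V := C_R_CompleteNormedModule)).
      apply (is_RInt_Chasles (V := C_R_CompleteNormedModule) f a b' b); [|exact Hp].
      now apply (is_RInt_Chasles (V := C_R_CompleteNormedModule) f a a' b'). }
    assert (Kp := Cmod_RInt_le_atan f M b' b p (fun x Hx => Hb x (HD b' b x Db' Db Hx)) Hp).
    assert (Kq := Cmod_RInt_le_atan f M a a' q (fun x Hx => Hb x (HD a a' x Da Da' Hx)) Hq).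
    apply (norm_compat1 (V := C_R_NormedModule)).
    rewrite <- Cmod_norm. change (Cmod (v - u)%C < eps). rewrite E.
    replace (v - (q + v + p))%C with (- (q + p))%C by ring. rewrite Cmod_opp.
    assert (T := Cmod_triangle q p).
    apply Rabs_def2 in Ha. apply Rabs_def2 in Ha'. apply Rabs_def2 in Hb'. apply Rabs_def2 in Hb''.
    assert (K1 : Rabs (atan b - atan b') <= 2 * (eps / (4 * (M + 1)))) by (apply Rabs_le; lra).
    assert (K2 : Rabs (atan a' - atan a) <= 2 * (eps / (4 * (M + 1)))) by (apply Rabs_le; lra).
    apply Rle_lt_trans with (M * (2 * (eps / (4 * (M + 1)))) + M * (2 * (eps / (4 * (M + 1)))));
      [set (er := eps / (4 * (M + 1))) in *; nra|].
    replace (M * (2 * (eps / (4 * (M + 1)))) + M * (2 * (eps / (4 * (M + 1)))))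
      with (eps * (M / (M + 1))) by (field; lra).
    assert (He0 := cond_pos eps). rewrite <- (Rmult_1_r eps) at 2. apply Rmult_lt_compat_l; [lra|].
    apply (Rmult_lt_reg_r (M + 1)); [lra|]. unfold Rdiv. rewrite Rmult_assoc, Rinv_l; lra.
  - exists l. split; [exact Hl|]. rewrite Cmod_norm.
    apply (RInt_gen_norm (V := C_R_CompleteNormedModule) (Fa := Fa) (Fb := Fb) f
      (fun x => M / (1 + x ^ 2)) l (M * (lb - la)) Hle).
    + exists D D; [exact HDa | exact HDb |]. intros a b Ha Hb' x Hx. simpl in Hx. rewrite <- Cmod_norm. apply Hb.
      apply (HD a b); auto. rewrite Rmin_left, Rmax_right by lra. exact Hx.
    + exact Hl.
    + assert (Dr : forall x, is_derive (fun x => M * atan x) x (M / (1 + x ^ 2)))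
        by (intros; apply is_derive_scal, is_derive_atan_pow).
      assert (DD : forall x, Derive (fun x => M * atan x) x = M / (1 + x ^ 2))
        by (intros; now apply is_derive_unique).
      apply (is_RInt_gen_ext (V := R_NormedModule) (Derive (fun x => M * atan x))).
      { exists D D; [exact HDa | exact HDb |]. intros; apply DD. }
      rewrite Rmult_minus_distr_l.
      apply is_RInt_gen_Derive.
      * exists D D; [exact HDa | exact HDb |]. intros. eexists; apply Dr.
      * exists D D; [exact HDa | exact HDb |]. intros a b _ _ x _.
        apply (continuous_ext (fun x => M / (1 + x ^ 2))); [intros; now rewrite DD|].
        apply (ex_derive_continuous (fun x => M / (1 + x ^ 2))). auto_derive. nra.
      * apply (filterlim_comp _ _ _ atan (fun y => M * y) _ (locally la)); [exact Hla|].
        apply (filterlim_scal_r (K := R_AbsRing) (V := R_NormedModule) M la).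
      * apply (filterlim_comp _ _ _ atan (fun y => M * y) _ (locally lb)); [exact Hlb|].
        apply (filterlim_scal_r (K := R_AbsRing) (V := R_NormedModule) M lb).
Qed.

Lemma filterlim_atan_p_infty : filterlim atan (Rbar_locally p_infty) (locally (PI / 2)).
Proof.
  intros P [eps HP]. assert (HPI := PI_RGT_0). assert (He := cond_pos eps).
  set (e := Rmin eps 1).
  assert (He1 : 0 < e) by (apply Rmin_glb_lt; lra).
  assert (He2 := Rmin_l eps 1). assert (He3 := Rmin_r eps 1). fold e in He2, He3.
  assert (H3 := PI2_1).
  exists (tan (PI / 2 - e)). intros x Hx. apply HP.
  apply atan_increasing in Hx. rewrite atan_tan in Hx by lra.
  assert (Hb := atan_bound x).
  change (Rabs (atan x - PI / 2) < eps). apply Rabs_def1; lra.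
Qed.

Lemma filterlim_atan_m_infty : filterlim atan (Rbar_locally m_infty) (locally (- (PI / 2))).
Proof.
  intros P [eps HP]. assert (HPI := PI_RGT_0). assert (He := cond_pos eps).
  set (e := Rmin eps 1).
  assert (He1 : 0 < e) by (apply Rmin_glb_lt; lra).
  assert (He2 := Rmin_l eps 1). assert (He3 := Rmin_r eps 1). fold e in He2, He3.
  assert (H3 := PI2_1).
  exists (tan (- (PI / 2) + e)). intros x Hx. apply HP.
  apply atan_increasing in Hx. rewrite atan_tan in Hx by lra.
  assert (Hb := atan_bound x).
  change (Rabs (atan x - - (PI / 2)) < eps). apply Rabs_def1; lra.
Qed.

Lemma at_right_pos : at_right 0 (fun u => 0 < u).
Proof. exists (mkposreal 1 Rlt_0_1). intros y _ Hy. exact Hy. Qed.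

Lemma p_infty_gt (a : R) : Rbar_locally p_infty (fun u => a < u).
Proof. exists a. intros x Hx. exact Hx. Qed.

Lemma m_infty_lt (a : R) : Rbar_locally m_infty (fun u => u < a).
Proof. exists a. intros x Hx. exact Hx. Qed.

Lemma Cint0_dom (f : R -> C) (M : R) :
  (forall u, 0 < u -> Ccontinuous f u) ->
  (forall u, 0 < u -> Cmod (f u) <= M / (1 + u ^ 2)) ->
  exists l : C, Cint0 f l /\ Cmod l <= M * (PI / 2).
Proof.
  intros Hc Hb.
  assert (K := dominated_integral f M 0 (PI / 2) (fun u => 0 < u)
    (at_right 0) (Rbar_locally p_infty)).
  rewrite Rminus_0_r in K. apply K; auto.
  - intros a b x Ha Hb' Hx. apply Rlt_le_trans with (Rmin a b); [now apply Rmin_glb_lt | lra].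
  - apply at_right_pos.
  - apply p_infty_gt.
  - exists (fun a => a < 1) (fun b => 1 < b).
    + exists (mkposreal 1 Rlt_0_1). intros y Hy _.
      assert (Hy' : Rabs (y - 0) < 1) by exact Hy. apply Rabs_def2 in Hy'. lra.
    + apply p_infty_gt.
    + intros; simpl; lra.
  - assert (Ha : filterlim atan (locally 0) (locally 0)).
    { rewrite <- atan_0 at 2. apply (ex_derive_continuous atan). eexists; apply is_derive_atan. }
    intros P HP. destruct (Ha P HP) as [e He]. exists e. intros y Hy _. now apply He.
  - apply filterlim_atan_p_infty.
Qed.

Lemma CintR_dom (f : R -> C) (M : R) :
  (forall u, Ccontinuous f u) ->
  (forall u, Cmod (f u) <= M / (1 + u ^ 2)) ->
  exists l : C, CintR f l /\ Cmod l <= M * PI.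
Proof.
  intros Hc Hb.
  assert (K := dominated_integral f M (- (PI / 2)) (PI / 2) (fun u => True)
    (Rbar_locally m_infty) (Rbar_locally p_infty)).
  replace (PI / 2 - - (PI / 2)) with PI in K by field. apply K; auto.
  - apply filter_true.
  - apply filter_true.
  - exists (fun a => a < 0) (fun b => 0 < b); [apply m_infty_lt | apply p_infty_gt |].
    intros; simpl; lra.
  - apply filterlim_atan_m_infty.
  - apply filterlim_atan_p_infty.
Qed.

Lemma Cint_unique (f : R -> C) (Fa Fb : (R -> Prop) -> Prop)
    {PFa : ProperFilter Fa} {PFb : ProperFilter Fb} (l l' : C) :
  Cint f Fa Fb l -> Cint f Fa Fb l' -> l = l'.
Proof.
  intros H H'. rewrite <- (is_RInt_gen_unique (V := C_R_CompleteNormedModule) _ _ H).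
  now apply (is_RInt_gen_unique (V := C_R_CompleteNormedModule)).
Qed.

Lemma Cint_plus (f g : R -> C) (Fa Fb : (R -> Prop) -> Prop)
    {PFa : Filter Fa} {PFb : Filter Fb} (l m : C) :
  Cint f Fa Fb l -> Cint g Fa Fb m -> Cint (fun t => f t + g t)%C Fa Fb (l + m)%C.
Proof. apply (is_RInt_gen_plus (V := C_R_CompleteNormedModule)). Qed.

Lemma Cint_minus (f g : R -> C) (Fa Fb : (R -> Prop) -> Prop)
    {PFa : Filter Fa} {PFb : Filter Fb} (l m : C) :
  Cint f Fa Fb l -> Cint g Fa Fb m -> Cint (fun t => f t - g t)%C Fa Fb (l - m)%C.
Proof. apply (is_RInt_gen_minus (V := C_R_CompleteNormedModule)). Qed.

(** The scalars of the module are real, so a complex constant has to act through real and imaginary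
    parts. *)
Lemma is_RInt_Cmult (c : C) (f : R -> C) (a b : R) (l : C) :
  is_RInt (V := C_R_CompleteNormedModule) f a b l ->
  is_RInt (V := C_R_CompleteNormedModule) (fun t => c * f t)%C a b (c * l)%C.
Proof.
  intros H.
  assert (H1 := is_RInt_fct_extend_fst (U := R_NormedModule) (V := R_NormedModule) f a b l H).
  assert (H2 := is_RInt_fct_extend_snd (U := R_NormedModule) (V := R_NormedModule) f a b l H).
  apply (is_RInt_fct_extend_pair (U := R_NormedModule) (V := R_NormedModule)).
  - apply (is_RInt_minus (fun t => fst c * fst (f t)) (fun t => snd c * snd (f t)));
      now apply (is_RInt_scal (V := R_NormedModule)).
  - apply (is_RInt_plus (fun t => fst c * snd (f t)) (fun t => snd c * fst (f t)));
      now apply (is_RInt_scal (V := R_NormedModule)).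
Qed.

Lemma Cint_scal (c : C) (f : R -> C) (Fa Fb : (R -> Prop) -> Prop)
    {PFa : Filter Fa} {PFb : Filter Fb} (l : C) :
  Cint f Fa Fb l -> Cint (fun t => c * f t)%C Fa Fb (c * l)%C.
Proof.
  intros H P HP.
  assert (Hc : filterlim (fun y : C => (c * y)%C) (locally (T := C_R_NormedModule) l)
                 (locally (T := C_R_NormedModule) (c * l)%C)).
  { apply (filterlim_locally (U := C_R_NormedModule)). intros eps.
    assert (Hc0 := Cmod_ge_0 c).
    assert (He : 0 < eps / (2 * (Cmod c + 1))) by (apply Rdiv_lt_0_compat; [apply cond_pos | lra]).
    exists (mkposreal _ He). intros y [B1 B2]. simpl in B1, B2.
    assert (B1' : Rabs (Re (y - l)%C) < eps / (2 * (Cmod c + 1))) by exact B1.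
    assert (B2' : Rabs (Im (y - l)%C) < eps / (2 * (Cmod c + 1))) by exact B2.
    apply (norm_compat1 (V := C_R_NormedModule)). rewrite <- Cmod_norm.
    change (Cmod (c * y - c * l)%C < eps).
    replace (c * y - c * l)%C with (c * (y - l))%C by ring. rewrite Cmod_mult.
    assert (Hd := Cmod_le_Re_Im (y - l)%C). assert (Hd0 := Cmod_ge_0 (y - l)%C).
    apply Rle_lt_trans with ((Cmod c + 1) * (Rabs (Re (y - l)%C) + Rabs (Im (y - l)%C))); [nra|].
    apply Rlt_le_trans with ((Cmod c + 1) * (2 * (eps / (2 * (Cmod c + 1))))).
    - apply Rmult_lt_compat_l; lra.
    - right; field; lra. }
  specialize (H _ (Hc P HP)). unfold filtermapi in H |- *. revert H. apply filter_imp.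
  intros ab [y [Hy Py]]. exists (c * y)%C. split; [now apply is_RInt_Cmult | exact Py].
Qed.

Lemma Cint0_ext (f g : R -> C) (l : C) :
  (forall u, 0 < u -> f u = g u) -> Cint0 f l -> Cint0 g l.
Proof.
  intros Hfg. apply (is_RInt_gen_ext (V := C_R_CompleteNormedModule)).
  exists (fun u => 0 < u) (fun u => 0 < u); [apply at_right_pos | apply p_infty_gt |].
  intros a b Ha Hb x Hx. simpl in Hx. apply Hfg.
  apply Rlt_trans with (Rmin a b); [now apply Rmin_glb_lt | lra].
Qed.

Lemma CintR_ext (f g : R -> C) (l : C) :
  (forall u, f u = g u) -> CintR f l -> CintR g l.
Proof.
  intros Hfg. apply (is_RInt_gen_ext (V := C_R_CompleteNormedModule)).
  exists (fun _ => True) (fun _ => True); [apply filter_true | apply filter_true |].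
  intros; apply Hfg.
Qed.

Lemma Cint_comp_lin (f : R -> C) (u v : R) (Fa Fb Fa' Fb' : (R -> Prop) -> Prop)
    {PFa : Filter Fa} {PFb : Filter Fb} (l : C) :
  filterlim (fun x => u * x + v) Fa Fa' -> filterlim (fun x => u * x + v) Fb Fb' ->
  Cint f Fa' Fb' l -> Cint (fun y => RtoC u * f (u * y + v)%R)%C Fa Fb l.
Proof.
  intros Ha Hb H P HP. destruct (H P HP) as [A B HA HB HAB].
  exists (fun x => A (u * x + v)) (fun x => B (u * x + v)); [now apply Ha | now apply Hb |].
  intros a b Aa Bb. destruct (HAB _ _ Aa Bb) as [y [Hy Py]]. exists y. split; [|exact Py].
  simpl in Hy |- *.
  apply (is_RInt_ext (V := C_R_CompleteNormedModule) (fun y => scal u (f (u * y + v)))).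
  { intros x _. apply Ceq_pair; unfold Re, Im; simpl; unfold scal; simpl; unfold mult; simpl; ring. }
  now apply (is_RInt_comp_lin (V := C_R_CompleteNormedModule)).
Qed.

Lemma Cint0_scale (f : R -> C) (c : R) (l : C) : 0 < c ->
  Cint0 f l -> Cint0 (fun u => c * f (c * u)%R)%C l.
Proof.
  intros Hc H.
  apply (Cint0_ext (fun u => c * f (c * u + 0)%R)%C). { intros u _. now rewrite Rplus_0_r. }
  apply (Cint_comp_lin f c 0 _ _ (at_right 0) (Rbar_locally p_infty)); [| | exact H].
  - intros P [e HP].
    assert (He : 0 < e / c) by (apply Rdiv_lt_0_compat; [apply cond_pos | lra]).
    exists (mkposreal _ He). intros y Hy Hy0. apply HP.
    + assert (Hy' : Rabs (y - 0) < e / c) by exact Hy.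
      change (Rabs (c * y + 0 - 0) < e).
      replace (c * y + 0 - 0) with (c * (y - 0)) by ring.
      rewrite Rabs_mult, (Rabs_pos_eq c) by lra.
      apply Rlt_le_trans with (c * (e / c)); [now apply Rmult_lt_compat_l | right; field; lra].
    + nra.
  - intros P [m HP]. exists (m / c). intros x Hx. apply HP.
    apply (Rmult_lt_compat_l c) in Hx; [|lra].
    replace (c * (m / c)) with m in Hx by (field; lra). lra.
Qed.

Lemma CintR_lin (f : R -> C) (c v : R) (l : C) : 0 < c ->
  CintR f l -> CintR (fun u => c * f (c * u + v)%R)%C l.
Proof.
  intros Hc H.
  apply (Cint_comp_lin f c v _ _ (Rbar_locally m_infty) (Rbar_locally p_infty)); [| | exact H];
    intros P [m HP]; exists ((m - v) / c); intros x Hx; apply HP;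
    (apply (Rmult_lt_compat_l c) in Hx; [|lra]);
    replace (c * ((m - v) / c)) with (m - v) in Hx by (field; lra); lra.
Qed.

Lemma Ccontinuous_Re (f : R -> C) (t : R) : Ccontinuous f t -> continuous (fun s => Re (f s)) t.
Proof. intros H. apply (continuous_comp f fst); [exact H | apply continuous_fst]. Qed.

Lemma Ccontinuous_Im (f : R -> C) (t : R) : Ccontinuous f t -> continuous (fun s => Im (f s)) t.
Proof. intros H. apply (continuous_comp f snd); [exact H | apply continuous_snd]. Qed.

Lemma Ccontinuous_mult (f g : R -> C) (t : R) :
  Ccontinuous f t -> Ccontinuous g t -> Ccontinuous (fun s => f s * g s)%C t.
Proof.
  intros Hf Hg.
  assert (F1 := Ccontinuous_Re f t Hf). assert (F2 := Ccontinuous_Im f t Hf).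
  assert (G1 := Ccontinuous_Re g t Hg). assert (G2 := Ccontinuous_Im g t Hg).
  apply Ccontinuous_pair.
  - apply (continuous_minus (V := R_NormedModule) (fun s => Re (f s) * Re (g s)) (fun s => Im (f s) * Im (g s)));
      now apply (continuous_mult (K := R_AbsRing)).
  - apply (continuous_plus (V := R_NormedModule) (fun s => Re (f s) * Im (g s)) (fun s => Im (f s) * Re (g s)));
      now apply (continuous_mult (K := R_AbsRing)).
Qed.

Lemma Ccontinuous_const (c : C) (t : R) : Ccontinuous (fun _ => c) t.
Proof. apply continuous_const. Qed.

Lemma Ccontinuous_scal (c : C) (f : R -> C) (t : R) :
  Ccontinuous f t -> Ccontinuous (fun s => c * f s)%C t.
Proof. intros H. apply Ccontinuous_mult; [apply Ccontinuous_const | exact H]. Qed.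

Lemma Ccontinuous_minus (f g : R -> C) (t : R) :
  Ccontinuous f t -> Ccontinuous g t -> Ccontinuous (fun s => f s - g s)%C t.
Proof. apply (continuous_minus (V := C_R_NormedModule)). Qed.

Lemma Ccontinuous_plus (f g : R -> C) (t : R) :
  Ccontinuous f t -> Ccontinuous g t -> Ccontinuous (fun s => f s + g s)%C t.
Proof. apply (continuous_plus (V := C_R_NormedModule)). Qed.

Lemma Ccontinuous_RtoC (f : R -> R) (t : R) :
  continuous f t -> Ccontinuous (fun s => RtoC (f s)) t.
Proof. intros H. apply Ccontinuous_pair; [exact H | apply continuous_const]. Qed.

(** * Differentiation of parametric improper integrals *)

(** Two applications of the mean value inequality; the constant B in place of B / 2 is good enough
    and needs no integral remainder. *)
Lemma Taylor2_bound (f f1 f2 : C -> C) (z h : C) (B : R) :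
  (forall t : R, 0 <= t <= 1 -> Cder f (z + t * h)%C (f1 (z + t * h)%C)) ->
  (forall t : R, 0 <= t <= 1 -> Cder f1 (z + t * h)%C (f2 (z + t * h)%C)) ->
  (forall t : R, 0 <= t <= 1 -> Cmod (f2 (z + t * h)%C) <= B) ->
  Cmod (f (z + h) - f z - f1 z * h)%C <= B * (Cmod h * Cmod h).
Proof.
  intros H1 H2 HB.
  assert (Hh := Cmod_ge_0 h).
  assert (HB0 : 0 <= B) by (apply Rle_trans with (Cmod (f2 (z + 0%R * h)%C)); [apply Cmod_ge_0 | apply HB; lra]).
  assert (K := C_mvt (fun w => f w - f1 z * w)%C (fun w => f1 w - f1 z)%C z (z + h)%C (B * Cmod h)).
  replace (z + h - z)%C with h in K by ring.
  replace (f (z + h) - f z - f1 z * h)%C with (f (z + h) - f1 z * (z + h) - (f z - f1 z * z))%C by ring.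
  rewrite <- Rmult_assoc. apply K.
  - intros t Ht. eapply Cder_eq.
    + apply Cder_minus; [now apply H1 | apply Cder_scal, Cder_id].
    + ring.
  - intros t Ht.
    assert (K2 := C_mvt f1 f2 z (z + t * h)%C B).
    replace (z + t * h - z)%C with (t * h)%C in K2 by ring.
    apply Rle_trans with (B * Cmod (t * h)%C).
    + apply K2; intros s Hs;
        replace (z + s * (t * h))%C with (z + (s * t)%R * h)%C by (rewrite RtoC_mult; ring);
        [apply H2 | apply HB]; nra.
    + rewrite Cmod_mult, Cmod_RtoC_nonneg by lra. apply Rmult_le_compat_l; [exact HB0 | nra].
Qed.

(** A uniform majorant of the second derivative of the kernel makes the pointwise Taylor remainder
    integrable, so the integral itself has a quadratic remainder. *)
Lemma Cder_Cint0 (phi phi1 phi2 : C -> R -> C) (I I1 : C -> C) (z : C) (M delta : R) :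
  0 < delta ->
  (forall w u, Cmod (w - z)%C < delta -> 0 < u -> Cder (fun v => phi v u) w (phi1 w u)) ->
  (forall w u, Cmod (w - z)%C < delta -> 0 < u -> Cder (fun v => phi1 v u) w (phi2 w u)) ->
  (forall w u, Cmod (w - z)%C < delta -> 0 < u -> Cmod (phi2 w u) <= M / (1 + u ^ 2)) ->
  (forall w u, Cmod (w - z)%C < delta -> 0 < u -> Ccontinuous (phi w) u) ->
  (forall u, 0 < u -> Ccontinuous (phi1 z) u) ->
  (forall w, Cmod (w - z)%C < delta -> Cint0 (phi w) (I w)) ->
  Cint0 (phi1 z) (I1 z) ->
  Cder I z (I1 z).
Proof.
  intros Hd H1 H2 HB Hc Hc1 HI HI1.
  apply (Cder_quad _ _ _ (M * (PI / 2)) delta Hd). intros h Hh.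
  assert (Hz : forall t : R, 0 <= t <= 1 -> Cmod (z + t * h - z)%C < delta).
  { intros t Ht. replace (z + t * h - z)%C with (t * h)%C by ring.
    rewrite Cmod_mult, Cmod_RtoC_nonneg by lra. assert (H0 := Cmod_ge_0 h). nra. }
  assert (Hz0 : Cmod (z - z)%C < delta) by (replace (z - z)%C with (RtoC 0) by ring; now rewrite Cmod_0).
  assert (Hz1 : Cmod (z + h - z)%C < delta) by (now replace (z + h - z)%C with h by ring).
  assert (HR : Cint0 (fun u => phi (z + h)%C u - phi z u - h * phi1 z u)%C (I (z + h) - I z - h * I1 z)%C).
  { apply (Cint_minus (fun u => phi (z + h)%C u - phi z u)%C (fun u => h * phi1 z u)%C); try apply _.
    - apply (Cint_minus (phi (z + h)%C) (phi z)); try apply _; now apply HI.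
    - apply (Cint_scal h (phi1 z)); try apply _. exact HI1. }
  destruct (Cint0_dom (fun u => phi (z + h)%C u - phi z u - h * phi1 z u)%C (M * (Cmod h * Cmod h)))
    as [l [Hl Hlb]].
  - intros u Hu. unfold Ccontinuous.
    apply Ccontinuous_minus.
    + apply Ccontinuous_minus; now apply Hc.
    + now apply Ccontinuous_scal, Hc1.
  - intros u Hu.
    replace (phi (z + h)%C u - phi z u - h * phi1 z u)%C
      with (phi (z + h)%C u - phi z u - phi1 z u * h)%C by ring.
    replace (M * (Cmod h * Cmod h) / (1 + u ^ 2)) with (M / (1 + u ^ 2) * (Cmod h * Cmod h))
      by (field; nra).
    apply (Taylor2_bound (fun w => phi w u) (fun w => phi1 w u) (fun w => phi2 w u)); auto.
  - replace (I (z + h) - I z - I1 z * h)%C with (I (z + h) - I z - h * I1 z)%C by ring.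
    rewrite (Cint_unique _ _ _ _ _ HR Hl). lra.
Qed.

(** * The kernels of the hyperbolic gamma function *)

Lemma nonneg_of_derive (f f' : R -> R) (x : R) : 0 <= x -> f 0 = 0 ->
  (forall t, is_derive f t (f' t)) -> (forall t, 0 <= t <= x -> 0 <= f' t) -> 0 <= f x.
Proof.
  intros Hx H0 Hd Hp.
  destruct (MVT_gen f 0 x f') as [c [Hc E]].
  - intros; apply Hd.
  - intros; apply continuity_pt_filterlim, (ex_derive_continuous f). now exists (f' x0).
  - rewrite Rmin_left, Rmax_right in Hc by exact Hx. rewrite H0, !Rminus_0_r in E. rewrite E.
    apply Rmult_le_pos; [now apply Hp | exact Hx].
Qed.

Lemma is_derive_sinh (x : R) : is_derive sinh x (cosh x).
Proof. apply is_derive_Reals, derivable_pt_lim_sinh. Qed.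

Lemma sinh_nonneg (x : R) : 0 <= x -> 0 <= sinh x.
Proof.
  intros H. unfold sinh. assert (exp (- x) <= exp x) by (apply exp_le_exp; lra). lra.
Qed.

Lemma cosh_ge_1 (x : R) : 1 <= cosh x.
Proof.
  unfold cosh. assert (H := exp_ineq1_le x). assert (H' := exp_ineq1_le (- x)). lra.
Qed.

Lemma cosh2_sinh2 (x : R) : cosh x * cosh x - sinh x * sinh x = 1.
Proof.
  unfold cosh, sinh. assert (E : exp x * exp (- x) = 1).
  { rewrite <- exp_plus, Rplus_opp_r. apply exp_0. }
  nra.
Qed.

Lemma sinh_ge_id (x : R) : 0 <= x -> x <= sinh x.
Proof.
  intros Hx. assert (H := nonneg_of_derive (fun t => sinh t - t) (fun t => cosh t - 1) x Hx).
  cut (0 <= sinh x - x); [lra|]. apply H.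
  - rewrite sinh_0. lra.
  - intros t. unfold sinh, cosh. auto_derive; [trivial | field].
  - intros t _. assert (K := cosh_ge_1 t). lra.
Qed.

Lemma sinh_pos (x : R) : 0 < x -> 0 < sinh x.
Proof. intros Hx. apply Rlt_le_trans with x; [exact Hx | apply sinh_ge_id; lra]. Qed.

Lemma sinh_le_id_cosh (x : R) : 0 <= x -> sinh x <= x * cosh x.
Proof.
  intros Hx. assert (H := nonneg_of_derive (fun t => t * cosh t - sinh t) (fun t => t * sinh t) x Hx).
  cut (0 <= x * cosh x - sinh x); [lra|]. apply H.
  - rewrite sinh_0. lra.
  - intros t. unfold sinh, cosh. auto_derive; [trivial | field].
  - intros t Ht. assert (K := sinh_nonneg t (proj1 Ht)). nra.
Qed.

Lemma cosh_double (x : R) : cosh x = 1 + 2 * (sinh (x / 2) * sinh (x / 2)).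
Proof.
  assert (E : exp (x / 2) * exp (- (x / 2)) = 1).
  { rewrite <- exp_plus, Rplus_opp_r. apply exp_0. }
  unfold cosh, sinh. replace (exp x) with (exp (x / 2) * exp (x / 2)) by (rewrite <- exp_plus; f_equal; field).
  replace (exp (- x)) with (exp (- (x / 2)) * exp (- (x / 2))) by (rewrite <- exp_plus; f_equal; field).
  nra.
Qed.

(** The value at 0 fills the removable singularity, so that the kernels make sense at beta = 0. *)
Definition rsh (v : R) : R := if Req_dec_T v 0 then 1 else v / sinh v.

Lemma rsh_0 : rsh 0 = 1.
Proof. unfold rsh. destruct Req_dec_T; lra. Qed.

Lemma rsh_pos_eq (v : R) : 0 < v -> rsh v = v / sinh v.
Proof. intros H. unfold rsh. destruct Req_dec_T; lra. Qed.

(** The quadratic estimate serves twice: it keeps (1 - kappa) / u^2 bounded, and it produces the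
    order beta^2 of H_beta - H_0. *)
Lemma rsh_bounds (v : R) : 0 <= v -> 0 < rsh v <= 1 /\ 1 - rsh v <= v ^ 2.
Proof.
  intros [Hv|<-]; [|rewrite rsh_0; lra].
  rewrite rsh_pos_eq by exact Hv. assert (Hs := sinh_pos v Hv).
  assert (H1 := sinh_ge_id v ltac:(lra)).
  split; [split|].
  - now apply Rdiv_lt_0_compat.
  - apply (Rmult_le_reg_r (sinh v)); [exact Hs|]. unfold Rdiv. rewrite Rmult_assoc, Rinv_l; lra.
  - assert (H2 := sinh_le_id_cosh v ltac:(lra)).
    assert (Hh := sinh_le_id_cosh (v / 2) ltac:(lra)).
    assert (Hh0 := sinh_nonneg (v / 2) ltac:(lra)).
    assert (Hd := cosh_double v). assert (Hc2 := cosh2_sinh2 (v / 2)).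
    assert (Hc := cosh_ge_1 v).
    set (s := sinh (v / 2)) in *. set (c := cosh (v / 2)) in *.
    assert (Hss : s * s <= (v / 2) * (v / 2) * (c * c)).
    { apply Rle_trans with (v / 2 * c * (v / 2 * c)); [apply Rmult_le_compat; lra | right; ring]. }
    assert (Hk : cosh v - 1 <= v ^ 2 * cosh v) by nra.
    apply (Rmult_le_reg_r (sinh v)); [exact Hs|].
    replace ((1 - v / sinh v) * sinh v) with (sinh v - v) by (field; lra).
    (* The chain is sinh v - v <= v (cosh v - 1) <= v^2 sinh v. The second comparison holds because
       v sinh v - (cosh v - 1) vanishes at 0 and has derivative v cosh v. *)
    apply Rle_trans with (v * (cosh v - 1)); [lra|].
    destruct (Rle_dec (cosh v - 1) (v * sinh v)) as [L|L].
    + nra.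
    + exfalso. apply L.
      assert (K := nonneg_of_derive (fun t => t * sinh t - (cosh t - 1)) (fun t => t * cosh t) v ltac:(lra)).
      cut (0 <= v * sinh v - (cosh v - 1)); [lra|]. apply K.
      * rewrite cosh_0. lra.
      * intros t. unfold sinh, cosh. auto_derive; [trivial | field].
      * intros t Ht. assert (K1 := cosh_ge_1 t). nra.
Qed.

(** After multiplication by sinh v this is (1 + 2 v) exp (- 2 v) <= 1, an instance of 1 + x <= exp
    x. The rate exp (- v) fixes the half-width 1/2 of the strip, as sin (2 u z) can grow like exp (2
    u |Im z|). *)
Lemma rsh_exp_bound (v : R) : 0 <= v -> rsh v <= (1 + 2 * v) * exp (- v).
Proof.
  intros [Hv|<-].
  - rewrite rsh_pos_eq by exact Hv. assert (Hs := sinh_pos v Hv).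
    apply (Rmult_le_reg_r (sinh v)); [exact Hs|].
    replace (v / sinh v * sinh v) with v by (field; lra).
    unfold sinh.
    assert (E1 : exp v * exp (- v) = 1) by (rewrite <- exp_plus, Rplus_opp_r; apply exp_0).
    assert (H2 : 1 + 2 * v <= exp v * exp v).
    { rewrite <- exp_plus. replace (v + v) with (2 * v) by ring. apply exp_ineq1_le. }
    assert (Hp := exp_pos (- v)). assert (Hp' := exp_pos v).
    replace ((1 + 2 * v) * exp (- v) * ((exp v - exp (- v)) / 2))
      with ((1 + 2 * v) * (exp v * exp (- v) - exp (- v) * exp (- v)) / 2) by field.
    rewrite E1.
    assert (K : (1 + 2 * v) * (exp (- v) * exp (- v)) <= 1).
    { apply Rle_trans with (exp v * exp v * (exp (- v) * exp (- v))).
      - apply Rmult_le_compat_r; [nra | exact H2].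
      - right. replace (exp v * exp v * (exp (- v) * exp (- v))) with
          ((exp v * exp (- v)) * (exp v * exp (- v))) by ring. rewrite E1; ring. }
    nra.
  - rewrite rsh_0, Ropp_0, exp_0. lra.
Qed.

Lemma continuous_rsh (v : R) : v <> 0 -> continuous rsh v.
Proof.
  intros Hv.
  apply (continuous_ext_loc _ (fun t => t / sinh t)).
  - assert (Hp : 0 < Rabs v) by now apply Rabs_pos_lt.
    exists (mkposreal _ Hp). intros y Hy. assert (Hy' : Rabs (y - v) < Rabs v) by exact Hy.
    unfold rsh. destruct Req_dec_T as [E|E]; [|reflexivity]. exfalso. subst y.
    rewrite Rminus_0_l, Rabs_Ropp in Hy'. lra.
  - assert (Hs : sinh v <> 0).
    { intros E. destruct (Rtotal_order v 0) as [L|[L|L]]; [|lra|].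
      - assert (K := sinh_pos (- v) ltac:(lra)). unfold sinh in *.
        rewrite Ropp_involutive in K. lra.
      - assert (K := sinh_pos v L). lra. }
    apply (ex_derive_continuous (fun t => t / sinh t)).
    apply (ex_derive_div (fun t => t) sinh); [apply ex_derive_id | exists (cosh v); apply is_derive_sinh | exact Hs].
Qed.

(** For positive beta and u this is beta u^2 / (sinh (beta u) sinh u), the part of the kernel of s_b
    that depends on beta after the substitution u = y / b. *)
Definition kappa (beta u : R) : R := rsh (beta * u) * rsh u.

Lemma kappa_bounds (beta u : R) : 0 <= beta -> 0 < u ->
  0 < kappa beta u <= 1 /\ kappa beta u <= (1 + 2 * u) * exp (- u) /\
  1 - kappa beta u <= (1 + beta ^ 2) * u ^ 2.
Proof.
  intros Hb Hu. unfold kappa.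
  destruct (rsh_bounds (beta * u) ltac:(nra)) as [[A1 A2] A3].
  destruct (rsh_bounds u ltac:(lra)) as [[B1 B2] B3].
  assert (B4 := rsh_exp_bound u ltac:(lra)).
  split; [split; nra|]. split; [nra|].
  replace ((beta * u) ^ 2) with (beta ^ 2 * u ^ 2) in A3 by ring. nra.
Qed.

Lemma continuous_kappa (beta u : R) : 0 <= beta -> 0 < u -> continuous (kappa beta) u.
Proof.
  intros Hb Hu. apply (continuous_mult (K := R_AbsRing) (fun u => rsh (beta * u)) rsh).
  - destruct Hb as [Hb|<-].
    + apply (continuous_comp (fun u => beta * u) rsh).
      * apply (continuous_scal_r (V := R_NormedModule) beta (fun u => u)), continuous_id.
      * apply continuous_rsh. nra.
    + apply (continuous_ext (fun _ => rsh 0)); [intros; f_equal; ring | apply continuous_const].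
  - apply continuous_rsh. lra.
Qed.

(** The kernel of [log s_b] at [z / b], where [beta = b^2], and its successive derivatives in [z]. *)
Definition phi (n : nat) (beta : R) (z : C) (u : R) : C :=
  let k := kappa beta u in
  match n with
  | 0 => (RtoC (k / (2 * u ^ 3)) * Csin (RtoC (2 * u) * z) - RtoC (/ u ^ 2) * z)%C
  | 1 => (RtoC (k / u ^ 2) * Ccos (RtoC (2 * u) * z) - RtoC (/ u ^ 2))%C
  | 2 => (- (RtoC (2 * k / u) * Csin (RtoC (2 * u) * z)))%C
  | 3 => (- (RtoC (4 * k) * Ccos (RtoC (2 * u) * z)))%C
  | _ => (RtoC (8 * k * u) * Csin (RtoC (2 * u) * z))%C
  end.

Lemma Cder_phi (n : nat) (beta : R) (z : C) (u : R) : (n <= 3)%nat -> 0 < u ->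
  Cder (fun w => phi n beta w u) z (phi (S n) beta z u).
Proof.
  intros Hn Hu.
  assert (Hs : Cder (fun w => Csin (RtoC (2 * u) * w)%C) z (Ccos (RtoC (2 * u) * z) * RtoC (2 * u))%C).
  { apply (Cder_comp Csin (fun w => (RtoC (2 * u) * w)%C)); [apply Cder_Csin|].
    eapply Cder_eq; [apply Cder_scal, Cder_id | ring]. }
  assert (Hc : Cder (fun w => Ccos (RtoC (2 * u) * w)%C) z (- Csin (RtoC (2 * u) * z) * RtoC (2 * u))%C).
  { apply (Cder_comp Ccos (fun w => (RtoC (2 * u) * w)%C)); [apply Cder_Ccos|].
    eapply Cder_eq; [apply Cder_scal, Cder_id | ring]. }
  set (k := kappa beta u).
  destruct n as [|[|[|[|n]]]]; [| | | | lia]; unfold phi; fold k.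
  - eapply Cder_eq; [apply Cder_minus; [apply Cder_scal, Hs | apply Cder_scal, Cder_id]|].
    replace (k / u ^ 2) with (k / (2 * u ^ 3) * (2 * u)) by (field; lra). rewrite (RtoC_mult (k / (2 * u ^ 3))). ring.
  - eapply Cder_eq; [apply Cder_minus; [apply Cder_scal, Hc | apply Cder_const]|].
    replace (2 * k / u) with (k / u ^ 2 * (2 * u)) by (field; lra). rewrite (RtoC_mult (k / u ^ 2)). ring.
  - eapply Cder_eq; [apply Cder_opp, Cder_scal, Hs|].
    replace (4 * k) with (2 * k / u * (2 * u)) by (field; lra). rewrite (RtoC_mult (2 * k / u)). ring.
  - eapply Cder_eq; [apply Cder_opp, Cder_scal, Hc|].
    replace (8 * k * u) with (4 * k * (2 * u)) by ring. rewrite (RtoC_mult (4 * k)). ring.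
Qed.

Lemma Ccontinuous_Cder_line (f f' : C -> C) (z : C) (u : R) :
  (forall w, Cder f w (f' w)) -> Ccontinuous (fun s => f (RtoC (2 * s) * z)%C) u.
Proof.
  intros H.
  apply (continuous_ext (T := R_UniformSpace) (U := C_R_NormedModule) (fun s => f (0 + s * (2 * z))%C)).
  { intros s. f_equal. rewrite RtoC_mult. ring. }
  eapply Rder_Ccontinuous. apply Cder_Rder, H.
Qed.

Lemma continuous_kappa_mult (beta : R) (g : R -> R) (u : R) : 0 <= beta -> 0 < u ->
  ex_derive g u -> Ccontinuous (fun s => RtoC (kappa beta s * g s)) u.
Proof.
  intros Hb Hu Hg. apply Ccontinuous_RtoC.
  apply (continuous_mult (K := R_AbsRing) (kappa beta) g);
    [now apply continuous_kappa | now apply (ex_derive_continuous g)].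
Qed.

Lemma Ccontinuous_ext (f g : R -> C) (t : R) : (forall s, f s = g s) -> Ccontinuous f t -> Ccontinuous g t.
Proof. intros H. now apply (continuous_ext (T := R_UniformSpace) (U := C_R_NormedModule)). Qed.

Lemma Ccontinuous_phi (n : nat) (beta : R) (z : C) (u : R) : 0 <= beta -> 0 < u ->
  Ccontinuous (phi n beta z) u.
Proof.
  intros Hb Hu.
  assert (Hs := Ccontinuous_Cder_line Csin Ccos z u Cder_Csin).
  assert (Hc := Ccontinuous_Cder_line Ccos (fun w => - Csin w)%C z u Cder_Ccos).
  destruct n as [|[|[|[|n]]]]; unfold phi.
  - apply Ccontinuous_minus; apply Ccontinuous_mult; auto.
    + apply (continuous_kappa_mult beta (fun s => / (2 * s ^ 3))); auto. auto_derive.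
      assert (0 < u * (u * (u * 1))) by (repeat apply Rmult_lt_0_compat; lra). lra.
    + apply Ccontinuous_RtoC, (ex_derive_continuous (fun s => / s ^ 2)). auto_derive. nra.
    + apply Ccontinuous_const.
  - apply Ccontinuous_minus; [apply Ccontinuous_mult; auto|].
    + apply (continuous_kappa_mult beta (fun s => / s ^ 2)); auto. auto_derive. nra.
    + apply Ccontinuous_RtoC, (ex_derive_continuous (fun s => / s ^ 2)). auto_derive. nra.
  - apply (Ccontinuous_ext (fun s => RtoC (kappa beta s * (- (2 / s))) * Csin (RtoC (2 * s) * z))%C).
    { intros s. replace (kappa beta s * (- (2 / s))) with (- (2 * kappa beta s / s)) by (unfold Rdiv; ring).
      rewrite RtoC_opp. ring. }
    apply Ccontinuous_mult; auto. apply (continuous_kappa_mult beta (fun s => - (2 / s))); auto. auto_derive. lra.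
  - apply (Ccontinuous_ext (fun s => RtoC (kappa beta s * (- (4))) * Ccos (RtoC (2 * s) * z))%C).
    { intros s. replace (kappa beta s * (- (4))) with (- (4 * kappa beta s)) by ring.
      rewrite RtoC_opp. ring. }
    apply Ccontinuous_mult; auto. apply (continuous_kappa_mult beta (fun s => - (4))); auto. auto_derive. auto.
  - apply (Ccontinuous_ext (fun s => RtoC (kappa beta s * (8 * s)) * Csin (RtoC (2 * s) * z))%C).
    { intros s. f_equal. f_equal. ring. }
    apply Ccontinuous_mult; auto. apply (continuous_kappa_mult beta (fun s => 8 * s)); auto. auto_derive. auto.
Qed.

(** * Exponential majorants of the kernels *)

Lemma pow_1_plus_le_exp (n : nat) (x : R) : 0 <= x -> (1 + x) ^ n <= exp (INR n * x).
Proof.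
  intros Hx. induction n as [|n IH].
  - simpl. rewrite Rmult_0_l, exp_0. lra.
  - rewrite S_INR. replace ((INR n + 1) * x) with (x + INR n * x) by ring.
    rewrite exp_plus. simpl. apply Rmult_le_compat; [lra | apply pow_le; lra | apply exp_ineq1_le | exact IH].
Qed.

(** Combine 1 + u <= c (1 + g u / N) with (1 + x)^n <= exp (n x). Taking N = n + 1 leaves the factor
    exp (- g u / N) <= 1 and keeps N positive at n = 0. *)
Lemma poly_exp_bound (n : nat) (g : R) : 0 < g ->
  exists M, 0 < M /\ forall u, 0 <= u -> (1 + u) ^ n * exp (- (g * u)) <= M.
Proof.
  intros Hg. set (N := INR n + 1).
  assert (HN : 1 <= N) by (unfold N; assert (H := pos_INR n); lra).
  set (c := Rmax 1 (N / g)).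
  assert (Hc1 : 1 <= c) by apply Rmax_l. assert (Hc2 : N / g <= c) by apply Rmax_r.
  exists (c ^ n). split; [apply pow_lt; lra|]. intros u Hu.
  assert (H1 : 1 + u <= c * (1 + g * u / N)).
  { replace u with (N / g * (g * u / N)) at 1 by (field; lra).
    assert (0 <= g * u / N) by (apply Rmult_le_pos; [nra | left; apply Rinv_0_lt_compat; lra]). nra. }
  assert (H0 : 0 <= g * u / N) by (apply Rmult_le_pos; [nra | left; apply Rinv_0_lt_compat; lra]).
  apply Rle_trans with (c ^ n * (1 + g * u / N) ^ n * exp (- (g * u))).
  - apply Rmult_le_compat_r; [left; apply exp_pos|]. rewrite <- Rpow_mult_distr. apply pow_incr. lra.
  - rewrite Rmult_assoc. rewrite <- (Rmult_1_r (c ^ n)) at 2. apply Rmult_le_compat_l; [apply pow_le; lra|].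
    apply Rle_trans with (exp (INR n * (g * u / N)) * exp (- (g * u))).
    + apply Rmult_le_compat_r; [left; apply exp_pos | now apply pow_1_plus_le_exp].
    + rewrite <- exp_plus. rewrite <- exp_0. apply exp_le_exp.
      replace (INR n * (g * u / N) + - (g * u)) with (- (g * u / N)) by (unfold N; field; unfold N in HN; lra). lra.
Qed.

(** The factor 1 + 2 u comes from [rsh_exp_bound], and 1 + u leaves room for the extra power of u in
    [phi 4]. *)
Lemma exp_dominated (g : R) : 0 < g -> exists M, 0 < M /\ forall u, 0 <= u ->
  (1 + u) * (1 + 2 * u) * exp (- (g * u)) <= M / (1 + u ^ 2).
Proof.
  intros Hg. destruct (poly_exp_bound 4 g Hg) as [M [HM H]].
  exists (2 * M). split; [lra|]. intros u Hu. specialize (H u Hu).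
  assert (Hp : 0 < 1 + u ^ 2) by nra. assert (He := exp_pos (- (g * u))).
  apply (Rmult_le_reg_r (1 + u ^ 2)); [exact Hp|].
  replace (2 * M / (1 + u ^ 2) * (1 + u ^ 2)) with (2 * M) by (field; lra).
  apply Rle_trans with (2 * ((1 + u) ^ 4 * exp (- (g * u)))); [|lra].
  replace ((1 + u) * (1 + 2 * u) * exp (- (g * u)) * (1 + u ^ 2))
    with ((1 + u) * (1 + 2 * u) * (1 + u ^ 2) * exp (- (g * u))) by ring.
  rewrite <- Rmult_assoc. apply Rmult_le_compat_r; [lra|]. nra.
Qed.

Lemma kappa_exp (beta : R) (z : C) (u y0 : R) : 0 <= beta -> 0 < u -> Rabs (Im z) <= y0 ->
  kappa beta u * exp (Rabs (Im (RtoC (2 * u) * z)%C)) <= (1 + 2 * u) * exp (- ((1 - 2 * y0) * u)).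
Proof.
  intros Hb Hu Hz. destruct (kappa_bounds beta u Hb Hu) as [[K1 _] [K2 _]].
  rewrite Im_RtoC_mult, Rabs_mult, (Rabs_pos_eq (2 * u)) by lra.
  apply Rle_trans with ((1 + 2 * u) * exp (- u) * exp (2 * u * y0)).
  - apply Rmult_le_compat; [lra | left; apply exp_pos | exact K2 | apply exp_le_exp; nra].
  - right. rewrite Rmult_assoc, <- exp_plus. f_equal. f_equal. ring.
Qed.

(** At infinity the decay exp (- u) of [kappa] beats the growth exp (2 u y0) because y0 < 1/2; at 0
    the negative powers of u are cancelled by the Taylor estimates of sine and cosine. One constant
    serves all n, which is what differentiation under the integral asks for. *)
Lemma phi_bound (y0 Z beta : R) : y0 < 1 / 2 -> 0 <= Z -> 0 <= beta ->
  exists M, 0 <= M /\ forall n z u, Rabs (Im z) <= y0 -> Cmod z <= Z -> 0 < u ->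
    Cmod (phi n beta z u) <= M / (1 + u ^ 2).
Proof.
  intros Hy HZ Hb.
  destruct (exp_dominated (1 - 2 * y0) ltac:(lra)) as [M0 [HM0 H0]].
  set (c := 8 + 4 * Z + 4 * Z ^ 2 + 4 * Z ^ 3).
  assert (HZ2 : 0 <= Z ^ 2) by nra. assert (HZ3 : 0 <= Z ^ 3) by (simpl; nra).
  exists (c * M0 + (1 + Z) * (2 * (1 + beta ^ 2))).
  split. { assert (0 <= beta ^ 2) by nra. unfold c. nra. }
  intros n z u Hz HzZ Hu. specialize (H0 u ltac:(lra)).
  assert (HE := kappa_exp beta z u y0 Hb Hu Hz).
  destruct (kappa_bounds beta u Hb Hu) as [[K1 K1'] [_ K3]].
  set (k := kappa beta u) in *. set (e := exp (Rabs (Im (RtoC (2 * u) * z)%C))) in *.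
  assert (He : 0 < e) by apply exp_pos.
  set (g := exp (- ((1 - 2 * y0) * u))) in *. assert (Hg : 0 < g) by apply exp_pos.
  assert (Hm0 := Cmod_ge_0 z).
  assert (Hw : Cmod (RtoC (2 * u) * z)%C <= 2 * u * Z).
  { rewrite Cmod_mult, Cmod_RtoC_nonneg by lra. nra. }
  assert (Hw0 := Cmod_ge_0 (RtoC (2 * u) * z)%C).
  assert (Hu2 : 0 < 1 + u ^ 2) by nra.
  set (D := M0 / (1 + u ^ 2)) in *.
  assert (HkD : k * e <= D) by nra.
  assert (HD0 : 0 <= D) by nra.
  assert (HukD : u * (k * e) <= D) by nra.
  assert (Hk1 : (1 - k) / u ^ 2 <= 2 * (1 + beta ^ 2) / (1 + u ^ 2)).
  { apply (Rmult_le_reg_r (1 + u ^ 2)); [exact Hu2|].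
    replace (2 * (1 + beta ^ 2) / (1 + u ^ 2) * (1 + u ^ 2)) with (2 * (1 + beta ^ 2)) by (field; lra).
    replace ((1 - k) / u ^ 2 * (1 + u ^ 2)) with ((1 - k) / u ^ 2 + (1 - k)) by (field; lra).
    assert ((1 - k) / u ^ 2 <= 1 + beta ^ 2).
    { apply (Rmult_le_reg_r (u ^ 2)); [nra|]. replace ((1 - k) / u ^ 2 * u ^ 2) with (1 - k) by (field; lra). exact K3. }
    assert (0 <= beta ^ 2) by nra. lra. }
  assert (Hk0 : 0 <= (1 - k) / u ^ 2) by (apply Rmult_le_pos; [lra | left; apply Rinv_0_lt_compat; nra]).
  set (E2 := 2 * (1 + beta ^ 2) / (1 + u ^ 2)) in *.
  replace ((c * M0 + (1 + Z) * (2 * (1 + beta ^ 2))) / (1 + u ^ 2)) with (c * D + (1 + Z) * E2)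
    by (unfold D, E2; field; lra).
  assert (HE20 : 0 <= E2) by lra.
  assert (Hu3 : 0 < u ^ 3) by (simpl; repeat apply Rmult_lt_0_compat; lra).
  destruct n as [|[|[|[|n]]]]; unfold phi; fold k.
  (* The singular terms are regrouped into sine minus its linear part, which is of order u^3, and a
     multiple of (1 - k) / u^2. *)
  - replace (RtoC (k / (2 * u ^ 3)) * Csin (RtoC (2 * u) * z) - RtoC (/ u ^ 2) * z)%C
      with (RtoC (k / (2 * u ^ 3)) * (Csin (RtoC (2 * u) * z) - RtoC (2 * u) * z) - RtoC ((1 - k) / u ^ 2) * z)%C.
    2: { assert (E : RtoC ((1 - k) / u ^ 2) = (RtoC (/ u ^ 2) - RtoC (k / (2 * u ^ 3)) * RtoC (2 * u))%C)
           by (rewrite <- RtoC_mult, <- RtoC_minus; f_equal; field; lra). rewrite E; ring. }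
    eapply Rle_trans; [apply Cmod_triangle_minus|]. rewrite !Cmod_mult.
    rewrite (Cmod_RtoC_nonneg (k / (2 * u ^ 3))) by (apply Rmult_le_pos; [lra | left; apply Rinv_0_lt_compat; lra]).
    rewrite (Cmod_RtoC_nonneg ((1 - k) / u ^ 2)) by exact Hk0.
    assert (HS := Csin_minus_id_bound (RtoC (2 * u) * z)%C). fold e in HS.
    assert (HP3 : Cmod (RtoC (2 * u) * z)%C ^ 3 <= (2 * u * Z) ^ 3) by (apply pow_incr; lra).
    assert (A : k / (2 * u ^ 3) * Cmod (Csin (RtoC (2 * u) * z) - RtoC (2 * u) * z)%C <= 4 * Z ^ 3 * D).
    { apply Rle_trans with (k / (2 * u ^ 3) * ((2 * u * Z) ^ 3 * e)).
      - apply Rmult_le_compat_l; [apply Rmult_le_pos; [lra | left; apply Rinv_0_lt_compat; lra]|].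
        eapply Rle_trans; [exact HS|]. apply Rmult_le_compat_r; lra.
      - replace (k / (2 * u ^ 3) * ((2 * u * Z) ^ 3 * e)) with (4 * Z ^ 3 * (k * e)) by (field; lra).
        apply Rmult_le_compat_l; lra. }
    assert (B : (1 - k) / u ^ 2 * Cmod z <= Z * E2).
    { rewrite Rmult_comm. apply Rmult_le_compat; lra. }
    unfold c. nra.
  - replace (RtoC (k / u ^ 2) * Ccos (RtoC (2 * u) * z) - RtoC (/ u ^ 2))%C
      with (RtoC (k / u ^ 2) * (Ccos (RtoC (2 * u) * z) - 1) - RtoC ((1 - k) / u ^ 2))%C.
    2: { assert (E : RtoC ((1 - k) / u ^ 2) = (RtoC (/ u ^ 2) - RtoC (k / u ^ 2))%C)
           by (rewrite <- RtoC_minus; f_equal; field; lra). rewrite E; ring. }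
    eapply Rle_trans; [apply Cmod_triangle_minus|]. rewrite Cmod_mult.
    rewrite (Cmod_RtoC_nonneg (k / u ^ 2)) by (apply Rmult_le_pos; [lra | left; apply Rinv_0_lt_compat; nra]).
    rewrite (Cmod_RtoC_nonneg ((1 - k) / u ^ 2)) by exact Hk0.
    assert (HS := Ccos_minus_1_bound (RtoC (2 * u) * z)%C). fold e in HS.
    assert (HP2 : Cmod (RtoC (2 * u) * z)%C ^ 2 <= (2 * u * Z) ^ 2) by (apply pow_incr; lra).
    assert (A : k / u ^ 2 * Cmod (Ccos (RtoC (2 * u) * z) - 1)%C <= 4 * Z ^ 2 * D).
    { apply Rle_trans with (k / u ^ 2 * ((2 * u * Z) ^ 2 * e)).
      - apply Rmult_le_compat_l; [apply Rmult_le_pos; [lra | left; apply Rinv_0_lt_compat; nra]|].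
        eapply Rle_trans; [exact HS|]. apply Rmult_le_compat_r; lra.
      - replace (k / u ^ 2 * ((2 * u * Z) ^ 2 * e)) with (4 * Z ^ 2 * (k * e)) by (field; lra).
        apply Rmult_le_compat_l; lra. }
    unfold c. nra.
  - rewrite Cmod_opp, Cmod_mult.
    rewrite (Cmod_RtoC_nonneg (2 * k / u)) by (apply Rmult_le_pos; [lra | left; apply Rinv_0_lt_compat; lra]).
    assert (HS := Csin_bound (RtoC (2 * u) * z)%C). fold e in HS.
    assert (A : 2 * k / u * Cmod (Csin (RtoC (2 * u) * z)) <= 4 * Z * D).
    { apply Rle_trans with (2 * k / u * (2 * u * Z * e)).
      - apply Rmult_le_compat_l; [apply Rmult_le_pos; [lra | left; apply Rinv_0_lt_compat; lra]|].
        eapply Rle_trans; [exact HS|]. apply Rmult_le_compat_r; lra.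
      - replace (2 * k / u * (2 * u * Z * e)) with (4 * Z * (k * e)) by (field; lra).
        apply Rmult_le_compat_l; lra. }
    unfold c. nra.
  - rewrite Cmod_opp, Cmod_mult, (Cmod_RtoC_nonneg (4 * k)) by lra.
    assert (HS := Cmod_Ccos_le (RtoC (2 * u) * z)%C). fold e in HS.
    assert (A : 4 * k * Cmod (Ccos (RtoC (2 * u) * z)) <= 4 * D) by nra.
    unfold c. nra.
  - rewrite Cmod_mult, (Cmod_RtoC_nonneg (8 * k * u)) by nra.
    assert (HS := Cmod_Csin_le (RtoC (2 * u) * z)%C). fold e in HS.
    assert (A : 8 * k * u * Cmod (Csin (RtoC (2 * u) * z)) <= 8 * D).
    { apply Rle_trans with (8 * k * u * e); [apply Rmult_le_compat_l; nra | nra]. }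
    unfold c. nra.
Qed.

(** * The integrated kernels *)

(** [IPhi 0 beta] is H_beta, and for n <= 3 [IPhi n beta] is its n-th derivative on the strip. *)
Definition IPhi (n : nat) (beta : R) (z : C) : C :=
  RInt_gen (V := C_R_CompleteNormedModule) (phi n beta z) (at_right 0) (Rbar_locally p_infty).

Lemma IPhi_correct (n : nat) (beta : R) (z : C) : 0 <= beta -> Rabs (Im z) < 1 / 2 ->
  Cint0 (phi n beta z) (IPhi n beta z).
Proof.
  intros Hb Hz.
  destruct (phi_bound (Rabs (Im z)) (Cmod z) beta Hz (Cmod_ge_0 z) Hb) as [M [_ HM]].
  destruct (Cint0_dom (phi n beta z) M) as [l [Hl _]].
  - intros; now apply Ccontinuous_phi.
  - intros u Hu. apply HM; lra.
  - apply (RInt_gen_correct (V := C_R_CompleteNormedModule)). now exists l.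
Qed.

Lemma IPhi_unique (n : nat) (beta : R) (z l : C) : Cint0 (phi n beta z) l -> IPhi n beta z = l.
Proof. apply (is_RInt_gen_unique (V := C_R_CompleteNormedModule)). Qed.

Lemma IPhi_bound (y0 Z beta : R) : y0 < 1 / 2 -> 0 <= Z -> 0 <= beta ->
  exists B, 0 <= B /\ forall n z, Rabs (Im z) <= y0 -> Cmod z <= Z -> Cmod (IPhi n beta z) <= B.
Proof.
  intros Hy HZ Hb. destruct (phi_bound y0 Z beta Hy HZ Hb) as [M [HM0 HM]].
  assert (HP := PI_RGT_0).
  exists (M * (PI / 2)). split; [nra|]. intros n z Hz HzZ.
  destruct (Cint0_dom (phi n beta z) M) as [l [Hl Hlb]].
  - intros; now apply Ccontinuous_phi.
  - intros u Hu. now apply HM.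
  - now rewrite (IPhi_unique _ _ _ _ Hl).
Qed.

Lemma Im_minus_le (w z : C) : Rabs (Im w) <= Rabs (Im z) + Cmod (w - z)%C.
Proof.
  assert (H := Im_le_Cmod (w - z)%C). replace (Im w) with (Im z + Im (w - z)%C) by (unfold Im; simpl; ring).
  eapply Rle_trans; [apply Rabs_triang | lra].
Qed.

(** The restriction n <= 2 leaves two further kernels, up to [phi 4], for the Taylor remainder; [d]
    is half the distance to the boundary of the strip. *)
Lemma Cder_IPhi (n : nat) (beta : R) (z : C) : (n <= 2)%nat -> 0 <= beta -> Rabs (Im z) < 1 / 2 ->
  Cder (IPhi n beta) z (IPhi (S n) beta z).
Proof.
  intros Hn Hb Hz.
  set (d := (1 / 2 - Rabs (Im z)) / 2). assert (Hd : 0 < d) by (unfold d; lra).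
  assert (Hm := Cmod_ge_0 z).
  destruct (phi_bound (Rabs (Im z) + d) (Cmod z + d) beta) as [M [_ HM]]; [unfold d; lra | lra | exact Hb |].
  assert (Hw : forall w, Cmod (w - z)%C < d -> Rabs (Im w) <= Rabs (Im z) + d /\ Cmod w <= Cmod z + d).
  { intros w Hw. assert (H1 := Im_minus_le w z). assert (H2 := Cmod_minus_lower w z). lra. }
  apply (Cder_Cint0 (phi n beta) (phi (S n) beta) (phi (S (S n)) beta) (IPhi n beta) (IPhi (S n) beta) z M d).
  - exact Hd.
  - intros; apply Cder_phi; auto; lia.
  - intros; apply Cder_phi; auto; lia.
  - intros w u Hwz Hu. destruct (Hw w Hwz). now apply HM.
  - intros; now apply Ccontinuous_phi.
  - intros; now apply Ccontinuous_phi.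
  - intros w Hwz. apply IPhi_correct; auto. destruct (Hw w Hwz). unfold d in *. lra.
  - now apply IPhi_correct.
Qed.

(** The kernels differ by the factor 1 - [rsh (beta * u)] <= beta^2 u^2. This removes two of the
    three negative powers of u, and the sine removes the last one at the price of |z|. The
    subtracted terms z / u^2 do not depend on beta and cancel. *)
Lemma IPhi0_diff (y0 : R) : y0 < 1 / 2 -> exists B, 0 <= B /\
  forall beta z, 0 <= beta -> Rabs (Im z) <= y0 ->
    Cmod (IPhi 0 beta z - IPhi 0 0 z)%C <= B * beta ^ 2 * Cmod z.
Proof.
  intros Hy. destruct (exp_dominated (1 - 2 * y0) ltac:(lra)) as [M [HM H]].
  assert (HP := PI_RGT_0).
  exists (M * (PI / 2)). split; [nra|]. intros beta z Hb Hz.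
  assert (HI : Cint0 (fun u => phi 0 beta z u - phi 0 0 z u)%C (IPhi 0 beta z - IPhi 0 0 z)%C).
  { apply (Cint_minus (phi 0 beta z) (phi 0 0 z)); try apply _; apply IPhi_correct; lra. }
  destruct (Cint0_dom (fun u => phi 0 beta z u - phi 0 0 z u)%C (M * beta ^ 2 * Cmod z)) as [l [Hl Hlb]].
  - intros u Hu. apply Ccontinuous_minus; apply Ccontinuous_phi; lra.
  - intros u Hu. specialize (H u ltac:(lra)).
    assert (HE := kappa_exp 0 z u y0 ltac:(lra) Hu Hz).
    destruct (rsh_bounds (beta * u) ltac:(nra)) as [[A1 A2] A3].
    destruct (rsh_bounds u ltac:(lra)) as [[B1 B2] _].
    assert (E0 : kappa 0 u = rsh u) by (unfold kappa; rewrite Rmult_0_l, rsh_0; ring).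
    rewrite E0 in HE.
    assert (Hu3 : 0 < u ^ 3) by (simpl; repeat apply Rmult_lt_0_compat; lra).
    unfold phi. rewrite E0.
    replace (RtoC (kappa beta u / (2 * u ^ 3)) * Csin (RtoC (2 * u) * z) - RtoC (/ u ^ 2) * z -
      (RtoC (rsh u / (2 * u ^ 3)) * Csin (RtoC (2 * u) * z) - RtoC (/ u ^ 2) * z))%C
      with (- (RtoC ((1 - rsh (beta * u)) * rsh u / (2 * u ^ 3)) * Csin (RtoC (2 * u) * z)))%C.
    2: { assert (E : RtoC ((1 - rsh (beta * u)) * rsh u / (2 * u ^ 3)) =
           (RtoC (rsh u / (2 * u ^ 3)) - RtoC (kappa beta u / (2 * u ^ 3)))%C)
           by (rewrite <- RtoC_minus; f_equal; unfold kappa; field; lra). rewrite E; ring. }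
    rewrite Cmod_opp, Cmod_mult, Cmod_RtoC_nonneg
      by (apply Rmult_le_pos; [nra | left; apply Rinv_0_lt_compat; lra]).
    assert (HS := Csin_bound (RtoC (2 * u) * z)%C).
    rewrite Cmod_mult, (Cmod_RtoC_nonneg (2 * u)) in HS by lra.
    set (e := exp (Rabs (Im (RtoC (2 * u) * z)%C))) in *. assert (He : 0 < e) by apply exp_pos.
    assert (Hm := Cmod_ge_0 z).
    apply Rle_trans with ((beta * u) ^ 2 * rsh u / (2 * u ^ 3) * (2 * u * Cmod z * e)).
    + apply Rmult_le_compat; [apply Rmult_le_pos; [nra | left; apply Rinv_0_lt_compat; lra] | apply Cmod_ge_0 | | exact HS].
      apply Rmult_le_compat_r; [left; apply Rinv_0_lt_compat; lra|]. nra.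
    + replace ((beta * u) ^ 2 * rsh u / (2 * u ^ 3) * (2 * u * Cmod z * e))
        with (beta ^ 2 * Cmod z * (rsh u * e)) by (field; lra).
      replace (M * beta ^ 2 * Cmod z / (1 + u ^ 2)) with (beta ^ 2 * Cmod z * (M / (1 + u ^ 2))) by (field; nra).
      apply Rmult_le_compat_l; [nra|].
      eapply Rle_trans; [exact HE|]. eapply Rle_trans; [|exact H].
      assert (Hx := exp_pos (- ((1 - 2 * y0) * u))). nra.
  - rewrite (Cint_unique _ _ _ _ _ HI Hl). eapply Rle_trans; [exact Hlb|]. right; ring.
Qed.

(** * Closed forms at [beta = 0] by the Herglotz trick *)

(** From sin t >= t cos t at t = y / 2: sin y = 2 sin (y/2) cos (y/2) >= y cos (y/2)^2 = y (1 + cos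
    y) / 2. *)
Lemma sin_ge_half (y : R) : 0 <= y <= PI / 2 -> y / 2 <= sin y.
Proof.
  intros Hy. assert (HP := PI_RGT_0).
  assert (H1 : y / 2 * cos (y / 2) <= sin (y / 2)).
  { cut (0 <= sin (y / 2) - y / 2 * cos (y / 2)); [lra|].
    apply (nonneg_of_derive (fun t => sin t - t * cos t) (fun t => t * sin t)).
    - lra.
    - rewrite sin_0. ring.
    - intros t. auto_derive; [trivial | ring].
    - intros t Ht. apply Rmult_le_pos; [lra | apply sin_ge_0; lra]. }
  assert (Hc : 0 <= cos y) by (apply cos_ge_0; lra).
  assert (Hc2 : 0 <= cos (y / 2)) by (apply cos_ge_0; lra).
  assert (E : cos y = 2 * (cos (y / 2) * cos (y / 2)) - 1).
  { replace y with (2 * (y / 2)) at 1 by field. rewrite cos_2a_cos. ring. }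
  assert (Es : sin y = 2 * sin (y / 2) * cos (y / 2)).
  { replace y with (2 * (y / 2)) at 1 by field. apply sin_2a. }
  rewrite Es. nra.
Qed.

Lemma sin_sqr_ge (y : R) : Rabs y <= PI / 2 -> (y / 2) * (y / 2) <= sin y * sin y.
Proof.
  intros Hy. destruct (Rle_dec 0 y) as [H|H].
  - rewrite Rabs_pos_eq in Hy by exact H. assert (K := sin_ge_half y ltac:(lra)). nra.
  - rewrite Rabs_left in Hy by lra. assert (K := sin_ge_half (- y) ltac:(lra)).
    rewrite sin_neg in K. nra.
Qed.

(** This is 2 sinh (v / 2); near v = 0 its inverse square models the double pole of H_0''' at i /
    2. *)
Definition Cshh (v : C) : C := (Cexp (v / 2) - Cexp (- (v / 2)))%C.

(** For v / 2 = a + i c one has |2 sinh (v / 2)|^2 = 4 (sinh a)^2 + 4 (sin c)^2, and |c| <= PI / 2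
    allows the lower bound of sine. *)
Lemma Cshh_lower (v : C) : Rabs (Im v) <= PI -> Cmod v / 2 <= Cmod (Cshh v).
Proof.
  intros Hv. apply Rsqr_incr_0_var; [|apply Cmod_ge_0]. unfold Rsqr.
  rewrite (Cmod_sqr (Cshh v)).
  assert (Hi : Rabs (Im v / 2) <= PI / 2).
  { unfold Rdiv at 1. rewrite Rabs_mult, (Rabs_pos_eq (/ 2)) by lra. lra. }
  assert (Ha := sin_sqr_ge _ Hi).
  set (a := Re v / 2). set (c := Im v / 2) in *.
  assert (E : Cshh v = (2 * sinh a * cos c, 2 * cosh a * sin c)).
  { unfold Cshh. replace (v / 2)%C with (a, c).
    2: { unfold a, c. destruct v. apply Ceq_pair; unfold Re, Im; simpl; field. }
    unfold Cexp. apply Ceq_pair; unfold Re, Im; simpl; rewrite ?cos_neg, ?sin_neg; unfold sinh, cosh; field. }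
  rewrite E; simpl.
  assert (Hs : a * a <= sinh a * sinh a).
  { destruct (Rle_dec 0 a) as [H|H].
    - assert (K := sinh_ge_id a H). nra.
    - assert (K := sinh_ge_id (- a) ltac:(lra)). unfold sinh in *. rewrite Ropp_involutive in K. nra. }
  assert (Hc := cosh2_sinh2 a). assert (Hsc := sin2_cos2 c). unfold Rsqr in Hsc.
  assert (Hm := Cmod_sqr v).
  replace (Re v) with (2 * a) in Hm by (unfold a; field).
  replace (Im v) with (2 * c) in Hm by (unfold c; field).
  assert (E2 : 2 * sinh a * cos c * (2 * sinh a * cos c) + 2 * cosh a * sin c * (2 * cosh a * sin c)
    = 4 * (sinh a * sinh a) + 4 * (sin c * sin c)).
  { replace (2 * cosh a * sin c * (2 * cosh a * sin c)) with (4 * (cosh a * cosh a) * (sin c * sin c)) by ring.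
    replace (cosh a * cosh a) with (1 + sinh a * sinh a) by lra.
    replace (2 * sinh a * cos c * (2 * sinh a * cos c)) with (4 * (sinh a * sinh a) * (cos c * cos c)) by ring.
    replace (cos c * cos c) with (1 - sin c * sin c) by lra. ring. }
  rewrite E2. nra.
Qed.

Lemma Cshh_diff (v : C) : Cmod v <= 1 -> Cmod (Cshh v - v)%C <= Cmod v ^ 3.
Proof.
  intros Hv. set (w := (- (Ci * (v / 2)))%C).
  assert (E : (Cshh v - v)%C = (2 * Ci * (Csin w - w))%C).
  { rewrite Csin_alt. unfold Cshh, w.
    replace (Ci * - (Ci * (v / 2)))%C with (- (Ci * Ci) * (v / 2))%C by ring. rewrite Ci_sqr.
    replace (- - (1) * (v / 2))%C with (v / 2)%C by ring.
    replace (2 * Ci * (- (Ci / 2) * (Cexp (v / 2) - Cexp (- (v / 2))) - - (Ci * (v / 2))))%C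
      with (- (Ci * Ci) * (2 * / 2 * (Cexp (v / 2) - Cexp (- (v / 2))) - v * (2 / 2)))%C by (unfold Cdiv; ring).
    rewrite Ci_sqr. field. }
  rewrite E, !Cmod_mult, Cmod_Ci, Cmod_RtoC_nonneg by lra.
  assert (HS := Csin_minus_id_bound w).
  assert (Hw : Cmod w = Cmod v / 2).
  { unfold w. rewrite Cmod_opp, Cmod_mult, Cmod_Ci, Cmod_div by (apply RtoC_neq_0; lra).
    rewrite Cmod_RtoC_nonneg by lra. field. }
  assert (Hv0 := Cmod_ge_0 v).
  assert (Hi := Im_le_Cmod w). rewrite Hw in *.
  assert (He : exp (Rabs (Im w)) <= 4).
  { apply Rle_trans with (exp 1); [apply exp_le_exp; lra | apply Rle_trans with 3; [apply exp_le_3 | lra]]. }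
  assert (Hp : 0 <= (Cmod v / 2) ^ 3) by (apply pow_le; lra).
  apply Rle_trans with (2 * 1 * ((Cmod v / 2) ^ 3 * 4)); [nra|]. right. field.
Qed.

(** The double poles cancel: with S = [Cshh v], the numerator (v - S) (v + S) is at most |v|^3 times
    3 |v|, against a denominator of at least |v|^4 / 4. This gives 12 for |v| < 1; for |v| >= 1 the
    two terms are at most 4 and 1. *)
Lemma Cshh_inv_sqr_bound (v : C) : v <> 0%C -> Rabs (Im v) <= PI ->
  Cmod (/ (Cshh v * Cshh v) - / (v * v))%C <= 12.
Proof.
  intros Hv Hi. assert (Hm : 0 < Cmod v) by now apply Cmod_gt_0.
  assert (HL := Cshh_lower v Hi).
  assert (HS : Cshh v <> 0%C) by (apply Cmod_gt_0; lra).
  assert (HS2 : (Cshh v * Cshh v)%C <> 0%C) by now apply Cmult_neq_0.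
  assert (Hv2 : (v * v)%C <> 0%C) by now apply Cmult_neq_0.
  destruct (Rle_dec 1 (Cmod v)) as [H1|H1].
  - eapply Rle_trans; [apply Cmod_triangle_minus|]. rewrite !Cmod_inv, !Cmod_mult by assumption.
    assert (/ (Cmod (Cshh v) * Cmod (Cshh v)) <= / (1 / 2 * (1 / 2))) by (apply Rinv_le_contravar; nra).
    assert (/ (Cmod v * Cmod v) <= / 1) by (apply Rinv_le_contravar; nra).
    replace (/ (1 / 2 * (1 / 2))) with 4 in * by field. rewrite Rinv_1 in *. lra.
  - assert (HD := Cshh_diff v ltac:(lra)).
    replace (/ (Cshh v * Cshh v) - / (v * v))%C
      with (((v - Cshh v) * (v + Cshh v)) / ((v * v) * (Cshh v * Cshh v)))%C by (field; auto).
    rewrite Cmod_div by (now apply Cmult_neq_0). rewrite !Cmod_mult.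
    set (m := Cmod v) in *. set (S := Cmod (Cshh v)) in *.
    assert (Hd1 : Cmod (v - Cshh v)%C <= m ^ 3) by (rewrite Cmod_minus_sym; exact HD).
    assert (HSm : S <= 2 * m).
    { assert (K := Cmod_minus_lower (Cshh v) v). fold S in K. fold m in K.
      assert (m ^ 3 <= m) by (simpl; nra). lra. }
    assert (Hs1 : Cmod (v + Cshh v)%C <= 3 * m).
    { eapply Rle_trans; [apply Cmod_triangle|]. fold S m. lra. }
    assert (P : 0 < m * m * (S * S)) by (repeat apply Rmult_lt_0_compat; lra).
    apply (Rmult_le_reg_r (m * m * (S * S))); [exact P|].
    unfold Rdiv. rewrite Rmult_assoc, Rinv_l, Rmult_1_r by lra.
    apply Rle_trans with (m ^ 3 * (3 * m)).
    + apply Rmult_le_compat; try apply Cmod_ge_0; assumption.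
    + assert (m * m / 4 <= S * S) by nra. assert (0 < m * m) by nra.
      replace (m ^ 3 * (3 * m)) with (3 * (m * m) * (m * m)) by ring. nra.
Qed.

(** * The double pole at the edge of the strip *)

Lemma Cint0_antiderivative (F f : R -> C) (la lb : C) :
  (forall u, 0 < u -> Rder F u (f u)) -> (forall u, 0 < u -> Ccontinuous f u) ->
  (forall eps, 0 < eps -> at_right 0 (fun u => Cmod (F u - la)%C < eps)) ->
  (forall eps, 0 < eps -> Rbar_locally p_infty (fun u => Cmod (F u - lb)%C < eps)) ->
  Cint0 f (lb - la)%C.
Proof.
  intros Hd Hc Ha Hb P [eps HP].
  assert (He : 0 < eps / 2) by (assert (H := cond_pos eps); lra).
  exists (fun a => 0 < a /\ Cmod (F a - la)%C < eps / 2) (fun b => 0 < b /\ Cmod (F b - lb)%C < eps / 2).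
  - apply filter_and; [apply at_right_pos | now apply Ha].
  - apply filter_and; [apply p_infty_gt | now apply Hb].
  - intros a b [Ha0 Ha1] [Hb0 Hb1]. exists (F b - F a)%C. simpl. split.
    + assert (Hm : 0 < Rmin a b) by now apply Rmin_glb_lt.
      apply is_RInt_Rder; intros x Hx; [apply Hd | apply Hc]; lra.
    + apply HP. apply (norm_compat1 (V := C_R_NormedModule)). rewrite <- Cmod_norm.
      change (Cmod (F b - F a - (lb - la))%C < eps).
      replace (F b - F a - (lb - la))%C with (F b - lb - (F a - la))%C by ring.
      eapply Rle_lt_trans; [apply Cmod_triangle_minus|]. lra.
Qed.

Lemma Rder_ext (f g : R -> C) (t : R) (l : C) : (forall s, f s = g s) -> Rder f t l -> Rder g t l.
Proof.
  intros H [H1 H2]. split; [apply (is_derive_ext (fun s => Re (f s))) | apply (is_derive_ext (fun s => Im (f s)))];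
    auto; intros; now rewrite H.
Qed.

Lemma Cder_Rder_real (f : C -> C) (l : C) (t : R) : Cder f t l -> Rder (fun s => f (RtoC s)) t l.
Proof.
  intros H. apply (Rder_ext (fun s : R => f (0 + s * 1)%C)).
  { intros s. f_equal. ring. }
  rewrite <- (Cmult_1_r l). apply Cder_Rder. replace (0 + t * 1)%C with (RtoC t) by ring. exact H.
Qed.

(** This is the integral of the dominant exponential of [phi 3] as Im z tends to 1/2, with p = 1 + 2
    i z. It exhibits the double pole at z = i / 2. *)
Lemma Cint0_u_exp (p : C) : 0 < Re p ->
  Cint0 (fun u => 4 * u * Cexp (- (u * p)))%C (4 / (p * p))%C.
Proof.
  intros Hp.
  assert (Hp0 : p <> 0%C) by (intros E; rewrite E in Hp; simpl in Hp; lra).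
  assert (Hm : 0 < Cmod p) by now apply Cmod_gt_0.
  set (A := fun w : C => (- (4) * (w / p + / (p * p)) * Cexp (- (w * p)))%C).
  assert (HA : forall w, Cder A w (4 * w * Cexp (- (w * p)))%C).
  { intros w. unfold A. eapply Cder_eq.
    - apply Cder_mult.
      + apply Cder_scal, Cder_plus; [|apply Cder_const].
        apply (Cder_ext (fun w => / p * w)%C); [intros; unfold Cdiv; ring | apply Cder_scal, Cder_id].
      + apply Cder_Cexp_comp, Cder_opp.
        apply (Cder_ext (fun w => p * w)%C); [intros; ring | apply Cder_scal, Cder_id].
    - simpl. field. exact Hp0. }
  assert (HR : forall u : R, Rder (fun s => A s) u (4 * u * Cexp (- (u * p)))%C).
  { intros u. apply Cder_Rder_real, HA. }
  replace (4 / (p * p))%C with (0 - A 0%C)%C.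
  2: { unfold A. replace (- (0 * p))%C with (RtoC 0) by ring. rewrite Cexp_0. field. exact Hp0. }
  apply (Cint0_antiderivative (fun s => A s)).
  - intros u _. apply HR.
  - intros u _.
    assert (HB : forall w : C, Cder (fun w => 4 * w * Cexp (- (w * p)))%C w
        (4 * Cexp (- (w * p)) + 4 * w * (Cexp (- (w * p)) * - p))%C).
    { intros w. eapply Cder_eq.
      - apply Cder_mult; [apply Cder_scal, Cder_id | apply Cder_Cexp_comp, Cder_opp].
        apply (Cder_ext (fun w => p * w)%C); [intros; ring | apply Cder_scal, Cder_id].
      - simpl. ring. }
    eapply Rder_Ccontinuous. apply (Cder_Rder_real (fun w => 4 * w * Cexp (- (w * p)))%C), HB.
  - intros eps He. destruct (Cder_cont A 0%C _ (HA 0%C) eps He) as [d [Hd Hcont]].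
    exists (mkposreal d Hd). intros y Hy _. apply Hcont.
    replace (RtoC y - 0)%C with (RtoC y) by ring. rewrite Cmod_R.
    assert (Hy' : Rabs (y - 0) < d) by exact Hy. now rewrite Rminus_0_r in Hy'.
  - intros eps He.
    destruct (poly_exp_bound 2 (Re p) Hp) as [M [HM Hb]].
    set (c := 4 * (/ Cmod p + / (Cmod p * Cmod p))).
    assert (Hc : 0 < c).
    { unfold c. assert (0 < / Cmod p) by (now apply Rinv_0_lt_compat).
      assert (0 < / (Cmod p * Cmod p)) by (apply Rinv_0_lt_compat; nra). lra. }
    exists (c * M / eps). intros u Hu.
    assert (HcM : 0 < c * M / eps) by (apply Rdiv_lt_0_compat; nra).
    assert (Hu0 : 0 < u) by lra.
    replace (A u - 0)%C with (A u) by ring. unfold A.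
    rewrite !Cmod_mult, Cmod_opp, Cmod_RtoC_nonneg, Cmod_Cexp by lra.
    change (Re (- (u * p))%C) with (- Re (u * p)%C). rewrite Re_RtoC_mult.
    assert (H1 : Cmod (u / p + / (p * p))%C <= (1 + u) * (/ Cmod p + / (Cmod p * Cmod p))).
    { eapply Rle_trans; [apply Cmod_triangle|].
      rewrite Cmod_div, Cmod_inv, Cmod_mult, Cmod_RtoC_nonneg by (assumption || lra || now apply Cmult_neq_0).
      assert (0 < / Cmod p) by (now apply Rinv_0_lt_compat).
      assert (0 < / (Cmod p * Cmod p)) by (apply Rinv_0_lt_compat; nra). unfold Rdiv. nra. }
    specialize (Hb u ltac:(lra)). assert (Hx := exp_pos (- (u * Re p))).
    rewrite (Rmult_comm (Re p)) in Hb.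
    apply Rle_lt_trans with (c * ((1 + u) * exp (- (u * Re p)))).
    + unfold c. replace (4 * (/ Cmod p + / (Cmod p * Cmod p)) * ((1 + u) * exp (- (u * Re p))))
        with (4 * ((1 + u) * (/ Cmod p + / (Cmod p * Cmod p))) * exp (- (u * Re p))) by ring.
      apply Rmult_le_compat_r; lra.
    + assert (Hu1 : c * M < eps * (1 + u)).
      { apply (Rmult_lt_compat_l eps) in Hu; [|exact He].
        replace (eps * (c * M / eps)) with (c * M) in Hu by (field; lra). nra. }
      apply (Rmult_lt_reg_r (1 + u)); [lra|].
      apply Rle_lt_trans with (c * M); [|exact Hu1].
      rewrite Rmult_assoc. apply Rmult_le_compat_l; [lra|]. simpl in Hb.
      replace ((1 + u) * exp (- (u * Re p)) * (1 + u)) with ((1 + u) * ((1 + u) * 1) * exp (- (u * Re p))) by ring.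
      exact Hb.
Qed.

Definition q2 (z : C) : C := Cexp (2 * PI * z)%C.

Lemma Re_2PI (z : C) : Re (2 * PI * z)%C = 2 * PI * Re z.
Proof. unfold Re, Im; simpl; ring. Qed.
Lemma Im_2PI (z : C) : Im (2 * PI * z)%C = 2 * PI * Im z.
Proof. unfold Re, Im; simpl; ring. Qed.

Lemma q2_slit (z : C) : Rabs (Im z) < 1 / 2 -> slit (1 + q2 z)%C.
Proof.
  intros Hz. apply Rabs_def2 in Hz. assert (HP := PI_RGT_0).
  assert (He := exp_pos (2 * PI * Re z)).
  unfold slit, q2, Cexp. rewrite Re_2PI, Im_2PI.
  destruct (Req_dec (Im z) 0) as [E|E].
  - left. rewrite E, Rmult_0_r, cos_0. simpl. lra.
  - right. simpl. rewrite Rplus_0_l. apply Rmult_integral_contrapositive_currified; [lra|].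
    destruct (Rlt_dec 0 (Im z)).
    + assert (0 < sin (2 * PI * Im z)) by (apply sin_gt_0; nra). lra.
    + assert (0 < sin (- (2 * PI * Im z))) by (apply sin_gt_0; nra). rewrite sin_neg in *. lra.
Qed.

Lemma q2_neq (z : C) : Rabs (Im z) < 1 / 2 -> (1 + q2 z)%C <> 0%C.
Proof. intros H. now apply slit_neq_0, q2_slit. Qed.

Lemma Cder_q2 (z : C) : Cder q2 z (2 * PI * q2 z)%C.
Proof.
  unfold q2. eapply Cder_eq; [apply Cder_Cexp_comp, Cder_scal, Cder_id|]. ring.
Qed.

Lemma q2_plus (z w : C) : q2 (z + w)%C = (q2 z * q2 w)%C.
Proof. unfold q2. rewrite <- Cexp_plus. f_equal. ring. Qed.

Lemma q2_opp (z : C) : q2 (- z)%C = (/ q2 z)%C.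
Proof. unfold q2. rewrite <- Cexp_opp. f_equal. ring. Qed.

Lemma q2_neq_0 (z : C) : q2 z <> 0%C.
Proof. apply Cexp_neq_0. Qed.

Definition quarter_i : C := (0, 1 / 4).

Lemma q2_quarter : q2 quarter_i = Ci.
Proof.
  unfold q2, Cexp. rewrite Re_2PI, Im_2PI. unfold quarter_i; simpl.
  replace (2 * PI * (1 / 4)) with (PI / 2) by field.
  rewrite cos_PI2, sin_PI2, (Rmult_0_r (2 * PI)), exp_0. apply Ceq_pair; simpl; ring.
Qed.

(** This is PI^2 / cosh (PI z)^2 in terms of q = exp (2 PI z). *)
Definition gsech (z : C) : C := (4 * PI * PI * (q2 z / ((1 + q2 z) * (1 + q2 z))))%C.

(** Writing u = [rsh u * sinh u], the added term 4 u exp (- u p) removes the growing exponential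
    from the cosine. What remains is at most 4 [rsh u], uniformly in z because Im z >= 0 makes exp
    (2 i u z) decay. *)
Lemma IPhi3_near_pole : exists B, 0 <= B /\ forall z, 0 <= Im z < 1 / 2 ->
  Cmod (IPhi 3 0 z + 4 / ((1 + 2 * Ci * z) * (1 + 2 * Ci * z)))%C <= B.
Proof.
  destruct (exp_dominated 1 Rlt_0_1) as [M [HM Hb]]. assert (HP := PI_RGT_0).
  exists (4 * M * (PI / 2)). split; [nra|]. intros z Hz.
  set (p := (1 + 2 * Ci * z)%C).
  assert (Hp : 0 < Re p).
  { replace (Re p) with (1 - 2 * Im z) by (unfold p, Re, Im; simpl; ring). lra. }
  assert (HI : Cint0 (fun u => phi 3 0 z u + 4 * u * Cexp (- (u * p)))%C (IPhi 3 0 z + 4 / (p * p))%C).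
  { apply (Cint_plus (phi 3 0 z)); try apply _; [apply IPhi_correct; [lra | rewrite Rabs_pos_eq; lra] | now apply Cint0_u_exp]. }
  destruct (Cint0_dom (fun u => phi 3 0 z u + 4 * u * Cexp (- (u * p)))%C (4 * M)) as [l [Hl Hlb]].
  - intros u Hu. apply Ccontinuous_plus; [apply Ccontinuous_phi; lra|].
    apply Ccontinuous_mult.
    + apply Ccontinuous_scal, Ccontinuous_RtoC, continuous_id.
    + apply (Ccontinuous_ext (fun s : R => Cexp (s * (- p)))%C); [intros; f_equal; ring|].
      eapply Rder_Ccontinuous, Rder_Cexp_line.
  - intros u Hu. specialize (Hb u ltac:(lra)).
    unfold phi, kappa. rewrite Rmult_0_l, rsh_0, Rmult_1_l.
    assert (Hr := rsh_exp_bound u ltac:(lra)).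
    destruct (rsh_bounds u ltac:(lra)) as [[Hr0 _] _].
    set (E := Cexp (Ci * (RtoC (2 * u) * z))). set (E' := Cexp (- (Ci * (RtoC (2 * u) * z)))).
    assert (Ep : Cexp (- (u * p)) = (RtoC (exp (- u)) * E')%C).
    { unfold E'. rewrite <- Cexp_RtoC, <- Cexp_plus. f_equal. unfold p. rewrite RtoC_opp, RtoC_mult. ring. }
    assert (Eu : u = rsh u * sinh u).
    { rewrite rsh_pos_eq by exact Hu. assert (K := sinh_pos u Hu). field. lra. }
    assert (Ee : exp u * exp (- u) = 1) by (rewrite <- exp_plus, Rplus_opp_r; apply exp_0).
    replace (- (RtoC (4 * rsh u) * Ccos (RtoC (2 * u) * z)) + 4 * u * Cexp (- (u * p)))%C
      with (- (RtoC (2 * rsh u) * (E + RtoC (exp (- u) * exp (- u)) * E')))%C.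
    2: { rewrite Ep. unfold Ccos. fold E E'.
         replace (4 * u * (RtoC (exp (- u)) * E'))%C with (RtoC (4 * u * exp (- u)) * E')%C
           by (rewrite !RtoC_mult; ring).
         replace (4 * u * exp (- u)) with (2 * rsh u * (1 - exp (- u) * exp (- u))).
         2: { transitivity (4 * (rsh u * sinh u) * exp (- u)); [|now rewrite <- Eu].
              unfold sinh. rewrite <- Ee. field. }
         rewrite !(RtoC_mult (2 * rsh u)), RtoC_minus, !RtoC_mult. field. }
    rewrite Cmod_opp, Cmod_mult, Cmod_RtoC_nonneg by lra.
    assert (Hn : Cmod (E + RtoC (exp (- u) * exp (- u)) * E')%C <= 2).
    { eapply Rle_trans; [apply Cmod_triangle|]. rewrite Cmod_mult, Cmod_RtoC_nonneg
        by (apply Rlt_le, Rmult_lt_0_compat; apply exp_pos).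
      unfold E, E'. rewrite !Cmod_Cexp.
      change (Re (- (Ci * (RtoC (2 * u) * z)))%C) with (- Re (Ci * (RtoC (2 * u) * z))%C).
      rewrite Re_Ci_mult, Im_RtoC_mult, <- !exp_plus.
      assert (exp (- (2 * u * Im z)) <= exp 0) by (apply exp_le_exp; nra).
      assert (exp (- u + - u + - - (2 * u * Im z)) <= exp 0) by (apply exp_le_exp; nra).
      rewrite exp_0 in *. lra. }
    rewrite Rmult_1_l in Hb. assert (Hx := exp_pos (- u)).
    replace (4 * M / (1 + u ^ 2)) with (4 * (M / (1 + u ^ 2))) by (field; nra).
    apply Rle_trans with (2 * rsh u * 2); [apply Rmult_le_compat_l; lra|]. nra.
  - fold p. rewrite (Cint_unique _ _ _ _ _ HI Hl). exact Hlb.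
Qed.

(** With v = 2 PI (z - i / 2) one has exp v = - q, so [gsech z] = - 4 PI^2 / (2 sinh (v / 2))^2,
    while 1 + 2 i z = i v / PI makes the subtracted term equal to - 4 PI^2 / v^2. *)
Lemma gsech_near_pole (z : C) : 0 <= Im z < 1 / 2 ->
  Cmod (gsech z - 4 / ((1 + 2 * Ci * z) * (1 + 2 * Ci * z)))%C <= 4 * PI * PI * 12.
Proof.
  intros Hz. assert (HP := PI_RGT_0).
  assert (HPC : RtoC PI <> 0%C) by (apply RtoC_neq_0; lra).
  assert (Hq := q2_neq z ltac:(rewrite Rabs_pos_eq; lra)).
  set (v := (2 * PI * (z - Ci / 2))%C).
  assert (Hiv : Im v = 2 * PI * (Im z - 1 / 2)).
  { unfold v. rewrite Im_2PI. f_equal. unfold Im; simpl. field. }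
  assert (Hv0 : v <> 0%C). { intros E. rewrite E in Hiv. simpl in Hiv. nra. }
  assert (K := Cshh_inv_sqr_bound v Hv0).
  specialize (K ltac:(rewrite Hiv; apply Rabs_le; nra)).
  assert (Ev : (1 + 2 * Ci * z)%C = (Ci * v / PI)%C).
  { unfold v. replace (Ci * (2 * PI * (z - Ci / 2)) / PI)%C with (2 * Ci * z - Ci * Ci)%C by (field; exact HPC).
    rewrite Ci_sqr. ring. }
  assert (Ee : Cexp v = (- q2 z)%C).
  { unfold v, q2. replace (2 * PI * (z - Ci / 2))%C with (2 * PI * z + (- (PI * Ci)))%C by field.
    rewrite Cexp_plus. assert (Em : Cexp (- (PI * Ci))%C = (- (1))%C).
    { unfold Cexp. replace (Re (- (PI * Ci))%C) with 0 by (unfold Re; simpl; ring).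
      replace (Im (- (PI * Ci))%C) with (- PI) by (unfold Im; simpl; ring).
      rewrite cos_neg, sin_neg, cos_PI, sin_PI, exp_0. apply Ceq_pair; unfold Re, Im; simpl; ring. }
    rewrite Em. ring. }
  assert (Es : (Cshh v * Cshh v)%C = (Cexp v - 2 + / Cexp v)%C).
  { unfold Cshh. rewrite <- Cexp_opp.
    replace (Cexp v) with (Cexp (v / 2) * Cexp (v / 2))%C by (rewrite <- Cexp_plus; f_equal; field).
    replace (Cexp (- v)) with (Cexp (- (v / 2)) * Cexp (- (v / 2)))%C by (rewrite <- Cexp_plus; f_equal; field).
    assert (E1 := Cexp_opp_l (v / 2)%C).
    replace (Cexp (v / 2) * Cexp (v / 2) - 2 + Cexp (- (v / 2)) * Cexp (- (v / 2)))%C with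
      (Cexp (v / 2) * Cexp (v / 2) - 2 * (Cexp (- (v / 2)) * Cexp (v / 2)) + Cexp (- (v / 2)) * Cexp (- (v / 2)))%C
      by (rewrite E1; ring). ring. }
  assert (Hq0 := q2_neq_0 z).
  assert (Eg : (/ (Cshh v * Cshh v))%C = (- (q2 z / ((1 + q2 z) * (1 + q2 z))))%C).
  { rewrite Es, Ee.
    replace (- q2 z - 2 + / - q2 z)%C with (- ((1 + q2 z) * (1 + q2 z)) / q2 z)%C by (field; exact Hq0).
    field. auto. }
  replace (gsech z - 4 / ((1 + 2 * Ci * z) * (1 + 2 * Ci * z)))%C
    with (- (4 * PI * PI) * (/ (Cshh v * Cshh v) - / (v * v)))%C.
  2: { rewrite Eg, Ev. unfold gsech.
       replace (Ci * v / PI * (Ci * v / PI))%C with ((Ci * Ci) * (v * v) / (PI * PI))%C by (field; exact HPC).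
       rewrite Ci_sqr. field. repeat split; auto. }
  rewrite Cmod_mult, Cmod_opp, !Cmod_mult, !Cmod_RtoC_nonneg by lra.
  apply Rmult_le_compat_l; [nra | exact K].
Qed.

(** * Evenness and duplication *)

Lemma phi_even (n : nat) (z : C) (u : R) : phi (S (2 * n)) 0 (- z)%C u = phi (S (2 * n)) 0 z u \/ (2 <= n)%nat.
Proof.
  destruct n as [|[|n]]; [left | left | right; lia]; simpl;
    replace (RtoC (2 * u) * - z)%C with (- (RtoC (2 * u) * z))%C by ring; now rewrite Ccos_opp.
Qed.

Lemma IPhi3_opp (z : C) : IPhi 3 0 (- z)%C = IPhi 3 0 z.
Proof.
  unfold IPhi. f_equal. apply FunctionalExtensionality.functional_extensionality. intros u.
  destruct (phi_even 1 z u) as [H|H]; [exact H | lia].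
Qed.

Lemma IPhi1_opp (z : C) : IPhi 1 0 (- z)%C = IPhi 1 0 z.
Proof.
  unfold IPhi. f_equal. apply FunctionalExtensionality.functional_extensionality. intros u.
  destruct (phi_even 0 z u) as [H|H]; [exact H | lia].
Qed.

Lemma gsech_opp (z : C) : Rabs (Im z) < 1 / 2 -> gsech (- z)%C = gsech z.
Proof.
  intros Hz. unfold gsech. rewrite q2_opp.
  assert (H0 := q2_neq_0 z). assert (H1 := q2_neq z Hz).
  field. repeat split; auto.
Qed.

(** The shifts by plus and minus i / 4 replace q by i q and - i q, and (1 + i q) (1 - i q) = 1 + q^2
    is the denominator at 2 z. *)
Lemma gsech_dup (z : C) : Rabs (Im z) < 1 / 4 ->
  (gsech (z + quarter_i) + gsech (z - quarter_i))%C = (4 * gsech (2 * z))%C.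
Proof.
  intros Hz. unfold gsech, Cminus. rewrite !q2_plus, q2_opp, q2_quarter.
  assert (Hi := Ci_neq_0).
  assert (Ei : (/ Ci)%C = (- Ci)%C).
  { replace (- Ci)%C with (- (Ci * Ci) / Ci)%C by (field; exact Hi). rewrite Ci_sqr. field. exact Hi. }
  rewrite Ei. replace (2 * z)%C with (z + z)%C by ring. rewrite q2_plus.
  apply Rabs_def2 in Hz.
  assert (H1 := q2_neq (z + quarter_i)%C). rewrite q2_plus, q2_quarter in H1.
  specialize (H1 ltac:(apply Rabs_def1; unfold quarter_i; rewrite Im_plus; simpl; lra)).
  assert (H2 := q2_neq (z + - quarter_i)%C). rewrite q2_plus, q2_opp, q2_quarter, Ei in H2.
  specialize (H2 ltac:(apply Rabs_def1; unfold quarter_i; rewrite Im_plus; simpl; lra)).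
  set (q := q2 z) in *.
  assert (Em : ((1 + q * Ci) * (1 + q * - Ci))%C = (1 + q * q)%C).
  { replace ((1 + q * Ci) * (1 + q * - Ci))%C with (1 - (Ci * Ci) * (q * q))%C by ring. rewrite Ci_sqr. ring. }
  assert (H3 : (1 + q * q)%C <> 0%C) by (rewrite <- Em; now apply Cmult_neq_0).
  rewrite <- Em.
  replace (4 * (4 * PI * PI * (q * q / ((1 + q * Ci) * (1 + q * - Ci) * ((1 + q * Ci) * (1 + q * - Ci))))))%C
    with (4 * PI * PI * (q * Ci * ((1 + q * - Ci) * (1 + q * - Ci)) - q * Ci * ((1 + q * Ci) * (1 + q * Ci)))
          / ((1 + q * Ci) * (1 + q * - Ci) * ((1 + q * Ci) * (1 + q * - Ci))))%C.
  - field. auto.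
  - replace (q * Ci * ((1 + q * - Ci) * (1 + q * - Ci)) - q * Ci * ((1 + q * Ci) * (1 + q * Ci)))%C
      with (- (4) * (Ci * Ci) * (q * q))%C by ring.
    rewrite Ci_sqr. field. auto.
Qed.

Lemma Csin_dup (w d : C) : (Csin (w + d) + Csin (w - d))%C = (2 * Csin w * Ccos d)%C.
Proof.
  rewrite !Csin_alt. unfold Ccos.
  replace (Ci * (w + d))%C with (Ci * w + Ci * d)%C by ring.
  replace (Ci * (w - d))%C with (Ci * w + - (Ci * d))%C by ring.
  replace (- (Ci * w + Ci * d))%C with (- (Ci * w) + - (Ci * d))%C by ring.
  replace (- (Ci * w + - (Ci * d)))%C with (- (Ci * w) + Ci * d)%C by ring.
  rewrite !Cexp_plus. field.
Qed.

Lemma Ccos_dup (w d : C) : (Ccos (w + d) + Ccos (w - d))%C = (2 * Ccos w * Ccos d)%C.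
Proof.
  unfold Ccos.
  replace (Ci * (w + d))%C with (Ci * w + Ci * d)%C by ring.
  replace (Ci * (w - d))%C with (Ci * w + - (Ci * d))%C by ring.
  replace (- (Ci * w + Ci * d))%C with (- (Ci * w) + - (Ci * d))%C by ring.
  replace (- (Ci * w + - (Ci * d)))%C with (- (Ci * w) + Ci * d)%C by ring.
  rewrite !Cexp_plus. field.
Qed.

Lemma Ccos_quarter (u : R) : Ccos (RtoC (2 * u) * quarter_i)%C = RtoC (cosh (u / 2)).
Proof.
  unfold Ccos. replace (Ci * (RtoC (2 * u) * quarter_i))%C with (RtoC (- (u / 2)))
    by (unfold quarter_i; apply Ceq_pair; unfold Re, Im; simpl; field).
  rewrite <- RtoC_opp, !Cexp_RtoC, Ropp_involutive, <- RtoC_plus, <- RtoC_div by lra.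
  f_equal. unfold cosh. field.
Qed.

Lemma rsh_half (u : R) : 0 < u -> rsh u * cosh (u / 2) = rsh (u / 2).
Proof.
  intros Hu. rewrite !rsh_pos_eq by lra.
  assert (H1 := sinh_pos u Hu). assert (H2 := sinh_pos (u / 2) ltac:(lra)).
  assert (E : sinh u = 2 * sinh (u / 2) * cosh (u / 2)).
  { unfold sinh, cosh. replace (exp u) with (exp (u / 2) * exp (u / 2)) by (rewrite <- exp_plus; f_equal; field).
    replace (exp (- u)) with (exp (- (u / 2)) * exp (- (u / 2))) by (rewrite <- exp_plus; f_equal; field).
    field. }
  assert (Hc := cosh_ge_1 (u / 2)). rewrite E. field. lra.
Qed.

(** Adding the shifts by plus and minus i / 4 multiplies the trigonometric factor by 2 cosh (u / 2),
    and [rsh u * cosh (u / 2)] = [rsh (u / 2)] turns the kernel at u into the one at u / 2. This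
    uses beta = 0; for positive beta the other factor of [kappa] would not halve its argument. *)
Lemma phi_dup (n : nat) (z : C) (u : R) : n = 0%nat \/ n = 1%nat \/ n = 3%nat -> 0 < u ->
  (phi n 0 (z + quarter_i) u + phi n 0 (z - quarter_i) u)%C = (RtoC (2 ^ n / 4) * phi n 0 (2 * z) (u / 2))%C.
Proof.
  intros Hn Hu.
  assert (Hr := rsh_half u Hu). assert (Hc := cosh_ge_1 (u / 2)).
  assert (Hk : rsh u = rsh (u / 2) / cosh (u / 2)) by (rewrite <- Hr; field; lra).
  assert (E1 : (RtoC (2 * u) * (z + quarter_i))%C = (RtoC (2 * u) * z + RtoC (2 * u) * quarter_i)%C) by ring.
  assert (E2 : (RtoC (2 * u) * (z - quarter_i))%C = (RtoC (2 * u) * z - RtoC (2 * u) * quarter_i)%C) by ring.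
  assert (E3 : (RtoC (2 * (u / 2)) * (2 * z))%C = (RtoC (2 * u) * z)%C)
    by (rewrite !RtoC_mult, RtoC_div by lra; field).
  assert (Hk0 : forall v, kappa 0 v = rsh v) by (intros; unfold kappa; rewrite Rmult_0_l, rsh_0; ring).
  destruct Hn as [-> | [-> | ->]]; unfold phi; rewrite !Hk0, E1, E2, E3.
  - assert (ED := Csin_dup (RtoC (2 * u) * z) (RtoC (2 * u) * quarter_i)). rewrite Ccos_quarter in ED.
    set (s1 := Csin _) in *. set (s2 := Csin (_ - _)%C) in *. set (s := Csin (RtoC (2 * u) * z)) in *.
    transitivity (RtoC (rsh u / (2 * u ^ 3)) * (s1 + s2) - RtoC (/ u ^ 2) * (2 * z))%C; [ring|].
    rewrite ED.
    transitivity (RtoC (rsh u / (2 * u ^ 3) * 2 * cosh (u / 2)) * s - RtoC (/ u ^ 2 * 2) * z)%C;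
      [rewrite !RtoC_mult; ring|].
    transitivity (RtoC (2 ^ 0 / 4 * (rsh (u / 2) / (2 * (u / 2) ^ 3))) * s - RtoC (2 ^ 0 / 4 * (/ (u / 2) ^ 2) * 2) * z)%C;
      [|rewrite !RtoC_mult; ring].
    f_equal; [f_equal; f_equal; rewrite Hk; field; lra | do 3 f_equal; field; lra].
  - assert (ED := Ccos_dup (RtoC (2 * u) * z) (RtoC (2 * u) * quarter_i)). rewrite Ccos_quarter in ED.
    set (s1 := Ccos _) in *. set (s2 := Ccos (_ - _)%C) in *. set (s := Ccos (RtoC (2 * u) * z)) in *.
    transitivity (RtoC (rsh u / (u ^ 2)) * (s1 + s2) - RtoC (/ u ^ 2) * 2)%C; [ring|].
    rewrite ED.
    transitivity (RtoC (rsh u / (u ^ 2) * 2 * cosh (u / 2)) * s - RtoC (/ u ^ 2 * 2))%C;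
      [rewrite !RtoC_mult; ring|].
    transitivity (RtoC (2 ^ 1 / 4 * (rsh (u / 2) / ((u / 2) ^ 2))) * s - RtoC (2 ^ 1 / 4 * (/ (u / 2) ^ 2)))%C;
      [|rewrite !RtoC_mult; ring].
    f_equal; [f_equal; f_equal; rewrite Hk; field; lra | f_equal; field; lra].
  - assert (ED := Ccos_dup (RtoC (2 * u) * z) (RtoC (2 * u) * quarter_i)). rewrite Ccos_quarter in ED.
    set (s1 := Ccos _) in *. set (s2 := Ccos (_ - _)%C) in *. set (s := Ccos (RtoC (2 * u) * z)) in *.
    transitivity (- RtoC (4 * rsh u) * (s1 + s2))%C; [ring|].
    rewrite ED.
    transitivity (- RtoC (4 * rsh u * 2 * cosh (u / 2)) * s)%C; [rewrite !RtoC_mult; ring|].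
    transitivity (- RtoC (2 ^ 3 / 4 * (4 * rsh (u / 2))) * s)%C; [|rewrite !RtoC_mult; ring].
    f_equal. f_equal. f_equal. rewrite Hk; field; lra.
Qed.

Lemma IPhi_dup (n : nat) (z : C) : n = 0%nat \/ n = 1%nat \/ n = 3%nat -> Rabs (Im z) < 1 / 4 ->
  (IPhi n 0 (z + quarter_i) + IPhi n 0 (z - quarter_i))%C = (RtoC (2 ^ n / 2) * IPhi n 0 (2 * z))%C.
Proof.
  intros Hn Hz. apply Rabs_def2 in Hz.
  assert (H1 : Cint0 (fun u => phi n 0 (z + quarter_i) u + phi n 0 (z - quarter_i) u)%C
     (IPhi n 0 (z + quarter_i) + IPhi n 0 (z - quarter_i))%C).
  { apply (Cint_plus (phi n 0 (z + quarter_i)) (phi n 0 (z - quarter_i))); try apply _; apply IPhi_correct; try lra;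
    apply Rabs_def1; unfold quarter_i, Cminus; rewrite Im_plus; simpl; lra. }
  assert (H2 : Cint0 (phi n 0 (2 * z)) (IPhi n 0 (2 * z))).
  { apply IPhi_correct; [lra|]. rewrite Im_RtoC_mult. apply Rabs_def1; lra. }
  apply (Cint0_scale _ (/ 2)) in H2; [|lra].
  apply (Cint_scal (RtoC (2 ^ n / 2))) in H2; try apply _.
  refine (Cint_unique _ _ _ _ _ H1 _).
  eapply Cint0_ext; [|exact H2]. intros u Hu. rewrite phi_dup by assumption.
  replace (/ 2 * u) with (u / 2) by field.
  replace (2 ^ n / 4) with (2 ^ n / 2 * / 2) by field. rewrite (RtoC_mult (2 ^ n / 2)). ring.
Qed.

(** Since the polar parts agree, [D] is bounded on the whole open strip. Duplication writes D (2 x)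
    as a quarter of D (x + i/4) + D (x - i/4), both points lying in the strip, so each bound for [D]
    can be halved and [D] vanishes. *)
Lemma IPhi3_closed (z : C) : Rabs (Im z) < 1 / 2 -> IPhi 3 0 z = (- gsech z)%C.
Proof.
  destruct IPhi3_near_pole as [B [HB0 HB]]. assert (HP := PI_RGT_0).
  set (D := fun z => (IPhi 3 0 z + gsech z)%C).
  set (N := B + 4 * PI * PI * 12). assert (HN : 0 <= N) by (unfold N; nra).
  assert (Hpos : forall z, 0 <= Im z < 1 / 2 -> Cmod (D z) <= N).
  { intros w Hw. unfold D, N.
    set (c := (4 / ((1 + 2 * Ci * w) * (1 + 2 * Ci * w)))%C).
    replace (IPhi 3 0 w + gsech w)%C with ((IPhi 3 0 w + c) + (gsech w - c))%C by ring.
    eapply Rle_trans; [apply Cmod_triangle|].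
    assert (K1 := HB w Hw). assert (K2 := gsech_near_pole w Hw). fold c in K1, K2. lra. }
  assert (Hall : forall z, Rabs (Im z) < 1 / 2 -> Cmod (D z) <= N).
  { intros w Hw. destruct (Rle_dec 0 (Im w)) as [H|H].
    - apply Hpos. rewrite Rabs_pos_eq in Hw by exact H. lra.
    - replace (D w) with (D (- w)%C) by (unfold D; now rewrite IPhi3_opp, gsech_opp).
      apply Hpos. rewrite Rabs_left in Hw by lra. change (Im (- w)%C) with (- Im w). lra. }
  assert (Hn : forall n z, Rabs (Im z) < 1 / 2 -> Cmod (D z) <= N * (/ 2) ^ n).
  { induction n as [|n IH]; intros w Hw.
    - simpl. rewrite Rmult_1_r. now apply Hall.
    - set (x := (w / 2)%C).
      assert (Hx : Rabs (Im x) < 1 / 4).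
      { replace (Im x) with (Im w / 2) by (unfold x, Im; simpl; field).
        apply Rabs_def2 in Hw. apply Rabs_def1; lra. }
      assert (Ew : w = (2 * x)%C) by (unfold x; field). clearbody x.
      assert (ED : (D w)%C = (/ 4 * (D (x + quarter_i) + D (x - quarter_i)))%C).
      { unfold D. assert (K1 := IPhi_dup 3 x ltac:(auto) Hx). assert (K2 := gsech_dup x Hx).
        rewrite <- Ew in K1, K2. replace (2 ^ 3 / 2) with 4 in K1 by field.
        transitivity (/ 4 * ((IPhi 3 0 (x + quarter_i) + IPhi 3 0 (x - quarter_i)) +
           (gsech (x + quarter_i) + gsech (x - quarter_i))))%C; [rewrite K1, K2; field | ring]. }
      rewrite ED, Cmod_mult, Cmod_inv, Cmod_RtoC_nonneg by (lra || (apply RtoC_neq_0; lra)).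
      apply Rabs_def2 in Hx.
      assert (K1 := IH (x + quarter_i)%C ltac:(apply Rabs_def1; unfold quarter_i; rewrite Im_plus; simpl; lra)).
      assert (K2 := IH (x - quarter_i)%C ltac:(apply Rabs_def1; unfold quarter_i, Cminus; rewrite Im_plus; simpl; lra)).
      assert (K3 := Cmod_triangle (D (x + quarter_i)%C) (D (x - quarter_i)%C)).
      simpl. lra. }
  intros Hz.
  assert (H0 : Cmod (D z) = 0).
  { apply Rle_antisym; [|apply Cmod_ge_0]. apply Rnot_lt_le. intros Hlt.
    destruct (pow_lt_1_zero (/ 2) ltac:(rewrite Rabs_pos_eq; lra) (Cmod (D z) / (N + 1))
      ltac:(apply Rdiv_lt_0_compat; lra)) as [n0 Hn0].
    specialize (Hn0 n0 (le_n _)). specialize (Hn n0 z Hz).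
    rewrite Rabs_pos_eq in Hn0 by (apply pow_le; lra).
    assert (Hp : 0 < (/ 2) ^ n0) by (apply pow_lt; lra).
    apply (Rmult_lt_compat_r (N + 1)) in Hn0; [|lra].
    unfold Rdiv in Hn0. rewrite Rmult_assoc, Rinv_l in Hn0 by lra. nra. }
  apply Cmod_eq_0 in H0. unfold D in H0.
  transitivity (IPhi 3 0 z + gsech z - gsech z)%C; [ring | rewrite H0; ring].
Qed.

(** * Integration of the third derivative back to the first *)

Lemma strip_const (f g d : C -> C) :
  (forall z, Rabs (Im z) < 1 / 2 -> Cder f z (d z)) -> (forall z, Rabs (Im z) < 1 / 2 -> Cder g z (d z)) ->
  forall z, Rabs (Im z) < 1 / 2 -> (f z - g z)%C = (f 0 - g 0)%C.
Proof.
  intros Hf Hg z Hz.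
  assert (K := C_mvt (fun w => f w - g w)%C (fun w => d w - d w)%C 0%C z 0).
  rewrite Rmult_0_l in K.
  assert (Hs : forall t : R, 0 <= t <= 1 -> Rabs (Im (0 + t * (z - 0))%C) < 1 / 2).
  { intros t Ht. replace (0 + t * (z - 0))%C with (t * z)%C by ring.
    rewrite Im_RtoC_mult, Rabs_mult, (Rabs_pos_eq t) by lra. assert (H := Rabs_pos (Im z)). nra. }
  assert (E : Cmod (f z - g z - (f 0 - g 0))%C = 0).
  { apply Rle_antisym; [|apply Cmod_ge_0]. apply K.
    - intros t Ht. specialize (Hs t Ht). apply Cder_minus; auto.
    - intros t Ht. replace (d (0 + t * (z - 0)) - d (0 + t * (z - 0)))%C with (RtoC 0) by ring.
      rewrite Cmod_0. lra. }
  apply Cmod_eq_0 in E.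
  transitivity (f z - g z - (f 0 - g 0) + (f 0 - g 0))%C; [ring | rewrite E; ring].
Qed.

Lemma strip_0 : Rabs (Im 0%C) < 1 / 2.
Proof. simpl. rewrite Rabs_R0. lra. Qed.

Lemma q2_0 : q2 0 = 1%C.
Proof. unfold q2. replace (2 * PI * 0)%C with (RtoC 0) by ring. apply Cexp_0. Qed.

Lemma IPhi_zero (n : nat) : n = 0%nat \/ n = 2%nat -> forall beta, IPhi n beta 0 = 0%C.
Proof.
  intros Hn beta. apply IPhi_unique.
  apply (Cint0_ext (fun _ => RtoC 0)).
  { intros u _.
    destruct Hn as [-> | ->]; unfold phi; replace (RtoC (2 * u) * 0)%C with (RtoC 0) by ring; rewrite Csin_0; ring. }
  destruct (Cint0_dom (fun _ => RtoC 0) 0) as [l [Hl Hlb]].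
  - intros; apply Ccontinuous_const.
  - intros u _. rewrite Cmod_0. unfold Rdiv. lra.
  - rewrite Rmult_0_l in Hlb. assert (H0 := Cmod_ge_0 l).
    rewrite (Cmod_eq_0 l) in Hl by lra. exact Hl.
Qed.

Lemma IPhi2_closed (z : C) : Rabs (Im z) < 1 / 2 ->
  IPhi 2 0 z = (PI * ((1 - q2 z) / (1 + q2 z)))%C.
Proof.
  intros Hz.
  assert (K := strip_const (IPhi 2 0) (fun z => PI * ((1 - q2 z) / (1 + q2 z)))%C (IPhi 3 0)).
  specialize (K (fun w Hw => Cder_IPhi 2 0 w ltac:(lia) ltac:(lra) Hw)).
  assert (Hd : forall w, Rabs (Im w) < 1 / 2 -> Cder (fun z => PI * ((1 - q2 z) / (1 + q2 z)))%C w (IPhi 3 0 w)).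
  { intros w Hw. assert (Hq := q2_neq w Hw). eapply Cder_eq.
    - apply Cder_scal, Cder_mult.
      + apply Cder_minus; [apply Cder_const | apply Cder_q2].
      + apply (Cder_comp Cinv (fun w => 1 + q2 w)%C); [now apply Cder_inv|].
        apply Cder_plus; [apply Cder_const | apply Cder_q2].
    - rewrite IPhi3_closed by exact Hw. unfold gsech. field. exact Hq. }
  specialize (K Hd z Hz). simpl in K. rewrite IPhi_zero, q2_0 in K by auto.
  transitivity (IPhi 2 0 z - PI * ((1 - q2 z) / (1 + q2 z)) + PI * ((1 - q2 z) / (1 + q2 z)))%C; [ring|].
  rewrite K. replace (1 - 1)%C with (RtoC 0) by ring. unfold Cdiv. ring.
Qed.

Definition splog (z : C) : C := Cln (1 + q2 z)%C.

Lemma Cder_splog (z : C) : Rabs (Im z) < 1 / 2 -> Cder splog z (2 * PI * (q2 z / (1 + q2 z)))%C.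
Proof.
  intros Hz. unfold splog. eapply Cder_eq.
  - apply (Cder_Cln_comp (fun w => 1 + q2 w)%C); [now apply q2_slit|].
    apply Cder_plus; [apply Cder_const | apply Cder_q2].
  - field. now apply q2_neq.
Qed.

(** Integrating leaves a constant. Duplication at 0 together with evenness gives H_0'(0) = 2
    H_0'(i/4); comparison with the formula at 0 and at i / 4, where [splog] equals ln 2 and ln 2 / 2
    + i PI / 4, forces H_0'(0) = - ln 2. *)
Lemma IPhi1_closed (z : C) : Rabs (Im z) < 1 / 2 -> IPhi 1 0 z = (PI * z - splog z)%C.
Proof.
  intros Hz. assert (HP := PI_RGT_0).
  assert (K := strip_const (IPhi 1 0) (fun z => PI * z - splog z)%C (IPhi 2 0)).
  specialize (K (fun w Hw => Cder_IPhi 1 0 w ltac:(lia) ltac:(lra) Hw)).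
  assert (Hd : forall w, Rabs (Im w) < 1 / 2 -> Cder (fun z => PI * z - splog z)%C w (IPhi 2 0 w)).
  { intros w Hw. assert (Hq := q2_neq w Hw). eapply Cder_eq.
    - apply Cder_minus; [apply Cder_scal, Cder_id | now apply Cder_splog].
    - rewrite IPhi2_closed by exact Hw. field. exact Hq. }
  specialize (K Hd). simpl in K.
  assert (Hq : Rabs (Im quarter_i) < 1 / 2) by (simpl; rewrite Rabs_pos_eq; lra).
  assert (K1 := K quarter_i Hq).
  assert (D1 := IPhi_dup 1 0%C ltac:(auto) ltac:(simpl; rewrite Rabs_R0; lra)).
  replace (0 + quarter_i)%C with quarter_i in D1 by ring.
  replace (0 - quarter_i)%C with (- quarter_i)%C in D1 by ring.
  rewrite IPhi1_opp in D1. replace (2 ^ 1 / 2) with 1 in D1 by field.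
  replace (2 * 0)%C with (RtoC 0) in D1 by ring. rewrite Cmult_1_l in D1.
  set (a := IPhi 1 0 quarter_i) in *. rewrite <- D1 in K, K1.
  assert (S0 : splog 0 = RtoC (ln 2)).
  { unfold splog. rewrite q2_0. apply Cln_unique.
    - simpl. lra.
    - rewrite Cexp_RtoC, exp_ln by lra. apply Ceq_pair; simpl; ring. }
  assert (S1 : splog quarter_i = (RtoC (ln 2 / 2) + PI * quarter_i)%C).
  { unfold splog. rewrite q2_quarter. apply Cln_unique.
    - unfold quarter_i; simpl. lra.
    - replace (RtoC (ln 2 / 2) + PI * quarter_i)%C with (ln 2 / 2, PI / 4)
        by (unfold quarter_i; apply Ceq_pair; unfold Re, Im; simpl; field).
      unfold Cexp; simpl. rewrite cos_PI4, sin_PI4.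
      assert (Es : exp (ln 2 / 2) = sqrt 2).
      { symmetry. apply Rsqr_inj; [apply sqrt_pos | left; apply exp_pos |].
        rewrite Rsqr_sqrt by lra. unfold Rsqr. rewrite <- exp_plus.
        replace (ln 2 / 2 + ln 2 / 2) with (ln 2) by field. rewrite exp_ln; lra. }
      rewrite Es. assert (Hs : 0 < sqrt 2) by (apply sqrt_lt_R0; lra).
      apply Ceq_pair; simpl; field; lra. }
  rewrite S0 in K, K1. rewrite S1 in K1.
  assert (Ea : a = RtoC (- ln 2 / 2)).
  { assert (Eh : (RtoC (ln 2))%C = (RtoC (ln 2 / 2) + RtoC (ln 2 / 2))%C) by (rewrite <- RtoC_plus; f_equal; field).
    rewrite Eh in K1.
    replace (RtoC (- ln 2 / 2)) with (- RtoC (ln 2 / 2))%C by (rewrite <- RtoC_opp; f_equal; field).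
    transitivity (- (a - (PI * quarter_i - (RtoC (ln 2 / 2) + PI * quarter_i))) +
       (a + a - (PI * 0 - (RtoC (ln 2 / 2) + RtoC (ln 2 / 2)))) - RtoC (ln 2 / 2))%C; [ring|].
    rewrite K1. ring. }
  specialize (K z Hz).
  transitivity (IPhi 1 0 z - (PI * z - splog z) + (PI * z - splog z))%C; [ring|].
  rewrite K, Ea. rewrite <- RtoC_plus. replace (- ln 2 / 2 + - ln 2 / 2) with (- ln 2) by field.
  rewrite RtoC_opp. ring.
Qed.

(** * The dilogarithm on the strip *)

(** Normalized so that [Li2 (- q2 z) = 2 * PI * Kf z - PI ^ 2 / 12] on the strip. *)
Definition Kf (z : C) : C := (IPhi 0 0 z - PI / 2 * (z * z))%C.

Lemma Cder_Kf (z : C) : Rabs (Im z) < 1 / 2 -> Cder Kf z (- splog z)%C.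
Proof.
  intros Hz. unfold Kf. eapply Cder_eq.
  - apply Cder_minus; [apply Cder_IPhi; auto; lra | apply Cder_scal, Cder_mult; apply Cder_id].
  - rewrite IPhi1_closed by exact Hz. field.
Qed.

(** The ray t w of the dilogarithm integral thus becomes a horizontal half line in the strip, along
    which [Kf] provides a primitive. *)
Lemma q2_shift (z : C) (t : R) : 0 < t -> q2 (z + RtoC (ln t / (2 * PI)))%C = (t * q2 z)%C.
Proof.
  intros Ht. assert (HP := PI_RGT_0). rewrite q2_plus, Cmult_comm. f_equal. unfold q2.
  replace (2 * PI * RtoC (ln t / (2 * PI)))%C with (RtoC (ln t)).
  - now rewrite Cexp_RtoC, exp_ln.
  - rewrite <- !RtoC_mult. f_equal. field. lra.
Qed.

(** The integrand of [Li2] at - q before the overall sign, continued by its limit q at t = 0, so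
    that it is continuous up to the end point. *)
Definition Li2_integrand (q : C) (t : R) : C :=
  if Req_dec_T t 0 then q else (Cln (1 + t * q) / t)%C.

Lemma Li2_integrand_bound (q : C) (t : R) : 0 <= t -> t * Cmod q <= 1 / 2 ->
  Cmod (Li2_integrand q t) <= 4 * Cmod q.
Proof.
  intros Ht H. assert (Hq := Cmod_ge_0 q). unfold Li2_integrand. destruct Req_dec_T as [E|E]; [lra|].
  assert (Htq : Cmod (t * q)%C = t * Cmod q) by (rewrite Cmod_mult, Cmod_RtoC_nonneg; lra).
  assert (K := Cmod_Cln_1_plus (t * q)%C ltac:(lra)).
  rewrite Cmod_div, (Cmod_RtoC_nonneg t) by (lra || now apply RtoC_neq_0).
  apply (Rmult_le_reg_r t); [lra|]. unfold Rdiv. rewrite Rmult_assoc, Rinv_l by exact E. lra.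
Qed.

Lemma Li2_integrand_shift (z : C) (t : R) : 0 < t ->
  Li2_integrand (q2 z) t = (splog (z + RtoC (ln t / (2 * PI))) / t)%C.
Proof.
  intros Ht. unfold Li2_integrand, splog. destruct Req_dec_T; [lra|]. now rewrite q2_shift.
Qed.

Lemma Im_plus_RtoC (z : C) (t : R) : Im (z + RtoC t)%C = Im z.
Proof. unfold Im; simpl; ring. Qed.
Lemma Re_plus_RtoC (z : C) (t : R) : Re (z + RtoC t)%C = Re z + t.
Proof. reflexivity. Qed.

Lemma Rder_comp (f : R -> C) (g : R -> R) (t dg : R) (l : C) :
  Rder f (g t) l -> is_derive g t dg -> Rder (fun s => f (g s)) t (dg * l)%C.
Proof.
  intros [H1 H2] Hg. split.
  - rewrite Re_RtoC_mult. apply (is_derive_comp (fun s => Re (f s)) g); assumption.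
  - rewrite Im_RtoC_mult. apply (is_derive_comp (fun s => Im (f s)) g); assumption.
Qed.

Lemma Rder_shift (f : C -> C) (z l : C) (t : R) :
  Cder f (z + RtoC t)%C l -> Rder (fun s => f (z + RtoC s)%C) t l.
Proof.
  intros H. apply (Rder_ext (fun s : R => f (z + s * 1)%C)); [intros; f_equal; ring|].
  rewrite <- (Cmult_1_r l). apply Cder_Rder. now rewrite Cmult_1_r.
Qed.

Lemma is_derive_ln_scaled (t : R) : 0 < t ->
  is_derive (fun s => ln s / (2 * PI)) t (/ (2 * PI * t)).
Proof. intros Ht. assert (HP := PI_RGT_0). auto_derive; [exact Ht | field; lra]. Qed.

Lemma Ccontinuous_Li2_integrand_pos (z : C) (t : R) : Rabs (Im z) < 1 / 2 -> 0 < t ->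
  Ccontinuous (Li2_integrand (q2 z)) t.
Proof.
  intros Hz Ht. assert (HP := PI_RGT_0).
  apply (continuous_ext_loc (T := R_UniformSpace) (U := C_R_NormedModule) _
    (fun s => splog (z + RtoC (ln s / (2 * PI))) * RtoC (/ s))%C).
  - exists (mkposreal t Ht). intros y Hy.
    assert (Hy' : Rabs (y - t) < t) by exact Hy. apply Rabs_def2 in Hy'.
    rewrite Li2_integrand_shift by lra. unfold Cdiv. rewrite RtoC_inv by lra. reflexivity.
  - apply (Ccontinuous_mult (fun s => splog (z + RtoC (ln s / (2 * PI)))%C)).
    + eapply Rder_Ccontinuous.
      apply (Rder_comp (fun s => splog (z + RtoC s)%C) (fun s => ln s / (2 * PI)));
        [apply Rder_shift, Cder_splog; now rewrite Im_plus_RtoC | now apply is_derive_ln_scaled].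
    + apply Ccontinuous_RtoC, (ex_derive_continuous (fun s => / s)). auto_derive. lra.
Qed.

Lemma Ccontinuous_Li2_integrand_0 (q : C) : Ccontinuous (Li2_integrand q) 0.
Proof.
  apply (filterlim_locally (U := C_R_NormedModule)). intros eps.
  assert (Hs : slit 1%C) by (left; simpl; lra).
  assert (Hq := Cmod_ge_0 q).
  assert (He : 0 < eps / (Cmod q + 1)) by (apply Rdiv_lt_0_compat; [apply cond_pos | lra]).
  destruct (Cder_Cln 1%C Hs _ He) as [d [Hd H]].
  assert (Hd' : 0 < d / (Cmod q + 1)) by (apply Rdiv_lt_0_compat; lra).
  exists (mkposreal _ Hd'). intros t Ht. assert (Ht' : Rabs (t - 0) < d / (Cmod q + 1)) by exact Ht.
  rewrite Rminus_0_r in Ht'.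
  apply (norm_compat1 (V := C_R_NormedModule)). rewrite <- Cmod_norm.
  change (Cmod (Li2_integrand q t - Li2_integrand q 0)%C < eps).
  assert (Hl1 : Cln 1 = 0%C).
  { apply Cln_unique; [simpl; assert (HP := PI_RGT_0); lra | apply Cexp_0]. }
  unfold Li2_integrand at 2. destruct (Req_dec_T 0 0) as [_|N]; [|now destruct N].
  unfold Li2_integrand. destruct Req_dec_T as [E|E].
  { replace (q - q)%C with (RtoC 0) by ring. rewrite Cmod_0. apply cond_pos. }
  assert (Hta : 0 < Rabs t) by now apply Rabs_pos_lt.
  assert (HtC := RtoC_neq_0 t E).
  assert (Htq : Cmod (t * q)%C < d).
  { rewrite Cmod_mult, Cmod_R. apply Rle_lt_trans with (Rabs t * (Cmod q + 1)); [nra|].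
    apply (Rmult_lt_compat_r (Cmod q + 1)) in Ht'; [|lra].
    unfold Rdiv in Ht'. rewrite Rmult_assoc, Rinv_l in Ht' by lra. lra. }
  specialize (H _ Htq). rewrite Hl1 in H.
  replace (Cln (1 + t * q) / t - q)%C with ((Cln (1 + t * q) - 0 - / 1 * (t * q)) / t)%C by (field; exact HtC).
  rewrite Cmod_div, Cmod_R by exact HtC. rewrite Cmod_mult, Cmod_R in H.
  apply Rle_lt_trans with (eps / (Cmod q + 1) * Cmod q).
  - apply (Rmult_le_reg_r (Rabs t)); [exact Hta|]. unfold Rdiv at 1. rewrite Rmult_assoc, Rinv_l by lra. lra.
  - assert (He0 := cond_pos eps).
    apply (Rmult_lt_reg_r (Cmod q + 1)); [lra|].
    replace (eps / (Cmod q + 1) * Cmod q * (Cmod q + 1)) with (eps * Cmod q) by (field; lra). nra.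
Qed.

(** On [e, 1] a primitive of the integrand is - 2 PI [Kf] (z + ln t / (2 PI)); on [0, e] the
    integrand is at most 4 |q|. Cutting at e avoids taking the primitive to t = 0, where its
    argument goes to -oo. *)
Lemma Li2_split (z : C) (e : R) : Rabs (Im z) < 1 / 2 -> 0 < e <= 1 -> e * Cmod (q2 z) <= 1 / 2 ->
  Cmod (Li2 (- q2 z) - 2 * PI * Kf z + 2 * PI * Kf (z + RtoC (ln e / (2 * PI))))%C <= 4 * Cmod (q2 z) * e.
Proof.
  intros Hz He Heq. assert (HP := PI_RGT_0).
  assert (HPC : RtoC PI <> 0%C) by (apply RtoC_neq_0; lra).
  set (g := Li2_integrand (q2 z)).
  assert (Hc : forall t, 0 <= t -> Ccontinuous g t).
  { intros t [Ht|<-]; [now apply Ccontinuous_Li2_integrand_pos | apply Ccontinuous_Li2_integrand_0]. }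
  assert (Hex : ex_RInt (V := C_R_CompleteNormedModule) g 0 e).
  { apply (ex_RInt_continuous (V := C_R_CompleteNormedModule)). intros t Ht.
    rewrite Rmin_left in Ht by lra. apply Hc. lra. }
  destruct Hex as [A HA].
  assert (HB : is_RInt (V := C_R_CompleteNormedModule) g e 1
     (- (2) * PI * Kf (z + RtoC (ln 1 / (2 * PI))) - - (2) * PI * Kf (z + RtoC (ln e / (2 * PI))))%C).
  { apply (is_RInt_Rder (fun t => - (2) * PI * Kf (z + RtoC (ln t / (2 * PI))))%C); intros t Ht;
      rewrite Rmin_left in Ht by lra.
    - unfold g. rewrite Li2_integrand_shift by lra.
      assert (K := Rder_comp (fun s => - (2) * PI * Kf (z + RtoC s))%C (fun s => ln s / (2 * PI)) t (/ (2 * PI * t))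
        (- (2) * PI * - splog (z + RtoC (ln t / (2 * PI))))%C).
      replace (splog (z + RtoC (ln t / (2 * PI))) / t)%C
        with (RtoC (/ (2 * PI * t)) * (- (2) * PI * - splog (z + RtoC (ln t / (2 * PI)))))%C.
      2: { rewrite RtoC_inv, !RtoC_mult by nra. field. split; [apply RtoC_neq_0; lra | exact HPC]. }
      apply K; [|apply is_derive_ln_scaled; lra].
      apply (Rder_shift (fun w => - (2) * PI * Kf w)%C), Cder_scal, Cder_Kf. now rewrite Im_plus_RtoC.
    - apply Hc; lra. }
  assert (HL : Li2 (- q2 z)%C = (- (A + (- (2) * PI * Kf (z + RtoC (ln 1 / (2 * PI))) -
      - (2) * PI * Kf (z + RtoC (ln e / (2 * PI))))))%C).
  { unfold Li2. f_equal. apply (is_RInt_unique (V := C_R_CompleteNormedModule)).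
    apply (is_RInt_ext (V := C_R_CompleteNormedModule) g).
    - intros t Ht. rewrite Rmin_left, Rmax_right in Ht by lra. unfold g, Li2_integrand.
      destruct Req_dec_T; [lra|]. f_equal. f_equal. ring.
    - now apply (is_RInt_Chasles (V := C_R_CompleteNormedModule) g 0 e 1). }
  rewrite HL, ln_1. unfold Rdiv at 1. rewrite Rmult_0_l. replace (z + RtoC 0)%C with z by ring.
  match goal with |- Cmod ?X <= _ => replace X with (- A)%C by ring end.
  rewrite Cmod_opp, Cmod_norm.
  replace (4 * Cmod (q2 z) * e) with ((e - 0) * (4 * Cmod (q2 z))) by ring.
  apply (norm_RInt_le_const (V := C_R_CompleteNormedModule) g 0 e); [lra | | exact HA].
  intros t Ht. rewrite <- Cmod_norm. apply Li2_integrand_bound; [lra|].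
  assert (H := Cmod_ge_0 (q2 z)). nra.
Qed.

Lemma Cmod_q2 (z : C) : Cmod (q2 z) = exp (2 * PI * Re z).
Proof. unfold q2. rewrite Cmod_Cexp. f_equal. apply Re_2PI. Qed.

(** The case e = 1 of [Li2_split]: the two values of [Kf] coincide and only the error bound
    remains. *)
Lemma Li2_small (z : C) : Rabs (Im z) < 1 / 2 -> Cmod (q2 z) <= 1 / 2 ->
  Cmod (Li2 (- q2 z)%C) <= 4 * Cmod (q2 z).
Proof.
  intros Hz Hq. assert (K := Li2_split z 1 Hz ltac:(lra) ltac:(lra)).
  rewrite ln_1 in K. unfold Rdiv in K. rewrite Rmult_0_l, Rmult_1_r in K.
  replace (z + RtoC 0)%C with z in K by ring.
  replace (Li2 (- q2 z) - 2 * PI * Kf z + 2 * PI * Kf z)%C with (Li2 (- q2 z)) in K by ring. exact K.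
Qed.

Lemma Cmod_splog_small (z : C) : Cmod (q2 z) <= 1 / 2 -> Cmod (splog z) <= 4 * Cmod (q2 z).
Proof. intros H. now apply Cmod_Cln_1_plus. Qed.

Lemma zero_of_le_all (x c : R) : 0 <= x -> 0 <= c -> (forall e, 0 < e <= 1 -> x <= c * e) -> x = 0.
Proof.
  intros Hx Hc H. apply Rle_antisym; [|exact Hx]. apply Rnot_lt_le. intros Hlt.
  set (e := Rmin 1 (x / (2 * (c + 1)))).
  assert (Hp : 0 < x / (2 * (c + 1))) by (apply Rdiv_lt_0_compat; lra).
  assert (H1 := Rmin_l 1 (x / (2 * (c + 1)))). assert (H2 := Rmin_r 1 (x / (2 * (c + 1)))). fold e in H1, H2.
  assert (He : 0 < e) by (apply Rmin_glb_lt; lra).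
  specialize (H e ltac:(lra)).
  assert (c * e <= (c + 1) * (x / (2 * (c + 1)))) by (apply Rmult_le_compat; lra).
  replace ((c + 1) * (x / (2 * (c + 1)))) with (x / 2) in H0 by (field; lra). lra.
Qed.

Lemma convex_lt (t a b c : R) : 0 <= t <= 1 -> a < c -> b < c -> (1 - t) * a + t * b < c.
Proof. intros Ht Ha Hb. destruct (Rle_dec a b); nra. Qed.

Lemma convex_gt (t a b c : R) : 0 <= t <= 1 -> c < a -> c < b -> c < (1 - t) * a + t * b.
Proof. intros Ht Ha Hb. destruct (Rle_dec a b); nra. Qed.

(** After a translation far to the left the values of [Kf] at the two points become equal in the
    limit, since its derivative - [splog] is of the size of q there. *)
Lemma Li2_minus_Kf_const (z1 z2 : C) : Rabs (Im z1) < 1 / 2 -> Rabs (Im z2) < 1 / 2 ->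
  (Li2 (- q2 z1) - 2 * PI * Kf z1)%C = (Li2 (- q2 z2) - 2 * PI * Kf z2)%C.
Proof.
  intros H1 H2. assert (HP := PI_RGT_0).
  set (m := Cmod (q2 z1) + Cmod (q2 z2) + 1).
  assert (Hm1 := Cmod_ge_0 (q2 z1)). assert (Hm2 := Cmod_ge_0 (q2 z2)).
  set (X := (Li2 (- q2 z1) - 2 * PI * Kf z1 - (Li2 (- q2 z2) - 2 * PI * Kf z2))%C).
  assert (HX : Cmod X = 0).
  { apply (zero_of_le_all _ (2 * m * (8 * m + 2 * PI * (4 * m * Cmod (z1 - z2)%C)))); [apply Cmod_ge_0 | |].
    { assert (H := Cmod_ge_0 (z1 - z2)%C). assert (Hm : 0 <= m) by (unfold m; lra).
      assert (0 <= m * Cmod (z1 - z2)%C) by now apply Rmult_le_pos.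
      assert (0 <= PI * (m * Cmod (z1 - z2)%C)) by (apply Rmult_le_pos; lra).
      apply Rmult_le_pos; lra. }
    (* This cut makes e m <= 1/2, as [Li2_split] and the bound for small [splog] require. *)
    intros e0 He0. set (e := e0 / (2 * m)).
    assert (He : 0 < e) by (apply Rdiv_lt_0_compat; [lra | unfold m; lra]).
    assert (Hem : e * m = e0 / 2) by (unfold e; field; unfold m; lra).
    assert (Hm1' : 1 <= m) by (unfold m; lra).
    assert (Hma : Cmod (q2 z1) <= m /\ Cmod (q2 z2) <= m) by (unfold m; lra). destruct Hma as [Hma Hmb].
    clearbody m. clearbody e.
    assert (He1 : e <= 1) by nra.
    assert (S1 := Li2_split z1 e H1 ltac:(lra) ltac:(nra)).
    assert (S2 := Li2_split z2 e H2 ltac:(lra) ltac:(nra)).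
    set (s := RtoC (ln e / (2 * PI))) in *.
    set (Y1 := (Li2 (- q2 z1) - 2 * PI * Kf z1 + 2 * PI * Kf (z1 + s))%C) in *.
    set (Y2 := (Li2 (- q2 z2) - 2 * PI * Kf z2 + 2 * PI * Kf (z2 + s))%C) in *.
    assert (EX : X = (Y1 - Y2 - 2 * PI * (Kf (z1 + s) - Kf (z2 + s)))%C) by (unfold X, Y1, Y2; ring).
    assert (HK : Cmod (Kf (z1 + s) - Kf (z2 + s))%C <= 4 * (e * m) * Cmod (z1 - z2)%C).
    { replace (z1 - z2)%C with ((z1 + s) - (z2 + s))%C by ring.
      apply (C_mvt Kf (fun w => - splog w)%C); intros t Ht;
        set (w := (z2 + s + t * (z1 + s - (z2 + s)))%C).
      - apply Cder_Kf. replace (Im w) with ((1 - t) * Im z2 + t * Im z1) by (unfold w, s, Im; simpl; ring).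
        apply Rabs_def2 in H1. apply Rabs_def2 in H2.
        apply Rabs_def1; [apply convex_lt | apply convex_gt]; lra.
      - rewrite Cmod_opp.
        assert (Hw : Cmod (q2 w) <= e * m).
        { replace w with ((z2 + t * (z1 - z2)) + s)%C by (unfold w; ring).
          unfold s. rewrite q2_shift by exact He. rewrite Cmod_mult, Cmod_RtoC_nonneg by lra.
          apply Rmult_le_compat_l; [lra|].
          assert (Cmod (q2 (z2 + t * (z1 - z2))) <= Rmax (Cmod (q2 z1)) (Cmod (q2 z2))).
          { rewrite !Cmod_q2.
            replace (Re (z2 + t * (z1 - z2))%C) with (Re z2 + t * (Re z1 - Re z2)) by (unfold Re; simpl; ring).
            destruct (Rle_dec (Re z1) (Re z2)).
            - eapply Rle_trans; [|apply Rmax_r]. apply exp_le_exp. apply Rmult_le_compat_l; nra.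
            - eapply Rle_trans; [|apply Rmax_l]. apply exp_le_exp. apply Rmult_le_compat_l; nra. }
          assert (Rmax (Cmod (q2 z1)) (Cmod (q2 z2)) <= m) by (apply Rmax_lub; lra). lra. }
        eapply Rle_trans; [apply Cmod_splog_small; lra|]. lra. }
    rewrite EX. eapply Rle_trans; [apply Cmod_triangle_minus|].
    rewrite !Cmod_mult, !Cmod_RtoC_nonneg by lra.
    assert (T := Cmod_triangle_minus Y1 Y2).
    assert (HD := Cmod_ge_0 (z1 - z2)%C).
    assert (B1 : 4 * Cmod (q2 z1) * e <= 4 * (e * m)) by nra.
    assert (B2 : 4 * Cmod (q2 z2) * e <= 4 * (e * m)) by nra.
    assert (B3 : 2 * PI * Cmod (Kf (z1 + s) - Kf (z2 + s))%C <= 2 * PI * (4 * (e * m) * Cmod (z1 - z2)%C))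
      by (apply Rmult_le_compat_l; [lra | exact HK]).
    apply Rle_trans with (8 * (e * m) + 2 * PI * (4 * (e * m) * Cmod (z1 - z2)%C)); [lra|].
    rewrite Hem.
    assert (0 <= PI * Cmod (z1 - z2)%C * e0) by (apply Rmult_le_pos; [apply Rmult_le_pos; lra | lra]).
    assert (P2 : PI * Cmod (z1 - z2)%C * e0 * 1 <= PI * Cmod (z1 - z2)%C * e0 * (m * m)) by (apply Rmult_le_compat_l; nra).
    assert (1 * e0 <= (m * m) * e0) by (apply Rmult_le_compat_r; nra).
    nra. }
  apply Cmod_eq_0 in HX. unfold X in HX.
  transitivity (Li2 (- q2 z1) - 2 * PI * Kf z1 - (Li2 (- q2 z2) - 2 * PI * Kf z2) + (Li2 (- q2 z2) - 2 * PI * Kf z2))%C; [ring|].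
  rewrite HX. ring.
Qed.

(** The constant c follows from Li2 (- i q) + Li2 (i q) - Li2 (- q^2) / 2, whose terms all tend to 0
    with q. In terms of [Kf], duplication cancels the values of H_0 and the quadratic terms leave
    PI^2 / 8, so 3 c / 2 + PI^2 / 8 = 0. *)
Lemma Li2_closed (z : C) : Rabs (Im z) < 1 / 2 ->
  Li2 (- q2 z)%C = (2 * PI * Kf z - RtoC (PI * PI / 12))%C.
Proof.
  intros Hz. assert (HP := PI_RGT_0).
  set (c := (Li2 (- q2 0) - 2 * PI * Kf 0)%C).
  assert (Hc : forall w, Rabs (Im w) < 1 / 2 -> Li2 (- q2 w)%C = (c + 2 * PI * Kf w)%C).
  { intros w Hw. unfold c. rewrite (Li2_minus_Kf_const 0 w strip_0 Hw). ring. }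
  assert (HX : Cmod (RtoC (3 / 2) * c + RtoC (PI * PI / 8))%C = 0).
  { apply (zero_of_le_all _ 10); [apply Cmod_ge_0 | lra|].
    intros e0 He0. set (e := e0 / 2).
    set (w := (RtoC (ln e / (2 * PI)))%C).
    assert (Hqw : q2 w = RtoC e).
    { assert (K := q2_shift 0 e ltac:(unfold e; lra)). fold w in K. rewrite q2_0 in K.
      replace (0 + w)%C with w in K by ring. rewrite K. ring. }
    assert (Hiw : Im w = 0) by reflexivity.
    assert (H1 : Rabs (Im (w + quarter_i)%C) < 1 / 2)
      by (rewrite Im_plus, Hiw; unfold quarter_i; simpl; rewrite Rabs_pos_eq; lra).
    assert (H2 : Rabs (Im (w - quarter_i)%C) < 1 / 2)
      by (unfold Cminus; rewrite Im_plus, Hiw; unfold quarter_i; simpl; rewrite Rabs_left; lra).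
    assert (H3 : Rabs (Im (2 * w)%C) < 1 / 2) by (rewrite Im_RtoC_mult, Hiw, Rmult_0_r, Rabs_R0; lra).
    assert (M1 : Cmod (q2 (w + quarter_i)) = e)
      by (rewrite q2_plus, q2_quarter, Hqw, Cmod_mult, Cmod_Ci, Cmod_RtoC_nonneg; unfold e; lra).
    assert (M2 : Cmod (q2 (w - quarter_i)) = e).
    { unfold Cminus. rewrite q2_plus, q2_opp, q2_quarter, Hqw, Cmod_mult, Cmod_inv, Cmod_Ci, Cmod_RtoC_nonneg;
        [field | unfold e; lra | apply Ci_neq_0]. }
    assert (M3 : Cmod (q2 (2 * w)) = e * e).
    { replace (2 * w)%C with (w + w)%C by ring. rewrite q2_plus, Hqw, Cmod_mult, Cmod_RtoC_nonneg; unfold e; lra. }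
    assert (L1 := Li2_small _ H1 ltac:(rewrite M1; unfold e; lra)).
    assert (L2 := Li2_small _ H2 ltac:(rewrite M2; unfold e; lra)).
    assert (L3 := Li2_small _ H3 ltac:(rewrite M3; unfold e; nra)).
    assert (E : (RtoC (3 / 2) * c + RtoC (PI * PI / 8))%C =
       (Li2 (- q2 (w + quarter_i)) + Li2 (- q2 (w - quarter_i)) - / 2 * Li2 (- q2 (2 * w)))%C).
    { rewrite !Hc by assumption. unfold Kf.
      assert (D := IPhi_dup 0 w ltac:(auto) ltac:(rewrite Hiw, Rabs_R0; lra)).
      replace (RtoC (2 ^ 0 / 2)) with (/ 2)%C in D by (rewrite <- RtoC_inv by lra; f_equal; field).
      assert (Eq : (quarter_i * quarter_i)%C = RtoC (- / 16))
        by (unfold quarter_i; apply Ceq_pair; unfold Re, Im; simpl; field).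
      transitivity ((RtoC (3 / 2)) * c + 2 * PI * (IPhi 0 0 (w + quarter_i) + IPhi 0 0 (w - quarter_i) - / 2 * IPhi 0 0 (2 * w))
        - 2 * PI * PI * (quarter_i * quarter_i))%C.
      - rewrite D, Eq. replace (RtoC (PI * PI / 8)) with (- (2 * PI * PI * RtoC (- / 16)))%C
          by (rewrite <- !RtoC_mult, <- RtoC_opp; f_equal; field). ring.
      - replace (RtoC (3 / 2)) with (2 - / 2)%C.
        + field.
        + rewrite <- RtoC_inv, <- RtoC_minus by lra. f_equal. field. }
    rewrite E. eapply Rle_trans; [apply Cmod_triangle_minus|].
    assert (T := Cmod_triangle (Li2 (- q2 (w + quarter_i))) (Li2 (- q2 (w - quarter_i)))).
    rewrite Cmod_mult, Cmod_inv, Cmod_RtoC_nonneg by (lra || (apply RtoC_neq_0; lra)).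
    rewrite M1 in L1. rewrite M2 in L2. rewrite M3 in L3. unfold e in *. nra. }
  apply Cmod_eq_0 in HX. rewrite Hc by exact Hz.
  assert (Ec : c = (- RtoC (PI * PI / 12))%C).
  { assert (Hn : RtoC (3 / 2) <> 0%C) by (apply RtoC_neq_0; lra).
    transitivity ((RtoC (3 / 2) * c + RtoC (PI * PI / 8)) / RtoC (3 / 2) - RtoC (PI * PI / 8) / RtoC (3 / 2))%C.
    - field. exact Hn.
    - rewrite HX. replace (RtoC (PI * PI / 8)) with (RtoC (PI * PI / 12) * RtoC (3 / 2))%C
        by (rewrite <- RtoC_mult; f_equal; field).
      field. exact Hn. }
  rewrite Ec. ring.
Qed.

(** * A three-term relation for the dilogarithm *)

(** Chosen so that [- q2 (tau z) = 1 / (1 + q2 z)]. *)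
Definition tau (z : C) : C := (- (splog z + Ci * PI) / (2 * PI))%C.

Lemma PI_C_neq_0 : RtoC PI <> 0%C.
Proof. apply RtoC_neq_0. assert (H := PI_RGT_0). lra. Qed.

Lemma half_strip_strip (z : C) : - (1 / 2) < Im z < 0 -> Rabs (Im z) < 1 / 2.
Proof. intros H. apply Rabs_def1; lra. Qed.

Lemma Im_q2_neg (z : C) : - (1 / 2) < Im z < 0 -> Im (q2 z) < 0.
Proof.
  intros H. assert (HP := PI_RGT_0). unfold q2, Cexp. rewrite Re_2PI, Im_2PI. simpl.
  assert (0 < sin (- (2 * PI * Im z))) by (apply sin_gt_0; nra). rewrite sin_neg in *.
  assert (He := exp_pos (2 * PI * Re z)). nra.
Qed.

Lemma Im_splog (z : C) : - (1 / 2) < Im z < 0 -> - PI < Im (splog z) < 0.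
Proof.
  intros H. unfold splog. simpl. apply Carg_Im_neg. assert (K := Im_q2_neg z H).
  replace (Im (1 + q2 z)%C) with (Im (q2 z)) by (unfold Im; simpl; ring). exact K.
Qed.

(** The argument of 1 + q lies in (-PI, 0) when Im q < 0, so the lower half strip is stable under
    [tau]; this is what fixes all branches in the three-term relation. *)
Lemma Im_tau (z : C) : - (1 / 2) < Im z < 0 -> - (1 / 2) < Im (tau z) < 0.
Proof.
  intros H. assert (HP := PI_RGT_0). assert (K := Im_splog z H).
  assert (E : Im (tau z) = - (Im (splog z) + PI) / (2 * PI)).
  { unfold tau. rewrite <- RtoC_mult. unfold Cdiv. rewrite <- RtoC_inv by lra.
    rewrite Cmult_comm, Im_RtoC_mult. unfold Im; simpl. unfold Rdiv. ring. }
  rewrite E. split.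
  - apply (Rmult_lt_reg_r (2 * PI)); [lra|].
    replace (- (Im (splog z) + PI) / (2 * PI) * (2 * PI)) with (- (Im (splog z) + PI)) by (field; lra). lra.
  - apply (Rmult_lt_reg_r (2 * PI)); [lra|].
    replace (- (Im (splog z) + PI) / (2 * PI) * (2 * PI)) with (- (Im (splog z) + PI)) by (field; lra). lra.
Qed.

Lemma Cexp_Ci_PI : Cexp (Ci * PI)%C = (- (1))%C.
Proof.
  unfold Cexp. replace (Re (Ci * PI)%C) with 0 by (unfold Re; simpl; ring).
  replace (Im (Ci * PI)%C) with PI by (unfold Im; simpl; ring).
  rewrite cos_PI, sin_PI, exp_0. apply Ceq_pair; unfold Re, Im; simpl; ring.
Qed.

Lemma Cexp_splog (z : C) : Rabs (Im z) < 1 / 2 -> Cexp (splog z) = (1 + q2 z)%C.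
Proof. intros H. unfold splog. apply Cexp_Cln. now apply q2_neq. Qed.

Lemma q2_tau (z : C) : Rabs (Im z) < 1 / 2 -> q2 (tau z) = (- / (1 + q2 z))%C.
Proof.
  intros H. unfold q2 at 1. replace (2 * PI * tau z)%C with (- (splog z + Ci * PI))%C
    by (unfold tau; field; apply PI_C_neq_0).
  rewrite Cexp_opp, Cexp_plus, Cexp_Ci_PI, Cexp_splog by exact H. field. now apply q2_neq.
Qed.

(** This is ln (1 - 1 / (1 + q)) = ln q - ln (1 + q); the imaginary part of the right-hand side
    stays in (-PI, PI), so no multiple of 2 PI i appears. *)
Lemma splog_tau (z : C) : - (1 / 2) < Im z < 0 -> splog (tau z) = (2 * PI * z - splog z)%C.
Proof.
  intros H. assert (Hs := half_strip_strip z H). assert (HP := PI_RGT_0).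
  unfold splog at 1. rewrite q2_tau by exact Hs. apply Cln_unique.
  - assert (K := Im_splog z H). unfold Cminus. rewrite Im_plus, Im_2PI.
    change (Im (- splog z)%C) with (- Im (splog z)). nra.
  - unfold Cminus. rewrite Cexp_plus, Cexp_opp, Cexp_splog by exact Hs. fold (q2 z).
    field. now apply q2_neq.
Qed.

Lemma half_strip_const (f d : C -> C) :
  (forall z, - (1 / 2) < Im z < 0 -> Cder f z (d z)) ->
  (forall z, - (1 / 2) < Im z < 0 -> d z = 0%C) ->
  forall z w, - (1 / 2) < Im z < 0 -> - (1 / 2) < Im w < 0 -> f w = f z.
Proof.
  intros Hf Hd z w Hz Hw.
  assert (Hs : forall t : R, 0 <= t <= 1 -> - (1 / 2) < Im (z + t * (w - z))%C < 0).
  { intros t Ht. replace (Im (z + t * (w - z))%C) with ((1 - t) * Im z + t * Im w) by (unfold Im; simpl; ring).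
    split; [apply convex_gt | apply convex_lt]; lra. }
  assert (K := C_mvt f d z w 0). rewrite Rmult_0_l in K.
  assert (E : Cmod (f w - f z)%C = 0).
  { apply Rle_antisym; [|apply Cmod_ge_0]. apply K; intros t Ht; [now apply Hf, Hs|].
    rewrite Hd by now apply Hs. rewrite Cmod_0. lra. }
  apply Cmod_eq_0 in E. transitivity (f w - f z + f z)%C; [ring | rewrite E; ring].
Qed.

(** The two sides have equal derivatives on the half strip. The point z0 = - i / 3 is a fixed point
    of [tau], so the dilogarithms cancel there and the constant PI^2 / 6 comes from the elementary
    terms alone, without any special value of Li2. *)
Lemma Li2_three_term (z : C) : - (1 / 2) < Im z < 0 ->
  Li2 (- q2 (tau z))%C =
    (Li2 (- q2 z) + 2 * PI * z * splog z - / 2 * (splog z * splog z) + RtoC (PI * PI / 6))%C.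
Proof.
  intros Hz. assert (HP := PI_RGT_0). assert (HPC := PI_C_neq_0).
  set (f := fun z => (2 * PI * Kf (tau z) - 2 * PI * Kf z - 2 * PI * z * splog z + / 2 * (splog z * splog z))%C).
  set (d := fun z => (2 * PI * (- splog (tau z) * (- / (2 * PI) * (2 * PI * (q2 z / (1 + q2 z))))) - 2 * PI * (- splog z)
     - (2 * PI * 1 * splog z + 2 * PI * z * (2 * PI * (q2 z / (1 + q2 z))))
     + / 2 * (2 * PI * (q2 z / (1 + q2 z)) * splog z + splog z * (2 * PI * (q2 z / (1 + q2 z)))))%C).
  assert (Hf : forall z, - (1 / 2) < Im z < 0 -> Cder f z (d z)).
  { intros w Hw. assert (Hs := half_strip_strip w Hw). unfold f, d.
    apply Cder_plus; [apply Cder_minus; [apply Cder_minus|]|].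
    - apply Cder_scal. apply (Cder_comp Kf tau).
      + apply Cder_Kf, half_strip_strip, Im_tau, Hw.
      + unfold tau. apply (Cder_ext (fun w => - / (2 * PI) * (splog w + Ci * PI))%C).
        { intros v. unfold Cdiv. ring. }
        apply Cder_scal. eapply Cder_eq; [apply Cder_plus; [now apply Cder_splog | apply Cder_const]|]. ring.
    - apply Cder_scal, Cder_Kf, Hs.
    - apply (Cder_mult (fun z => 2 * PI * z)%C splog); [apply Cder_scal, Cder_id | now apply Cder_splog].
    - apply Cder_scal, Cder_mult; now apply Cder_splog. }
  assert (Hd : forall z, - (1 / 2) < Im z < 0 -> d z = 0%C).
  { intros w Hw. assert (Hs := half_strip_strip w Hw). unfold d. rewrite splog_tau by exact Hw.
    field. split; [now apply q2_neq | exact HPC]. }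
  set (z0 := (0, - (1 / 3)) : C).
  assert (Hz0 : - (1 / 2) < Im z0 < 0) by (simpl; lra).
  assert (K := half_strip_const f d Hf Hd z0 z Hz0 Hz).
  assert (S0 : splog z0 = (0, - (PI / 3))).
  { unfold splog. apply Cln_unique; [simpl; lra|].
    unfold q2, Cexp. rewrite Re_2PI, Im_2PI. unfold z0; simpl. rewrite Rmult_0_r, exp_0, !Rmult_1_l.
    replace (2 * PI * - (1 / 3)) with (- (2 * (PI / 3))) by field.
    rewrite !cos_neg, !sin_neg, cos_PI3, sin_PI3, cos_2a_cos, sin_2a, cos_PI3, sin_PI3.
    apply Ceq_pair; simpl; field. }
  assert (T0 : tau z0 = z0).
  { unfold tau. rewrite S0. rewrite <- RtoC_mult. unfold Cdiv. rewrite <- RtoC_inv by lra.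
    unfold z0. apply Ceq_pair; unfold Re, Im; simpl; field; lra. }
  unfold f in K. rewrite T0, S0 in K.
  set (m0 := (0, - (PI / 3)) : C) in *. change (0, - (PI / 3)) with m0 in K.
  rewrite !Li2_closed by (apply half_strip_strip; try apply Im_tau; exact Hz).
  replace (RtoC (PI * PI / 6)) with (- (2 * PI * z0 * m0) + / 2 * (m0 * m0))%C.
  2: { unfold z0, m0. rewrite <- RtoC_inv, <- RtoC_mult by lra. apply Ceq_pair; unfold Re, Im; simpl; field. }
  transitivity ((2 * PI * Kf (tau z) - 2 * PI * Kf z - 2 * PI * z * splog z + / 2 * (splog z * splog z))
    + 2 * PI * Kf z + 2 * PI * z * splog z - / 2 * (splog z * splog z) - RtoC (PI * PI / 12))%C; [ring|].
  rewrite K. ring.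
Qed.

(** * Holomorphy in two variables *)

Definition Ccont2 (f : C -> C -> C) (z w : C) : Prop :=
  forall eps : R, 0 < eps -> exists delta : R, 0 < delta /\
    forall z' w', Cmod (z' - z)%C < delta -> Cmod (w' - w)%C < delta ->
      Cmod (f z' w' - f z w)%C < eps.

Definition holo2 (f : C -> C -> C) (z w : C) : Prop :=
  Ccont2 f z w /\ (exists l, Cder (fun z' => f z' w) z l) /\ (exists l, Cder (fun w' => f z w') w l).

Lemma holo2_const (c z w : C) : holo2 (fun _ _ => c) z w.
Proof.
  split; [|split; exists 0%C; apply Cder_const].
  intros eps He. exists 1; split; [lra|]. intros. replace (c - c)%C with (RtoC 0) by ring. now rewrite Cmod_0.
Qed.

Lemma holo2_fst (z w : C) : holo2 (fun z _ => z) z w.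
Proof.
  split; [|split; [exists 1%C; apply Cder_id | exists 0%C; apply Cder_const]].
  intros eps He. exists eps; split; auto.
Qed.

Lemma holo2_snd (z w : C) : holo2 (fun _ w => w) z w.
Proof.
  split; [|split; [exists 0%C; apply Cder_const | exists 1%C; apply Cder_id]].
  intros eps He. exists eps; split; auto.
Qed.

Lemma holo2_plus (f g : C -> C -> C) (z w : C) :
  holo2 f z w -> holo2 g z w -> holo2 (fun z w => f z w + g z w)%C z w.
Proof.
  intros [F1 [[a F2] [b F3]]] [G1 [[c G2] [d G3]]]. split; [|split].
  - intros eps He. destruct (F1 (eps / 2) ltac:(lra)) as [d1 [Hd1 K1]].
    destruct (G1 (eps / 2) ltac:(lra)) as [d2 [Hd2 K2]].
    exists (Rmin d1 d2). split; [now apply Rmin_glb_lt|]. intros z' w' Hz Hw.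
    assert (M1 := Rmin_l d1 d2). assert (M2 := Rmin_r d1 d2).
    replace (f z' w' + g z' w' - (f z w + g z w))%C with ((f z' w' - f z w) + (g z' w' - g z w))%C by ring.
    eapply Rle_lt_trans; [apply Cmod_triangle|].
    specialize (K1 z' w' ltac:(lra) ltac:(lra)). specialize (K2 z' w' ltac:(lra) ltac:(lra)). lra.
  - exists (a + c)%C. now apply Cder_plus.
  - exists (b + d)%C. now apply Cder_plus.
Qed.

Lemma holo2_mult (f g : C -> C -> C) (z w : C) :
  holo2 f z w -> holo2 g z w -> holo2 (fun z w => f z w * g z w)%C z w.
Proof.
  intros [F1 [[a F2] [b F3]]] [G1 [[c G2] [d G3]]]. split; [|split].
  - intros eps He.
    assert (Hf := Cmod_ge_0 (f z w)). assert (Hg := Cmod_ge_0 (g z w)).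
    set (m := Cmod (f z w) + Cmod (g z w) + 2).
    set (e := Rmin 1 (eps / (2 * m))).
    assert (Hm : 0 < m) by (unfold m; lra).
    assert (He' : 0 < e) by (apply Rmin_glb_lt; [lra | apply Rdiv_lt_0_compat; lra]).
    assert (E1 := Rmin_l 1 (eps / (2 * m))). assert (E2 := Rmin_r 1 (eps / (2 * m))). fold e in E1, E2.
    destruct (F1 e He') as [d1 [Hd1 K1]]. destruct (G1 e He') as [d2 [Hd2 K2]].
    exists (Rmin d1 d2). split; [now apply Rmin_glb_lt|]. intros z' w' Hz Hw.
    assert (M1 := Rmin_l d1 d2). assert (M2 := Rmin_r d1 d2).
    specialize (K1 z' w' ltac:(lra) ltac:(lra)). specialize (K2 z' w' ltac:(lra) ltac:(lra)).
    replace (f z' w' * g z' w' - f z w * g z w)%C with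
      ((f z' w' - f z w) * (g z' w' - g z w) + (f z' w' - f z w) * g z w + f z w * (g z' w' - g z w))%C by ring.
    eapply Rle_lt_trans; [apply Cmod_triangle|].
    assert (T := Cmod_triangle ((f z' w' - f z w) * (g z' w' - g z w)) ((f z' w' - f z w) * g z w)).
    rewrite !Cmod_mult in *.
    assert (P1 := Cmod_ge_0 (f z' w' - f z w)%C). assert (P2 := Cmod_ge_0 (g z' w' - g z w)%C).
    assert (Hme : m * e <= eps / 2).
    { apply Rle_trans with (m * (eps / (2 * m))); [apply Rmult_le_compat_l; lra | right; field; lra]. }
    unfold m in Hme. nra.
  - eexists. apply Cder_mult; eassumption.
  - eexists. apply Cder_mult; eassumption.
Qed.

Lemma holo2_scal (c : C) (f : C -> C -> C) (z w : C) :
  holo2 f z w -> holo2 (fun z w => c * f z w)%C z w.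
Proof. intros H. apply holo2_mult; [apply holo2_const | exact H]. Qed.

Lemma holo2_minus (f g : C -> C -> C) (z w : C) :
  holo2 f z w -> holo2 g z w -> holo2 (fun z w => f z w - g z w)%C z w.
Proof.
  intros Hf Hg. assert (K := holo2_plus f (fun z w => - (1) * g z w)%C z w Hf (holo2_scal _ g z w Hg)).
  destruct K as [K1 [[a K2] [b K3]]]. split; [|split].
  - intros eps He. destruct (K1 eps He) as [d [Hd Hb]]. exists d; split; [exact Hd|]. intros z' w' Hz Hw.
    specialize (Hb z' w' Hz Hw).
    now replace (f z' w' - g z' w' - (f z w - g z w))%C
      with (f z' w' + - (1) * g z' w' - (f z w + - (1) * g z w))%C by ring.
  - exists a. eapply Cder_ext; [|exact K2]. intros; simpl; ring.
  - exists b. eapply Cder_ext; [|exact K3]. intros; simpl; ring.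
Qed.

Lemma holo2_comp (g : C -> C) (f : C -> C -> C) (z w l : C) :
  Cder g (f z w) l -> holo2 f z w -> holo2 (fun z w => g (f z w)) z w.
Proof.
  intros Hg [F1 [[a F2] [b F3]]]. split; [|split].
  - intros eps He. destruct (Cder_cont g _ _ Hg eps He) as [e [He' K]].
    destruct (F1 e He') as [d [Hd K1]]. exists d; split; [exact Hd|]. intros z' w' Hz Hw. now apply K, K1.
  - exists (l * a)%C. now apply (Cder_comp g (fun z' => f z' w)).
  - exists (l * b)%C. now apply (Cder_comp g (fun w' => f z w')).
Qed.

Lemma Ccont2_Re_pos (f : C -> C -> C) (z w : C) : Ccont2 f z w -> 0 < Re (f z w) ->
  exists d, 0 < d /\ forall z' w', Cmod (z' - z)%C < d -> Cmod (w' - w)%C < d -> 0 < Re (f z' w').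
Proof.
  intros H Hp. destruct (H _ Hp) as [d [Hd K]]. exists d; split; [exact Hd|]. intros z' w' Hz Hw.
  specialize (K z' w' Hz Hw). assert (R := re_le_Cmod (f z' w' - f z w)%C). apply Rabs_le_between in R.
  replace (Re (f z' w' - f z w)%C) with (Re (f z' w') - Re (f z w)) in R by (unfold Re; simpl; ring). lra.
Qed.

Lemma Ccont2_Im_lt (f : C -> C -> C) (z w : C) (m : R) : Ccont2 f z w -> Rabs (Im (f z w)) < m ->
  exists d, 0 < d /\ forall z' w', Cmod (z' - z)%C < d -> Cmod (w' - w)%C < d -> Rabs (Im (f z' w')) < m.
Proof.
  intros H Hp. destruct (H (m - Rabs (Im (f z w))) ltac:(lra)) as [d [Hd K]].
  exists d; split; [exact Hd|]. intros z' w' Hz Hw.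
  specialize (K z' w' Hz Hw). assert (R := Im_minus_le (f z' w') (f z w)). lra.
Qed.

(** * Connectedness *)

(** The part of U0 that is joined to the base point by polygonal paths. Taking it as the domain of
    the continuation makes connectedness a general fact, instead of a property to be checked for the
    explicit set [U0W]. *)
Inductive reach (U0 : C -> C -> Prop) (z0 w0 : C) : C -> C -> Prop :=
| reach_refl : reach U0 z0 w0 z0 w0
| reach_step (z w z' w' : C) : reach U0 z0 w0 z w ->
    (forall t : R, 0 <= t <= 1 -> U0 (z + t * (z' - z))%C (w + t * (w' - w))%C) ->
    reach U0 z0 w0 z' w'.

Lemma reach_in (U0 : C -> C -> Prop) (z0 w0 z w : C) : U0 z0 w0 -> reach U0 z0 w0 z w -> U0 z w.
Proof.
  intros H0 H. destruct H as [|z w z' w' _ H]; [exact H0|].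
  specialize (H 1 ltac:(lra)). now replace z' with (z + 1%R * (z' - z))%C by ring;
    replace w' with (w + 1%R * (w' - w))%C by ring.
Qed.

Lemma reach_segment (U0 : C -> C -> Prop) (z0 w0 z w z' w' : C) : reach U0 z0 w0 z w ->
  (forall t : R, 0 <= t <= 1 -> U0 (z + t * (z' - z))%C (w + t * (w' - w))%C) ->
  forall t : R, 0 <= t <= 1 -> reach U0 z0 w0 (z + t * (z' - z))%C (w + t * (w' - w))%C.
Proof.
  intros Hr H t Ht. apply (reach_step _ _ _ z w _ _ Hr). intros s Hs.
  replace (z + s * (z + t * (z' - z) - z))%C with (z + (s * t)%R * (z' - z))%C by (rewrite RtoC_mult; ring).
  replace (w + s * (w + t * (w' - w) - w))%C with (w + (s * t)%R * (w' - w))%C by (rewrite RtoC_mult; ring).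
  apply H. nra.
Qed.

Lemma reach_open (U0 : C -> C -> Prop) (z0 w0 : C) : U0 z0 w0 -> C2open U0 -> C2open (reach U0 z0 w0).
Proof.
  intros H0 Ho z w Hr. destruct (Ho z w (reach_in _ _ _ _ _ H0 Hr)) as [e [He K]].
  exists e; split; [exact He|]. intros z' w' Hz Hw. apply (reach_step _ _ _ z w _ _ Hr). intros t Ht.
  apply K.
  - replace (z + t * (z' - z) - z)%C with (t * (z' - z))%C by ring.
    rewrite Cmod_mult, Cmod_RtoC_nonneg by lra. assert (H := Cmod_ge_0 (z' - z)%C). nra.
  - replace (w + t * (w' - w) - w)%C with (t * (w' - w))%C by ring.
    rewrite Cmod_mult, Cmod_RtoC_nonneg by lra. assert (H := Cmod_ge_0 (w' - w)%C). nra.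
Qed.

Definition clamp (t : R) : R := Rmax 0 (Rmin 1 t).

Lemma clamp_range (t : R) : 0 <= clamp t <= 1.
Proof. unfold clamp, Rmax, Rmin. repeat destruct Rle_dec; lra. Qed.

Lemma clamp_lip (s t : R) : Rabs (clamp s - clamp t) <= Rabs (s - t).
Proof. unfold clamp, Rmax, Rmin. repeat destruct Rle_dec; unfold Rabs; repeat destruct Rcase_abs; lra. Qed.

(** The indicator of P, extended to the real line by [clamp], is locally constant. Its derivative
    vanishes, and the mean value theorem gives equal values at 0 and 1. *)
Lemma clopen_interval (P Q : R -> Prop) :
  (forall t, 0 <= t <= 1 -> P t \/ Q t) -> (forall t, 0 <= t <= 1 -> P t -> Q t -> False) ->
  (forall t, 0 <= t <= 1 -> P t -> exists d, 0 < d /\ forall s, 0 <= s <= 1 -> Rabs (s - t) < d -> P s) ->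
  (forall t, 0 <= t <= 1 -> Q t -> exists d, 0 < d /\ forall s, 0 <= s <= 1 -> Rabs (s - t) < d -> Q s) ->
  P 0 -> P 1.
Proof.
  intros Hc Hd HP HQ H0.
  set (g := fun t => if excluded_middle_informative (P (clamp t)) then 1 else 0).
  assert (Hg : forall t, is_derive g t 0).
  { intros t. apply (is_derive_ext_loc (fun _ => g t)); [|apply (is_derive_const (K := R_AbsRing) (V := R_NormedModule))].
    assert (Hl : exists d, 0 < d /\ forall s, Rabs (s - t) < d -> g t = g s).
    { unfold g. destruct (excluded_middle_informative (P (clamp t))) as [Pt|Pt].
      - destruct (HP _ (clamp_range t) Pt) as [d [Hd0 K]]. exists d; split; [exact Hd0|]. intros s Hs.
        destruct (excluded_middle_informative (P (clamp s))) as [Ps|Ps]; [reflexivity|].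
        exfalso. apply Ps, K; [apply clamp_range|]. eapply Rle_lt_trans; [apply clamp_lip | exact Hs].
      - assert (Qt : Q (clamp t)) by (destruct (Hc _ (clamp_range t)); tauto).
        destruct (HQ _ (clamp_range t) Qt) as [d [Hd0 K]]. exists d; split; [exact Hd0|]. intros s Hs.
        destruct (excluded_middle_informative (P (clamp s))) as [Ps|Ps]; [|reflexivity].
        exfalso. apply (Hd _ (clamp_range s) Ps), K; [apply clamp_range|].
        eapply Rle_lt_trans; [apply clamp_lip | exact Hs]. }
    destruct Hl as [d [Hd0 K]]. exists (mkposreal d Hd0). intros s Hs. apply K. exact Hs. }
  assert (E : g 1 = g 0).
  { destruct (MVT_gen g 0 1 (fun _ => 0)) as [c [_ K]].
    - intros; apply Hg.
    - intros; apply continuity_pt_filterlim, (ex_derive_continuous g). eexists; apply Hg.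
    - lra. }
  assert (C0 : clamp 0 = 0) by (unfold clamp, Rmax, Rmin; repeat destruct Rle_dec; lra).
  assert (C1 : clamp 1 = 1) by (unfold clamp, Rmax, Rmin; repeat destruct Rle_dec; lra).
  unfold g in E. rewrite C0, C1 in E.
  destruct (excluded_middle_informative (P 0)); [|tauto].
  destruct (excluded_middle_informative (P 1)); [assumption | lra].
Qed.

Lemma open_along_segment (V : C -> C -> Prop) (z w z' w' : C) (t : R) : C2open V ->
  V (z + t * (z' - z))%C (w + t * (w' - w))%C ->
  exists d, 0 < d /\ forall s : R, Rabs (s - t) < d -> V (z + s * (z' - z))%C (w + s * (w' - w))%C.
Proof.
  intros HV H. destruct (HV _ _ H) as [e [He K]].
  assert (Hz := Cmod_ge_0 (z' - z)%C). assert (Hw := Cmod_ge_0 (w' - w)%C).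
  set (m := Cmod (z' - z)%C + Cmod (w' - w)%C + 1).
  exists (e / m). split; [apply Rdiv_lt_0_compat; unfold m; lra|]. intros s Hs.
  assert (Hsm : Rabs (s - t) * m < e).
  { apply (Rmult_lt_compat_r m) in Hs; [|unfold m; lra].
    unfold Rdiv in Hs. rewrite Rmult_assoc, Rinv_l in Hs by (unfold m; lra). lra. }
  assert (Hst := Rabs_pos (s - t)).
  apply K.
  - replace (z + s * (z' - z) - (z + t * (z' - z)))%C with ((s - t)%R * (z' - z))%C by (rewrite RtoC_minus; ring).
    rewrite Cmod_mult, Cmod_R. unfold m in Hsm. nra.
  - replace (w + s * (w' - w) - (w + t * (w' - w)))%C with ((s - t)%R * (w' - w))%C by (rewrite RtoC_minus; ring).
    rewrite Cmod_mult, Cmod_R. unfold m in Hsm. nra.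
Qed.

(** If V1 and V2 were disjoint on the set, membership in V1 would propagate along each segment in
    both directions, so it would be decided by the base point for all points at once. *)
Lemma reach_connected (U0 : C -> C -> Prop) (z0 w0 : C) : C2connected (reach U0 z0 w0).
Proof.
  intros V1 V2 O1 O2 Hcov [z1 [w1 [R1 H1]]] [z2 [w2 [R2 H2]]].
  apply NNPP. intros Hno.
  assert (Hdis : forall z w, reach U0 z0 w0 z w -> V1 z w -> V2 z w -> False).
  { intros z w Hr Ha Hb. apply Hno. exists z, w. auto. }
  assert (Hseg : forall z w z' w' (A B : C -> C -> Prop), C2open A -> C2open B ->
     (forall z w, reach U0 z0 w0 z w -> A z w \/ B z w) ->
     (forall z w, reach U0 z0 w0 z w -> A z w -> B z w -> False) ->
     (forall t : R, 0 <= t <= 1 -> reach U0 z0 w0 (z + t * (z' - z))%C (w + t * (w' - w))%C) ->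
     A z w -> A z' w').
  { intros z w z' w' A B OA OB Hc Hd Hr HA.
    assert (K := clopen_interval (fun t => A (z + t * (z' - z))%C (w + t * (w' - w))%C)
       (fun t => B (z + t * (z' - z))%C (w + t * (w' - w))%C)).
    cbv beta in K.
    replace (z + 1%R * (z' - z))%C with z' in K by ring. replace (w + 1%R * (w' - w))%C with w' in K by ring.
    replace (z + 0%R * (z' - z))%C with z in K by ring. replace (w + 0%R * (w' - w))%C with w in K by ring.
    apply K; auto.
    - intros t Ht Pt. apply (Hd _ _ (Hr t Ht) Pt).
    - intros t Ht Pt. destruct (open_along_segment A z w z' w' t OA Pt) as [d [Hd0 L]].
      exists d; split; auto.
    - intros t Ht Pt. destruct (open_along_segment B z w z' w' t OB Pt) as [d [Hd0 L]].
      exists d; split; auto. }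
  assert (Hall : forall z w, reach U0 z0 w0 z w -> (V1 z w <-> V1 z0 w0)).
  { intros z w Hr. induction Hr as [|z w z' w' Hr IH Hs]; [tauto|].
    assert (Hrs := reach_segment U0 z0 w0 z w z' w' Hr Hs).
    split.
    - intros H'. apply IH. destruct (Hcov z w Hr) as [H|H]; [exact H|]. exfalso.
      assert (K : V2 z' w').
      { apply (Hseg z w z' w' V2 V1); auto.
        - intros; rewrite or_comm; auto.
        - intros a b Hab Ha Hb. apply (Hdis a b); auto. }
      apply (Hdis z' w'); auto. now apply (reach_step _ _ _ z w).
    - intros H'. apply (Hseg z w z' w' V1 V2); auto. now apply IH. }
  apply (Hdis z2 w2 R2); [|exact H2]. apply Hall; [exact R2|]. now apply (Hall z1 w1 R1).
Qed.

(** * The analytic continuation of the generating function *)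

(** The sine of 2 PI eta. *)
Definition sW (sg nu : C) : C := (Cexp (PI * nu) * Csin (2 * PI * sg))%C.
(** The principal square root of 1 - s^2. *)
Definition csq (s : C) : C := Cexp (/ 2 * Cln (1 - s * s))%C.
(** This is exp (i arcsin s), hence the logarithm in [etaC] gives arcsin s / (2 PI). *)
Definition qW (s : C) : C := (csq s + Ci * s)%C.
Definition etaC (s : C) : C := (- Ci / (2 * PI) * Cln (qW s))%C.
(** The arguments of the two dilogarithms of W are - [q2] of [x1W] and - [q2] of [x2W]. *)
Definition x1W (sg nu : C) : C := (nu / 2 + Ci * (sg + etaC (sW sg nu)))%C.
Definition x2W (sg nu : C) : C := (nu / 2 - Ci * (sg + etaC (sW sg nu)))%C.

(** The defining formula of [W], with each dilogarithm replaced by its expression through [Kf]. *)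
Definition WcW (sg nu : C) : C :=
  ((2 * PI * Kf (x1W sg nu) - RtoC (PI * PI / 12) + (2 * PI * Kf (x2W sg nu) - RtoC (PI * PI / 12))
    + ((PI * nu) * (PI * nu) - (2 * PI * etaC (sW sg nu)) * (2 * PI * etaC (sW sg nu))))
   / (8 * (PI * PI)))%C.

(** Each condition keeps one ingredient holomorphic: the square root, the logarithm in the arcsine,
    and the two dilogarithms. Right half-planes are used instead of full cut planes because they are
    simpler to check and large enough. *)
Definition U0W (sg nu : C) : Prop :=
  0 < Re (1 - sW sg nu * sW sg nu)%C /\ 0 < Re (qW (sW sg nu)) /\
  Rabs (Im (x1W sg nu)) < 1 / 2 /\ Rabs (Im (x2W sg nu)) < 1 / 2.

Lemma holo2_sW (sg nu : C) : holo2 sW sg nu.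
Proof.
  unfold sW. apply (holo2_mult (fun _ nu => Cexp (PI * nu)) (fun sg _ => Csin (2 * PI * sg))).
  - eapply (holo2_comp Cexp (fun _ nu => PI * nu)%C); [apply Cder_Cexp | apply holo2_scal, holo2_snd].
  - eapply (holo2_comp Csin (fun sg _ => 2 * PI * sg)%C); [apply Cder_Csin | apply holo2_scal, holo2_fst].
Qed.

Lemma Cder_qW (s : C) : 0 < Re (1 - s * s)%C -> exists l, Cder qW s l.
Proof.
  intros H. unfold qW, csq. eexists. apply Cder_plus; [|apply Cder_scal, Cder_id].
  apply Cder_Cexp_comp, Cder_scal. apply (Cder_Cln_comp (fun s => 1 - s * s)%C); [now left|].
  apply Cder_minus; [apply Cder_const | apply Cder_mult; apply Cder_id].
Qed.

Lemma Cder_etaC (s : C) : 0 < Re (1 - s * s)%C -> 0 < Re (qW s) -> exists l, Cder etaC s l.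
Proof.
  intros H1 H2. destruct (Cder_qW s H1) as [l Hl]. unfold etaC. eexists.
  apply Cder_scal. apply (Cder_Cln_comp qW); [now left | exact Hl].
Qed.

Lemma holo2_etaC (sg nu : C) : U0W sg nu -> holo2 (fun sg nu => etaC (sW sg nu)) sg nu.
Proof.
  intros [H1 [H2 _]]. destruct (Cder_etaC _ H1 H2) as [l Hl].
  apply (holo2_comp etaC sW sg nu l Hl), holo2_sW.
Qed.

Lemma holo2_half_snd (sg nu : C) : holo2 (fun _ nu => nu / 2)%C sg nu.
Proof. apply (holo2_mult (fun _ nu => nu) (fun _ _ => / 2)%C); [apply holo2_snd | apply holo2_const]. Qed.

Lemma holo2_x1W (sg nu : C) : U0W sg nu -> holo2 x1W sg nu.
Proof.
  intros H. unfold x1W. apply (holo2_plus (fun _ nu => nu / 2)%C (fun sg nu => Ci * (sg + etaC (sW sg nu)))%C).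
  - apply holo2_half_snd.
  - apply (holo2_scal Ci), (holo2_plus (fun sg _ => sg)); [apply holo2_fst | now apply holo2_etaC].
Qed.

Lemma holo2_x2W (sg nu : C) : U0W sg nu -> holo2 x2W sg nu.
Proof.
  intros H. unfold x2W. apply (holo2_minus (fun _ nu => nu / 2)%C (fun sg nu => Ci * (sg + etaC (sW sg nu)))%C).
  - apply holo2_half_snd.
  - apply (holo2_scal Ci), (holo2_plus (fun sg _ => sg)); [apply holo2_fst | now apply holo2_etaC].
Qed.

Lemma U0W_open : C2open U0W.
Proof.
  intros z w H. assert (H' := H). destruct H as [H1 [H2 [H3 H4]]].
  assert (K1 : holo2 (fun z w => 1 - sW z w * sW z w)%C z w).
  { apply (holo2_minus (fun _ _ => RtoC 1)); [apply holo2_const|].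
    apply holo2_mult; apply holo2_sW. }
  destruct (Cder_qW _ H1) as [l Hl].
  assert (K2 : holo2 (fun z w => qW (sW z w)) z w) by (apply (holo2_comp qW sW z w l Hl), holo2_sW).
  destruct (Ccont2_Re_pos _ z w (proj1 K1) H1) as [d1 [P1 L1]].
  destruct (Ccont2_Re_pos _ z w (proj1 K2) H2) as [d2 [P2 L2]].
  destruct (Ccont2_Im_lt _ z w _ (proj1 (holo2_x1W z w H')) H3) as [d3 [P3 L3]].
  destruct (Ccont2_Im_lt _ z w _ (proj1 (holo2_x2W z w H')) H4) as [d4 [P4 L4]].
  exists (Rmin (Rmin d1 d2) (Rmin d3 d4)). split; [repeat apply Rmin_glb_lt; assumption|].
  intros z' w' Hz Hw.
  assert (M1 := Rmin_l (Rmin d1 d2) (Rmin d3 d4)). assert (M2 := Rmin_r (Rmin d1 d2) (Rmin d3 d4)).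
  assert (M3 := Rmin_l d1 d2). assert (M4 := Rmin_r d1 d2).
  assert (M5 := Rmin_l d3 d4). assert (M6 := Rmin_r d3 d4).
  repeat split; [apply L1 | apply L2 | apply L3 | apply L4]; lra.
Qed.

Lemma holo2_WcW (sg nu : C) : U0W sg nu -> holo2 WcW sg nu.
Proof.
  intros H. assert (E := holo2_etaC sg nu H). assert (H' := H). destruct H' as [H1 [H2 [H3 H4]]].
  unfold WcW, Cdiv.
  apply (holo2_mult _ (fun _ _ => / (8 * (PI * PI)))%C); [|apply holo2_const].
  apply (holo2_plus (fun sg nu => 2 * PI * Kf (x1W sg nu) - RtoC (PI * PI / 12) + (2 * PI * Kf (x2W sg nu) - RtoC (PI * PI / 12)))%C).
  - apply (holo2_plus (fun sg nu => 2 * PI * Kf (x1W sg nu) - RtoC (PI * PI / 12))%C);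
      (apply holo2_minus; [|apply holo2_const]); apply holo2_scal.
    + eapply (holo2_comp Kf x1W); [now apply Cder_Kf | now apply holo2_x1W].
    + eapply (holo2_comp Kf x2W); [now apply Cder_Kf | now apply holo2_x2W].
  - apply holo2_minus.
    + apply (holo2_mult (fun _ nu => PI * nu)%C (fun _ nu => PI * nu)%C); apply holo2_scal, holo2_snd.
    + apply holo2_mult; now apply (holo2_scal (2 * PI)%C).
Qed.

(** * Real values of the sine and the connected domain *)

Lemma Cln_RtoC (x : R) : 0 < x -> Cln (RtoC x) = RtoC (ln x).
Proof.
  intros Hx. apply Cln_unique; [simpl; assert (H := PI_RGT_0); lra|]. now rewrite Cexp_RtoC, exp_ln.
Qed.

Lemma exp_half_ln (x : R) : 0 < x -> exp (/ 2 * ln x) = sqrt x.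
Proof.
  intros Hx. symmetry. apply Rsqr_inj; [apply sqrt_pos | left; apply exp_pos |].
  rewrite Rsqr_sqrt by lra. unfold Rsqr. rewrite <- exp_plus.
  replace (/ 2 * ln x + / 2 * ln x) with (ln x) by field. now rewrite exp_ln.
Qed.

Lemma qW_real (s : R) : -1 < s < 1 ->
  0 < Re (1 - RtoC s * RtoC s)%C /\ qW (RtoC s) = (cos (asin s), sin (asin s)) /\ 0 < Re (qW (RtoC s)) /\
  etaC (RtoC s) = RtoC (asin s / (2 * PI)).
Proof.
  intros Hs. assert (HP := PI_RGT_0). assert (Hp : 0 < 1 - s * s) by nra.
  assert (Hb := asin_bound_lt s Hs).
  assert (E1 : (1 - RtoC s * RtoC s)%C = RtoC (1 - s * s)) by (rewrite RtoC_minus, RtoC_mult; reflexivity).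
  assert (E2 : qW (RtoC s) = (cos (asin s), sin (asin s))).
  { unfold qW, csq. rewrite E1, Cln_RtoC, <- RtoC_inv, <- RtoC_mult, Cexp_RtoC, exp_half_ln by lra.
    rewrite cos_asin, sin_asin by lra.
    apply Ceq_pair; unfold Re, Im; simpl; [|ring]. unfold Rsqr. ring. }
  split; [rewrite E1; exact Hp|]. split; [exact E2|]. split.
  - rewrite E2; simpl. apply cos_gt_0; lra.
  - unfold etaC. rewrite E2.
    assert (El : Cln (cos (asin s), sin (asin s)) = (0, asin s)).
    { apply Cln_unique; [simpl; lra|]. unfold Cexp; simpl. rewrite exp_0. f_equal; ring. }
    rewrite El. rewrite <- RtoC_mult. unfold Cdiv. rewrite <- RtoC_inv by lra.
    apply Ceq_pair; unfold Re, Im; simpl; field; lra.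
Qed.

Lemma Im_half (z : C) : Im (z / 2)%C = Im z / 2.
Proof. unfold Im; simpl. field. Qed.

Lemma Im_Ci_mult (w : C) : Im (Ci * w)%C = Re w.
Proof. unfold Re, Im; simpl; ring. Qed.

(** When s is real in (-1, 1) the first two conditions are automatic, and the imaginary parts of
    [x1W] and [x2W] are Im nu / 2 plus or minus Re sg + eta. *)
Lemma U0W_real (sg nu : C) (s : R) : sW sg nu = RtoC s -> -1 < s < 1 ->
  Rabs (Im nu / 2) + Rabs (Re sg + asin s / (2 * PI)) < 1 / 2 -> U0W sg nu.
Proof.
  intros Es Hs H. destruct (qW_real s Hs) as [A1 [A2 [A3 A4]]].
  assert (Ex : Re (sg + etaC (sW sg nu))%C = Re sg + asin s / (2 * PI)) by (rewrite Es, A4; reflexivity).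
  assert (B1 : Im (x1W sg nu) = Im nu / 2 + (Re sg + asin s / (2 * PI)))
    by (unfold x1W; rewrite Im_plus, Im_half, Im_Ci_mult, Ex; reflexivity).
  assert (B2 : Im (x2W sg nu) = Im nu / 2 + - (Re sg + asin s / (2 * PI))).
  { unfold x2W, Cminus. rewrite Im_plus, Im_half. change (Im (- (Ci * (sg + etaC (sW sg nu))))%C)
      with (- Im (Ci * (sg + etaC (sW sg nu)))%C). rewrite Im_Ci_mult, Ex. reflexivity. }
  unfold U0W. rewrite Es. repeat split; auto.
  - rewrite B1. eapply Rle_lt_trans; [apply Rabs_triang | exact H].
  - rewrite B2. eapply Rle_lt_trans; [apply Rabs_triang | rewrite Rabs_Ropp; exact H].
Qed.

Lemma asin_scaled_bound (s : R) : -1 < s < 1 -> - (1 / 4) < asin s / (2 * PI) < 1 / 4.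
Proof.
  intros Hs. assert (HP := PI_RGT_0). assert (Hb := asin_bound_lt s Hs).
  split; apply (Rmult_lt_reg_r (2 * PI)); try lra;
    replace (asin s / (2 * PI) * (2 * PI)) with (asin s) by (field; lra); lra.
Qed.

(** On the axis sigma = 0 the arcsine vanishes and only |Im nu| < 1 matters. From the base point (0,
    -1), a segment in nu along this axis and then a segment in sigma reach both the base region and
    the points where f_Q is evaluated. *)
Definition UW : C -> C -> Prop := reach U0W 0%C (RtoC (-1)).

Lemma U0W_zero (nu : C) : Rabs (Im nu) < 1 -> U0W 0%C nu.
Proof.
  intros H. apply (U0W_real _ _ 0); [| lra |].
  - unfold sW. replace (2 * PI * 0)%C with (RtoC 0) by ring. rewrite Csin_0. ring.
  - rewrite asin_0. unfold Rdiv at 2. rewrite Rmult_0_l. simpl. rewrite Rplus_0_l, Rabs_R0.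
    unfold Rdiv. rewrite Rabs_mult, (Rabs_pos_eq (/ 2)) by lra. lra.
Qed.

Lemma UW_axis (nu : C) : Rabs (Im nu) < 1 -> UW 0%C nu.
Proof.
  intros H. apply (reach_step _ _ _ 0%C (RtoC (-1))); [apply reach_refl|].
  intros t Ht. replace (0 + t * (0 - 0))%C with (RtoC 0) by ring. apply U0W_zero.
  replace (Im (RtoC (-1) + t * (nu - RtoC (-1)))%C) with (t * Im nu) by (unfold Im; simpl; ring).
  rewrite Rabs_mult, (Rabs_pos_eq t) by lra. assert (K := Rabs_pos (Im nu)). nra.
Qed.

Lemma UW_radial (sg nu : C) : Rabs (Im nu) < 1 ->
  (forall t : R, 0 <= t <= 1 -> U0W (t * sg)%C nu) -> UW sg nu.
Proof.
  intros H Ht. apply (reach_step _ _ _ 0%C nu); [now apply UW_axis|].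
  intros t Ht0. replace (0 + t * (sg - 0))%C with (t * sg)%C by ring.
  replace (nu + t * (nu - nu))%C with nu by ring. now apply Ht.
Qed.

Lemma Csin_RtoC (x : R) : Csin (RtoC x) = RtoC (sin x).
Proof.
  rewrite Csin_alt. replace (Ci * x)%C with ((0, x) : C) by (apply Ceq_pair; unfold Re, Im; simpl; ring).
  unfold Cexp; simpl. rewrite Ropp_0, exp_0, cos_neg, sin_neg. apply Ceq_pair; unfold Re, Im; simpl; field.
Qed.

Lemma Csin_imag (x : R) : Csin (0, x) = (0, sinh x).
Proof.
  rewrite Csin_alt. replace (Ci * (0, x))%C with (RtoC (- x)) by (apply Ceq_pair; unfold Re, Im; simpl; ring).
  rewrite <- RtoC_opp, !Cexp_RtoC, Ropp_involutive. unfold sinh.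
  apply Ceq_pair; unfold Re, Im; simpl; field.
Qed.

Lemma sW_base (sg nu : R) : sW (RtoC sg) (RtoC nu) = RtoC (exp (PI * nu) * sin (2 * PI * sg)).
Proof. unfold sW. rewrite <- !RtoC_mult, Cexp_RtoC, Csin_RtoC, <- RtoC_mult. reflexivity. Qed.

Lemma base_range (sg nu : R) : nu < 0 -> 0 <= sg < 1 / 4 -> 0 <= exp (PI * nu) * sin (2 * PI * sg) < 1.
Proof.
  intros Hn Hs. assert (HP := PI_RGT_0).
  assert (He : exp (PI * nu) < exp 0) by (apply exp_increasing; nra). rewrite exp_0 in He.
  assert (He0 := exp_pos (PI * nu)).
  assert (0 <= sin (2 * PI * sg)) by (apply sin_ge_0; nra).
  assert (sin (2 * PI * sg) <= 1) by apply SIN_bound. split; nra.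
Qed.

Lemma U0W_base (sg nu : R) : nu < 0 -> 0 <= sg < 1 / 4 -> U0W (RtoC sg) (RtoC nu).
Proof.
  intros Hn Hs. assert (HP := PI_RGT_0). assert (Hr := base_range sg nu Hn Hs).
  apply (U0W_real _ _ _ (sW_base sg nu)); [lra|].
  assert (Hb := asin_scaled_bound (exp (PI * nu) * sin (2 * PI * sg)) ltac:(lra)).
  simpl. replace (0 / 2) with 0 by field. rewrite Rabs_R0, Rplus_0_l. apply Rabs_def1; lra.
Qed.

Lemma WcW_base (sg nu : R) : W_base_region sg nu -> UW (RtoC sg) (RtoC nu) /\ WcW (RtoC sg) (RtoC nu) = W_base sg nu.
Proof.
  intros [Hn [He [Hes Hs]]]. assert (HP := PI_RGT_0). assert (HPC := PI_C_neq_0).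
  assert (Hr := base_range sg nu Hn ltac:(lra)).
  assert (HU : U0W (RtoC sg) (RtoC nu)) by (apply U0W_base; lra).
  split.
  - apply UW_radial; [simpl; rewrite Rabs_R0; lra|]. intros t Ht. rewrite <- RtoC_mult. apply U0W_base; [exact Hn|]. nra.
  - destruct (qW_real (exp (PI * nu) * sin (2 * PI * sg)) ltac:(lra)) as [_ [_ [_ E]]].
    rewrite <- sW_base in E.
    change (asin (exp (PI * nu) * sin (2 * PI * sg)) / (2 * PI)) with (etaW sg nu) in E.
    destruct HU as [_ [_ [H1 H2]]].
    unfold WcW, W_base. rewrite <- !Li2_closed by assumption.
    rewrite E. unfold Cdiv. f_equal.
    2: { f_equal. rewrite <- !RtoC_mult. f_equal. ring. }
    f_equal; [f_equal; f_equal; f_equal; unfold q2; f_equal; unfold x1W, x2W; rewrite E, ?RtoC_plus, RtoC_div by lra|].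
    + replace (2 * (Ci * PI) * (sg + etaW sg nu - Ci * (nu / 2)))%C
        with (2 * PI * (Ci * (sg + etaW sg nu)) - Ci * Ci * PI * nu)%C by field.
      rewrite Ci_sqr. field.
    + replace (- (2 * (Ci * PI) * (sg + etaW sg nu + Ci * (nu / 2))))%C
        with (- (2 * PI * (Ci * (sg + etaW sg nu))) - Ci * Ci * PI * nu)%C by field.
      rewrite Ci_sqr. field.
    + rewrite <- !RtoC_mult, <- RtoC_minus. f_equal. ring.
Qed.

Lemma WcW_continuation : is_continuation_W UW WcW.
Proof.
  assert (HU : U0W 0%C (RtoC (-1))) by (apply U0W_zero; simpl; rewrite Rabs_R0; lra).
  split; [|split; [|split]].
  - apply reach_open; [exact HU | apply U0W_open].
  - apply reach_connected.
  - intros z w H. assert (H' := reach_in _ _ _ _ _ HU H).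
    destruct (holo2_WcW z w H') as [K1 [[a K2] [b K3]]]. split; [exact K1|].
    split; [exists a | exists b]; now apply Cder_is_derive.
  - intros sg nu H. now apply WcW_base.
Qed.

(** * The saddle point *)

(** For X = exp (2 PI x) the saddle point equation is (1 + X exp (2 PI sg)) (1 + X exp (- 2 PI sg))
    = - exp (2 PI mu). Its roots are - cosh (2 PI sg) plus or minus i R; - [omegaQ] is the one in
    the lower half-plane, so that the saddle lies on the side of the contour. *)
Definition omegaQ (sg mu : R) : C := (cosh (2 * PI * sg), Rfq sg mu).

Definition x0Q (sg mu : R) : C := (Cln (- omegaQ sg mu) / (2 * PI))%C.

Section Saddle.

Variables sg mu : R.
Hypothesis Hadm : sinh (2 * PI * sg) ^ 2 < exp (2 * PI * mu).

Let sh := sinh (2 * PI * sg).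
Let ch := cosh (2 * PI * sg).
Let Rr := Rfq sg mu.
Let x0 := x0Q sg mu.

Lemma Rfq_pos : 0 < Rr.
Proof. unfold Rr, Rfq. apply sqrt_lt_R0. lra. Qed.

Lemma Rfq_sqr : Rr * Rr = exp (2 * PI * mu) - sh * sh.
Proof. unfold Rr, Rfq. rewrite sqrt_sqrt by lra. unfold sh. ring. Qed.

Lemma slit_omega : slit (- omegaQ sg mu)%C.
Proof. right. assert (H := Rfq_pos). unfold omegaQ; simpl. fold Rr. lra. Qed.

Lemma two_PI_x0 : (2 * PI * x0)%C = Cln (- omegaQ sg mu)%C.
Proof. unfold x0, x0Q. field. apply PI_C_neq_0. Qed.

Lemma q2_x0 : q2 x0 = (- omegaQ sg mu)%C.
Proof. unfold q2. rewrite two_PI_x0. apply Cexp_Cln, slit_neq_0, slit_omega. Qed.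

(** Both parts of - omega are negative, so its argument lies in (-PI, -PI/2). The resulting range is
    the limit of the contour strip -Q/2 < Im x < -Q/4 after rescaling by b. *)
Lemma Im_x0 : - (1 / 2) < Im x0 < - (1 / 4).
Proof.
  assert (HP := PI_RGT_0). assert (HR := Rfq_pos).
  assert (E : 2 * PI * Im x0 = Carg (- omegaQ sg mu)%C).
  { rewrite <- Im_2PI, two_PI_x0. reflexivity. }
  assert (Hn : Im (- omegaQ sg mu)%C < 0) by (unfold omegaQ; simpl; fold Rr; lra).
  assert (Ha := Carg_Im_neg _ Hn).
  assert (Hlt : Carg (- omegaQ sg mu)%C < - (PI / 2)).
  { destruct (Cln_Re_Im _ (slit_neq_0 _ slit_omega)) as [Hre _].
    assert (Hm : 0 < Cmod (- omegaQ sg mu)%C) by (apply Cmod_gt_0, slit_neq_0, slit_omega).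
    assert (Hc : Re (- omegaQ sg mu)%C < 0).
    { unfold omegaQ; simpl. assert (K := cosh_ge_1 (2 * PI * sg)). lra. }
    apply Rnot_le_lt. intros N.
    assert (0 <= cos (Carg (- omegaQ sg mu)%C)) by (apply cos_ge_0; lra). nra. }
  split; apply (Rmult_lt_reg_l (2 * PI)); lra.
Qed.

Lemma Im_x0_shift (r : R) : - (1 / 2) < Im (x0 + RtoC r)%C < 0.
Proof. rewrite Im_plus_RtoC. assert (H := Im_x0). lra. Qed.

Lemma q2_RtoC (r : R) : q2 (RtoC r) = RtoC (exp (2 * PI * r)).
Proof. unfold q2. now rewrite <- !RtoC_mult, Cexp_RtoC. Qed.

Lemma q2_x0_shift (r : R) : q2 (x0 + RtoC r)%C = (- (RtoC (exp (2 * PI * r)) * omegaQ sg mu))%C.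
Proof. rewrite q2_plus, q2_x0, q2_RtoC. ring. Qed.

(** This is 2 PI times the eta of the generating function at (i sg, - mu - i/2): there exp (PI nu) =
    - i exp (- PI mu), and the sine contributes i sinh (2 PI sg), so that their product is real. *)
Let eta := asin (exp (- (PI * mu)) * sh).

Lemma sin_eta_range : -1 < exp (- (PI * mu)) * sh < 1.
Proof.
  assert (E : exp (2 * PI * mu) * (exp (- (PI * mu)) * exp (- (PI * mu))) = 1).
  { rewrite <- !exp_plus. rewrite <- exp_0. f_equal. ring. }
  assert (H0 := exp_pos (- (PI * mu))). set (a := exp (- (PI * mu))) in *.
  assert (K : (a * sh) * (a * sh) < 1).
  { rewrite <- E. replace (a * sh * (a * sh)) with (sh ^ 2 * (a * a)) by ring.
    apply Rmult_lt_compat_r; [nra | exact Hadm]. }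
  split; nra.
Qed.

Lemma sin_eta : sin eta = exp (- (PI * mu)) * sh.
Proof. unfold eta. apply sin_asin. assert (H := sin_eta_range). lra. Qed.

Lemma cos_eta : cos eta = exp (- (PI * mu)) * Rr.
Proof.
  assert (H := sin_eta_range). assert (H0 := exp_pos (- (PI * mu))). assert (HR := Rfq_pos).
  assert (Hb := asin_bound_lt _ H). fold eta in Hb.
  assert (Hc : 0 < cos eta) by (apply cos_gt_0; lra).
  apply Rsqr_inj; [lra | nra |].
  assert (E := sin2_cos2 eta). rewrite sin_eta in E. unfold Rsqr in *.
  assert (E1 : exp (2 * PI * mu) * (exp (- (PI * mu)) * exp (- (PI * mu))) = 1).
  { rewrite <- !exp_plus. rewrite <- exp_0. f_equal. ring. }
  assert (HR2 := Rfq_sqr). set (a := exp (- (PI * mu))) in *.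
  replace (a * Rr * (a * Rr)) with (a * a * (Rr * Rr)) by ring. rewrite HR2. nra.
Qed.

Lemma ch_sh_exp : exp (2 * PI * sg) = ch + sh /\ exp (- (2 * PI * sg)) = ch - sh.
Proof. unfold ch, sh, cosh, sinh. split; field. Qed.

Lemma Cexp_rotated (s e : R) :
  Cexp (RtoC s + (RtoC (PI * mu) - Ci * RtoC (PI / 2)) + Ci * RtoC e)%C =
  (RtoC (exp s * exp (PI * mu)) * (sin e, (- cos e)%R))%C.
Proof.
  unfold Cexp.
  replace (Re (RtoC s + (RtoC (PI * mu) - Ci * RtoC (PI / 2)) + Ci * RtoC e)%C) with (s + PI * mu) by (unfold Re; simpl; ring).
  replace (Im (RtoC s + (RtoC (PI * mu) - Ci * RtoC (PI / 2)) + Ci * RtoC e)%C) with (- (PI / 2 - e)) by (unfold Im; simpl; ring).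
  rewrite cos_neg, sin_neg, cos_shift, sin_shift, exp_plus. apply Ceq_pair; unfold Re, Im; simpl; ring.
Qed.

Lemma exp_mu_cancel (x : R) : exp (PI * mu) * (exp (- (PI * mu)) * x) = x.
Proof. rewrite <- Rmult_assoc, <- exp_plus, Rplus_opp_r, exp_0. ring. Qed.

(** Here 1 - exp (- 2 PI sg) omega = exp (- 2 PI sg) (sinh (2 PI sg) - i R), and the last bracket is
    exp (PI mu) (sin eta - i cos eta) because its modulus is exp (PI mu). The argument eta - PI / 2
    is principal. *)
Lemma splog_z1 :
  splog (x0 + RtoC (- sg))%C =
  (RtoC (- (2 * PI * sg)) + (RtoC (PI * mu) - Ci * RtoC (PI / 2)) + Ci * RtoC eta)%C.
Proof.
  assert (HP := PI_RGT_0). assert (H := sin_eta_range). assert (Hb := asin_bound_lt _ H). fold eta in Hb.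
  unfold splog. apply Cln_unique.
  - replace (Im _) with (eta - PI / 2) by (unfold Im; simpl; ring). lra.
  - rewrite Cexp_rotated, q2_x0_shift. replace (2 * PI * - sg) with (- (2 * PI * sg)) by ring.
    rewrite sin_eta, cos_eta. unfold omegaQ. fold ch Rr.
    destruct ch_sh_exp as [E1 E2].
    assert (E3 : exp (- (2 * PI * sg)) * exp (2 * PI * sg) = 1).
    { rewrite <- exp_plus, Rplus_opp_l. apply exp_0. }
    apply Ceq_pair; unfold Re, Im; simpl.
    + transitivity (exp (- (2 * PI * sg)) * (exp (PI * mu) * (exp (- (PI * mu)) * sh))); [ring|].
      rewrite exp_mu_cancel. rewrite <- E3, E1. ring.
    + transitivity (exp (- (2 * PI * sg)) * - (exp (PI * mu) * (exp (- (PI * mu)) * Rr))); [ring|].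
      rewrite exp_mu_cancel. ring.
Qed.

Lemma splog_z2 :
  splog (x0 + RtoC sg)%C =
  (RtoC (2 * PI * sg) + (RtoC (PI * mu) - Ci * RtoC (PI / 2)) + Ci * RtoC (- eta))%C.
Proof.
  assert (HP := PI_RGT_0). assert (H := sin_eta_range). assert (Hb := asin_bound_lt _ H). fold eta in Hb.
  unfold splog. apply Cln_unique.
  - replace (Im _) with (- eta - PI / 2) by (unfold Im; simpl; ring). lra.
  - rewrite Cexp_rotated, q2_x0_shift.
    rewrite sin_neg, cos_neg, sin_eta, cos_eta. unfold omegaQ. fold ch Rr.
    destruct ch_sh_exp as [E1 E2].
    assert (E3 : exp (2 * PI * sg) * exp (- (2 * PI * sg)) = 1).
    { rewrite <- exp_plus, Rplus_opp_r. apply exp_0. }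
    apply Ceq_pair; unfold Re, Im; simpl.
    + transitivity (exp (2 * PI * sg) * - (exp (PI * mu) * (exp (- (PI * mu)) * sh))); [ring|].
      rewrite exp_mu_cancel. rewrite <- E3, E2. ring.
    + transitivity (exp (2 * PI * sg) * - (exp (PI * mu) * (exp (- (PI * mu)) * Rr))); [ring|].
      rewrite exp_mu_cancel. ring.
Qed.

Lemma sW_target (r : R) : sW (0, r) (- mu, - (1 / 2)) = RtoC (exp (- (PI * mu)) * sinh (2 * PI * r)).
Proof.
  unfold sW. replace (2 * PI * (0, r))%C with ((0, 2 * PI * r) : C) by (apply Ceq_pair; unfold Re, Im; simpl; ring).
  rewrite Csin_imag.
  replace (Cmult PI (- mu, - (1 / 2))) with ((- (PI * mu), - (PI / 2)) : C)
    by (apply Ceq_pair; unfold Re, Im; simpl; field).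
  unfold Cexp; simpl. rewrite cos_neg, sin_neg, cos_PI2, sin_PI2.
  apply Ceq_pair; unfold Re, Im; simpl; ring.
Qed.

Lemma sinh_mono (x y : R) : x <= y -> sinh x <= sinh y.
Proof.
  intros H. unfold sinh. assert (exp x <= exp y) by now apply exp_le_exp.
  assert (exp (- y) <= exp (- x)) by (apply exp_le_exp; lra). lra.
Qed.

(** Along the segment the sine stays real, and monotonicity of sinh keeps it in (-1, 1). The part Im
    nu / 2 = - 1/4 uses up half of the width, and the arcsine contributes strictly less than the
    remaining 1/4. *)
Lemma U0W_target (t : R) : 0 <= t <= 1 -> U0W (t * (0, sg))%C (- mu, - (1 / 2)).
Proof.
  intros Ht. replace (t * (0, sg))%C with ((0, t * sg) : C) by (apply Ceq_pair; unfold Re, Im; simpl; ring).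
  assert (HP := PI_RGT_0).
  assert (H := sin_eta_range). assert (H0 := exp_pos (- (PI * mu))).
  assert (Hr : -1 < exp (- (PI * mu)) * sinh (2 * PI * (t * sg)) < 1).
  { set (a := exp (- (PI * mu))) in *. unfold sh in H. set (S := sinh (2 * PI * sg)) in *.
    set (St := sinh (2 * PI * (t * sg))).
    destruct (Rle_dec 0 sg) as [Hs|Hs].
    - assert (0 <= St) by (apply sinh_nonneg; assert (0 <= t * sg) by nra; nra).
      assert (St <= S) by (apply sinh_mono; apply Rmult_le_compat_l; nra). split; nra.
    - assert (K1 : sinh 0 >= St) by (apply Rle_ge, sinh_mono; assert (t * sg <= 0) by nra; nra).
      rewrite sinh_0 in K1.
      assert (S <= St) by (apply sinh_mono; apply Rmult_le_compat_l; nra). split; nra. }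
  apply (U0W_real _ _ _ (sW_target (t * sg)) Hr).
  assert (Hb := asin_scaled_bound _ Hr). simpl. rewrite Rplus_0_l.
  replace (- (1 / 2) / 2) with (- (1 / 4)) by field. rewrite Rabs_Ropp, (Rabs_pos_eq (1 / 4)) by lra.
  assert (Rabs (asin (exp (- (PI * mu)) * sinh (2 * PI * (t * sg))) / (2 * PI)) < 1 / 4) by (apply Rabs_def1; lra).
  lra.
Qed.

Lemma UW_target : UW (0, sg) (- mu, - (1 / 2)).
Proof.
  apply UW_radial; [simpl; rewrite Rabs_Ropp, Rabs_pos_eq; lra | apply U0W_target].
Qed.

Lemma fQ_alt : fQ sg mu =
  (- (Li2 (RtoC (- exp (2 * PI * mu))) / twoPIi) - Li2 (- q2 (x0 + RtoC (- sg))) / twoPIi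
   - Li2 (- q2 (x0 + RtoC sg)) / twoPIi + (/ 2 + Ci * mu) * (2 * PI * x0)
   - PI * mu + RtoC (5 * PI / 12) * Ci)%C.
Proof.
  rewrite !q2_x0_shift, two_PI_x0. unfold fQ, Cminus. fold (omegaQ sg mu).
  replace (2 * PI * - sg) with (- (2 * PI * sg)) by ring.
  replace (- - (RtoC (exp (- (2 * PI * sg))) * omegaQ sg mu))%C with (RtoC (exp (- (2 * PI * sg))) * omegaQ sg mu)%C by ring.
  replace (- - (RtoC (exp (2 * PI * sg)) * omegaQ sg mu))%C with (RtoC (exp (2 * PI * sg)) * omegaQ sg mu)%C by ring.
  assert (E1 : ((1 / 2, mu) : C) = (/ 2 + Ci * mu)%C) by (apply Ceq_pair; unfold Re, Im; simpl; field).
  assert (E2 : ((- (PI * mu), 5 * PI / 12) : C) = (- (PI * mu) + RtoC (5 * PI / 12) * Ci)%C)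
    by (apply Ceq_pair; unfold Re, Im; simpl; field).
  rewrite E1, E2. unfold omegaQ. ring.
Qed.

(** The points of W are the images under [tau] of the points x0 + sg and x0 - sg of f_Q, so the
    three-term relation converts one pair of dilogarithms into the other. The logarithms that it
    introduces are explicit by [splog_z1] and [splog_z2], which leaves an algebraic identity modulo
    i^2 = -1. *)
Lemma fQ_WcW : fQ sg mu =
   Cplus (Cplus (Cplus
     (Cmult (Cmult (RtoC (4 * PI)) Ci) (WcW (0, sg) (- mu, - (1/2))))
     (Copp (Cdiv (Li2 (RtoC (- exp (2 * PI * mu)))) twoPIi)))
     (0, - (2 * PI * sg ^ 2)))
     (0, PI / 4).
Proof.
  assert (HP := PI_RGT_0). assert (HPC := PI_C_neq_0). assert (Hi := Ci_neq_0).
  assert (HU := U0W_target 1 ltac:(lra)). replace (RtoC 1 * (0, sg))%C with ((0, sg) : C) in HU by (apply Ceq_pair; unfold Re, Im; simpl; ring).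
  destruct HU as [_ [_ [H1 H2]]].
  unfold WcW. rewrite <- !Li2_closed by assumption.
  assert (Ee : etaC (sW (0, sg) (- mu, - (1 / 2))) = RtoC (eta / (2 * PI))).
  { rewrite sW_target. now destruct (qW_real _ sin_eta_range) as [_ [_ [_ E]]]. }
  assert (T1 : x2W (0, sg) (- mu, - (1 / 2)) = tau (x0 + RtoC (- sg))%C).
  { unfold tau, x2W. rewrite splog_z1, Ee, <- RtoC_mult. unfold Cdiv. rewrite <- !RtoC_inv by lra.
    apply Ceq_pair; unfold Re, Im; simpl; field; lra. }
  assert (T2 : x1W (0, sg) (- mu, - (1 / 2)) = tau (x0 + RtoC sg)%C).
  { unfold tau, x1W. rewrite splog_z2, Ee, <- RtoC_mult. unfold Cdiv. rewrite <- !RtoC_inv by lra.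
    apply Ceq_pair; unfold Re, Im; simpl; field; lra. }
  rewrite T1, T2, !Li2_three_term by apply Im_x0_shift.
  rewrite fQ_alt, Ee, splog_z1, splog_z2.
  set (L0 := Li2 (RtoC (- exp (2 * PI * mu)))).
  set (L1 := Li2 (- q2 (x0 + RtoC (- sg)))). set (L2 := Li2 (- q2 (x0 + RtoC sg))).
  replace (2 * PI * RtoC (eta / (2 * PI)))%C with (RtoC eta) by (rewrite <- !RtoC_mult; f_equal; field; lra).
  replace ((0, - (2 * PI * sg ^ 2)) : C) with (- (2 * PI * (sg * sg)) * Ci)%C
    by (apply Ceq_pair; unfold Re, Im; simpl; ring).
  replace ((0, PI / 4) : C) with (PI / 4 * Ci)%C by (apply Ceq_pair; unfold Re, Im; simpl; field).
  replace ((- mu, - (1 / 2)) : C) with (- mu - Ci / 2)%C by (apply Ceq_pair; unfold Re, Im; simpl; field).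
  unfold twoPIi.
  rewrite !RtoC_opp, !RtoC_mult, !RtoC_div, !RtoC_mult by lra.
  assert (EL : forall X : C, (X / (2 * PI * Ci))%C = (- Ci * X / (2 * PI))%C).
  { intros X. transitivity (X * (- (Ci * Ci)) / (2 * PI * Ci))%C; [rewrite Ci_sqr; field; auto | field; auto]. }
  rewrite !EL.
  set (ix := x0). clearbody ix. clearbody L0 L1 L2.
  assert (Ei := Ci_sqr).
  field [Ei]. auto.
Qed.

End Saddle.

(** * Gaussian integrals with a complex parameter *)

(** Balls of the product structure are squares, hence the factor 2. *)
Lemma Cball_Cmod (l y : C) (eps : R) : ball (M := C_R_NormedModule) l eps y -> Cmod (y - l)%C < 2 * eps.
Proof.
  intros [B1 B2]. assert (B1' : Rabs (Re (y - l)%C) < eps) by exact B1.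
  assert (B2' : Rabs (Im (y - l)%C) < eps) by exact B2.
  assert (K := Cmod_le_Re_Im (y - l)%C). lra.
Qed.

(** For a function continuous at 0 the improper lower end may be replaced by 0, since the piece over
    [0, a] is at most a M. *)
Lemma Cint0_limit (f : R -> C) (N : C) (M : R) : Cint0 f N ->
  (forall u, Ccontinuous f u) -> (forall u, 0 <= u <= 1 -> Cmod (f u) <= M) ->
  forall eps, 0 < eps -> exists B, forall (b : R) (y : C), B < b ->
    is_RInt (V := C_R_CompleteNormedModule) f 0 b y -> Cmod (y - N)%C < eps.
Proof.
  intros H Hc Hb eps He.
  assert (HM : 0 <= M) by (eapply Rle_trans; [apply Cmod_ge_0 | apply (Hb 0); lra]).
  assert (He4 : 0 < eps / 4) by lra.
  destruct (H (ball (M := C_R_NormedModule) N (eps / 4)) (locally_ball (T := C_R_NormedModule) N (mkposreal _ He4)))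
    as [Q S HQ [B HS] K].
  assert (Hr : 0 < eps / (4 * (M + 1))) by (apply Rdiv_lt_0_compat; lra).
  assert (HQ2 : at_right 0 (fun a => Q a /\ a < Rmin 1 (eps / (4 * (M + 1))))).
  { apply filter_and; [exact HQ|].
    assert (Hm : 0 < Rmin 1 (eps / (4 * (M + 1)))) by (apply Rmin_glb_lt; lra).
    exists (mkposreal _ Hm). intros y Hy _. assert (Hy' : Rabs (y - 0) < Rmin 1 (eps / (4 * (M + 1)))) by exact Hy.
    apply Rabs_def2 in Hy'. lra. }
  destruct (filter_ex (F := at_right 0) _ (filter_and _ _ at_right_pos HQ2)) as [a [Ha0 [Qa Ha]]].
  assert (Hmin1 := Rmin_l 1 (eps / (4 * (M + 1)))). assert (Hmin2 := Rmin_r 1 (eps / (4 * (M + 1)))).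
  exists B. intros b y HBb Hy.
  destruct (K a b Qa (HS b HBb)) as [y' [Hy' By']]. simpl in Hy'.
  assert (Hex : exists r : C, is_RInt (V := C_R_CompleteNormedModule) f 0 a r)
    by (apply (ex_RInt_continuous (V := C_R_CompleteNormedModule)); intros; apply Hc).
  destruct Hex as [r Hrr].
  assert (E : y = (r + y')%C).
  { rewrite <- (is_RInt_unique (V := C_R_CompleteNormedModule) _ _ _ _ Hy).
    apply (is_RInt_unique (V := C_R_CompleteNormedModule)).
    now apply (is_RInt_Chasles (V := C_R_CompleteNormedModule) f 0 a b). }
  assert (Hr2 : Cmod r <= (a - 0) * M).
  { rewrite Cmod_norm. apply (norm_RInt_le_const (V := C_R_CompleteNormedModule) f 0 a); [lra | | exact Hrr].
    intros x Hx. rewrite <- Cmod_norm. apply Hb. lra. }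
  apply Cball_Cmod in By'. rewrite E. replace (r + y' - N)%C with (r + (y' - N))%C by ring.
  eapply Rle_lt_trans; [apply Cmod_triangle|].
  assert (a * M <= eps / 4).
  { apply Rle_trans with (eps / (4 * (M + 1)) * (M + 1)); [apply Rmult_le_compat; lra | right; field; lra]. }
  lra.
Qed.

Lemma CintR_limit (f : R -> C) (L : C) : CintR f L ->
  forall eps, 0 < eps -> exists B, forall b, B < b ->
    exists y : C, is_RInt (V := C_R_CompleteNormedModule) f (- b) b y /\ Cmod (y - L)%C < eps.
Proof.
  intros H eps He. assert (He2 : 0 < eps / 2) by lra.
  destruct (H (ball (M := C_R_NormedModule) L (eps / 2)) (locally_ball (T := C_R_NormedModule) L (mkposreal _ He2)))
    as [Q S [A HQ] [B HS] K].
  exists (Rmax B (- A)). intros b Hb. assert (M1 := Rmax_l B (- A)). assert (M2 := Rmax_r B (- A)).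
  destruct (K (- b) b (HQ (- b) ltac:(lra)) (HS b ltac:(lra))) as [y [Hy By]]. exists y. split; [exact Hy|].
  apply Cball_Cmod in By. lra.
Qed.

(** * The real Gaussian integral *)

Definition gaussI (x : R) : R := RInt (fun s => exp (- (s * s))) 0 x.

Lemma continuous_gauss (s : R) : continuous (fun s => exp (- (s * s))) s.
Proof. apply (ex_derive_continuous (fun s => exp (- (s * s)))). auto_derive. trivial. Qed.

Lemma ex_RInt_gauss (a b : R) : ex_RInt (fun s => exp (- (s * s))) a b.
Proof. apply (ex_RInt_continuous (V := R_CompleteNormedModule)). intros; apply continuous_gauss. Qed.

Lemma is_derive_gaussI (x : R) : is_derive gaussI x (exp (- (x * x))).
Proof.
  apply (is_derive_RInt (fun s => exp (- (s * s))) gaussI 0).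
  - apply filter_forall. intros b. apply (RInt_correct (V := R_CompleteNormedModule)), ex_RInt_gauss.
  - apply continuous_gauss.
Qed.

(** The classical auxiliary function: by the substitution s = x t, [gaussJ] has derivative opposite
    to that of [gaussI] squared. Their sum is therefore its value arctan 1 = PI / 4 at 0, and
    [gaussJ] tends to 0 at infinity. *)
Definition gaussG (x t : R) : R := exp (- (x * x * (1 + t * t))) / (1 + t * t).
Definition gaussJ (x : R) : R := RInt (gaussG x) 0 1.

Lemma is_derive_gaussG (x t : R) : is_derive (fun u => gaussG u t) x (- (2 * x) * exp (- (x * x * (1 + t * t)))).
Proof. unfold gaussG. auto_derive; [nra | field; nra]. Qed.

Lemma is_derive_gaussJ (x : R) : is_derive gaussJ x (- 2 * exp (- (x * x)) * gaussI x).
Proof.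
  assert (E : RInt (fun t => Derive (fun u => gaussG u t) x) 0 1 = - 2 * exp (- (x * x)) * gaussI x).
  { transitivity (RInt (fun t => (- 2 * exp (- (x * x))) * (x * exp (- ((x * t + 0) * (x * t + 0))))) 0 1).
    - apply RInt_ext. intros t _. transitivity (- (2 * x) * exp (- (x * x * (1 + t * t)))); [apply is_derive_unique, is_derive_gaussG|].
      replace (- (x * x * (1 + t * t))) with (- (x * x) + - ((x * t + 0) * (x * t + 0))) by ring.
      rewrite exp_plus. match goal with |- @eq _ ?l ?r => change (@eq R l r) end. ring.
    - assert (K := RInt_comp_lin (V := R_CompleteNormedModule) (fun s => exp (- (s * s))) x 0 0 1 (ex_RInt_gauss _ _)).
      assert (Hex : ex_RInt (fun t => x * exp (- ((x * t + 0) * (x * t + 0)))) 0 1).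
      { apply (ex_RInt_continuous (V := R_CompleteNormedModule)). intros t _.
        apply (ex_derive_continuous (fun t => x * exp (- ((x * t + 0) * (x * t + 0))))). auto_derive. trivial. }
      rewrite (RInt_scal (V := R_CompleteNormedModule) _ _ _ _ Hex).
      unfold scal in K |- *; simpl in K |- *; unfold mult in K |- *; simpl in K |- *. rewrite K.
      unfold gaussI. replace (x * 0 + 0) with 0 by ring. replace (x * 1 + 0) with x by ring. reflexivity. }
  rewrite <- E. apply (is_derive_RInt_param gaussG 0 1 x).
  - apply filter_forall. intros y t _. eexists. apply is_derive_gaussG.
  - intros t _.
    apply (continuity_2d_pt_ext (fun u v => - (2 * u) * exp (- (u * u * (1 + v * v))))).
    { intros u v. symmetry. apply is_derive_unique, is_derive_gaussG. }
    apply continuity_2d_pt_mult.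
    + apply continuity_2d_pt_opp, continuity_2d_pt_mult; [apply continuity_2d_pt_const | apply continuity_2d_pt_id1].
    + apply (continuity_1d_2d_pt_comp exp (fun u v => - (u * u * (1 + v * v)))).
      * apply derivable_continuous_pt, derivable_pt_exp.
      * apply continuity_2d_pt_opp, continuity_2d_pt_mult.
        -- apply continuity_2d_pt_mult; apply continuity_2d_pt_id1.
        -- apply continuity_2d_pt_plus; [apply continuity_2d_pt_const|].
           apply continuity_2d_pt_mult; apply continuity_2d_pt_id2.
  - apply filter_forall. intros y. apply (ex_RInt_continuous (V := R_CompleteNormedModule)). intros t _.
    apply (ex_derive_continuous (gaussG y)). unfold gaussG. auto_derive. nra.
Qed.

Lemma gauss_identity (x : R) : gaussI x * gaussI x + gaussJ x = PI / 4.
Proof.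
  assert (Hd : forall y, is_derive (fun y => gaussI y * gaussI y + gaussJ y) y 0).
  { intros y.
    replace 0 with (exp (- (y * y)) * gaussI y + gaussI y * exp (- (y * y)) + (- 2 * exp (- (y * y)) * gaussI y)) by ring.
    apply (is_derive_plus (fun y => gaussI y * gaussI y) gaussJ); [|apply is_derive_gaussJ].
    apply (is_derive_mult (K := R_AbsRing) gaussI gaussI); try apply is_derive_gaussI. intros; apply Rmult_comm. }
  destruct (MVT_gen (fun y => gaussI y * gaussI y + gaussJ y) 0 x (fun _ => 0)) as [c [_ K]].
  - intros; apply Hd.
  - intros; apply continuity_pt_filterlim, (ex_derive_continuous (fun y => gaussI y * gaussI y + gaussJ y)).
    eexists; apply Hd.
  - assert (I0 : gaussI 0 = 0) by (unfold gaussI; apply (RInt_point (V := R_CompleteNormedModule))).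
    assert (J0 : gaussJ 0 = PI / 4).
    { unfold gaussJ. rewrite <- atan_1. replace (atan 1) with (minus (atan 1) (atan 0)) by (rewrite atan_0; unfold minus, plus, opp; simpl; ring).
      apply (is_RInt_unique (V := R_CompleteNormedModule)).
      apply (is_RInt_ext (fun t => / (1 + t ^ 2))).
      { intros t _. unfold gaussG. replace (- (0 * 0 * (1 + t * t))) with 0 by ring. rewrite exp_0.
        match goal with |- @eq _ ?l ?r => change (@eq R l r) end. field. nra. }
      apply (is_RInt_derive (V := R_CompleteNormedModule) atan (fun t => / (1 + t ^ 2))).
      - intros; apply is_derive_atan_pow.
      - intros t _. apply (ex_derive_continuous (fun t => / (1 + t ^ 2))). auto_derive. nra. }
    rewrite I0, J0 in K. lra.
Qed.

Lemma gaussJ_bound (x : R) : 0 < x -> 0 <= gaussJ x <= / (x * x).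
Proof.
  intros Hx.
  assert (Hex : ex_RInt (gaussG x) 0 1).
  { apply (ex_RInt_continuous (V := R_CompleteNormedModule)). intros t _.
    apply (ex_derive_continuous (gaussG x)). unfold gaussG. auto_derive. nra. }
  assert (Hp : forall t, 0 <= gaussG x t <= / (x * x)).
  { intros t. unfold gaussG. assert (H1 : 1 <= 1 + t * t) by nra. assert (He := exp_pos (- (x * x * (1 + t * t)))).
    split; [apply Rmult_le_pos; [lra | left; apply Rinv_0_lt_compat; lra]|].
    assert (Hx2 : 0 < x * x) by nra.
    apply Rle_trans with (exp (- (x * x * (1 + t * t))) / 1).
    - apply Rmult_le_compat_l; [lra | apply Rinv_le_contravar; lra].
    - rewrite exp_Ropp. unfold Rdiv. rewrite Rinv_1, Rmult_1_r. apply Rinv_le_contravar; [exact Hx2|].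
      assert (K := exp_ineq1_le (x * x * (1 + t * t))). nra. }
  split.
  - apply (RInt_ge_0 (gaussG x) 0 1); [lra | exact Hex | intros; apply Hp].
  - replace (/ (x * x)) with (RInt (fun _ => / (x * x)) 0 1).
    + apply RInt_le; [lra | exact Hex | apply ex_RInt_const | intros; apply Hp].
    + rewrite (RInt_const (V := R_CompleteNormedModule)). unfold scal; simpl; unfold mult; simpl. ring.
Qed.

(** * Continuation of the Gaussian integral to the right half-plane *)

Lemma gauss_phi_bound (n : nat) (d : R) : (n <= 4)%nat -> 0 < d -> exists M, forall (a : C) u, d <= Re a -> 0 <= u ->
  u ^ n * Cmod (Cexp (- (a * (u * u)))) <= M / (1 + u ^ 2).
Proof.
  intros Hn Hd. destruct (poly_exp_bound (n + 2) (2 * d) ltac:(lra)) as [M [HM H]].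
  exists (exp d * M). intros a u Ha Hu. specialize (H u Hu).
  rewrite Cmod_Cexp.
  replace (Re (- (a * (u * u)))%C) with (- (Re a * (u * u))) by (unfold Re; simpl; ring).
  assert (He : exp (- (Re a * (u * u))) <= exp d * exp (- (2 * d * u))).
  { rewrite <- exp_plus. apply exp_le_exp.
    assert (0 <= d * ((u - 1) * (u - 1))) by (apply Rmult_le_pos; [lra | apply Rle_0_sqr]).
    assert (0 <= (Re a - d) * (u * u)) by (apply Rmult_le_pos; [lra | apply Rle_0_sqr]). lra. }
  assert (He0 := exp_pos (- (2 * d * u))). assert (Hed := exp_pos d).
  apply (Rmult_le_reg_r (1 + u ^ 2)); [nra|].
  replace (exp d * M / (1 + u ^ 2) * (1 + u ^ 2)) with (exp d * M) by (field; nra).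
  assert (Hun : 0 <= u ^ n) by now apply pow_le.
  apply Rle_trans with ((1 + u) ^ n * (exp d * exp (- (2 * d * u))) * (1 + u) ^ 2).
  - apply Rmult_le_compat; [apply Rmult_le_pos; [exact Hun | left; apply exp_pos] | nra | | nra].
    apply Rmult_le_compat; [exact Hun | left; apply exp_pos | apply pow_incr; lra | exact He].
  - rewrite pow_add in H.
    replace ((1 + u) ^ n * (exp d * exp (- (2 * d * u))) * (1 + u) ^ 2)
      with (exp d * ((1 + u) ^ n * (1 + u) ^ 2 * exp (- (2 * d * u)))) by ring.
    apply Rmult_le_compat_l; lra.
Qed.

(** The n-th derivative of exp (- a u^2) with respect to a. *)
Definition gphi (n : nat) (a : C) (u : R) : C :=
  (RtoC ((- (u * u)) ^ n) * Cexp (- (a * (u * u))))%C.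

Lemma Cder_gphi (n : nat) (a : C) (u : R) : Cder (fun a => gphi n a u) a (gphi (S n) a u).
Proof.
  unfold gphi. eapply Cder_eq.
  - apply Cder_scal. apply (Cder_Cexp_comp (fun a => - (a * (u * u)))%C).
    apply (Cder_ext (fun a => - (u * u) * a)%C); [intros; ring | apply Cder_scal, Cder_id].
  - simpl. rewrite (RtoC_mult (- (u * u))), RtoC_opp, RtoC_mult. ring.
Qed.

Lemma Ccontinuous_gphi (n : nat) (a : C) (u : R) : Ccontinuous (gphi n a) u.
Proof.
  unfold gphi. apply Ccontinuous_mult.
  - apply Ccontinuous_RtoC, (ex_derive_continuous (fun u => (- (u * u)) ^ n)).
    apply (ex_derive_pow (fun u => - (u * u))). auto_derive. trivial.
  - eapply Rder_Ccontinuous. apply (Cder_Rder_real (fun w => Cexp (- (a * (w * w))))).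
    apply Cder_Cexp_comp, Cder_opp, Cder_scal, Cder_mult; apply Cder_id.
Qed.

Lemma gphi_bound (d : R) : 0 < d -> exists M, forall n (a : C) u, (n <= 2)%nat -> d <= Re a -> 0 < u ->
  Cmod (gphi n a u) <= M / (1 + u ^ 2).
Proof.
  intros Hd. destruct (gauss_phi_bound 0 d ltac:(lia) Hd) as [M0 H0].
  destruct (gauss_phi_bound 2 d ltac:(lia) Hd) as [M1 H1]. destruct (gauss_phi_bound 4 d ltac:(lia) Hd) as [M2 H2].
  exists (Rmax M0 (Rmax M1 M2)). intros n a u Hn Ha Hu.
  assert (E : Cmod (gphi n a u) = u ^ (2 * n) * Cmod (Cexp (- (a * (u * u))))).
  { unfold gphi. rewrite Cmod_mult, Cmod_R, <- RPow_abs, Rabs_Ropp, Rabs_pos_eq by nra.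
    rewrite pow_mult. f_equal. f_equal. ring. }
  rewrite E.
  assert (Hp : 0 <= / (1 + u ^ 2)) by (left; apply Rinv_0_lt_compat; nra).
  destruct n as [|[|[|n]]]; [| | | lia].
  - eapply Rle_trans; [apply H0; lra|]. apply Rmult_le_compat_r; [exact Hp | apply Rmax_l].
  - eapply Rle_trans; [apply H1; lra|]. apply Rmult_le_compat_r; [exact Hp|].
    eapply Rle_trans; [|apply Rmax_r]. apply Rmax_l.
  - eapply Rle_trans; [apply H2; lra|]. apply Rmult_le_compat_r; [exact Hp|].
    eapply Rle_trans; [|apply Rmax_r]. apply Rmax_r.
Qed.

Definition Ngauss (n : nat) (a : C) : C :=
  RInt_gen (V := C_R_CompleteNormedModule) (gphi n a) (at_right 0) (Rbar_locally p_infty).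

Lemma Ngauss_correct (n : nat) (a : C) : (n <= 2)%nat -> 0 < Re a -> Cint0 (gphi n a) (Ngauss n a).
Proof.
  intros Hn Ha. destruct (gphi_bound (Re a) Ha) as [M HM].
  destruct (Cint0_dom (gphi n a) M) as [l [Hl _]].
  - intros; apply Ccontinuous_gphi.
  - intros u Hu. apply HM; auto; lra.
  - apply (RInt_gen_correct (V := C_R_CompleteNormedModule)). now exists l.
Qed.

Lemma Cder_Ngauss (a : C) : 0 < Re a -> Cder (Ngauss 0) a (Ngauss 1 a).
Proof.
  intros Ha. destruct (gphi_bound (Re a / 2) ltac:(lra)) as [M HM].
  assert (Hw : forall w, Cmod (w - a)%C < Re a / 2 -> Re a / 2 <= Re w).
  { intros w Hw. assert (K := re_le_Cmod (w - a)%C). apply Rabs_le_between in K.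
    replace (Re (w - a)%C) with (Re w - Re a) in K by (unfold Re; simpl; ring). lra. }
  apply (Cder_Cint0 (gphi 0) (gphi 1) (gphi 2) (Ngauss 0) (Ngauss 1) a M (Re a / 2)).
  - lra.
  - intros; apply Cder_gphi.
  - intros; apply Cder_gphi.
  - intros w u Hwa Hu. apply HM; auto.
  - intros; apply Ccontinuous_gphi.
  - intros; apply Ccontinuous_gphi.
  - intros w Hwa. apply Ngauss_correct; [lia|]. specialize (Hw w Hwa). lra.
  - apply Ngauss_correct; [lia | exact Ha].
Qed.

(** The integrand is the derivative of u exp (- a u^2), which vanishes at both ends. *)
Lemma Ngauss_1 (a : C) : 0 < Re a -> (Ngauss 0 a + 2 * a * Ngauss 1 a)%C = 0%C.
Proof.
  intros Ha.
  assert (H1 : Cint0 (fun u => gphi 0 a u + 2 * a * gphi 1 a u)%C (Ngauss 0 a + 2 * a * Ngauss 1 a)%C).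
  { apply (Cint_plus (gphi 0 a) (fun u => 2 * a * gphi 1 a u)%C); try apply _; [now apply Ngauss_correct; [lia|]|].
    apply (Cint_scal (2 * a)%C (gphi 1 a)); try apply _. apply Ngauss_correct; [lia | exact Ha]. }
  refine (Cint_unique _ _ _ _ _ H1 _).
  replace (RtoC 0) with (0 - 0)%C by ring.
  apply (Cint0_antiderivative (fun u => u * Cexp (- (a * (u * u))))%C).
  - intros u _. apply (Cder_Rder_real (fun w => w * Cexp (- (a * (w * w))))%C). eapply Cder_eq.
    + apply Cder_mult; [apply Cder_id|]. apply Cder_Cexp_comp, Cder_opp, Cder_scal, Cder_mult; apply Cder_id.
    + unfold gphi. simpl. rewrite Rmult_1_r, RtoC_opp, RtoC_mult. ring.
  - intros u _. apply Ccontinuous_plus; [apply Ccontinuous_gphi | apply Ccontinuous_scal, Ccontinuous_gphi].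
  - intros eps He. exists (mkposreal eps He). intros y Hy Hy0.
    assert (Hy' : Rabs (y - 0) < eps) by exact Hy. apply Rabs_def2 in Hy'.
    replace (y * Cexp (- (a * (y * y))) - 0)%C with (y * Cexp (- (a * (y * y))))%C by ring.
    rewrite Cmod_mult, Cmod_RtoC_nonneg, Cmod_Cexp by lra.
    replace (Re (- (a * (y * y)))%C) with (- (Re a * (y * y))) by (unfold Re; simpl; ring).
    assert (exp (- (Re a * (y * y))) <= exp 0) by (apply exp_le_exp; nra). rewrite exp_0 in *.
    assert (0 < exp (- (Re a * (y * y)))) by apply exp_pos. nra.
  - intros eps He. destruct (gauss_phi_bound 2 (Re a) ltac:(lia) Ha) as [M HM].
    exists (Rmax 1 (M / eps)). intros u Hu. assert (M1 := Rmax_l 1 (M / eps)). assert (M2 := Rmax_r 1 (M / eps)).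
    specialize (HM a u ltac:(lra) ltac:(lra)).
    replace (u * Cexp (- (a * (u * u))) - 0)%C with (u * Cexp (- (a * (u * u))))%C by ring.
    rewrite Cmod_mult, Cmod_RtoC_nonneg by lra.
    set (E := Cmod (Cexp (- (a * (u * u))))) in *. assert (HE : 0 <= E) by apply Cmod_ge_0.
    assert (HMu : M < eps * u).
    { apply Rle_lt_trans with (eps * (M / eps)); [right; field; lra | apply Rmult_lt_compat_l; lra]. }
    assert (Hq : (u ^ 2 * E) * (1 + u ^ 2) <= M).
    { apply (Rmult_le_compat_r (1 + u ^ 2)) in HM; [|nra].
      replace (M / (1 + u ^ 2) * (1 + u ^ 2)) with M in HM by (field; nra). exact HM. }
    apply (Rmult_lt_reg_r (u * (1 + u ^ 2))); [nra|].
    apply Rle_lt_trans with M; [nra|]. apply Rlt_trans with (eps * u); [exact HMu|].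
    replace (eps * (u * (1 + u ^ 2))) with (eps * u + eps * u * u ^ 2) by ring.
    assert (0 < eps * u * u ^ 2) by (apply Rmult_lt_0_compat; nra). lra.
Qed.

(** By [Ngauss_1] the integral N satisfies N' = - N / (2 a), so N times the square root of a is
    constant along the segment from 1 to a, which stays in the right half-plane. *)
Lemma Ngauss_closed (a : C) : 0 < Re a -> Ngauss 0 a = (Ngauss 0 1 * Cexp (- (/ 2 * Cln a)))%C.
Proof.
  intros Ha.
  set (f := fun a => (Ngauss 0 a * Cexp (/ 2 * Cln a))%C).
  set (d := fun a => (Ngauss 1 a * Cexp (/ 2 * Cln a) + Ngauss 0 a * (Cexp (/ 2 * Cln a) * (/ 2 * / a)))%C).
  assert (Hre : forall t : R, 0 <= t <= 1 -> 0 < Re (1 + t * (a - 1))%C).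
  { intros t Ht. replace (Re (1 + t * (a - 1))%C) with ((1 - t) * 1 + t * Re a) by (unfold Re; simpl; ring).
    apply convex_gt; lra. }
  assert (K := C_mvt f d 1%C a 0). rewrite Rmult_0_l in K.
  assert (E : Cmod (f a - f 1)%C = 0).
  { apply Rle_antisym; [|apply Cmod_ge_0]. apply K; intros t Ht; specialize (Hre t Ht);
      set (w := (1 + t * (a - 1))%C) in *.
    - apply (Cder_mult (Ngauss 0) (fun a => Cexp (/ 2 * Cln a))%C); [now apply Cder_Ngauss|].
      apply (Cder_Cexp_comp (fun a => / 2 * Cln a)%C), (Cder_scal _ Cln), Cder_Cln. now left.
    - unfold d. assert (Hw0 : w <> 0%C) by (apply slit_neq_0; now left).
      assert (N1 := Ngauss_1 w Hre).
      replace (Ngauss 1 w * Cexp (/ 2 * Cln w) + Ngauss 0 w * (Cexp (/ 2 * Cln w) * (/ 2 * / w)))%C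
        with ((Ngauss 0 w + 2 * w * Ngauss 1 w) * (Cexp (/ 2 * Cln w) * (/ 2 * / w)))%C by (field; exact Hw0).
      rewrite N1, Cmult_0_l, Cmod_0. lra. }
  apply Cmod_eq_0 in E. unfold f in E.
  assert (L1 : Cln 1 = 0%C) by (rewrite (Cln_RtoC 1), ln_1 by lra; reflexivity).
  rewrite L1, Cmult_0_r, Cexp_0, Cmult_1_r in E.
  rewrite Cexp_opp. assert (Hx := Cexp_neq_0 (/ 2 * Cln a)%C).
  transitivity (((Ngauss 0 a * Cexp (/ 2 * Cln a) - Ngauss 0 1) + Ngauss 0 1) / Cexp (/ 2 * Cln a))%C; [field; exact Hx|].
  rewrite E. field. exact Hx.
Qed.

Lemma gphi_1_real (u : R) : gphi 0 1 u = RtoC (exp (- (u * u))).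
Proof.
  unfold gphi. simpl. rewrite Cmult_1_l, Cmult_1_l, <- RtoC_mult, <- RtoC_opp. apply Cexp_RtoC.
Qed.

Lemma Ngauss_1_value : Ngauss 0 1 = RtoC (sqrt PI / 2).
Proof.
  assert (HP := PI_RGT_0).
  assert (HI := Ngauss_correct 0 1%C ltac:(lia) ltac:(simpl; lra)).
  set (N := Ngauss 0 1) in *.
  assert (HL := Cint0_limit _ _ 1 HI (Ccontinuous_gphi 0 1%C)).
  assert (Hb : forall u, 0 <= u <= 1 -> Cmod (gphi 0 1 u) <= 1).
  { intros u _. rewrite gphi_1_real, Cmod_RtoC_nonneg by (left; apply exp_pos).
    rewrite <- exp_0. apply exp_le_exp. nra. }
  specialize (HL Hb).
  assert (Hint : forall b, is_RInt (V := C_R_CompleteNormedModule) (gphi 0 1) 0 b (RtoC (gaussI b))).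
  { intros b. apply (is_RInt_ext (V := C_R_CompleteNormedModule) (fun u => RtoC (exp (- (u * u))))).
    { intros; symmetry; apply gphi_1_real. }
    apply (is_RInt_fct_extend_pair (U := R_NormedModule) (V := R_NormedModule) (fun u => RtoC (exp (- (u * u)))) 0 b).
    - apply (RInt_correct (V := R_CompleteNormedModule)), ex_RInt_gauss.
    - assert (K : is_RInt (V := R_NormedModule) (fun _ : R => 0) 0 b ((b - 0) * 0))
        by apply (is_RInt_const (V := R_NormedModule) 0 b 0).
      rewrite Rmult_0_r in K. exact K. }
  assert (Hpos : forall b, 0 < b -> 0 <= gaussI b).
  { intros b Hb0. apply (RInt_ge_0 (fun s => exp (- (s * s))) 0 b); [lra | apply ex_RInt_gauss | intros; left; apply exp_pos]. }
  set (s := sqrt PI / 2). assert (Hs : 0 < s) by (unfold s; assert (K := sqrt_lt_R0 PI HP); lra).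
  assert (Hss : s * s = PI / 4).
  { unfold s. replace (sqrt PI / 2 * (sqrt PI / 2)) with (sqrt PI * sqrt PI / 4) by field. rewrite sqrt_sqrt; lra. }
  assert (E : Cmod (N - RtoC s)%C = 0).
  { apply (zero_of_le_all _ 2); [apply Cmod_ge_0 | lra|]. intros e He.
    destruct (HL e ltac:(lra)) as [B HB].
    assert (Hes : 0 < e * s) by nra.
    set (b := Rmax (Rmax B 0 + 1) (/ (e * s) + 1)).
    assert (Hb1 := Rmax_l (Rmax B 0 + 1) (/ (e * s) + 1)). assert (Hb2 := Rmax_r (Rmax B 0 + 1) (/ (e * s) + 1)). fold b in Hb1, Hb2.
    assert (Hb3 := Rmax_l B 0). assert (Hb4 := Rmax_r B 0).
    assert (Hi := Rinv_0_lt_compat _ Hes).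
    specialize (HB b _ ltac:(lra) (Hint b)).
    assert (HJ := gaussJ_bound b ltac:(lra)). assert (Hid := gauss_identity b). assert (HIp := Hpos b ltac:(lra)).
    assert (HJ2 : gaussJ b <= e * s).
    { apply Rle_trans with (/ (b * b)); [lra|]. rewrite <- (Rinv_inv (e * s)). apply Rinv_le_contravar; [exact Hi|]. nra. }
    (* As s^2 - [gaussI b]^2 = [gaussJ b], dividing by s + [gaussI b] >= s leaves a gap of at most
       [gaussJ b] / s. *)
    assert (Hd : Rabs (gaussI b - s) <= e).
    { assert (Hfac : (s - gaussI b) * (s + gaussI b) = gaussJ b) by nra.
      rewrite Rabs_minus_sym. apply Rabs_le. split; nra. }
    replace (N - RtoC s)%C with (RtoC (gaussI b - s) - (RtoC (gaussI b) - N))%C by (rewrite RtoC_minus; ring).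
    eapply Rle_trans; [apply Cmod_triangle_minus|]. rewrite Cmod_R. lra. }
  apply Cmod_eq_0 in E. transitivity (N - RtoC s + RtoC s)%C; [ring | rewrite E; ring].
Qed.

(** Evenness doubles the half line integral; the two improper integrals are compared on the
    intervals [-b, b]. *)
Lemma gauss_line (a : C) : 0 < Re a ->
  CintR (gphi 0 a) (RtoC (sqrt PI) * Cexp (- (/ 2 * Cln a)))%C.
Proof.
  intros Ha. destruct (gphi_bound (Re a) Ha) as [M HM].
  assert (Heven : forall u, gphi 0 a (- u) = gphi 0 a u).
  { intros u. unfold gphi. simpl. f_equal. f_equal. rewrite RtoC_opp. ring. }
  assert (Hz : Cmod (gphi 0 a 0) <= 1).
  { unfold gphi. simpl. replace (- (a * (0 * 0)))%C with (RtoC 0) by ring. rewrite Cexp_0, Cmult_1_l, Cmod_1. lra. }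
  set (M' := Rmax M 1).
  destruct (CintR_dom (gphi 0 a) M') as [L [HL _]].
  - intros; apply Ccontinuous_gphi.
  - intros u. assert (Hp : 0 <= / (1 + u ^ 2)) by (left; apply Rinv_0_lt_compat; nra).
    assert (M1 := Rmax_l M 1). assert (M2 := Rmax_r M 1). fold M' in M1, M2.
    destruct (Rtotal_order u 0) as [H|[H|H]].
    + rewrite <- Heven. eapply Rle_trans; [apply (HM 0%nat a (- u)); [lia | lra | lra]|].
      replace ((- u) ^ 2) with (u ^ 2) by ring. now apply Rmult_le_compat_r.
    + subst u. eapply Rle_trans; [exact Hz|]. unfold Rdiv. replace (/ (1 + 0 ^ 2)) with 1 by (simpl; field). lra.
    + eapply Rle_trans; [apply (HM 0%nat a u); [lia | lra | lra]|]. now apply Rmult_le_compat_r.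
  - assert (HI := Ngauss_correct 0 a ltac:(lia) Ha).
    assert (Hb : forall u, 0 <= u <= 1 -> Cmod (gphi 0 a u) <= 1).
    { intros u _. unfold gphi. simpl. rewrite Cmult_1_l, Cmod_Cexp.
      replace (Re (- (a * (u * u)))%C) with (- (Re a * (u * u))) by (unfold Re; simpl; ring).
      rewrite <- exp_0. apply exp_le_exp. nra. }
    assert (H0 := Cint0_limit _ _ 1 HI (Ccontinuous_gphi 0 a) Hb).
    assert (HR := CintR_limit _ _ HL).
    assert (E : Cmod (L - 2 * Ngauss 0 a)%C = 0).
    { apply (zero_of_le_all _ 3); [apply Cmod_ge_0 | lra|]. intros e He.
      destruct (H0 e ltac:(lra)) as [B0 HB0]. destruct (HR e ltac:(lra)) as [B1 HB1].
      set (b := Rmax B0 B1 + 1). assert (K1 := Rmax_l B0 B1). assert (K2 := Rmax_r B0 B1).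
      destruct (HB1 b ltac:(unfold b; lra)) as [y [Hy Hyb]].
      assert (Hex : exists r : C, is_RInt (V := C_R_CompleteNormedModule) (gphi 0 a) 0 b r)
        by (apply (ex_RInt_continuous (V := C_R_CompleteNormedModule)); intros; apply Ccontinuous_gphi).
      destruct Hex as [r Hr].
      specialize (HB0 b r ltac:(unfold b; lra) Hr).
      assert (Hneg : is_RInt (V := C_R_CompleteNormedModule) (gphi 0 a) (- b) 0 r).
      { apply (is_RInt_swap (V := C_R_CompleteNormedModule)) in Hr.
        replace b with (- - b) in Hr by ring. rewrite <- Ropp_0 in Hr at 1.
        apply (is_RInt_comp_opp (V := C_R_CompleteNormedModule)) in Hr.
        apply (is_RInt_opp (V := C_R_CompleteNormedModule)) in Hr. rewrite opp_opp in Hr.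
        eapply (is_RInt_ext (V := C_R_CompleteNormedModule)); [|exact Hr].
        intros x _. change ((- - gphi 0 a (- x))%C = gphi 0 a x). rewrite Heven. ring. }
      assert (Ey : y = (r + r)%C).
      { rewrite <- (is_RInt_unique (V := C_R_CompleteNormedModule) _ _ _ _ Hy).
        apply (is_RInt_unique (V := C_R_CompleteNormedModule)).
        now apply (is_RInt_Chasles (V := C_R_CompleteNormedModule) (gphi 0 a) (- b) 0 b). }
      subst y.
      replace (L - 2 * Ngauss 0 a)%C with ((r - Ngauss 0 a) + (r - Ngauss 0 a) - (r + r - L))%C by ring.
      eapply Rle_trans; [apply Cmod_triangle_minus|].
      assert (T := Cmod_triangle (r - Ngauss 0 a)%C (r - Ngauss 0 a)%C). lra. }
    apply Cmod_eq_0 in E.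
    replace (RtoC (sqrt PI) * Cexp (- (/ 2 * Cln a)))%C with L; [exact HL|].
    transitivity (L - 2 * Ngauss 0 a + 2 * Ngauss 0 a)%C; [ring|]. rewrite E, Ngauss_closed, Ngauss_1_value by exact Ha.
    rewrite RtoC_div by lra. field.
Qed.

(** * Shifting a horizontal contour *)

Definition iy (y : R) : C := (0, y).

Lemma Im_iy (y t : R) : Im (iy y + RtoC t)%C = y.
Proof. unfold Im, iy; simpl; ring. Qed.
Lemma Re_iy (y t : R) : Re (iy y + RtoC t)%C = t.
Proof. unfold Re, iy; simpl; ring. Qed.

Lemma Ccontinuous_line (f : C -> C) (z l : C) (t : R) :
  Cder f (z + RtoC t)%C l -> Ccontinuous (fun s => f (z + RtoC s)%C) t.
Proof. intros H. eapply Rder_Ccontinuous, Rder_shift, H. Qed.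

Section Shift.

Variables (f f1 f2 : C -> C) (ya yb M : R).
Hypothesis Hab : ya <= yb.
Hypothesis Hf : forall z, ya <= Im z <= yb -> Cder f z (f1 z).
Hypothesis Hf1 : forall z, ya <= Im z <= yb -> Cder f1 z (f2 z).
Hypothesis Hf2 : forall T, exists B, forall z, ya <= Im z <= yb -> Rabs (Re z) <= T -> Cmod (f2 z) <= B.
Hypothesis HM : forall z, ya <= Im z <= yb -> Cmod (f z) <= M / (1 + Re z ^ 2).

Let line (y : R) (t : R) : C := f (iy y + RtoC t)%C.

Lemma ex_line (T y : R) : ya <= y <= yb -> exists l : C, is_RInt (V := C_R_CompleteNormedModule) (line y) (- T) T l.
Proof.
  intros Hy. apply (ex_RInt_continuous (V := C_R_CompleteNormedModule)). intros t _.
  eapply (Ccontinuous_line f). apply Hf. now rewrite Im_iy.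
Qed.

(** A substitute for Cauchy's theorem: f (z + i h) - f (z) differs from i h f'(z) by O(h^2), and the
    linear term integrates exactly to the values at the two vertical ends, where f is small. *)
Lemma shift_step (T B y h : R) (l l' : C) : 0 < T -> 0 <= h -> ya <= y -> y + h <= yb ->
  (forall z, ya <= Im z <= yb -> Rabs (Re z) <= T -> Cmod (f2 z) <= B) ->
  is_RInt (V := C_R_CompleteNormedModule) (line y) (- T) T l ->
  is_RInt (V := C_R_CompleteNormedModule) (line (y + h)) (- T) T l' ->
  Cmod (l' - l)%C <= h * (2 * M / (1 + T ^ 2)) + 2 * T * (B * (h * h)).
Proof.
  intros HT Hh Hy Hyh HB Hl Hl'.
  set (d := iy h).
  assert (Hd : Cmod d = h).
  { unfold d, iy, Cmod; simpl. rewrite Rmult_0_l, Rplus_0_l, Rmult_1_r. apply sqrt_square. exact Hh. }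
  assert (HI : is_RInt (V := C_R_CompleteNormedModule) (fun t => d * f1 (iy y + RtoC t))%C (- T) T
     (d * (f (iy y + RtoC T) - f (iy y + RtoC (- T))))%C).
  { apply is_RInt_Cmult. apply (is_RInt_Rder (fun t => f (iy y + RtoC t)%C)); intros t _.
    - apply Rder_shift, Hf. rewrite Im_iy. lra.
    - eapply (Ccontinuous_line f1), Hf1. rewrite Im_iy. lra. }
  assert (HD : is_RInt (V := C_R_CompleteNormedModule)
     (fun t => line (y + h) t - line y t - d * f1 (iy y + RtoC t))%C (- T) T
     (l' - l - d * (f (iy y + RtoC T) - f (iy y + RtoC (- T))))%C).
  { apply (is_RInt_minus (V := C_R_CompleteNormedModule) (fun t => line (y + h) t - line y t)%C); [|exact HI].
    now apply (is_RInt_minus (V := C_R_CompleteNormedModule) (line (y + h)) (line y)). }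
  assert (K : Cmod (l' - l - d * (f (iy y + RtoC T) - f (iy y + RtoC (- T))))%C <= (T - - T) * (B * (h * h))).
  { rewrite Cmod_norm.
    apply (norm_RInt_le_const (V := C_R_CompleteNormedModule)
      (fun t => line (y + h) t - line y t - d * f1 (iy y + RtoC t))%C (- T) T); [lra | | exact HD].
    intros t Ht. rewrite <- Cmod_norm. unfold line.
    replace (iy (y + h) + RtoC t)%C with ((iy y + RtoC t) + d)%C
      by (unfold d, iy; apply Ceq_pair; unfold Re, Im; simpl; ring).
    rewrite (Cmult_comm d). rewrite <- Hd.
    assert (Hz : forall s : R, 0 <= s <= 1 ->
      ya <= Im (iy y + RtoC t + s * d)%C <= yb /\ Rabs (Re (iy y + RtoC t + s * d)%C) <= T).
    { intros s Hs. replace (Im (iy y + RtoC t + s * d)%C) with (y + s * h) by (unfold Im, d, iy; simpl; ring).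
      replace (Re (iy y + RtoC t + s * d)%C) with t by (unfold Re, d, iy; simpl; ring).
      split; [nra | apply Rabs_le; lra]. }
    apply (Taylor2_bound f f1 f2); intros s Hs; destruct (Hz s Hs); auto. }
  replace (l' - l)%C with ((l' - l - d * (f (iy y + RtoC T) - f (iy y + RtoC (- T)))) +
     d * (f (iy y + RtoC T) - f (iy y + RtoC (- T))))%C by ring.
  eapply Rle_trans; [apply Cmod_triangle|]. rewrite Cmod_mult, Hd.
  assert (T1 := Cmod_triangle_minus (f (iy y + RtoC T)%C) (f (iy y + RtoC (- T))%C)).
  assert (M1 := HM (iy y + RtoC T)%C ltac:(rewrite Im_iy; lra)).
  assert (M2 := HM (iy y + RtoC (- T))%C ltac:(rewrite Im_iy; lra)).
  rewrite Re_iy in M1, M2. replace ((- T) ^ 2) with (T ^ 2) in M2 by ring.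
  assert (h * Cmod (f (iy y + RtoC T) - f (iy y + RtoC (- T)))%C <= h * (2 * M / (1 + T ^ 2))).
  { apply Rmult_le_compat_l; [exact Hh|]. replace (2 * M / (1 + T ^ 2)) with (M / (1 + T ^ 2) + M / (1 + T ^ 2)) by (field; nra). lra. }
  lra.
Qed.

(** The rectangle is cut into n strips of height D / n; their quadratic errors add up to O(1 / n)
    and disappear, while the end contributions add up to the full height. *)
Lemma shift_finite (T : R) (l l' : C) : 0 < T ->
  is_RInt (V := C_R_CompleteNormedModule) (line ya) (- T) T l ->
  is_RInt (V := C_R_CompleteNormedModule) (line yb) (- T) T l' ->
  Cmod (l' - l)%C <= (yb - ya) * (2 * M / (1 + T ^ 2)).
Proof.
  intros HT Hl Hl'. destruct (Hf2 T) as [B HB].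
  set (D := yb - ya). assert (HD : 0 <= D) by (unfold D; lra).
  assert (HB0 : 0 <= B).
  { eapply Rle_trans; [apply Cmod_ge_0 | apply (HB (iy ya + RtoC 0)%C)].
    - rewrite Im_iy; lra.
    - rewrite Re_iy, Rabs_R0. lra. }
  assert (Hn : forall n : nat, (0 < n)%nat ->
    Cmod (l' - l)%C <= D * (2 * M / (1 + T ^ 2)) + 2 * T * (B * (D * D)) * / INR n).
  { intros n Hn. assert (HnR : 0 < INR n) by now apply lt_0_INR.
    set (h := D / INR n). assert (Hh : 0 <= h) by (apply Rmult_le_pos; [lra | left; now apply Rinv_0_lt_compat]).
    assert (Hk : forall k, (k <= n)%nat -> forall lk : C,
       is_RInt (V := C_R_CompleteNormedModule) (line (ya + INR k * h)) (- T) T lk ->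
       Cmod (lk - l)%C <= INR k * (h * (2 * M / (1 + T ^ 2)) + 2 * T * (B * (h * h)))).
    { induction k as [|k IH]; intros Hkn lk Hlk.
      - simpl in *. rewrite Rmult_0_l, Rplus_0_r in Hlk.
        assert (E : lk = l).
        { rewrite <- (is_RInt_unique (V := C_R_CompleteNormedModule) _ _ _ _ Hlk).
          now apply (is_RInt_unique (V := C_R_CompleteNormedModule)). }
        rewrite E. replace (l - l)%C with (RtoC 0) by ring. rewrite Cmod_0. lra.
      - rewrite S_INR in *.
        assert (Hkn' : INR k + 1 <= INR n) by (rewrite <- S_INR; now apply le_INR).
        assert (Hk0 := pos_INR k).
        assert (Hnh : INR n * h = D) by (unfold h; field; lra).
        assert (Hkh : (INR k + 1) * h <= D) by (rewrite <- Hnh; apply Rmult_le_compat_r; lra).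
        assert (Hkh0 : 0 <= INR k * h) by (now apply Rmult_le_pos).
        assert (HkD : (INR k + 1) * h <= yb - ya) by exact Hkh.
        destruct (ex_line T (ya + INR k * h)) as [m Hm]; [clear Hk0 Hnh; split; lra|].
        specialize (IH ltac:(lia) m Hm).
        replace (ya + (INR k + 1) * h) with (ya + INR k * h + h) in Hlk by ring.
        assert (S := shift_step T B (ya + INR k * h) h m lk HT Hh ltac:(lra) ltac:(lra) HB Hm Hlk).
        replace (lk - l)%C with ((lk - m) + (m - l))%C by ring.
        eapply Rle_trans; [apply Cmod_triangle|]. lra. }
    specialize (Hk n (le_n n) l'). replace (ya + INR n * h) with yb in Hk by (unfold h, D; field; lra).
    specialize (Hk Hl').
    replace (D * (2 * M / (1 + T ^ 2)) + 2 * T * (B * (D * D)) * / INR n)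
      with (INR n * (h * (2 * M / (1 + T ^ 2)) + 2 * T * (B * (h * h)))); [exact Hk|].
    unfold h. field. split; nra. }
  apply Rnot_lt_le. intros Hlt.
  set (c := 2 * T * (B * (D * D))) in *.
  assert (Hc : 0 <= c) by (unfold c; apply Rmult_le_pos; [lra | apply Rmult_le_pos; [lra | nra]]).
  set (g := Cmod (l' - l)%C - D * (2 * M / (1 + T ^ 2))) in *. assert (Hg : 0 < g) by (unfold g; lra).
  destruct (archimed_cor1 (g / (c + 1)) ltac:(apply Rdiv_lt_0_compat; lra)) as [n [Hn1 Hn2]].
  specialize (Hn n Hn2).
  assert (HnR : 0 < / INR n) by (apply Rinv_0_lt_compat, lt_0_INR; exact Hn2).
  assert ((c + 1) * / INR n < g).
  { apply (Rmult_lt_compat_l (c + 1)) in Hn1; [|lra].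
    replace ((c + 1) * (g / (c + 1))) with g in Hn1 by (field; lra). exact Hn1. }
  unfold g in *. nra.
Qed.

Lemma contour_shift (La Lb : C) : CintR (line ya) La -> CintR (line yb) Lb -> La = Lb.
Proof.
  intros Ha Hb.
  assert (HM0 : 0 <= M).
  { assert (K := HM (iy ya + RtoC 0)%C ltac:(rewrite Im_iy; lra)). rewrite Re_iy in K.
    replace (M / (1 + 0 ^ 2)) with M in K by (simpl; field). assert (K0 := Cmod_ge_0 (f (iy ya + RtoC 0)%C)). lra. }
  assert (E : Cmod (Lb - La)%C = 0).
  { apply (zero_of_le_all _ (2 + (yb - ya) * (2 * M))); [apply Cmod_ge_0 | |].
    { assert (0 <= (yb - ya) * (2 * M)) by (apply Rmult_le_pos; lra). lra. }
    intros e He.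
    destruct (CintR_limit _ _ Ha e ltac:(lra)) as [B1 H1]. destruct (CintR_limit _ _ Hb e ltac:(lra)) as [B2 H2].
    set (T := Rmax (Rmax B1 B2) (/ e) + 1).
    assert (K1 := Rmax_l (Rmax B1 B2) (/ e)). assert (K2 := Rmax_r (Rmax B1 B2) (/ e)).
    assert (K3 := Rmax_l B1 B2). assert (K4 := Rmax_r B1 B2).
    assert (Hie : 0 < / e) by (apply Rinv_0_lt_compat; lra).
    destruct (H1 T ltac:(unfold T; lra)) as [l [Hl Hle]]. destruct (H2 T ltac:(unfold T; lra)) as [l' [Hl' Hle']].
    assert (S := shift_finite T l l' ltac:(unfold T; lra) Hl Hl').
    assert (HT : / (1 + T ^ 2) <= e).
    { rewrite <- (Rinv_inv e). apply Rinv_le_contravar; [exact Hie|]. assert (/ e + 1 <= T) by (unfold T; lra). nra. }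
    replace (Lb - La)%C with ((l' - l) - (l' - Lb) + (l - La))%C by ring.
    eapply Rle_trans; [apply Cmod_triangle|].
    assert (T1 := Cmod_triangle_minus (l' - l)%C (l' - Lb)%C).
    assert ((yb - ya) * (2 * M / (1 + T ^ 2)) <= (yb - ya) * (2 * M) * e).
    { rewrite (Rmult_assoc (yb - ya)). apply Rmult_le_compat_l; [lra|]. apply Rmult_le_compat_l; lra. }
    lra. }
  apply Cmod_eq_0 in E. transitivity (Lb - (Lb - La))%C; [ring | rewrite E; ring].
Qed.

End Shift.

(** * Laplace's method *)

(** The variable s is the distance to the saddle divided by b, so the window |s| <= dl / b is a
    fixed neighbourhood of the saddle. The difference from the Gaussian is shown to be at most M b /
    (1 + s^2) for every s, which gives existence and the error at once. *)
Lemma laplace (A : R -> R -> C) (a : C) (kap dl Cc b0 : R) :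
  0 < kap -> kap <= Re a -> 0 < dl -> 0 <= Cc -> 0 < b0 ->
  (forall b s, 0 < b < b0 -> Ccontinuous (fun s => Cexp (A b s)) s) ->
  (forall b s, 0 < b < b0 -> Rabs s <= dl / b ->
     Cmod (A b s + a * (s * s))%C <= Cc * b * (1 + Rabs s ^ 3) /\ Re (A b s) <= Cc - kap * (s * s)) ->
  (forall b s, 0 < b < b0 -> dl / b <= Rabs s -> Re (A b s) <= Cc - Rabs s) ->
  exists K, 0 <= K /\ forall b, 0 < b < b0 -> exists I : C, CintR (fun s => Cexp (A b s)) I /\
    Cmod (I - RtoC (sqrt PI) * Cexp (- (/ 2 * Cln a)))%C <= K * b.
Proof.
  intros Hk Hka Hdl HC Hb0 Hcont Hin Hout. assert (HP := PI_RGT_0).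
  (* The power 5 is 3 for the cubic error plus 2 for the majorant 1 / (1 + s^2). *)
  destruct (poly_exp_bound 5 (2 * kap) ltac:(lra)) as [M1 [HM1 B1]].
  destruct (poly_exp_bound 5 1 ltac:(lra)) as [M2 [HM2 B2]].
  assert (HeC := exp_pos Cc). assert (Hek := exp_pos kap).
  (* The first summand is for the window, the second for its complement, where both exponentials are
     estimated separately. *)
  set (M := Cc * exp Cc * exp kap * M1 + / dl * (exp Cc * M2 + exp kap * M1)).
  assert (Hid : 0 < / dl) by now apply Rinv_0_lt_compat.
  assert (HM : 0 <= M).
  { unfold M. apply Rplus_le_le_0_compat.
    - apply Rmult_le_pos; [|lra]. apply Rmult_le_pos; [|lra]. apply Rmult_le_pos; lra.
    - apply Rmult_le_pos; [lra|]. apply Rplus_le_le_0_compat; apply Rmult_le_pos; lra. }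
  exists (M * PI). split; [now apply Rmult_le_pos; [|lra]|]. intros b Hb.
  assert (Hgs : forall s, gphi 0 a s = Cexp (- (a * (s * s)))) by (intros; unfold gphi; simpl; ring).
  assert (Hq : forall s, exp (- (kap * (s * s))) <= exp kap * exp (- (2 * kap * Rabs s))).
  { intros s. rewrite <- exp_plus. apply exp_le_exp.
    assert (Es : s * s = Rabs s * Rabs s) by (rewrite <- Rabs_mult, Rabs_pos_eq; nra).
    assert (0 <= kap * ((Rabs s - 1) * (Rabs s - 1))) by (apply Rmult_le_pos; [lra | apply Rle_0_sqr]).
    rewrite Es. lra. }
  assert (Hga : forall s : R, Cmod (Cexp (- (a * (s * s)))) <= exp (- (kap * (s * s)))).
  { intros s. rewrite Cmod_Cexp.
    replace (Re (- (a * (s * s)))%C) with (- (Re a * (s * s))) by (unfold Re; simpl; ring).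
    apply exp_le_exp. assert (0 <= (Re a - kap) * (s * s)) by (apply Rmult_le_pos; [lra | apply Rle_0_sqr]). lra. }
  assert (Hdom : forall s, Cmod (Cexp (A b s) - gphi 0 a s)%C <= M * b / (1 + s ^ 2)).
  { intros s. rewrite Hgs. set (x := Rabs s). assert (Hx : 0 <= x) by apply Rabs_pos.
    assert (Es : s ^ 2 = x ^ 2) by (unfold x; now rewrite pow2_abs).
    assert (Hs2 : 0 < 1 + x ^ 2) by nra.
    rewrite Es. specialize (B1 x Hx). specialize (B2 x Hx).
    assert (Hp5 : (1 + x) ^ 5 = (1 + x) ^ 3 * (1 + x) ^ 2) by ring.
    assert (Hx2 : 1 + x ^ 2 <= (1 + x) ^ 2) by nra.
    assert (Hx3 : 1 + x ^ 3 <= (1 + x) ^ 3) by nra.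
    set (e1 := exp (- (2 * kap * x))) in *. assert (He1 : 0 < e1) by apply exp_pos.
    rewrite Rmult_1_l in B2. set (e2 := exp (- x)) in *. assert (He2 : 0 < e2) by apply exp_pos.
    assert (Hp3 : 0 <= (1 + x) ^ 3) by (apply pow_le; lra).
    assert (F1 : (1 + x) ^ 3 * e1 <= M1 / (1 + x ^ 2)).
    { apply (Rmult_le_reg_r (1 + x ^ 2)); [exact Hs2|].
      replace (M1 / (1 + x ^ 2) * (1 + x ^ 2)) with M1 by (field; lra).
      apply Rle_trans with ((1 + x) ^ 3 * e1 * (1 + x) ^ 2); [apply Rmult_le_compat_l; [apply Rmult_le_pos; lra | lra]|].
      rewrite Hp5 in B1. lra. }
    assert (F2 : (1 + x) ^ 3 * e2 <= M2 / (1 + x ^ 2)).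
    { apply (Rmult_le_reg_r (1 + x ^ 2)); [exact Hs2|].
      replace (M2 / (1 + x ^ 2) * (1 + x ^ 2)) with M2 by (field; lra).
      apply Rle_trans with ((1 + x) ^ 3 * e2 * (1 + x) ^ 2); [apply Rmult_le_compat_l; [apply Rmult_le_pos; lra | lra]|].
      rewrite Hp5 in B2. lra. }
    assert (Hx1 : x <= (1 + x) ^ 3) by nra.
    assert (Hi2 : 0 < / (1 + x ^ 2)) by now apply Rinv_0_lt_compat.
    assert (Hq' := Hq s). fold x in Hq'. fold e1 in Hq'.
    destruct (Rle_dec x (dl / b)) as [Hxd|Hxd].
    - destruct (Hin b s Hb Hxd) as [I1 I2]. fold x in I1.
      eapply Rle_trans; [apply Cexp_diff|].
      replace (A b s - - (a * (s * s)))%C with (A b s + a * (s * s))%C by ring.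
      assert (Hmax : exp (Rmax (Re (A b s)) (Re (- (a * (s * s)))%C)) <= exp Cc * (exp kap * e1)).
      { apply Rle_trans with (exp Cc * exp (- (kap * (s * s)))).
        - rewrite <- exp_plus. apply exp_le_exp. apply Rmax_lub; [lra|].
          replace (Re (- (a * (s * s)))%C) with (- (Re a * (s * s))) by (unfold Re; simpl; ring).
          assert (0 <= (Re a - kap) * (s * s)) by (apply Rmult_le_pos; [lra | apply Rle_0_sqr]). lra.
        - apply Rmult_le_compat_l; lra. }
      apply Rle_trans with (Cc * b * (1 + x) ^ 3 * (exp Cc * (exp kap * e1))).
      + apply Rmult_le_compat; [apply Cmod_ge_0 | left; apply exp_pos | | exact Hmax].
        eapply Rle_trans; [exact I1|]. apply Rmult_le_compat_l; [apply Rmult_le_pos; lra | exact Hx3].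
      + replace (Cc * b * (1 + x) ^ 3 * (exp Cc * (exp kap * e1))) with
          (Cc * exp Cc * exp kap * b * ((1 + x) ^ 3 * e1)) by ring.
        assert (Hcc : 0 <= Cc * exp Cc * exp kap * b)
          by (apply Rmult_le_pos; [apply Rmult_le_pos; [apply Rmult_le_pos|]|]; lra).
        apply Rle_trans with (Cc * exp Cc * exp kap * b * (M1 / (1 + x ^ 2))); [now apply Rmult_le_compat_l|].
        replace (Cc * exp Cc * exp kap * b * (M1 / (1 + x ^ 2))) with
          (Cc * exp Cc * exp kap * M1 * b * / (1 + x ^ 2)) by (field; lra).
        unfold Rdiv. apply Rmult_le_compat_r; [lra|]. apply Rmult_le_compat_r; [lra|]. unfold M.
        assert (0 <= / dl * (exp Cc * M2 + exp kap * M1)).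
        { apply Rmult_le_pos; [lra|]. apply Rplus_le_le_0_compat; apply Rmult_le_pos; lra. }
        lra.
    - assert (Hxd' : dl / b <= x) by lra. assert (I2 := Hout b s Hb Hxd'). fold x in I2.
      (* Outside the window this inequality supplies the missing factor b at the price of one power
         of |s|. *)
      assert (Hone : 1 <= / dl * b * x).
      { apply (Rmult_le_compat_l (/ dl * b)) in Hxd'; [|apply Rmult_le_pos; lra].
        replace (/ dl * b * (dl / b)) with 1 in Hxd' by (field; lra). exact Hxd'. }
      assert (HA : Cmod (Cexp (A b s)) <= exp Cc * e2).
      { rewrite Cmod_Cexp. unfold e2. rewrite <- exp_plus. apply exp_le_exp. lra. }
      assert (HG := Hga s).
      eapply Rle_trans; [apply Cmod_triangle_minus|].
      set (S := exp Cc * e2 + exp kap * e1). assert (HS : 0 <= S) by (unfold S; apply Rplus_le_le_0_compat; apply Rmult_le_pos; lra).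
      apply Rle_trans with S; [unfold S; lra|].
      apply Rle_trans with (/ dl * b * (x * S)); [nra|].
      assert (HxS : x * S <= (exp Cc * M2 + exp kap * M1) * / (1 + x ^ 2)).
      { apply Rle_trans with ((1 + x) ^ 3 * S); [now apply Rmult_le_compat_r|]. unfold S.
        replace ((1 + x) ^ 3 * (exp Cc * e2 + exp kap * e1)) with
          (exp Cc * ((1 + x) ^ 3 * e2) + exp kap * ((1 + x) ^ 3 * e1)) by ring.
        replace ((exp Cc * M2 + exp kap * M1) * / (1 + x ^ 2)) with
          (exp Cc * (M2 / (1 + x ^ 2)) + exp kap * (M1 / (1 + x ^ 2))) by (field; lra).
        apply Rplus_le_compat; apply Rmult_le_compat_l; lra. }
      apply Rle_trans with (/ dl * b * ((exp Cc * M2 + exp kap * M1) * / (1 + x ^ 2))).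
      { apply Rmult_le_compat_l; [apply Rmult_le_pos; lra | exact HxS]. }
      replace (/ dl * b * ((exp Cc * M2 + exp kap * M1) * / (1 + x ^ 2))) with
        (/ dl * (exp Cc * M2 + exp kap * M1) * b * / (1 + x ^ 2)) by ring.
      unfold Rdiv. apply Rmult_le_compat_r; [lra|]. apply Rmult_le_compat_r; [lra|]. unfold M.
      assert (0 <= Cc * exp Cc * exp kap * M1)
        by (apply Rmult_le_pos; [apply Rmult_le_pos; [apply Rmult_le_pos|]|]; lra).
      lra. }
  destruct (CintR_dom (fun s => Cexp (A b s) - gphi 0 a s)%C (M * b)) as [D [HD HDb]].
  - intros s. apply Ccontinuous_minus; [now apply (Hcont b s) | apply Ccontinuous_gphi].
  - exact Hdom.
  - exists (D + RtoC (sqrt PI) * Cexp (- (/ 2 * Cln a)))%C. split.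
    + apply (CintR_ext (fun s => (Cexp (A b s) - gphi 0 a s) + gphi 0 a s)%C); [intros; ring|].
      apply (Cint_plus (fun s => Cexp (A b s) - gphi 0 a s)%C (gphi 0 a)); try apply _; [exact HD|].
      apply gauss_line. lra.
    + replace (D + RtoC (sqrt PI) * Cexp (- (/ 2 * Cln a)) - RtoC (sqrt PI) * Cexp (- (/ 2 * Cln a)))%C with D by ring.
      eapply Rle_trans; [exact HDb|]. lra.
Qed.

(** * Concave functions with a nondegenerate maximum *)

(** Integrating the slope bound gives a quadratic drop up to dl; beyond, the slope stays below - m
    dl, and halving the constant absorbs the drop not yet reached at dl. *)
Lemma concave_max_half (g g1 : R -> R) (m dl : R) : 0 < m -> 0 < dl ->
  (forall t, is_derive g t (g1 t)) ->
  (forall t, 0 <= t <= dl -> g1 t <= - m * t) -> (forall t, dl <= t -> g1 t <= - m * dl) ->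
  forall t, 0 <= t -> (t <= dl -> g t - g 0 <= - (m / 2) * (t * t)) /\
                      (dl <= t -> g t - g 0 <= - (m / 2) * dl * t).
Proof.
  intros Hm Hdl Hd H1 H2.
  assert (Hin : forall t, 0 <= t <= dl -> g t - g 0 <= - (m / 2) * (t * t)).
  { intros t Ht.
    destruct (MVT_gen (fun s => g s + m / 2 * (s * s)) 0 t (fun s => g1 s + m * s)) as [c [Hc K]].
    - intros x _. apply (is_derive_plus g (fun s => m / 2 * (s * s))); [apply Hd|]. auto_derive; [trivial | field].
    - intros x _. apply continuity_pt_filterlim, (ex_derive_continuous (fun s => g s + m / 2 * (s * s))).
      exists (g1 x + m * x). apply (is_derive_plus g (fun s => m / 2 * (s * s))); [apply Hd|]. auto_derive; [trivial | field].
    - rewrite Rmin_left, Rmax_right in Hc by lra. specialize (H1 c ltac:(lra)).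
      assert ((g1 c + m * c) * (t - 0) <= 0) by nra. nra. }
  intros t Ht. split; [intros; apply Hin; lra|]. intros Htd.
  assert (K0 := Hin dl ltac:(lra)).
  destruct (MVT_gen g dl t g1) as [c [Hc K]].
  - intros; apply Hd.
  - intros; apply continuity_pt_filterlim, (ex_derive_continuous g). eexists; apply Hd.
  - rewrite Rmin_left, Rmax_right in Hc by lra. specialize (H2 c ltac:(lra)).
    assert (g1 c * (t - dl) <= - m * dl * (t - dl)) by (apply Rmult_le_compat_r; lra).
    assert (0 <= m * dl) by nra. nra.
Qed.

(** * The phase function *)

(** The derivatives in x of b^2 times the exponent of the integrand at x / b, with beta = b^2 and
    without the factor exp (PI x). The shift mu - i / 2 is the part of mu / b - i Q / 2 of order 1 /
    b. *)
Definition Psi (n : nat) (sg mu beta : R) (x : C) : C :=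
  let S := (Ci * (IPhi n beta (x + RtoC sg) + IPhi n beta (x + RtoC (- sg))))%C in
  match n with
  | 0 => (- (Ci * PI) * (x * x) + 2 * Ci * PI * (mu - Ci / 2) * x + S)%C
  | 1 => (- (2 * Ci * PI) * x + 2 * Ci * PI * (mu - Ci / 2) + S)%C
  | 2 => (- (2 * Ci * PI) + S)%C
  | _ => S
  end.

Lemma Cder_Psi (n : nat) (sg mu beta : R) (x : C) : (n <= 2)%nat -> 0 <= beta -> Rabs (Im x) < 1 / 2 ->
  Cder (Psi n sg mu beta) x (Psi (S n) sg mu beta x).
Proof.
  intros Hn Hb Hx.
  assert (HS : Cder (fun x => Ci * (IPhi n beta (x + RtoC sg) + IPhi n beta (x + RtoC (- sg))))%C x
     (Ci * (IPhi (S n) beta (x + RtoC sg) + IPhi (S n) beta (x + RtoC (- sg))))%C).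
  { assert (K : forall r : R, Cder (fun x => IPhi n beta (x + RtoC r)%C) x (IPhi (S n) beta (x + RtoC r)%C)).
    { intros r. eapply Cder_eq.
      - apply (Cder_comp (IPhi n beta) (fun x => x + RtoC r)%C).
        + apply Cder_IPhi; auto. now rewrite Im_plus_RtoC.
        + apply Cder_plus; [apply Cder_id | apply Cder_const].
      - ring. }
    apply Cder_scal, Cder_plus; apply K. }
  destruct n as [|[|[|n]]]; [| | |lia]; unfold Psi.
  - eapply Cder_eq.
    + apply Cder_plus; [apply Cder_plus|exact HS].
      * apply Cder_scal, Cder_mult; apply Cder_id.
      * apply Cder_scal, Cder_id.
    + cbv beta. ring.
  - eapply Cder_eq.
    + apply Cder_plus; [apply Cder_plus|exact HS]; [apply Cder_scal, Cder_id | apply Cder_const].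
    + cbv beta. ring.
  - eapply Cder_eq.
    + apply Cder_plus; [apply Cder_const | exact HS].
    + cbv beta. ring.
Qed.

Lemma Psi_bound (sg mu beta y0 Z : R) : 0 <= beta -> y0 < 1 / 2 -> 0 <= Z ->
  exists B, 0 <= B /\ forall n x, Rabs (Im x) <= y0 -> Cmod x <= Z -> Cmod (Psi n sg mu beta x) <= B.
Proof.
  intros Hb Hy HZ. assert (HP := PI_RGT_0).
  assert (Hs0 := Rabs_pos sg).
  destruct (IPhi_bound y0 (Z + Rabs sg) beta Hy ltac:(lra) Hb) as [B0 [HB0 H0]].
  set (c := Cmod (2 * Ci * PI * (mu - Ci / 2))%C). assert (Hc : 0 <= c) by apply Cmod_ge_0.
  set (p := PI * Z * Z + 2 * PI * Z + 2 * PI).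
  assert (Hp1 : 0 <= PI * Z * Z) by (apply Rmult_le_pos; [apply Rmult_le_pos; lra | lra]).
  assert (Hp2 : 0 <= PI * Z) by (apply Rmult_le_pos; lra).
  assert (Hcz : 0 <= c * Z) by now apply Rmult_le_pos.
  exists (p + c * Z + c + 2 * B0). split; [unfold p; lra|].
  intros n x Hx HxZ. assert (Hx0 := Cmod_ge_0 x).
  assert (HI : forall r, Rabs r <= Rabs sg -> Cmod (IPhi n beta (x + RtoC r)) <= B0).
  { intros r Hr. apply H0; [now rewrite Im_plus_RtoC|]. eapply Rle_trans; [apply Cmod_triangle|].
    rewrite Cmod_R. lra. }
  assert (HS : Cmod (Ci * (IPhi n beta (x + RtoC sg) + IPhi n beta (x + RtoC (- sg))))%C <= 2 * B0).
  { rewrite Cmod_mult, Cmod_Ci, Rmult_1_l. eapply Rle_trans; [apply Cmod_triangle|].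
    assert (K1 := HI sg ltac:(lra)). assert (K2 := HI (- sg) ltac:(rewrite Rabs_Ropp; lra)). lra. }
  unfold Psi. set (S := (Ci * (IPhi n beta (x + RtoC sg) + IPhi n beta (x + RtoC (- sg))))%C) in *.
  assert (H2i : Cmod (2 * Ci * PI)%C = 2 * PI) by (rewrite !Cmod_mult, Cmod_Ci, !Cmod_RtoC_nonneg by lra; ring).
  destruct n as [|[|[|n]]].
  - eapply Rle_trans; [apply Cmod_triangle|].
    assert (T := Cmod_triangle (- (Ci * PI) * (x * x)) (2 * Ci * PI * (mu - Ci / 2) * x)).
    rewrite (Cmod_mult (2 * Ci * PI * (mu - Ci / 2))) in T. fold c in T.
    rewrite (Cmod_mult (- (Ci * PI))), Cmod_opp, !Cmod_mult, Cmod_Ci, Cmod_RtoC_nonneg in T by lra.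
    assert (1 * PI * (Cmod x * Cmod x) <= PI * Z * Z).
    { rewrite Rmult_1_l, Rmult_assoc. apply Rmult_le_compat_l; [lra|]. apply Rmult_le_compat; lra. }
    assert (c * Cmod x <= c * Z) by (apply Rmult_le_compat_l; lra).
    unfold p. lra.
  - eapply Rle_trans; [apply Cmod_triangle|].
    assert (T := Cmod_triangle (- (2 * Ci * PI) * x) (2 * Ci * PI * (mu - Ci / 2))). fold c in T.
    rewrite (Cmod_mult (- (2 * Ci * PI))), Cmod_opp, H2i in T.
    assert (2 * PI * Cmod x <= 2 * PI * Z) by (apply Rmult_le_compat_l; lra). unfold p. lra.
  - eapply Rle_trans; [apply Cmod_triangle|]. rewrite Cmod_opp, H2i. unfold p. lra.
  - unfold p. lra.
Qed.

Lemma Psi1_closed (sg mu : R) (x : C) : Rabs (Im x) < 1 / 2 ->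
  Psi 1 sg mu 0 x = (2 * Ci * PI * mu + PI - Ci * (splog (x + RtoC sg) + splog (x + RtoC (- sg))))%C.
Proof.
  intros Hx. unfold Psi. rewrite !IPhi1_closed by now rewrite Im_plus_RtoC.
  assert (Ei := Ci_sqr). rewrite RtoC_opp. field [Ei].
Qed.

Lemma Psi2_closed (sg mu : R) (x : C) : Rabs (Im x) < 1 / 2 ->
  Psi 2 sg mu 0 x = (- (2 * Ci * PI) * (q2 (x + RtoC sg) / (1 + q2 (x + RtoC sg)) +
      q2 (x + RtoC (- sg)) / (1 + q2 (x + RtoC (- sg)))))%C.
Proof.
  intros Hx. unfold Psi. rewrite !IPhi2_closed by now rewrite Im_plus_RtoC.
  field. split; apply q2_neq; now rewrite Im_plus_RtoC.
Qed.

Lemma Im_sigmoid_neg (w : C) : Im w < 0 -> Im (w / (1 + w))%C < 0.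
Proof.
  intros H. assert (Hd : 0 < (1 + Re w) * (1 + Re w) + Im w * Im w).
  { assert (0 < Im w * Im w) by nra. assert (K := Rle_0_sqr (1 + Re w)). unfold Rsqr in K. lra. }
  replace (Im (w / (1 + w))%C) with (Im w / ((1 + Re w) * (1 + Re w) + Im w * Im w)).
  - apply (Rmult_lt_reg_r ((1 + Re w) * (1 + Re w) + Im w * Im w)); [exact Hd|].
    unfold Rdiv. rewrite Rmult_assoc, Rinv_l; lra.
  - destruct w as [u v]. unfold Re, Im in *; simpl in *. field.
    replace ((1 + u) * ((1 + u) * 1) + (0 + v) * ((0 + v) * 1)) with ((1 + u) * (1 + u) + v * v) by ring. lra.
Qed.

(** The second derivative is - 2 PI i times a sum of terms w / (1 + w) with w = q. In the lower half
    strip w lies in the lower half-plane, which this Moebius map preserves, so the real part is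
    strictly concave on horizontal lines. *)
Lemma Re_Psi2_neg (sg mu : R) (x : C) : - (1 / 2) < Im x < 0 -> Re (Psi 2 sg mu 0 x) < 0.
Proof.
  intros Hx. assert (HP := PI_RGT_0). rewrite Psi2_closed by now apply half_strip_strip.
  assert (K : forall r : R, Im (q2 (x + RtoC r) / (1 + q2 (x + RtoC r)))%C < 0).
  { intros r. apply Im_sigmoid_neg, Im_q2_neg. now rewrite Im_plus_RtoC. }
  assert (K1 := K sg). assert (K2 := K (- sg)).
  set (u := (q2 (x + RtoC sg) / (1 + q2 (x + RtoC sg)))%C) in *.
  set (v := (q2 (x + RtoC (- sg)) / (1 + q2 (x + RtoC (- sg))))%C) in *.
  replace (Re (- (2 * Ci * PI) * (u + v))%C) with (2 * PI * (Im u + Im v)) by (unfold Re, Im; simpl; ring). nra.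
Qed.

Section Expansion.

Variables sg mu : R.
Hypothesis Hadm : sinh (2 * PI * sg) ^ 2 < exp (2 * PI * mu).

Let x0 := x0Q sg mu.
Let om := omegaQ sg mu.
Let Rr := Rfq sg mu.
Let Mm := exp (2 * PI * mu).

Lemma x0_strip : Rabs (Im x0) < 1 / 2.
Proof. assert (H := Im_x0 sg mu Hadm). apply Rabs_def1; unfold x0; lra. Qed.

Lemma Psi1_x0 : Psi 1 sg mu 0 x0 = 0%C.
Proof.
  rewrite Psi1_closed by apply x0_strip. unfold x0.
  rewrite (splog_z1 sg mu Hadm), (splog_z2 sg mu Hadm).
  assert (Ei := Ci_sqr). rewrite !RtoC_opp, !RtoC_mult, RtoC_div by lra. field [Ei].
Qed.

(** The Gaussian coefficient - Psi''(x0) / 2. Its argument is that of omega, so its square root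
    later cancels against exp (PI x0) up to a constant phase. *)
Definition aQ : C := (RtoC (2 * PI * Rr / Mm) * om)%C.

(** The denominators are exp (2 PI sg) (- sinh - i R) and exp (- 2 PI sg) (sinh - i R); the two
    brackets have product - exp (2 PI mu) and sum - 2 i R. *)
Lemma Psi2_x0 : Psi 2 sg mu 0 x0 = (- (2) * aQ)%C.
Proof.
  assert (HP := PI_RGT_0). assert (HR := Rfq_pos sg mu Hadm). assert (HR2 := Rfq_sqr sg mu Hadm). fold Rr in HR, HR2. fold Mm in HR2.
  assert (HM : 0 < Mm) by apply exp_pos.
  rewrite Psi2_closed by apply x0_strip. unfold x0. rewrite !(q2_x0_shift sg mu Hadm). fold om.
  destruct (ch_sh_exp sg) as [E1 E2].
  replace (2 * PI * - sg) with (- (2 * PI * sg)) by ring.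
  assert (Ee : exp (2 * PI * sg) * exp (- (2 * PI * sg)) = 1) by (rewrite <- exp_plus, Rplus_opp_r; apply exp_0).
  set (sh := sinh (2 * PI * sg)) in *. set (ch := cosh (2 * PI * sg)) in *.
  assert (H1 := exp_pos (2 * PI * sg)). assert (H2 := exp_pos (- (2 * PI * sg))).
  set (e := exp (2 * PI * sg)) in *. set (e' := exp (- (2 * PI * sg))) in *.
  assert (D1 : (1 + - (RtoC e * om))%C = (RtoC e * (RtoC (- sh) - Ci * RtoC Rr))%C).
  { unfold om, omegaQ. fold ch Rr. apply Ceq_pair; unfold Re, Im; simpl; [|ring]. nra. }
  assert (D2 : (1 + - (RtoC e' * om))%C = (RtoC e' * (RtoC sh - Ci * RtoC Rr))%C).
  { unfold om, omegaQ. fold ch Rr. apply Ceq_pair; unfold Re, Im; simpl; [|ring]. nra. }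
  assert (He : RtoC e <> 0%C) by (apply RtoC_neq_0; lra).
  assert (He' : RtoC e' <> 0%C) by (apply RtoC_neq_0; lra).
  assert (HMC : RtoC Mm <> 0%C) by (apply RtoC_neq_0; lra).
  assert (Hprod : ((RtoC (- sh) - Ci * RtoC Rr) * (RtoC sh - Ci * RtoC Rr))%C = (- RtoC Mm)%C).
  { apply Ceq_pair; unfold Re, Im; simpl; nra. }
  assert (N1 : (RtoC (- sh) - Ci * RtoC Rr)%C <> 0%C).
  { intros E. rewrite E, Cmult_0_l in Hprod. apply HMC. transitivity (- (- RtoC Mm))%C; [ring | rewrite <- Hprod; ring]. }
  assert (N2 : (RtoC sh - Ci * RtoC Rr)%C <> 0%C).
  { intros E. rewrite E, Cmult_0_r in Hprod. apply HMC. transitivity (- (- RtoC Mm))%C; [ring | rewrite <- Hprod; ring]. }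
  rewrite D1, D2.
  set (u := (RtoC (- sh) - Ci * RtoC Rr)%C) in *. set (v := (RtoC sh - Ci * RtoC Rr)%C) in *.
  assert (Hsum : (u + v)%C = (- (2) * Ci * RtoC Rr)%C) by (unfold u, v; rewrite RtoC_opp; ring).
  transitivity (2 * Ci * PI * om * (u + v) / (u * v))%C; [field; auto|].
  rewrite Hsum, Hprod. unfold aQ. rewrite RtoC_div, !RtoC_mult by lra.
  assert (Ei := Ci_sqr). field [Ei]. exact HMC.
Qed.

Lemma Re_aQ : 0 < Re aQ.
Proof.
  assert (H := Re_Psi2_neg sg mu x0). rewrite Psi2_x0 in H.
  specialize (H ltac:(assert (K := Im_x0 sg mu Hadm); unfold x0; lra)).
  replace (Re (- (2) * aQ)%C) with (- (2) * Re aQ) in H by (unfold Re; simpl; ring). lra.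
Qed.

Lemma line_strip (t : R) : Rabs (Im (x0 + RtoC t)%C) < 1 / 2.
Proof. rewrite Im_plus_RtoC. apply x0_strip. Qed.

Lemma line_half_strip (t : R) : - (1 / 2) < Im (x0 + RtoC t)%C < 0.
Proof. rewrite Im_plus_RtoC. assert (K := Im_x0 sg mu Hadm). unfold x0. lra. Qed.

Lemma Psi_taylor : exists B, 0 <= B /\ forall t : R, Rabs t <= 1 ->
  Cmod (Psi 1 sg mu 0 (x0 + RtoC t) - Psi 2 sg mu 0 x0 * RtoC t)%C <= B * t ^ 2 /\
  Cmod (Psi 0 sg mu 0 (x0 + RtoC t) - Psi 0 sg mu 0 x0 - / 2 * Psi 2 sg mu 0 x0 * (RtoC t * RtoC t))%C <= B * Rabs t ^ 3.
Proof.
  assert (Hx := x0_strip). assert (Hm := Cmod_ge_0 x0).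
  destruct (Psi_bound sg mu 0 (Rabs (Im x0)) (Cmod x0 + 1) ltac:(lra) Hx ltac:(lra)) as [B [HB0 HB]].
  assert (HBt : forall t : R, Rabs t <= 1 -> Cmod (Psi 3 sg mu 0 (x0 + RtoC t)) <= B).
  { intros t Ht. apply HB; [rewrite Im_plus_RtoC; lra|]. eapply Rle_trans; [apply Cmod_triangle|]. rewrite Cmod_R. lra. }
  assert (H1 : forall t : R, Rabs t <= 1 ->
    Cmod (Psi 1 sg mu 0 (x0 + RtoC t) - Psi 2 sg mu 0 x0 * RtoC t)%C <= B * t ^ 2).
  { intros t Ht.
    assert (K := Taylor2_bound (Psi 1 sg mu 0) (Psi 2 sg mu 0) (Psi 3 sg mu 0) x0 (RtoC t) B).
    assert (E : forall s : R, (x0 + s * RtoC t)%C = (x0 + RtoC (s * t))%C) by (intros; now rewrite RtoC_mult).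
    rewrite Psi1_x0 in K. rewrite Cmod_R, <- Rabs_mult in K.
    rewrite (Rabs_pos_eq (t * t)) in K by nra. replace (t ^ 2) with (t * t) by ring.
    replace (Psi 1 sg mu 0 (x0 + RtoC t) - Psi 2 sg mu 0 x0 * RtoC t)%C
      with (Psi 1 sg mu 0 (x0 + RtoC t) - 0 - Psi 2 sg mu 0 x0 * RtoC t)%C by ring.
    apply K; intros s Hs; rewrite E.
    - apply Cder_Psi; [lia | lra | apply line_strip].
    - apply Cder_Psi; [lia | lra | apply line_strip].
    - apply HBt. rewrite Rabs_mult, (Rabs_pos_eq s) by lra. assert (K0 := Rabs_pos t). nra. }
  exists B. split; [exact HB0|]. intros t Ht. split; [now apply H1|].
  set (P2 := Psi 2 sg mu 0 x0) in *.
  (* The cubic remainder follows from the quadratic remainder of the first derivative by one more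
     mean value inequality. *)
  assert (K := C_mvt (fun w => Psi 0 sg mu 0 w - / 2 * P2 * ((w - x0) * (w - x0)))%C
    (fun w => Psi 1 sg mu 0 w - P2 * (w - x0))%C x0 (x0 + RtoC t)%C (B * t ^ 2)).
  cbv beta in K.
  replace (x0 + RtoC t - x0)%C with (RtoC t) in K by ring.
  replace (x0 - x0)%C with (RtoC 0) in K by ring.
  replace (Psi 0 sg mu 0 (x0 + RtoC t) - Psi 0 sg mu 0 x0 - / 2 * P2 * (RtoC t * RtoC t))%C with
    (Psi 0 sg mu 0 (x0 + RtoC t) - / 2 * P2 * (RtoC t * RtoC t) - (Psi 0 sg mu 0 x0 - / 2 * P2 * (0 * 0)))%C by ring.
  replace (B * Rabs t ^ 3) with (B * t ^ 2 * Cmod (RtoC t)) by (rewrite Cmod_R, <- (pow2_abs t); ring).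
  apply K; intros s Hs; replace (x0 + s * RtoC t)%C with (x0 + RtoC (s * t))%C by (rewrite RtoC_mult; ring).
  - eapply Cder_eq.
    + apply Cder_minus; [apply Cder_Psi; [lia | lra | apply line_strip]|].
      apply Cder_scal, Cder_mult; (apply Cder_minus; [apply Cder_id | apply Cder_const]).
    + cbv beta. field.
  - replace (x0 + RtoC (s * t) - x0)%C with (RtoC (s * t)) by ring.
    assert (Hst : Rabs (s * t) <= 1) by (rewrite Rabs_mult, (Rabs_pos_eq s) by lra; assert (K0 := Rabs_pos t); nra).
    eapply Rle_trans; [now apply H1|]. apply Rmult_le_compat_l; [exact HB0|].
    replace ((s * t) ^ 2) with (s * s * t ^ 2) by ring. assert (0 <= t ^ 2) by nra.
    assert (s * s <= 1) by nra. nra.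
Qed.

Lemma is_derive_Re_Psi (n : nat) (t : R) : (n <= 2)%nat ->
  is_derive (fun s => Re (Psi n sg mu 0 (x0 + RtoC s))) t (Re (Psi (S n) sg mu 0 (x0 + RtoC t))).
Proof. intros Hn. apply (Rder_shift (Psi n sg mu 0)). apply Cder_Psi; [exact Hn | lra | apply line_strip]. Qed.

Lemma Re_Psi1_decr (s t : R) : s <= t -> Re (Psi 1 sg mu 0 (x0 + RtoC t)) <= Re (Psi 1 sg mu 0 (x0 + RtoC s)).
Proof.
  intros Hst.
  destruct (MVT_gen (fun s => Re (Psi 1 sg mu 0 (x0 + RtoC s))) s t (fun t => Re (Psi 2 sg mu 0 (x0 + RtoC t)))) as [c [_ K]].
  - intros; now apply is_derive_Re_Psi; lia.
  - intros; apply continuity_pt_filterlim, (ex_derive_continuous (fun s => Re (Psi 1 sg mu 0 (x0 + RtoC s)))).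
    eexists. apply is_derive_Re_Psi. lia.
  - assert (Hneg := Re_Psi2_neg sg mu (x0 + RtoC c)%C (line_half_strip c)).
    assert (Re (Psi 2 sg mu 0 (x0 + RtoC c)) * (t - s) <= 0) by nra. lra.
Qed.

(** Near the saddle the slope is read off from Taylor's formula; far away only the monotonicity of
    the slope is available, which still gives linear decay. The half line t < 0 is reflected to t >
    0. *)
Lemma Psi_concave : exists m dl, 0 < m /\ 0 < dl <= 1 /\ 2 * m <= Re aQ /\ forall t : R,
  (Rabs t <= dl -> Re (Psi 0 sg mu 0 (x0 + RtoC t)) - Re (Psi 0 sg mu 0 x0) <= - m * (t * t)) /\
  (dl <= Rabs t -> Re (Psi 0 sg mu 0 (x0 + RtoC t)) - Re (Psi 0 sg mu 0 x0) <= - m * dl * Rabs t).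
Proof.
  destruct Psi_taylor as [B [HB0 HB]]. assert (Ha := Re_aQ).
  set (a := Re aQ) in *.
  assert (Hq : 0 < a / (B + 1)) by (apply Rdiv_lt_0_compat; lra).
  (* With this dl the Taylor error B t^2 is at most a |t|, half of the linear term 2 a |t| of the
     slope. *)
  set (dl := Rmin 1 (a / (B + 1))).
  assert (Hdl : 0 < dl) by (apply Rmin_glb_lt; lra).
  assert (Hdl1 := Rmin_l 1 (a / (B + 1))). assert (Hdl2 := Rmin_r 1 (a / (B + 1))). fold dl in Hdl1, Hdl2.
  assert (HBd : B * dl <= a).
  { apply Rle_trans with ((B + 1) * (a / (B + 1))); [apply Rmult_le_compat; lra | right; field; lra]. }
  set (g1 := fun t => Re (Psi 1 sg mu 0 (x0 + RtoC t))).
  assert (Hlin : forall t, Rabs t <= dl -> Rabs (g1 t + 2 * a * t) <= a * Rabs t).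
  { intros t Ht. destruct (HB t ltac:(lra)) as [K _]. rewrite Psi2_x0 in K.
    apply Rle_trans with (B * t ^ 2).
    - eapply Rle_trans; [|exact K]. eapply Rle_trans; [|apply re_le_Cmod]. right. f_equal.
      unfold g1, a. unfold Re; simpl. ring.
    - rewrite <- pow2_abs. assert (Ht0 := Rabs_pos t). simpl. rewrite Rmult_1_r, <- Rmult_assoc.
      apply Rmult_le_compat_r; [exact Ht0|]. apply Rle_trans with (B * dl); [apply Rmult_le_compat_l; lra | exact HBd]. }
  assert (Hz : (x0 + RtoC 0)%C = x0) by ring.
  exists (a / 2), dl. split; [lra|]. split; [lra|]. split; [lra|].
  assert (Hp := concave_max_half (fun s => Re (Psi 0 sg mu 0 (x0 + RtoC s))) g1 a dl Ha Hdl
    ltac:(intros; apply is_derive_Re_Psi; lia)).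
  assert (Hn := concave_max_half (fun s => Re (Psi 0 sg mu 0 (x0 + RtoC (- s)))) (fun t => - g1 (- t)) a dl Ha Hdl).
  cbv beta in Hp, Hn. rewrite Ropp_0, Hz in Hn. rewrite Hz in Hp.
  assert (Hp1 : forall t, 0 <= t <= dl -> g1 t <= - a * t).
  { intros t Ht. assert (K := Hlin t ltac:(rewrite Rabs_pos_eq; lra)). rewrite (Rabs_pos_eq t) in K by lra.
    apply Rabs_le_between in K. lra. }
  assert (Hn1 : forall t, 0 <= t <= dl -> - g1 (- t) <= - a * t).
  { intros t Ht. assert (K := Hlin (- t) ltac:(rewrite Rabs_Ropp, Rabs_pos_eq; lra)).
    rewrite Rabs_Ropp, (Rabs_pos_eq t) in K by lra. apply Rabs_le_between in K. lra. }
  specialize (Hp Hp1). specialize (Hp ltac:(intros t Ht; eapply Rle_trans; [apply (Re_Psi1_decr dl t Ht) | apply Hp1; lra])).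
  assert (Hnd : forall t, is_derive (fun s => Re (Psi 0 sg mu 0 (x0 + RtoC (- s)))) t (- g1 (- t))).
  { intros t. replace (- g1 (- t)) with (-1 * g1 (- t)) by ring.
    apply (is_derive_comp (fun s => Re (Psi 0 sg mu 0 (x0 + RtoC s))) Ropp t (g1 (- t)) (-1)).
    - apply is_derive_Re_Psi. lia.
    - auto_derive; [trivial | ring]. }
  specialize (Hn Hnd Hn1).
  specialize (Hn ltac:(intros t Ht; apply Rle_trans with (- g1 (- dl));
    [apply Ropp_le_contravar, Re_Psi1_decr; lra | apply Hn1; lra])).
  intros t. destruct (Rle_dec 0 t) as [Ht|Ht].
  - rewrite Rabs_pos_eq by exact Ht. destruct (Hp t Ht) as [K1 K2]. split; auto.
  - rewrite Rabs_left by lra. destruct (Hn (- t) ltac:(lra)) as [K1 K2].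
    rewrite Ropp_involutive in K1, K2. replace (- t * - t) with (t * t) in K1 by ring. split; auto.
Qed.

(** The full exponent at x0 + b s minus its leading value at the saddle; the last term is what
    remains of exp (PI x). *)
Definition AQ (b s : R) : C :=
  (RtoC (/ b ^ 2) * (Psi 0 sg mu (b ^ 2) (x0 + RtoC (b * s)) - Psi 0 sg mu 0 x0) + RtoC (PI * b * s))%C.

Lemma Psi_beta_diff (y0 : R) : y0 < 1 / 2 -> exists B, 0 <= B /\ forall beta x, 0 <= beta -> Rabs (Im x) <= y0 ->
  Cmod (Psi 0 sg mu beta x - Psi 0 sg mu 0 x)%C <= B * beta ^ 2 * (Cmod x + Rabs sg).
Proof.
  intros Hy. destruct (IPhi0_diff y0 Hy) as [B [HB0 HB]].
  exists (2 * B). split; [lra|]. intros beta x Hb Hx.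
  assert (K : forall r : R, Rabs r = Rabs sg -> Cmod (IPhi 0 beta (x + RtoC r) - IPhi 0 0 (x + RtoC r))%C
     <= B * beta ^ 2 * (Cmod x + Rabs sg)).
  { intros r Hr. eapply Rle_trans; [apply HB; [exact Hb | now rewrite Im_plus_RtoC]|].
    apply Rmult_le_compat_l; [apply Rmult_le_pos; [lra | nra]|].
    eapply Rle_trans; [apply Cmod_triangle|]. rewrite Cmod_R, Hr. lra. }
  unfold Psi.
  match goal with |- Cmod ?X <= _ => replace X with
    (Ci * ((IPhi 0 beta (x + RtoC sg) - IPhi 0 0 (x + RtoC sg)) + (IPhi 0 beta (x + RtoC (- sg)) - IPhi 0 0 (x + RtoC (- sg)))))%C by ring end.
  rewrite Cmod_mult, Cmod_Ci, Rmult_1_l. eapply Rle_trans; [apply Cmod_triangle|].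
  assert (K1 := K sg eq_refl). assert (K2 := K (- sg) (Rabs_Ropp sg)). lra.
Qed.

Lemma laplace_Q : exists K b0, 0 <= K /\ 0 < b0 <= 1 /\ forall b, 0 < b < b0 ->
  exists I : C, CintR (fun s => Cexp (AQ b s)) I /\
    Cmod (I - RtoC (sqrt PI) * Cexp (- (/ 2 * Cln aQ)))%C <= K * b.
Proof.
  assert (HP := PI_RGT_0).
  destruct Psi_taylor as [B [HB0 HB]].
  destruct Psi_concave as [m [dl [Hm [[Hdl Hdl1] [Hma Hconc]]]]].
  destruct (Psi_beta_diff (Rabs (Im x0)) x0_strip) as [D [HD0 HD]].
  set (X := Cmod x0 + Rabs sg).
  assert (HX : 0 <= X) by (unfold X; assert (K1 := Cmod_ge_0 x0); assert (K2 := Rabs_pos sg); lra).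
  assert (HDX : 0 <= D * X) by now apply Rmult_le_pos.
  (* The slope wanted outside the window: PI and D absorb the factor exp (PI x) and the beta error,
     and 1 is left for the decay - |s|. *)
  set (den := 1 + PI + D).
  set (b0 := Rmin 1 (m * dl / den)).
  assert (Hmd : 0 < m * dl) by nra.
  assert (Hb0 : 0 < b0) by (apply Rmin_glb_lt; [lra | apply Rdiv_lt_0_compat; unfold den; lra]).
  assert (Hb1 := Rmin_l 1 (m * dl / den)). assert (Hb2 := Rmin_r 1 (m * dl / den)). fold b0 in Hb1, Hb2.
  (* B pays for the cubic Taylor error, 2 PI for the factor exp (PI x), and D (X + 1) for the
     passage from beta = 0 to beta = b^2. *)
  set (Cc := B + 2 * PI + D * (X + 1)).
  assert (HC : 0 <= Cc) by (unfold Cc; lra).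
  assert (Herr : forall b s, 0 < b < b0 ->
     Cmod (RtoC (/ b ^ 2) * (Psi 0 sg mu (b ^ 2) (x0 + RtoC (b * s)) - Psi 0 sg mu 0 (x0 + RtoC (b * s))))%C
       <= D * b ^ 2 * (X + b * Rabs s)).
  { intros b s Hb. assert (Hb2p : 0 < b ^ 2) by nra.
    rewrite Cmod_mult, Cmod_RtoC_nonneg by (left; now apply Rinv_0_lt_compat).
    assert (K := HD (b ^ 2) (x0 + RtoC (b * s))%C ltac:(lra) ltac:(rewrite Im_plus_RtoC; lra)).
    apply (Rmult_le_reg_l (b ^ 2)); [exact Hb2p|]. rewrite <- Rmult_assoc, Rinv_r, Rmult_1_l by lra.
    eapply Rle_trans; [exact K|].
    assert (Cmod (x0 + RtoC (b * s))%C + Rabs sg <= X + b * Rabs s).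
    { unfold X. assert (T := Cmod_triangle x0 (RtoC (b * s))). rewrite Cmod_R, Rabs_mult, (Rabs_pos_eq b) in T by lra. lra. }
    replace (b ^ 2 * (D * b ^ 2 * (X + b * Rabs s))) with (D * (b ^ 2) ^ 2 * (X + b * Rabs s)) by ring.
    apply Rmult_le_compat_l; [apply Rmult_le_pos; [lra | nra] | assumption]. }
  assert (HRe : forall b s, 0 < b < b0 -> Re (AQ b s) <=
     / b ^ 2 * (Re (Psi 0 sg mu 0 (x0 + RtoC (b * s))) - Re (Psi 0 sg mu 0 x0)) + PI * b * Rabs s + D * b ^ 2 * (X + b * Rabs s)).
  { intros b s Hb. assert (E := Herr b s Hb).
    set (Y := (RtoC (/ b ^ 2) * (Psi 0 sg mu (b ^ 2) (x0 + RtoC (b * s)) - Psi 0 sg mu 0 (x0 + RtoC (b * s))))%C) in *.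
    assert (HY := Re_le_Cmod Y).
    replace (AQ b s) with (Y + RtoC (/ b ^ 2) * (Psi 0 sg mu 0 (x0 + RtoC (b * s)) - Psi 0 sg mu 0 x0) + RtoC (PI * b * s))%C
      by (unfold AQ, Y; ring).
    rewrite !Re_plus, Re_RtoC_mult.
    replace (Re (Psi 0 sg mu 0 (x0 + RtoC (b * s)) - Psi 0 sg mu 0 x0)%C) with
      (Re (Psi 0 sg mu 0 (x0 + RtoC (b * s))) - Re (Psi 0 sg mu 0 x0)) by (unfold Re; simpl; ring).
    change (Re (RtoC (PI * b * s))) with (PI * b * s).
    assert (PI * b * s <= PI * b * Rabs s) by (apply Rmult_le_compat_l; [nra | apply Rle_abs]). lra. }
  destruct (laplace AQ aQ m dl Cc b0) as [K [HK0 HK]]; try assumption.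
  - lra.
  - intros b s Hb. unfold AQ.
    apply (Ccontinuous_ext (fun s : R => (fun w => Cexp (RtoC (/ b ^ 2) * (Psi 0 sg mu (b ^ 2) (x0 + RtoC b * w) - Psi 0 sg mu 0 x0)
       + RtoC (PI * b) * w))%C (RtoC s))).
    { intros r. rewrite !RtoC_mult. reflexivity. }
    eapply Rder_Ccontinuous.
    apply (Cder_Rder_real (fun w => Cexp (RtoC (/ b ^ 2) * (Psi 0 sg mu (b ^ 2) (x0 + RtoC b * w) - Psi 0 sg mu 0 x0) + RtoC (PI * b) * w))%C).
    apply Cder_Cexp_comp, Cder_plus; [|apply Cder_scal, Cder_id].
    apply Cder_scal, Cder_minus; [|apply Cder_const].
    apply (Cder_comp (Psi 0 sg mu (b ^ 2)) (fun w => x0 + RtoC b * w)%C).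
    + apply Cder_Psi; [lia | nra |]. rewrite <- RtoC_mult. apply line_strip.
    + apply Cder_plus; [apply Cder_const | apply Cder_scal, Cder_id].
  - intros b s Hb Hs.
    assert (Hx0 := Rabs_pos s). set (x := Rabs s) in *.
    assert (Hbs : Rabs (b * s) <= dl).
    { rewrite Rabs_mult, (Rabs_pos_eq b) by lra. fold x. apply (Rmult_le_compat_l b) in Hs; [|lra].
      replace (b * (dl / b)) with dl in Hs by (field; lra). exact Hs. }
    assert (Hbx : b * x <= 1) by (rewrite Rabs_mult, (Rabs_pos_eq b) in Hbs by lra; fold x in Hbs; lra).
    assert (E := Herr b s Hb). fold x in E.
    assert (Hb2p : 0 < b ^ 2) by nra.
    assert (HbbC : RtoC (b ^ 2) <> 0%C) by (apply RtoC_neq_0; lra).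
    assert (HE2 : D * b ^ 2 * (X + b * x) <= D * (X + 1) * b).
    { replace (D * b ^ 2 * (X + b * x)) with (D * (b * b * (X + b * x))) by ring.
      rewrite (Rmult_assoc D (X + 1)). apply Rmult_le_compat_l; [exact HD0|].
      assert (b * b <= b) by nra. assert (0 <= X + b * x) by nra.
      apply Rle_trans with (b * (X + b * x)); [now apply Rmult_le_compat_r|]. nra. }
    split.
    + destruct (HB (b * s) ltac:(lra)) as [_ K]. rewrite Psi2_x0 in K.
      set (Y := (RtoC (/ b ^ 2) * (Psi 0 sg mu (b ^ 2) (x0 + RtoC (b * s)) - Psi 0 sg mu 0 (x0 + RtoC (b * s))))%C) in *.
      set (Z := (Psi 0 sg mu 0 (x0 + RtoC (b * s)) - Psi 0 sg mu 0 x0 - / 2 * (- (2) * aQ) * (RtoC (b * s) * RtoC (b * s)))%C) in *.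
      replace (AQ b s + aQ * (s * s))%C with (Y + RtoC (/ b ^ 2) * Z + RtoC (PI * b * s))%C.
      2: { unfold AQ, Y, Z. rewrite RtoC_inv, !RtoC_mult, !RtoC_pow by lra. field. apply RtoC_neq_0; lra. }
      eapply Rle_trans; [apply Cmod_triangle|].
      assert (T := Cmod_triangle Y (RtoC (/ b ^ 2) * Z)).
      rewrite Cmod_mult, (Cmod_RtoC_nonneg (/ b ^ 2)) in T by (left; now apply Rinv_0_lt_compat).
      rewrite Cmod_R, !Rabs_mult, (Rabs_pos_eq PI), (Rabs_pos_eq b) by lra. fold x.
      assert (HZ : / b ^ 2 * Cmod Z <= B * b * x ^ 3).
      { apply (Rmult_le_reg_l (b ^ 2)); [exact Hb2p|]. rewrite <- Rmult_assoc, Rinv_r, Rmult_1_l by lra.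
        eapply Rle_trans; [exact K|]. rewrite Rabs_mult, (Rabs_pos_eq b) by lra. fold x. right; ring. }
      assert (Hx30 : 0 <= x ^ 3) by now apply pow_le.
      assert (Hx3 : x <= 1 + x ^ 3) by (destruct (Rle_dec x 1); [lra | simpl; nra]).
      assert (P1 : PI * b * x <= 2 * PI * b * (1 + x ^ 3)).
      { assert (0 <= PI * b) by nra. apply Rle_trans with (PI * b * (1 + x ^ 3)); [now apply Rmult_le_compat_l|]. nra. }
      assert (P2 : B * b * x ^ 3 <= B * b * (1 + x ^ 3)) by (apply Rmult_le_compat_l; nra).
      assert (P3 : D * (X + 1) * b <= D * (X + 1) * b * (1 + x ^ 3)).
      { rewrite <- (Rmult_1_r (D * (X + 1) * b)) at 1. apply Rmult_le_compat_l; [|lra].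
        apply Rmult_le_pos; [apply Rmult_le_pos; lra | lra]. }
      unfold Cc. lra.
    + destruct (Hconc (b * s)) as [K _]. specialize (K Hbs).
      eapply Rle_trans; [apply HRe; exact Hb|]. fold x.
      assert (K2 : / b ^ 2 * (Re (Psi 0 sg mu 0 (x0 + RtoC (b * s))) - Re (Psi 0 sg mu 0 x0)) <= - m * (s * s)).
      { apply (Rmult_le_reg_l (b ^ 2)); [exact Hb2p|]. rewrite <- Rmult_assoc, Rinv_r, Rmult_1_l by lra.
        eapply Rle_trans; [exact K|]. right; ring. }
      assert (PI * b * x <= PI * 1) by (rewrite Rmult_assoc; apply Rmult_le_compat_l; lra).
      assert (D * (X + 1) * b <= D * (X + 1)).
      { rewrite <- (Rmult_1_r (D * (X + 1))) at 2. apply Rmult_le_compat_l; [apply Rmult_le_pos; lra | lra]. }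
      unfold Cc. lra.
  - intros b s Hb Hs.
    assert (Hx0 := Rabs_pos s). set (x := Rabs s) in *.
    assert (Hbs : dl <= Rabs (b * s)).
    { rewrite Rabs_mult, (Rabs_pos_eq b) by lra. fold x. apply (Rmult_le_compat_l b) in Hs; [|lra].
      replace (b * (dl / b)) with dl in Hs by (field; lra). exact Hs. }
    assert (Hb2p : 0 < b ^ 2) by nra.
    destruct (Hconc (b * s)) as [_ K]. specialize (K Hbs).
    eapply Rle_trans; [apply HRe; exact Hb|]. fold x.
    rewrite Rabs_mult, (Rabs_pos_eq b) in K by lra. fold x in K.
    assert (K2 : / b ^ 2 * (Re (Psi 0 sg mu 0 (x0 + RtoC (b * s))) - Re (Psi 0 sg mu 0 x0)) <= - (m * dl / b) * x).
    { apply (Rmult_le_reg_l (b ^ 2)); [exact Hb2p|]. rewrite <- Rmult_assoc, Rinv_r, Rmult_1_l by lra.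
      eapply Rle_trans; [exact K|]. right. field. lra. }
    assert (Hden : den <= m * dl / b).
    { apply (Rmult_le_reg_r b); [lra|]. replace (m * dl / b * b) with (m * dl) by (field; lra).
      apply Rle_trans with (den * (m * dl / den)); [apply Rmult_le_compat_l; unfold den in *; lra|].
      right. field. unfold den; lra. }
    assert (K3 : - (m * dl / b) * x <= - den * x) by (apply Rmult_le_compat_r; lra).
    assert (K4 : PI * b * x <= PI * x) by (apply Rmult_le_compat_r; nra).
    assert (K5 : D * b ^ 2 * (X + b * x) <= D * X + D * x).
    { replace (D * b ^ 2 * (X + b * x)) with (D * (b ^ 2 * (X + b * x))) by ring. rewrite <- Rmult_plus_distr_l.
      apply Rmult_le_compat_l; [exact HD0|]. assert (b ^ 2 <= 1) by nra. assert (b * x <= x) by nra.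
      assert (0 <= X + b * x) by nra. apply Rle_trans with (1 * (X + b * x)); [now apply Rmult_le_compat_r | lra]. }
    unfold den in K3. unfold Cc. lra.
  - exists K, b0. split; [exact HK0|]. split; [lra | exact HK].
Qed.

End Expansion.

(** * The hyperbolic gamma function and the contour integral *)

Lemma s_b_scaled (b : R) (z : C) : 0 < b -> Rabs (Im z) < 1 / 2 ->
  s_b b (RtoC (/ b) * z)%C = Cexp (RtoC (/ b ^ 2) * (Ci * IPhi 0 (b ^ 2) z))%C.
Proof.
  intros Hb Hz. unfold s_b.
  assert (Hb2 : 0 < b ^ 2) by nra.
  assert (HI := IPhi_correct 0 (b ^ 2) z ltac:(lra) Hz).
  (* The substitution u = y / b turns sinh (y / b) sinh (b y) into sinh u sinh (beta u). *)
  apply (Cint0_scale _ (/ b)) in HI; [|now apply Rinv_0_lt_compat].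
  apply (Cint_scal (RtoC (/ b ^ 2))) in HI; try apply _.
  match goal with |- Cexp (Ci * ?X)%C = _ => replace X with (RtoC (/ b ^ 2) * IPhi 0 (b ^ 2) z)%C end.
  - f_equal. ring.
  - symmetry. apply (is_RInt_gen_unique (V := C_R_CompleteNormedModule)).
    eapply Cint0_ext; [|exact HI]. intros y Hy. cbv beta.
    assert (Hu : 0 < / b * y) by (apply Rmult_lt_0_compat; [now apply Rinv_0_lt_compat | exact Hy]).
    unfold phi, kappa.
    replace (b ^ 2 * (/ b * y)) with (b * y) by (field; lra).
    rewrite !rsh_pos_eq by (exact Hu || nra).
    replace (/ b * y) with (y / b) in * by (field; lra).
    assert (Hs1 := sinh_pos (b * y) ltac:(nra)). assert (Hs2 := sinh_pos (y / b) Hu).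
    set (s1 := sinh (b * y)) in *. set (s2 := sinh (y / b)) in *.
    replace (RtoC (2 * (y / b)) * z)%C with (RtoC (2 * y) * (RtoC (/ b) * z))%C
      by (replace (2 * (y / b)) with (2 * y * / b) by (field; lra); rewrite (RtoC_mult (2 * y)); ring).
    set (S := Csin _).
    assert (HyC : RtoC y <> 0%C) by (apply RtoC_neq_0; lra).
    unfold Cdiv. rewrite <- !RtoC_inv by nra.
    transitivity (RtoC (/ b ^ 2 * / b * (b * y / s1 * (y / b / s2) / (2 * (y / b) ^ 3))) * S
       - RtoC (/ b ^ 2 * / b * (/ (y / b) ^ 2)) * z)%C; [rewrite !RtoC_mult; ring|].
    transitivity (RtoC (/ (2 * s2 * s1) * / y) * S - RtoC (/ b * / y * / y) * z)%C; [|rewrite !RtoC_mult; ring].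
    f_equal; [f_equal; f_equal; field; lra | f_equal; f_equal; field; lra].
Qed.

(** The integrand of [Qcal] at [x / b]. *)
Definition HQ (sg mu b : R) (x : C) : C := Cexp (RtoC (/ b ^ 2) * Psi 0 sg mu (b ^ 2) x + PI * x)%C.

(** The line Im x = - 3 Q / 8 becomes Im = - 3 (1 + b^2) / 8 after rescaling. The hypothesis puts it
    inside the strip |Im| < 1/2, on which the kernels are dominated for every beta >= 0. *)
Lemma Qcal_integrand (sg mu b t : R) : 0 < b -> 3 * (1 + b ^ 2) / 8 < 1 / 2 ->
  (let x : C := (t, - (3 * Qb b / 8)) in
   Cmult (Cmult (Cmult
     (Cexp (Copp (Cmult (Cmult Ci (RtoC PI)) (Cmult x x))))
     (Cexp (Cmult (Cmult (Cmult (RtoC 2) (Cmult Ci (RtoC PI))) x)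
                  (Cminus (RtoC (mu / b)) (Cmult Ci (RtoC (Qb b / 2)))))))
     (s_b b (Cplus x (RtoC (sg / b)))))
     (s_b b (Cminus x (RtoC (sg / b))))) =
  HQ sg mu b (iy (- (3 * (1 + b ^ 2) / 8)) + RtoC (b * t))%C.
Proof.
  intros Hb Hlt. set (xi := (iy (- (3 * (1 + b ^ 2) / 8)) + RtoC (b * t))%C).
  assert (HbC : RtoC b <> 0%C) by (apply RtoC_neq_0; lra).
  assert (Ex : ((t, - (3 * Qb b / 8)) : C) = (RtoC (/ b) * xi)%C).
  { unfold xi, iy, Qb. apply Ceq_pair; unfold Re, Im; simpl; field; lra. }
  cbv zeta. rewrite Ex.
  assert (Hi : forall r : R, Rabs (Im (xi + RtoC r)%C) < 1 / 2).
  { intros r. rewrite Im_plus_RtoC. unfold xi. rewrite Im_iy, Rabs_Ropp, Rabs_pos_eq; [exact Hlt|]. nra. }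
  replace (RtoC (/ b) * xi + RtoC (sg / b))%C with (RtoC (/ b) * (xi + RtoC sg))%C
    by (rewrite RtoC_div, RtoC_inv by lra; field; exact HbC).
  replace (RtoC (/ b) * xi - RtoC (sg / b))%C with (RtoC (/ b) * (xi + RtoC (- sg)))%C
    by (rewrite RtoC_opp, RtoC_div, RtoC_inv by lra; field; exact HbC).
  rewrite !s_b_scaled by (assumption || apply Hi).
  unfold HQ, Psi. rewrite <- !Cexp_plus. f_equal.
  replace (RtoC (Qb b / 2)) with ((RtoC b + / RtoC b) / 2)%C
    by (unfold Qb; rewrite RtoC_div, RtoC_plus, RtoC_inv by lra; reflexivity).
  rewrite RtoC_div, !RtoC_inv, !RtoC_pow by nra.
  assert (Ei := Ci_sqr). field [Ei]. exact HbC.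
Qed.

Definition DQ (sg mu b : R) (x : C) : C := (RtoC (/ b ^ 2) * Psi 1 sg mu (b ^ 2) x + PI)%C.

Lemma Cder_HQ (sg mu b : R) (x : C) : Rabs (Im x) < 1 / 2 ->
  Cder (HQ sg mu b) x (HQ sg mu b x * DQ sg mu b x)%C.
Proof.
  intros Hx. unfold HQ, DQ. apply (Cder_Cexp_comp (fun x => RtoC (/ b ^ 2) * Psi 0 sg mu (b ^ 2) x + PI * x)%C).
  apply Cder_plus; [apply Cder_scal, Cder_Psi; [lia | nra | exact Hx]|].
  eapply Cder_eq; [apply Cder_scal, Cder_id | ring].
Qed.

Lemma Cder_HQ1 (sg mu b : R) (x : C) : Rabs (Im x) < 1 / 2 ->
  Cder (fun x => HQ sg mu b x * DQ sg mu b x)%C x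
    (HQ sg mu b x * DQ sg mu b x * DQ sg mu b x + HQ sg mu b x * (RtoC (/ b ^ 2) * Psi 2 sg mu (b ^ 2) x))%C.
Proof.
  intros Hx. apply (Cder_mult (HQ sg mu b) (DQ sg mu b)); [now apply Cder_HQ|].
  unfold DQ. eapply Cder_eq.
  - apply Cder_plus; [apply Cder_scal, Cder_Psi; [lia | nra | exact Hx] | apply Cder_const].
  - ring.
Qed.

(** * Decay of the integrand in the contour strip *)

Lemma splog_reflect (z : C) : Rabs (Im z) < 1 / 2 -> splog z = (2 * PI * z + splog (- z))%C.
Proof.
  intros Hz. assert (E := IPhi1_opp z).
  rewrite !IPhi1_closed in E by (try exact Hz; change (Im (- z)%C) with (- Im z); now rewrite Rabs_Ropp).
  transitivity (PI * z - (PI * z - splog z))%C; [ring|]. rewrite <- E. ring.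
Qed.

Lemma splog_far (e : R) : 0 < e -> exists T, forall z, Re z <= - T -> Cmod (splog z) <= e.
Proof.
  intros He. assert (HP := PI_RGT_0). set (e' := Rmin (1 / 2) (e / 4)).
  assert (He' : 0 < e') by (apply Rmin_glb_lt; lra).
  assert (M1 := Rmin_l (1 / 2) (e / 4)). assert (M2 := Rmin_r (1 / 2) (e / 4)). fold e' in M1, M2.
  exists (- (ln e' / (2 * PI))). intros z Hz.
  assert (Hq : Cmod (q2 z) <= e').
  { rewrite Cmod_q2. rewrite <- (exp_ln e') by exact He'. apply exp_le_exp.
    apply Rle_trans with (2 * PI * (ln e' / (2 * PI))); [apply Rmult_le_compat_l; lra | right; field; lra]. }
  eapply Rle_trans; [apply Cmod_splog_small; lra|]. lra.
Qed.

(** The real part of Psi' tends to PI as Re x -> -oo and to PI (1 + 4 Im x) as Re x -> +oo. The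
    second limit is negative exactly when Im x < - 1/4, which is the origin of the upper edge of the
    contour strip. *)
Lemma Psi_decay (sg mu c1 c2 : R) : 1 / 4 < c1 -> c1 <= c2 -> c2 < 1 / 2 ->
  exists kap Cc, 0 < kap /\ 0 <= Cc /\ forall x, - c2 <= Im x <= - c1 ->
    Re (Psi 0 sg mu 0 x) <= Cc - kap * Rabs (Re x).
Proof.
  intros H1 H12 H2. assert (HP := PI_RGT_0).
  (* Half of the guaranteed slope on the right; the other half, and on the left PI - kap >= kap,
     absorbs the two [splog] terms of size at most kap / 2. *)
  set (kap := PI * (4 * c1 - 1) / 2). assert (Hk : 0 < kap) by (unfold kap; nra).
  assert (HkP : kap <= PI / 2) by (unfold kap; nra).
  destruct (splog_far (kap / 2) ltac:(lra)) as [T1 HT1].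
  assert (Hsg := Rabs_pos sg).
  set (T0 := Rabs T1 + Rabs sg). assert (HT10 := Rabs_pos T1). assert (HT1a := Rle_abs T1).
  assert (HT0 : 0 <= T0) by (unfold T0; lra).
  assert (Hsp : forall x r, Rabs r <= Rabs sg -> Re x <= - T0 -> Cmod (splog (x + RtoC r)) <= kap / 2).
  { intros x r Hr Hx. apply HT1. rewrite Re_plus_RtoC. unfold T0 in Hx. assert (K := Rle_abs r). lra. }
  assert (Hstrip : forall x, - c2 <= Im x <= - c1 -> Rabs (Im x) < 1 / 2) by (intros; apply Rabs_def1; lra).
  destruct (Psi_bound sg mu 0 c2 (T0 + 1) ltac:(lra) ltac:(lra) ltac:(lra)) as [B [HB0 HB]].
  assert (Hneg : forall x, - c2 <= Im x <= - c1 -> Re x <= - T0 -> kap <= Re (Psi 1 sg mu 0 x)).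
  { intros x Hx Hr. rewrite Psi1_closed by now apply Hstrip.
    assert (K1 := Hsp x sg ltac:(lra) Hr). assert (K2 := Hsp x (- sg) ltac:(rewrite Rabs_Ropp; lra) Hr).
    assert (I1 := Im_le_Cmod (splog (x + RtoC sg))). assert (I2 := Im_le_Cmod (splog (x + RtoC (- sg)))).
    apply Rabs_le_between in I1. apply Rabs_le_between in I2.
    set (u := splog (x + RtoC sg)) in *. set (v := splog (x + RtoC (- sg))) in *.
    replace (Re (2 * Ci * PI * mu + PI - Ci * (u + v))%C) with (PI + (Im u + Im v)) by (unfold Re, Im; simpl; ring). lra. }
  assert (Hpos : forall x, - c2 <= Im x <= - c1 -> T0 <= Re x -> Re (Psi 1 sg mu 0 x) <= - kap).
  { intros x Hx Hr. rewrite Psi1_closed by now apply Hstrip.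
    assert (Hm : Re (- x)%C <= - T0) by (change (Re (- x)%C) with (- Re x); lra).
    assert (K1 := Hsp (- x)%C (- sg) ltac:(rewrite Rabs_Ropp; lra) Hm). assert (K2 := Hsp (- x)%C sg ltac:(lra) Hm).
    assert (I1 := Im_le_Cmod (splog (- x + RtoC (- sg)))). assert (I2 := Im_le_Cmod (splog (- x + RtoC sg))).
    apply Rabs_le_between in I1. apply Rabs_le_between in I2.
    rewrite (splog_reflect (x + RtoC sg)), (splog_reflect (x + RtoC (- sg))) by (rewrite Im_plus_RtoC; now apply Hstrip).
    replace (- (x + RtoC sg))%C with (- x + RtoC (- sg))%C by (rewrite RtoC_opp; ring).
    replace (- (x + RtoC (- sg)))%C with (- x + RtoC sg)%C by (rewrite RtoC_opp; ring).
    set (u := splog (- x + RtoC (- sg))) in *. set (v := splog (- x + RtoC sg)) in *.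
    replace (Re (2 * Ci * PI * mu + PI - Ci * (2 * PI * (x + RtoC sg) + u + (2 * PI * (x + RtoC (- sg)) + v)))%C)
      with (PI + 4 * PI * Im x + (Im u + Im v)) by (unfold Re, Im; simpl; ring).
    assert (4 * PI * Im x <= 4 * PI * - c1) by (apply Rmult_le_compat_l; lra). unfold kap in *. lra. }
  assert (Hbd : forall y t, - c2 <= y <= - c1 -> Rabs t <= T0 -> Re (Psi 0 sg mu 0 (iy y + RtoC t)) <= B).
  { intros y t Hy Ht. eapply Rle_trans; [apply Re_le_Cmod|]. apply HB.
    - rewrite Im_iy. apply Rabs_le. lra.
    - eapply Rle_trans; [apply Cmod_le_Re_Im|]. rewrite Re_iy, Im_iy. assert (Rabs y <= 1) by (apply Rabs_le; lra). lra. }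
  assert (Hder : forall y t, - c2 <= y <= - c1 ->
    is_derive (fun s => Re (Psi 0 sg mu 0 (iy y + RtoC s))) t (Re (Psi 1 sg mu 0 (iy y + RtoC t)))).
  { intros y t Hy. apply (Rder_shift (Psi 0 sg mu 0)). apply Cder_Psi; [lia | lra |]. apply Hstrip. now rewrite Im_iy. }
  exists kap, (B + kap * T0). split; [exact Hk|]. split; [nra|]. intros x Hx.
  replace x with (iy (Im x) + RtoC (Re x))%C by (unfold iy; apply Ceq_pair; unfold Re, Im; simpl; ring).
  set (y := Im x) in *. set (t := Re x). rewrite Re_iy.
  destruct (Rle_dec (Rabs t) T0) as [Ht|Ht].
  - assert (K := Hbd y t Hx Ht). assert (Ha := Rabs_pos t). nra.
  - destruct (Rle_dec 0 t) as [Ht0|Ht0].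
    + rewrite Rabs_pos_eq in * by exact Ht0.
      destruct (MVT_gen (fun s => Re (Psi 0 sg mu 0 (iy y + RtoC s))) T0 t (fun s => Re (Psi 1 sg mu 0 (iy y + RtoC s)))) as [c [Hc K]].
      * intros; now apply Hder.
      * intros; apply continuity_pt_filterlim, (ex_derive_continuous (fun s => Re (Psi 0 sg mu 0 (iy y + RtoC s)))).
        eexists; now apply Hder.
      * rewrite Rmin_left, Rmax_right in Hc by lra.
        assert (K1 := Hpos (iy y + RtoC c)%C ltac:(now rewrite Im_iy) ltac:(rewrite Re_iy; lra)).
        assert (K2 := Hbd y T0 Hx ltac:(rewrite Rabs_pos_eq; lra)).
        assert (Re (Psi 1 sg mu 0 (iy y + RtoC c)) * (t - T0) <= - kap * (t - T0)) by (apply Rmult_le_compat_r; lra). lra.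
    + rewrite Rabs_left in * by lra.
      destruct (MVT_gen (fun s => Re (Psi 0 sg mu 0 (iy y + RtoC s))) t (- T0) (fun s => Re (Psi 1 sg mu 0 (iy y + RtoC s)))) as [c [Hc K]].
      * intros; now apply Hder.
      * intros; apply continuity_pt_filterlim, (ex_derive_continuous (fun s => Re (Psi 0 sg mu 0 (iy y + RtoC s)))).
        eexists; now apply Hder.
      * rewrite Rmin_left, Rmax_right in Hc by lra.
        assert (K1 := Hneg (iy y + RtoC c)%C ltac:(now rewrite Im_iy) ltac:(rewrite Re_iy; lra)).
        assert (K2 := Hbd y (- T0) Hx ltac:(rewrite Rabs_Ropp, Rabs_pos_eq; lra)).
        assert (kap * (- T0 - t) <= Re (Psi 1 sg mu 0 (iy y + RtoC c)) * (- T0 - t)) by (apply Rmult_le_compat_r; lra). lra.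
Qed.

Lemma HQ_decay (sg mu c1 c2 : R) : 1 / 4 < c1 -> c1 <= c2 -> c2 < 1 / 2 ->
  exists b0, 0 < b0 <= 1 /\ forall b, 0 < b < b0 -> exists M, forall x, - c2 <= Im x <= - c1 ->
    Cmod (HQ sg mu b x) <= M / (1 + Re x ^ 2).
Proof.
  intros H1 H12 H2. assert (HP := PI_RGT_0).
  destruct (Psi_decay sg mu c1 c2 H1 H12 H2) as [kap [Cc [Hk [HC0 HC]]]].
  destruct (Psi_beta_diff sg mu c2 H2) as [D [HD0 HD]].
  destruct (poly_exp_bound 2 1 Rlt_0_1) as [M0 [HM0 HM]].
  (* A small b makes kap / b^2 at least 1 + PI + D, so the decay of the phase beats exp (PI x) and
     the beta error. *)
  set (b0 := Rmin 1 (kap / (1 + PI + D))).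
  assert (Hq : 0 < kap / (1 + PI + D)) by (apply Rdiv_lt_0_compat; lra).
  assert (Hb0 : 0 < b0) by (apply Rmin_glb_lt; lra).
  assert (M1 := Rmin_l 1 (kap / (1 + PI + D))). assert (M2 := Rmin_r 1 (kap / (1 + PI + D))). fold b0 in M1, M2.
  exists b0. split; [lra|]. intros b Hb.
  assert (Hb2 : 0 < b ^ 2) by nra. assert (Hb21 : b ^ 2 <= b) by nra.
  set (E := / b ^ 2 * Cc + D * (1 + Rabs sg)).
  exists (exp E * M0). intros x Hx.
  set (t := Rabs (Re x)). assert (Ht : 0 <= t) by apply Rabs_pos.
  assert (Hsg := Rabs_pos sg).
  assert (Hre : Re (RtoC (/ b ^ 2) * Psi 0 sg mu (b ^ 2) x + PI * x)%C <= E - t).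
  { rewrite Re_plus, !Re_RtoC_mult.
    assert (K := HC x Hx). fold t in K.
    assert (K2 := HD (b ^ 2) x ltac:(lra) ltac:(apply Rabs_le; lra)).
    assert (Hxm : Cmod x <= t + 1).
    { eapply Rle_trans; [apply Cmod_le_Re_Im|]. fold t. assert (Rabs (Im x) <= 1) by (apply Rabs_le; lra). lra. }
    assert (K3 := Re_le_Cmod (Psi 0 sg mu (b ^ 2) x - Psi 0 sg mu 0 x)%C).
    replace (Re (Psi 0 sg mu (b ^ 2) x - Psi 0 sg mu 0 x)%C) with (Re (Psi 0 sg mu (b ^ 2) x) - Re (Psi 0 sg mu 0 x)) in K3
      by (unfold Re; simpl; ring).
    assert (K4 : Re (Psi 0 sg mu (b ^ 2) x) <= Cc - kap * t + D * (b ^ 2) ^ 2 * (t + 1 + Rabs sg)).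
    { assert (D * (b ^ 2) ^ 2 * (Cmod x + Rabs sg) <= D * (b ^ 2) ^ 2 * (t + 1 + Rabs sg)).
      { apply Rmult_le_compat_l; [apply Rmult_le_pos; [lra | nra] | lra]. }
      lra. }
    assert (K5 : / b ^ 2 * Re (Psi 0 sg mu (b ^ 2) x) <= / b ^ 2 * Cc - (1 + PI + D) * t + D * (t + 1 + Rabs sg)).
    { apply Rle_trans with (/ b ^ 2 * (Cc - kap * t + D * (b ^ 2) ^ 2 * (t + 1 + Rabs sg))).
      { apply Rmult_le_compat_l; [left; now apply Rinv_0_lt_compat | exact K4]. }
      replace (/ b ^ 2 * (Cc - kap * t + D * (b ^ 2) ^ 2 * (t + 1 + Rabs sg))) with
        (/ b ^ 2 * Cc - kap / b ^ 2 * t + D * b ^ 2 * (t + 1 + Rabs sg)) by (field; lra).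
      assert (L1 : 1 + PI + D <= kap / b ^ 2).
      { apply (Rmult_le_reg_r (b ^ 2)); [exact Hb2|]. replace (kap / b ^ 2 * b ^ 2) with kap by (field; lra).
        apply Rle_trans with ((1 + PI + D) * (kap / (1 + PI + D))); [apply Rmult_le_compat_l; lra | right; field; lra]. }
      assert (L2 : (1 + PI + D) * t <= kap / b ^ 2 * t) by (now apply Rmult_le_compat_r).
      assert (L3 : D * b ^ 2 * (t + 1 + Rabs sg) <= D * (t + 1 + Rabs sg)).
      { apply Rmult_le_compat_r; [lra|]. rewrite <- (Rmult_1_r D) at 2. apply Rmult_le_compat_l; lra. }
      lra. }
    assert (PI * Re x <= PI * t) by (apply Rmult_le_compat_l; [lra | apply Rle_abs]).
    unfold E. lra. }
  unfold HQ. rewrite Cmod_Cexp.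
  apply Rle_trans with (exp E * exp (- t)); [rewrite <- exp_plus; apply exp_le_exp; lra|].
  specialize (HM t Ht). rewrite Rmult_1_l in HM. assert (He := exp_pos E). assert (Het := exp_pos (- t)).
  replace (Re x ^ 2) with (t ^ 2) by (unfold t; apply pow2_abs).
  assert (Ht2 : 0 < 1 + t ^ 2) by nra.
  unfold Rdiv. rewrite Rmult_assoc. apply Rmult_le_compat_l; [lra|].
  apply (Rmult_le_reg_r (1 + t ^ 2)); [exact Ht2|]. rewrite Rmult_assoc, Rinv_l, Rmult_1_r by lra.
  apply Rle_trans with ((1 + t) ^ 2 * exp (- t)); [|exact HM].
  rewrite Rmult_comm. apply Rmult_le_compat_r; nra.
Qed.

Section Assembly.

Variables sg mu : R.
Hypothesis Hadm : sinh (2 * PI * sg) ^ 2 < exp (2 * PI * mu).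

Let x0 := x0Q sg mu.

Lemma HQ_integral : exists K b0, 0 <= K /\ 0 < b0 <= 1 /\ forall b, 0 < b < b0 ->
  3 * (1 + b ^ 2) / 8 < 1 / 2 /\
  exists I : C,
    CintR (fun t => HQ sg mu b (iy (- (3 * (1 + b ^ 2) / 8)) + RtoC (b * t))%C)
      (Cexp (RtoC (/ b ^ 2) * Psi 0 sg mu 0 x0 + PI * x0) * I)%C /\
    Cmod (I - RtoC (sqrt PI) * Cexp (- (/ 2 * Cln (aQ sg mu))))%C <= K * b.
Proof.
  destruct (laplace_Q sg mu Hadm) as [K [b1 [HK0 [Hb1 HL]]]].
  assert (Hx := Im_x0 sg mu Hadm). fold x0 in Hx.
  (* The band between - c2 and - c1 contains the saddle line and, since b < 1/4, all contour lines,
     whose heights lie between - 2/5 and - 3/8. *)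
  set (c1 := Rmin (3 / 8) (- Im x0)). set (c2 := Rmax (2 / 5) (- Im x0)).
  assert (A1 : 1 / 4 < c1) by (apply Rmin_glb_lt; lra).
  assert (A2 : c2 < 1 / 2) by (apply Rmax_lub_lt; lra).
  assert (A3 := Rmin_l (3 / 8) (- Im x0)). assert (A4 := Rmin_r (3 / 8) (- Im x0)). fold c1 in A3, A4.
  assert (A5 := Rmax_l (2 / 5) (- Im x0)). assert (A6 := Rmax_r (2 / 5) (- Im x0)). fold c2 in A5, A6.
  destruct (HQ_decay sg mu c1 c2 A1 ltac:(lra) A2) as [b2 [Hb2 HM]].
  exists K, (Rmin (1 / 4) (Rmin b1 b2)). split; [exact HK0|].
  split. { split; [repeat apply Rmin_glb_lt; lra|]. eapply Rle_trans; [apply Rmin_l | lra]. }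
  intros b Hb.
  assert (B1 := Rmin_l (1 / 4) (Rmin b1 b2)). assert (B2 := Rmin_r (1 / 4) (Rmin b1 b2)).
  assert (B3 := Rmin_l b1 b2). assert (B4 := Rmin_r b1 b2).
  set (c := 3 * (1 + b ^ 2) / 8).
  assert (Hc : 3 / 8 <= c <= 2 / 5) by (unfold c; nra).
  split; [lra|].
  destruct (HL b ltac:(lra)) as [I [HI HIb]]. destruct (HM b ltac:(lra)) as [M HMb].
  exists I. split; [|exact HIb].
  assert (Hb0 : 0 < b) by lra. assert (HbC : RtoC b <> 0%C) by (apply RtoC_neq_0; lra).
  set (E0 := Cexp (RtoC (/ b ^ 2) * Psi 0 sg mu 0 x0 + PI * x0)%C).
  assert (J1 : CintR (fun s => HQ sg mu b (iy (Im x0) + RtoC s)%C) (b * E0 * I)%C).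
  { apply (CintR_lin _ (/ b) (- (Re x0 / b))) in HI; [|now apply Rinv_0_lt_compat].
    apply (Cint_scal (b * E0)%C) in HI; try apply _.
    eapply CintR_ext; [|exact HI]. intros s. cbv beta.
    unfold AQ, HQ, E0. fold x0.
    replace (b * (/ b * s + - (Re x0 / b))) with (s - Re x0) by (field; lra).
    replace (x0 + RtoC (s - Re x0))%C with (iy (Im x0) + RtoC s)%C
      by (unfold iy; apply Ceq_pair; unfold Re, Im; simpl; ring).
    replace (PI * b * (/ b * s + - (Re x0 / b))) with (PI * (s - Re x0)) by (field; lra).
    transitivity (b * RtoC (/ b) * (Cexp (RtoC (/ b ^ 2) * Psi 0 sg mu 0 x0 + PI * x0) *
      Cexp (RtoC (/ b ^ 2) * (Psi 0 sg mu (b ^ 2) (iy (Im x0) + RtoC s) - Psi 0 sg mu 0 x0) + RtoC (PI * (s - Re x0)))))%C; [ring|].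
    rewrite <- Cexp_plus. rewrite RtoC_inv by lra.
    replace (b * / RtoC b)%C with (RtoC 1) by (field; exact HbC). rewrite Cmult_1_l. f_equal.
    replace (iy (Im x0) + RtoC s)%C with (x0 + RtoC (s - Re x0))%C
      by (unfold iy; apply Ceq_pair; unfold Re, Im; simpl; ring).
    rewrite (RtoC_mult PI). ring. }
  assert (Hstrip : forall z, - c2 <= Im z <= - c1 -> Rabs (Im z) < 1 / 2) by (intros; apply Rabs_def1; lra).
  destruct (CintR_dom (fun s => HQ sg mu b (iy (- c) + RtoC s)%C) M) as [J [HJ _]].
  { intros s. eapply (Ccontinuous_line (HQ sg mu b)), Cder_HQ. rewrite Im_iy, Rabs_Ropp, Rabs_pos_eq; lra. }
  { intros s. assert (K1 := HMb (iy (- c) + RtoC s)%C ltac:(rewrite Im_iy; lra)). now rewrite Re_iy in K1. }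
  assert (HM0 : 0 <= M).
  { assert (K1 := HMb (iy (- c) + RtoC 0)%C ltac:(rewrite Im_iy; lra)). rewrite Re_iy in K1.
    replace (M / (1 + 0 ^ 2)) with M in K1 by (simpl; field).
    assert (K2 := Cmod_ge_0 (HQ sg mu b (iy (- c) + RtoC 0)%C)). lra. }
  assert (Hbnd : forall T, exists B, forall z, - c2 <= Im z <= - c1 -> Rabs (Re z) <= T ->
     Cmod (HQ sg mu b z * DQ sg mu b z * DQ sg mu b z + HQ sg mu b z * (RtoC (/ b ^ 2) * Psi 2 sg mu (b ^ 2) z))%C <= B).
  { intros T. assert (HP := PI_RGT_0). assert (Hb2p : 0 < b ^ 2) by nra.
    assert (Hib : 0 < / b ^ 2) by now apply Rinv_0_lt_compat.
    destruct (Psi_bound sg mu (b ^ 2) c2 (Rabs T + 1) ltac:(lra) A2 ltac:(assert (K1 := Rabs_pos T); lra)) as [B [HB0 HB]].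
    set (d := / b ^ 2 * B + PI). exists (M * d * d + M * (/ b ^ 2 * B)). intros z Hz HzT.
    assert (HzZ : Cmod z <= Rabs T + 1).
    { eapply Rle_trans; [apply Cmod_le_Re_Im|]. assert (Rabs (Im z) <= 1) by (apply Rabs_le; lra).
      assert (K1 := Rle_abs T). lra. }
    assert (HzI : Rabs (Im z) <= c2) by (apply Rabs_le; lra).
    assert (P1 := HB 1%nat z HzI HzZ). assert (P2 := HB 2%nat z HzI HzZ).
    assert (PH : Cmod (HQ sg mu b z) <= M).
    { eapply Rle_trans; [apply HMb; exact Hz|]. apply (Rmult_le_reg_r (1 + Re z ^ 2)); [nra|].
      unfold Rdiv. rewrite Rmult_assoc, Rinv_l by nra. assert (0 <= Re z ^ 2) by nra. nra. }
    assert (PD : Cmod (DQ sg mu b z) <= d).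
    { unfold DQ, d. eapply Rle_trans; [apply Cmod_triangle|]. rewrite Cmod_mult, !Cmod_RtoC_nonneg by lra.
      assert (/ b ^ 2 * Cmod (Psi 1 sg mu (b ^ 2) z) <= / b ^ 2 * B) by (apply Rmult_le_compat_l; lra). lra. }
    eapply Rle_trans; [apply Cmod_triangle|]. rewrite !Cmod_mult, Cmod_RtoC_nonneg by lra.
    assert (G1 := Cmod_ge_0 (HQ sg mu b z)). assert (G2 := Cmod_ge_0 (DQ sg mu b z)).
    assert (G3 := Cmod_ge_0 (Psi 2 sg mu (b ^ 2) z)).
    apply Rplus_le_compat.
    - apply Rmult_le_compat; [now apply Rmult_le_pos | exact G2 | | exact PD]. now apply Rmult_le_compat.
    - apply Rmult_le_compat; [exact G1 | apply Rmult_le_pos; lra | exact PH |]. apply Rmult_le_compat_l; lra. }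
  assert (Heq : J = (b * E0 * I)%C).
  (* Either line may be the upper one, depending on sg and mu. *)
  { destruct (Rle_dec (- c) (Im x0)) as [Hle|Hle].
    - apply (contour_shift (HQ sg mu b) (fun x => HQ sg mu b x * DQ sg mu b x)%C
        (fun z => HQ sg mu b z * DQ sg mu b z * DQ sg mu b z + HQ sg mu b z * (RtoC (/ b ^ 2) * Psi 2 sg mu (b ^ 2) z))%C
        (- c) (Im x0) M Hle); auto.
      + intros z Hz. apply Cder_HQ, Hstrip. lra.
      + intros z Hz. apply Cder_HQ1, Hstrip. lra.
      + intros T. destruct (Hbnd T) as [B HB]. exists B. intros z Hz HT. apply HB; [lra | exact HT].
      + intros z Hz. apply HMb. lra.
    - symmetry. apply (contour_shift (HQ sg mu b) (fun x => HQ sg mu b x * DQ sg mu b x)%C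
        (fun z => HQ sg mu b z * DQ sg mu b z * DQ sg mu b z + HQ sg mu b z * (RtoC (/ b ^ 2) * Psi 2 sg mu (b ^ 2) z))%C
        (Im x0) (- c) M ltac:(lra)); auto.
      + intros z Hz. apply Cder_HQ, Hstrip. lra.
      + intros z Hz. apply Cder_HQ1, Hstrip. lra.
      + intros T. destruct (Hbnd T) as [B HB]. exists B. intros z Hz HT. apply HB; [lra | exact HT].
      + intros z Hz. apply HMb. lra. }
  rewrite Heq in HJ.
  apply (CintR_lin _ b 0) in HJ; [|exact Hb0].
  apply (Cint_scal (/ RtoC b)%C) in HJ; try apply _.
  replace (E0 * I)%C with (/ b * (b * E0 * I))%C by (field; exact HbC).
  eapply CintR_ext; [|exact HJ]. intros t. cbv beta. rewrite Rplus_0_r. field. exact HbC.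
Qed.

Lemma Qcal_eq (b : R) (I : C) : 0 < b -> 3 * (1 + b ^ 2) / 8 < 1 / 2 ->
  CintR (fun t => HQ sg mu b (iy (- (3 * (1 + b ^ 2) / 8)) + RtoC (b * t))%C) I ->
  Qcal b (sg / b) (mu / b) =
  (Cexp (Ci * PI * (RtoC (1/6 + 7 * Qb b ^ 2 / 24 - (mu / b) ^ 2 / 2 - (sg / b) ^ 2) + Ci * RtoC (mu / b * Qb b)) +
     RtoC (/ b ^ 2) * (Ci * IPhi 0 (b ^ 2) (RtoC mu))) * I)%C.
Proof.
  intros Hb Hlt HI. unfold Qcal. cbv zeta. f_equal.
  - rewrite Cexp_plus. f_equal.
    rewrite <- s_b_scaled by (exact Hb || (simpl; rewrite Rabs_R0; lra)).
    f_equal. rewrite <- RtoC_mult. f_equal. field. lra.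
  - apply (is_RInt_gen_unique (V := C_R_CompleteNormedModule)).
    eapply CintR_ext; [|exact HI]. intros t. symmetry. now apply Qcal_integrand.
Qed.

(** The right-hand side collects the coefficient of 1 / b^2 from the explicit prefactor, from s_b
    (mu / b) and from the phase at the saddle. The three constants PI^2 / 12 of the dilogarithms
    turn 5 PI / 12 into the 7 PI / 24 that comes from 7 Q^2 / 24. *)
Lemma fQ_phase : fQ sg mu =
  (Ci * PI * (RtoC (7 / 24 - mu ^ 2 / 2 - sg ^ 2) + Ci * mu) + Ci * IPhi 0 0 (RtoC mu) + Psi 0 sg mu 0 x0)%C.
Proof.
  assert (HPC := PI_C_neq_0). assert (Hi := Ci_neq_0).
  rewrite (fQ_alt sg mu Hadm). fold x0.
  replace (RtoC (- exp (2 * PI * mu))) with (- q2 (RtoC mu))%C by (rewrite q2_RtoC, RtoC_opp; reflexivity).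
  rewrite !Li2_closed by (first [apply half_strip_strip, (Im_x0_shift sg mu Hadm) | simpl; rewrite Rabs_R0; lra]).
  unfold Kf, Psi, twoPIi.
  set (J0 := IPhi 0 0 (RtoC mu)). set (J1 := IPhi 0 0 (x0 + RtoC (- sg))%C). set (J2 := IPhi 0 0 (x0 + RtoC sg)%C).
  assert (EL : forall X : C, (X / (RtoC (2 * PI) * Ci))%C = (- Ci * X / (2 * PI))%C).
  { intros X. rewrite RtoC_mult. transitivity (X * (- (Ci * Ci)) / (2 * PI * Ci))%C; [rewrite Ci_sqr; field; auto | field; auto]. }
  rewrite !EL. clearbody J0 J1 J2. set (ix := x0). clearbody ix.
  rewrite !RtoC_opp, !RtoC_minus, !RtoC_div, !RtoC_mult, !RtoC_pow by lra.
  assert (Ei := Ci_sqr). field [Ei]. exact HPC.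
Qed.

(** The phase 3 PI / 4 is PI (1/6 + 7/12), the part of the prefactor of order b^0, and - PI mu comes
    from mu Q. Since exp (PI x0) is - i times the square root of omega, it cancels the square root
    of omega in the Gaussian factor and lowers the phase to PI / 4; the moduli combine to 1 / sqrt
    (2 R). *)
Lemma prefQ_eq : (Cexp (RtoC (3 * PI / 4) * Ci - PI * mu + PI * x0) *
  (RtoC (sqrt PI) * Cexp (- (/ 2 * Cln (aQ sg mu)))))%C = prefQ sg mu.
Proof.
  assert (HP := PI_RGT_0). assert (HR := Rfq_pos sg mu Hadm). set (Rr := Rfq sg mu) in *.
  set (om := omegaQ sg mu). assert (HM := exp_pos (2 * PI * mu)).
  assert (Hre : 0 < Re om) by (unfold om, omegaQ; simpl; assert (K := cosh_ge_1 (2 * PI * sg)); lra).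
  assert (Him : 0 < Im om) by (unfold om, omegaQ; simpl; exact HR).
  assert (Hom : om <> 0%C) by (apply slit_neq_0; now left).
  assert (Harg := Carg_Re_pos om Hre). assert (Harg2 := Carg_Im_pos om Him).
  assert (L1 : (2 * PI * x0)%C = (Cln om - Ci * PI)%C).
  { unfold x0. rewrite (two_PI_x0 sg mu). fold om. apply Cln_unique.
    - replace (Im (Cln om - Ci * PI)%C) with (Carg om - PI) by (unfold Im; simpl; ring). lra.
    - unfold Cminus. rewrite Cexp_plus, Cexp_opp, Cexp_Ci_PI, Cexp_Cln by exact Hom.
      field. }
  set (r := 2 * PI * Rr / exp (2 * PI * mu)).
  assert (Hr : 0 < r) by (unfold r; apply Rdiv_lt_0_compat; nra).
  assert (L2 : Cln (aQ sg mu) = (RtoC (ln r) + Cln om)%C).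
  { apply Cln_unique.
    - replace (Im (RtoC (ln r) + Cln om)%C) with (Carg om) by (unfold Im; simpl; ring). lra.
    - rewrite Cexp_plus, Cexp_RtoC, exp_ln, Cexp_Cln by assumption. reflexivity. }
  rewrite L2.
  transitivity (RtoC (sqrt PI) * (Cexp (RtoC (3 * PI / 4) * Ci - PI * mu + PI * x0) * Cexp (- (/ 2 * (RtoC (ln r) + Cln om)))))%C; [ring|].
  rewrite <- Cexp_plus.
  replace (RtoC (3 * PI / 4) * Ci - PI * mu + PI * x0 + - (/ 2 * (RtoC (ln r) + Cln om)))%C
    with (Cplus (0, PI / 4) (RtoC (- (PI * mu) - / 2 * ln r))).
  2: { replace (PI * x0)%C with (/ 2 * (2 * PI * x0))%C by field. rewrite L1.
       replace ((0, PI / 4) : C) with (PI / 4 * Ci)%C by (apply Ceq_pair; unfold Re, Im; simpl; field).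
       rewrite RtoC_minus, RtoC_opp, !RtoC_mult, RtoC_div, RtoC_mult, RtoC_inv by lra. field. }
  rewrite Cexp_plus, Cexp_RtoC. unfold prefQ, Cdiv.
  transitivity (Cmult (Cexp (0, PI / 4)) (RtoC (sqrt PI * exp (- (PI * mu) - / 2 * ln r)))); [rewrite RtoC_mult; ring|].
  f_equal. fold (Rfq sg mu). fold Rr.
  assert (S2 : 0 < sqrt 2) by (apply sqrt_lt_R0; lra). assert (SR : 0 < sqrt Rr) by (apply sqrt_lt_R0; lra).
  assert (SP : 0 < sqrt PI) by (apply sqrt_lt_R0; lra).
  rewrite <- RtoC_inv by nra. f_equal.
  assert (El : ln r = ln (2 * PI * Rr) - 2 * PI * mu).
  { unfold r. rewrite ln_div by nra. now rewrite ln_exp. }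
  rewrite El. replace (- (PI * mu) - / 2 * (ln (2 * PI * Rr) - 2 * PI * mu)) with (- (/ 2 * ln (2 * PI * Rr))) by field.
  rewrite exp_Ropp, exp_half_ln by nra. rewrite !sqrt_mult by nra. field. lra.
Qed.

(** After exp (f_Q / b^2) and the order one factor are taken out exactly, what remains is exp r
    times the rescaled integral, with r = O(b^2) and the integral within O(b) of its Gaussian value.
    Dividing by the nonzero modulus of that value makes the error relative. *)
Lemma Q_asymptotics : exists K b0 : R, 0 < b0 /\
  forall b : R, 0 < b < b0 ->
    Cmod (Cminus (Qcal b (sg / b) (mu / b))
                 (Cmult (prefQ sg mu) (Cexp (Cdiv (fQ sg mu) (RtoC (b ^ 2))))))
    <= K * b * Cmod (Cmult (prefQ sg mu) (Cexp (Cdiv (fQ sg mu) (RtoC (b ^ 2))))).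
Proof.
  assert (HP := PI_RGT_0).
  destruct HQ_integral as [K [b0 [HK0 [Hb0 HI]]]].
  destruct (IPhi0_diff 0 ltac:(lra)) as [D [HD0 HD]].
  set (N := (RtoC (sqrt PI) * Cexp (- (/ 2 * Cln (aQ sg mu))))%C).
  set (Th := (RtoC (3 * PI / 4) * Ci - PI * mu + PI * x0)%C).
  assert (HN : 0 < Cmod N).
  { unfold N. rewrite Cmod_mult, Cmod_Cexp, Cmod_RtoC_nonneg by apply sqrt_pos.
    apply Rmult_lt_0_compat; [now apply sqrt_lt_R0 | apply exp_pos]. }
  assert (EP := prefQ_eq). fold N in EP. fold Th in EP.
  (* The first term is the part of 7 PI Q^2 / 24 of order b^2, the second the beta error in s_b (mu
     / b). *)
  set (r1 := 7 * PI / 24 + D * Rabs mu). assert (Hmu := Rabs_pos mu).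
  assert (Hr1 : 0 <= r1) by (unfold r1; assert (0 <= D * Rabs mu) by (now apply Rmult_le_pos); lra).
  set (K1 := r1 * exp r1 * (Cmod N + K) + K).
  exists (K1 / Cmod N), b0. split; [lra|]. intros b Hb.
  destruct (HI b Hb) as [Hlt [I [HInt HIb]]]. fold N in HIb.
  rewrite (Qcal_eq b _ ltac:(lra) Hlt HInt).
  assert (Hb2 : 0 < b ^ 2) by nra. assert (Hb2b : b ^ 2 <= b) by nra.
  assert (HbC : RtoC b <> 0%C) by (apply RtoC_neq_0; lra).
  set (r := (Ci * RtoC (7 * PI / 24 * b ^ 2) + RtoC (/ b ^ 2) * (Ci * (IPhi 0 (b ^ 2) (RtoC mu) - IPhi 0 0 (RtoC mu))))%C).
  assert (Hr : Cmod r <= r1 * b).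
  { unfold r. eapply Rle_trans; [apply Cmod_triangle|]. rewrite !Cmod_mult, Cmod_Ci, !Rmult_1_l.
    rewrite !Cmod_RtoC_nonneg by (first [left; now apply Rinv_0_lt_compat | nra]).
    assert (Kd := HD (b ^ 2) (RtoC mu) ltac:(lra) ltac:(simpl; rewrite Rabs_R0; lra)). rewrite Cmod_R in Kd.
    assert (/ b ^ 2 * Cmod (IPhi 0 (b ^ 2) (RtoC mu) - IPhi 0 0 (RtoC mu))%C <= D * Rabs mu * b ^ 2).
    { apply (Rmult_le_reg_l (b ^ 2)); [exact Hb2|]. rewrite <- Rmult_assoc, Rinv_r, Rmult_1_l by lra.
      eapply Rle_trans; [exact Kd|]. right; ring. }
    apply Rle_trans with (r1 * b ^ 2); [unfold r1; lra | apply Rmult_le_compat_l; lra]. }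
  assert (EX : (Cexp (Ci * PI * (RtoC (1/6 + 7 * Qb b ^ 2 / 24 - (mu / b) ^ 2 / 2 - (sg / b) ^ 2) + Ci * RtoC (mu / b * Qb b)) +
     RtoC (/ b ^ 2) * (Ci * IPhi 0 (b ^ 2) (RtoC mu))) * (Cexp (RtoC (/ b ^ 2) * Psi 0 sg mu 0 x0 + PI * x0) * I))%C
     = (Cexp (fQ sg mu / RtoC (b ^ 2)) * Cexp Th * (Cexp r * I))%C).
  { rewrite !Cmult_assoc, <- !Cexp_plus. f_equal. f_equal. rewrite fQ_phase. unfold Th, r, Qb.
    set (P0 := Psi 0 sg mu 0 x0). set (Jb := IPhi 0 (b ^ 2) (RtoC mu)). set (J0 := IPhi 0 0 (RtoC mu)).
    clearbody P0 Jb J0. set (ix := x0). clearbody ix.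
    replace (RtoC (1/6 + 7 * (b + / b) ^ 2 / 24 - (mu / b) ^ 2 / 2 - (sg / b) ^ 2))
      with (RtoC (3 / 4) + RtoC (7 / 24) * RtoC (b ^ 2) + RtoC (7 / 24 - mu ^ 2 / 2 - sg ^ 2) / RtoC (b ^ 2))%C.
    2: { unfold Cdiv. rewrite <- RtoC_inv, <- !RtoC_mult, <- !RtoC_plus by lra. f_equal. field. lra. }
    replace (RtoC (mu / b * (b + / b))) with (mu + mu / RtoC (b ^ 2))%C.
    2: { unfold Cdiv. rewrite <- RtoC_inv, <- !RtoC_mult, <- !RtoC_plus by lra. f_equal. field. lra. }
    rewrite RtoC_inv by lra. rewrite (RtoC_mult (7 * PI / 24)).
    replace (RtoC (7 * PI / 24)) with (RtoC (7 / 24) * PI)%C by (rewrite <- RtoC_mult; f_equal; field).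
    replace (RtoC (3 * PI / 4)) with (RtoC (3 / 4) * PI)%C by (rewrite <- RtoC_mult; f_equal; field).
    assert (Hb2C : RtoC (b ^ 2) <> 0%C) by (apply RtoC_neq_0; lra).
    assert (Ei := Ci_sqr). field [Ei]. exact Hb2C. }
  rewrite EX, <- EP.
  replace (Cexp (fQ sg mu / RtoC (b ^ 2)) * Cexp Th * (Cexp r * I) - Cexp Th * N * Cexp (fQ sg mu / RtoC (b ^ 2)))%C
    with (Cexp (fQ sg mu / RtoC (b ^ 2)) * Cexp Th * ((Cexp r - 1) * I + (I - N)))%C by ring.
  rewrite !Cmod_mult.
  set (F := Cmod (Cexp (fQ sg mu / RtoC (b ^ 2))%C)). set (G := Cmod (Cexp Th)).
  assert (HF : 0 <= F) by apply Cmod_ge_0. assert (HG : 0 <= G) by apply Cmod_ge_0.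
  assert (HIm : Cmod I <= Cmod N + K).
  { assert (T := Cmod_triangle N (I - N)%C). replace (N + (I - N))%C with I in T by ring. nra. }
  assert (He : Cmod (Cexp r - 1)%C <= r1 * exp r1 * b).
  { eapply Rle_trans; [apply Cexp_minus_1_mod|].
    assert (exp (Cmod r) <= exp r1) by (apply exp_le_exp; nra).
    apply Rle_trans with (r1 * b * exp r1); [|right; ring].
    apply Rmult_le_compat; [apply Cmod_ge_0 | left; apply exp_pos | exact Hr | assumption]. }
  assert (Hmain : Cmod ((Cexp r - 1) * I + (I - N))%C <= K1 * b).
  { eapply Rle_trans; [apply Cmod_triangle|]. rewrite Cmod_mult.
    assert (Cmod (Cexp r - 1)%C * Cmod I <= r1 * exp r1 * b * (Cmod N + K))
      by (apply Rmult_le_compat; try apply Cmod_ge_0; assumption).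
    unfold K1. lra. }
  replace (K1 / Cmod N * b * (G * Cmod N * F)) with (F * G * (K1 * b)) by (field; lra).
  apply Rmult_le_compat_l; [now apply Rmult_le_pos | exact Hmain].
Qed.

End Assembly.

Theorem theorem2p4 :
  (forall sigma_s mu : R,
     sinh (2 * PI * sigma_s) ^ 2 < exp (2 * PI * mu) ->
     exists K b0 : R, 0 < b0 /\
       forall b : R, 0 < b < b0 ->
         Cmod (Cminus (Qcal b (sigma_s / b) (mu / b))
                      (Cmult (prefQ sigma_s mu)
                             (Cexp (Cdiv (fQ sigma_s mu) (RtoC (b ^ 2))))))
         <= K * b * Cmod (Cmult (prefQ sigma_s mu)
                                (Cexp (Cdiv (fQ sigma_s mu) (RtoC (b ^ 2))))))
  /\
  (exists (U : C -> C -> Prop) (Wc : C -> C -> C),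
     is_continuation_W U Wc /\
     forall sigma_s mu : R,
       sinh (2 * PI * sigma_s) ^ 2 < exp (2 * PI * mu) ->
       U (0, sigma_s) (- mu, - (1/2)) /\
       fQ sigma_s mu =
         Cplus (Cplus (Cplus
           (Cmult (Cmult (RtoC (4 * PI)) Ci) (Wc (0, sigma_s) (- mu, - (1/2))))
           (Copp (Cdiv (Li2 (RtoC (- exp (2 * PI * mu)))) twoPIi)))
           (0, - (2 * PI * sigma_s ^ 2)))
           (0, PI / 4)).
Proof.
  split.
  - exact Q_asymptotics.
  - exists UW, WcW. split; [exact WcW_continuation|].
    intros sg mu H. split; [now apply UW_target | now apply fQ_WcW].
Qed.
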